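(* Let $S\subseteq\mathbb R$ and let $X=(X_t)_{t\in[0,T]}$ be an $S$-valued Lévy process with characteristics $(b,a,F)$ and $X_0=x_0$. Assume that $F$ has bounded support and set $$\mathcal V:=\{h\in H(\mathbb C):\ |h(x)|,|h'(x)|,|h''(x)|\le C\exp(\kappa|x|)\ \forall x\in\mathbb R,\text{ for some }\kappa\in\mathbb R,\ C>0\},$$ $$\mathcal V^*:=\{\mathbf u\in\mathcal S^*:h_{\mathbf u}=h,\ h\in\mathcal V\}.$$ Then: (i) $X$ is an $S$-valued $\mathcal V$-holomorphic process. (ii) For each $h\in\mathcal V$ the process $N^h_t=h(X_t)-h(X_0)-\int_0^t\mathcal Ah(X_s)ds$, $t\in[0,T]$, is a true martingale. (iii) Fix $\mathbf u\in\mathcal V^*$. Assume that $\int_{\mathbb R}|h_{\mathbf u}(x)|dx<\infty$ or $\int_{\mathbb R}|h_{\mathbf u}(x)|^2dx<\infty$, and that the map $\hat h_{\mathbf u}:\mathbb R\to\mathbb C$, $\hat h_{\mathbf u}(u):=\int_{\mathbb R}h_{\mathbf u}(x)e^{-iux}dx$ (the Fourier transform of $h_{\mathbf u}$), satisfies $$\int_{\mathbb R}\exp(|ux|)\,|\hat h_{\mathbf u}(u)|\,du<\infty\qquad\text{for all }x\in\mathbb R.$$ Then there exists a $\mathcal V^*$-valued map $(\mathbf c(t))_{t\in[0,T]}$ with $$h_{\mathbf c(t)}(x)=h_{\mathbf u}(x)+\int_0^th_{L(\mathbf c(s))}(x)\,ds\quad\text{for all }x\in S,\ t\in[0,T],$$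 such that $N^{h_{\mathbf c(s)}}$ is a true martingale for each $s\in[0,T]$ and $\int_0^T\int_0^T\mathbb E[|\mathcal Ah_{\mathbf c(s)}(X_t)|]\,ds\,dt<\infty$. In particular, $\mathbb E[h_{\mathbf u}(X_T)]=h_{\mathbf c(T)}(x_0)$.
   Context: Lévy process. $T>0$ is fixed. The characteristics $(b,a,F)$, $b\in\mathbb R$, $a\ge0$, $F$ a Lévy measure on $\mathbb R$ with $F(\{0\})=0$ and $\int|y|\wedge|y|^2F(dy)<\infty$, are taken with respect to the truncation function $\chi(\xi)=\xi$; the extended generator is $$\mathcal Af(x)=bf'(x)+\tfrac12af''(x)+\int_{\mathbb R}f(x+y)-f(x)-f'(x)y\ F(dy),\quad x\in S,$$ with domain $\mathcal D(\mathcal A)=\{f\in C^2(\mathbb R;\mathbb C):\int|f(x+y)-f(x)-f'(x)y|F(dy)<\infty\ \forall x\in S\}$. Spaces. $H(\mathbb C)$ is the set of entire functions. For complex sequences $\mathbf u=(\mathbf u_\alpha)_{\alpha\in\mathbb N_0}$, $h_{\mathbf u}(z)=\sum_\alpha\mathbf u_\alpha z^\alpha/\alpha!$. With $R(S)=\sup\{|x|:x\in S\}$ and $P_R=\{z\in\mathbb C:|z|<R\}$: $\mathcal O(S)$ is the set of $f:S\to\mathbb C$ which are restrictions to $S$ of functions holomorphic on $P_{R(S)+\varepsilon}$ for some $\varepsilon>0$; $\mathcal S^*$ is the set of $\mathbf u$ whose power series $h_{\mathbf u}$ converges absolutely on $P_{R(S)}$ and coincides there with a function holomorphic on $P_{R(S)+\varepsilon}$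 for some $\varepsilon>0$. For a linear subset $\mathcal V\subseteq\mathcal O(S)$ (functions being restricted to $S$), $X$ is an $S$-valued $\mathcal V$-holomorphic process if for each $f\in\mathcal V$: $f\in\mathcal D(\mathcal A)$, $\mathcal Af\in\mathcal O(S)$, and $N^f$ is a local martingale. $L:\mathcal V^*\to\mathcal S^*$ denotes a linear map with $\mathcal Ah_{\mathbf u}=h_{L(\mathbf u)}|_S$ for all $\mathbf u\in\mathcal V^*$. If $h_{\mathbf u}$ is only square integrable on $\mathbb R$, $\hat h_{\mathbf u}$ is the $L^2$ Fourier transform. *)

(* Defs.v *)
From HB Require Import structures.
From mathcomp Require Import all_boot all_order all_algebra.
From mathcomp Require Import complex.
From mathcomp Require Import all_classical all_reals all_analysis.
From mathcomp Require Import measurable_realfun.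

Set Implicit Arguments.
Unset Strict Implicit.
Unset Printing Implicit Defensive.

Import Order.TTheory GRing.Theory Num.Theory.
Import numFieldNormedType.Exports.

Local Open Scope classical_set_scope.
Local Open Scope ring_scope.

(* R[i] declared as a numFieldType, so that its norm topology, its complex
   derivative ([derivable], [derive1]) and its limits are inferred. *)
Definition Cx (R : realType) : numFieldType := R[i].

Definition reC {R : realType} (z : Cx R) : R := complex.Re (z : R[i]).
Definition imC {R : realType} (z : Cx R) : R := complex.Im (z : R[i]).
Definition absC {R : realType} (z : Cx R) : R :=
  ComplexField.Normc.normc (z : R[i]).
Definition ofR {R : realType} (x : R) : Cx R := Complex x 0.
Definition imag {R : realType} : Cx R := Complex 0 1.
Definition cis {R : realType} (x : R) : Cx R := Complex (cos x) (sin x).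
Definition expC {R : realType} (z : Cx R) : Cx R :=
  ofR (expR (reC z)) * cis (imC z).

Section Integration.
Context {R : realType} {d : measure_display} {Y : measurableType d}.
Implicit Types (mu : {measure set Y -> \bar R}) (D : set Y) (f : Y -> Cx R).

Definition cmeasurable D f :=
  measurable_fun D (reC \o f) /\ measurable_fun D (imC \o f).

Definition cintegrable mu D f :=
  cmeasurable D f /\ (\int[mu]_(x in D) (absC (f x))%:E < +oo)%E.

Definition cintegral mu D f : Cx R :=
  Complex (Rintegral mu D (reC \o f)) (Rintegral mu D (imC \o f)).

Definition csquare_integrable mu f :=
  cmeasurable setT f /\ (\int[mu]_x (absC (f x) ^+ 2)%:E < +oo)%E.

Definition cvg_L2 mu (fn : nat -> Y -> Cx R) f :=
  (fun n => \int[mu]_x (absC (fn n x - f x) ^+ 2)%:E)%E @ \oo --> 0%E.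

End Integration.

Notation leb := lebesgue_measure.

Section Fourier.
Context {R : realType}.
Implicit Types (h g : measurableTypeR R -> Cx R).

Definition fourier_integral h (u : R) : Cx R :=
  cintegral leb setT (fun x => h x * cis (- (u * x))).

(* [g] is a version of the Fourier transform of [h]: the Fourier integral for
   integrable [h], and otherwise the extension by L2-continuity from the
   integrable and square integrable functions. *)
Definition is_fourier_transform h g :=
  (cintegrable leb setT h /\ forall u, g u = fourier_integral h u) \/
  [/\ ~ cintegrable leb setT h, csquare_integrable leb h,
      csquare_integrable leb g &
      exists phi : nat -> measurableTypeR R -> Cx R,
        [/\ forall n, cintegrable leb setT (phi n) /\
                      csquare_integrable leb (phi n),
            cvg_L2 leb phi h &
            cvg_L2 leb (fun n => fourier_integral (phi n)) g]].

End Fourier.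

Section HolomorphicFunctions.
Context {R : realType}.
Implicit Types (S : set R) (u : nat -> Cx R).

Definition on_reals (h : Cx R -> Cx R) : R -> Cx R := fun x => h (ofR x).

Definition sup_abs S : \bar R := ereal_sup [set `|x|%:E | x in S].

Definition disc (r : \bar R) : set (Cx R) := [set z | ((absC z)%:E < r)%E].

Definition holomorphic_on (D : set (Cx R)) (g : Cx R -> Cx R) :=
  forall z, D z -> derivable g z 1.

Definition entire (g : Cx R -> Cx R) := holomorphic_on setT g.

(* The elements of O(S) are functions on S; functions on the whole line stand
   for their restriction to S. *)
Definition calO S : set (R -> Cx R) := [set f |
  exists2 e : R, 0 < e & exists2 g : Cx R -> Cx R,
    holomorphic_on (disc (sup_abs S + e%:E)%E) g &
    forall x, S x -> f x = g (ofR x)].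

Definition pow_term u (z : Cx R) : nat -> Cx R :=
  fun n => u n * z ^+ n / (n`!)%:R.

Definition hser u (z : Cx R) : Cx R := limn (series (pow_term u z)).

Definition calSstar S : set (nat -> Cx R) := [set u |
  (forall z, disc (sup_abs S) z ->
     cvgn (series (fun n => absC (pow_term u z n)))) /\
  exists2 e : R, 0 < e & exists2 g : Cx R -> Cx R,
    holomorphic_on (disc (sup_abs S + e%:E)%E) g &
    forall z, disc (sup_abs S) z -> hser u z = g z].

(* The equality h_u = h is between entire functions: the power series converges
   to [h] on the whole plane.  For an unbounded [S] this convergence follows
   from membership in [calSstar S]. *)
Definition dual_set S (V : set (Cx R -> Cx R)) : set (nat -> Cx R) := [set u |
  calSstar S u /\
  exists2 h, V h & forall z, series (pow_term u z) @ \oo --> h z].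

Definition calV : set (Cx R -> Cx R) := [set h |
  entire h /\ exists kappa C0 : R, 0 < C0 /\ forall x : R,
    [/\ absC (h (ofR x)) <= C0 * expR (kappa * `|x|),
        absC (derive1 h (ofR x)) <= C0 * expR (kappa * `|x|) &
        absC (derive1n 2 h (ofR x)) <= C0 * expR (kappa * `|x|)]].

Definition linear_subset (V : set (R -> Cx R)) :=
  V (fun=> 0) /\
  forall (k : Cx R) f g, V f -> V g -> V (fun x => k * f x + g x).

End HolomorphicFunctions.

Section Generator.
Context {R : realType}.
Implicit Types (b a : R) (F : {measure set (measurableTypeR R) -> \bar R}).
Implicit Types (f : R -> Cx R) (S : set R).

Definition C2_real (g : R -> R) :=
  [/\ forall x, derivable g x 1, forall x, derivable (derive1 g) x 1 &
      continuous (derive1n 2 g)].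

Definition C2 f := C2_real (reC \o f) /\ C2_real (imC \o f).

Definition deriv_c f : R -> Cx R :=
  fun x => Complex (derive1 (reC \o f) x) (derive1 (imC \o f) x).

Definition jump_integrand f (x : R) : measurableTypeR R -> Cx R :=
  fun y => f (x + y) - f x - deriv_c f x * ofR y.

Definition generator b a F f (x : R) : Cx R :=
  ofR b * deriv_c f x + ofR (a / 2) * deriv_c (deriv_c f) x
  + cintegral F setT (jump_integrand f x).

Definition generator_domain S F f :=
  C2 f /\ forall x, S x -> (\int[F]_y (absC (jump_integrand f x y))%:E < +oo)%E.

Definition levy_measure F :=
  F [set 0] = 0%E /\
  (\int[F]_y (Num.min `|y| (`|y| ^+ 2))%:E < +oo)%E.

Definition bounded_support F := exists r : R, F [set y | r < `|y|] = 0%E.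

(* characteristic exponent for the truncation function chi(y) = y *)
Definition levy_exponent b a F (u : R) : Cx R :=
  ofR (b * u) * imag - ofR (a * u ^+ 2 / 2)
  + cintegral F setT (fun y => cis (u * y) - 1 - ofR (u * y) * imag).

End Generator.

Section Processes.
Context {R : realType} {d : measure_display} {Om : measurableType d}.
Variables (P : probability Om R) (T : R) (Ft : R -> set (set Om)).

Definition filtration :=
  [/\ forall t, 0 <= t <= T -> sigma_algebra setT (Ft t),
      forall t, 0 <= t <= T -> Ft t `<=` measurable &
      forall s t, 0 <= s -> s <= t -> t <= T -> Ft s `<=` Ft t].

Definition measurable_wrt (G : set (set Om)) (f : Om -> R) :=
  forall B : set (measurableTypeR R), measurable B -> G (f @^-1` B).

Definition cmeasurable_wrt (G : set (set Om)) (f : Om -> Cx R) :=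
  measurable_wrt G (reC \o f) /\ measurable_wrt G (imC \o f).

Definition cadlag (V : topologicalType) (p : R -> V) :=
  (forall t, 0 <= t < T -> p s @[s --> t^'+] --> p t) /\
  (forall t, 0 < t <= T -> exists l : V, p s @[s --> t^'-] --> l).

Definition is_cond_exp (G : set (set Om)) (Y Z : Om -> Cx R) :=
  [/\ cintegrable P setT Z, cmeasurable_wrt G Z &
      forall A, G A -> cintegral P A Z = cintegral P A Y].

Definition martingale (M : R -> Om -> Cx R) :=
  [/\ forall w, cadlag (M ^~ w),
      forall t, 0 <= t <= T -> cmeasurable_wrt (Ft t) (M t),
      forall t, 0 <= t <= T -> cintegrable P setT (M t) &
      forall s t, 0 <= s -> s <= t -> t <= T ->
        is_cond_exp (Ft s) (M t) (M s)].

Definition stopping_time (tau : Om -> \bar R) :=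
  (forall w, (0 <= tau w)%E) /\
  forall t, 0 <= t <= T -> Ft t [set w | (tau w <= t%:E)%E].

Definition stopped (M : R -> Om -> Cx R) (tau : Om -> \bar R) :
    R -> Om -> Cx R :=
  fun t w => M (fine (Order.min t%:E (tau w))) w.

(* On the horizon [0, T] a localizing sequence eventually reaches T. *)
Definition local_martingale (M : R -> Om -> Cx R) :=
  [/\ forall w, cadlag (M ^~ w),
      forall t, 0 <= t <= T -> cmeasurable_wrt (Ft t) (M t) &
      exists tau : nat -> Om -> \bar R,
        [/\ forall n, stopping_time (tau n),
            forall n w, (tau n w <= tau n.+1 w)%E,
            {ae P, forall w, exists n, (T%:E <= tau n w)%E} &
            forall n, martingale (stopped M (tau n))]].

(* X is a Levy process with respect to the filtration; its characteristics are
   identified by the Levy-Khintchine formula. *)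
Definition levy_process (X : R -> Om -> R) (b a : R)
    (F : {measure set (measurableTypeR R) -> \bar R}) :=
  [/\ forall t, 0 <= t <= T -> measurable_wrt (Ft t) (X t),
      forall w, cadlag (X ^~ w),
      forall s t, 0 <= s -> s <= t -> t <= T ->
        forall (A : set Om) (B : set (measurableTypeR R)),
          Ft s A -> measurable B ->
          P (A `&` [set w | B (X t w - X s w)])
          = (P A * P [set w | B (X t w - X s w)%R])%E,
      forall s t, 0 <= s -> s <= t -> t <= T ->
        forall B : set (measurableTypeR R), measurable B ->
          P [set w | B (X t w - X s w)]
          = P [set w | B (X (t - s) w - X 0 w)] &
      forall t u, 0 <= t <= T ->
        cintegral P setT (fun w => cis (u * (X t w - X 0 w)))
        = expC (ofR t * levy_exponent b a F u)].

Definition valued_in (S : set R) (X : R -> Om -> R) :=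
  forall t w, 0 <= t <= T -> S (X t w).

Variables (b a : R) (F : {measure set (measurableTypeR R) -> \bar R}).
Variable X : R -> Om -> R.

Let A := generator b a F.

Definition Nproc (f : R -> Cx R) : R -> Om -> Cx R := fun t w =>
  f (X t w) - f (X 0 w) - cintegral leb `[0, t] (fun s => A f (X s w)).

(* [cintegral] has a junk value outside of [cintegrable] functions *)
Definition Nproc_defined (f : R -> Cx R) :=
  forall w t, 0 <= t <= T ->
    cintegrable leb `[0, t]
      (fun s => A f (X s w)).

Definition holomorphic_process (S : set R) (V : set (R -> Cx R)) :=
  [/\ linear_subset V, V `<=` calO S, valued_in S X &
      forall f, V f ->
        [/\ generator_domain S F f, calO S (A f), Nproc_defined f &
            local_martingale (Nproc f)]].

Definition mean_abs_generator (c : R -> nat -> Cx R)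
    (st : measurableTypeR R * measurableTypeR R) : \bar R :=
  (\int[P]_w (absC (A (on_reals (hser (c st.1))) (X st.2 w)))%:E)%E.

End Processes.

Definition generator_lift {R : realType} (S : set R) (b a : R)
    (F : {measure set (measurableTypeR R) -> \bar R})
    (Vstar : set (nat -> Cx R)) (L : (nat -> Cx R) -> (nat -> Cx R)) :=
  [/\ forall u, Vstar u -> calSstar S (L u),
      forall (k : Cx R) u v, Vstar u -> Vstar v ->
        L (fun n => k * u n + v n) = (fun n => k * L u n + L v n) &
      forall u x, Vstar u -> S x ->
        generator b a F (on_reals (hser u)) x = hser (L u) (ofR x)].

(* Main.v *)
(** The characters [x |-> exp (iux)] satisfy Dynkin's formula by independence
    and stationarity of the increments, because the generator acts on them as
    multiplication by the characteristic exponent [psi u].  Linear combinations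
    and dominated limits carry the formula to [h (m sin (x / m))] for entire
    [h] (expand [h] in its power series: each partial sum is a trigonometric
    polynomial), and, letting [m] tend to infinity, to [h] itself.  Domination
    by [C exp (k |x|)] suffices once [X] has exponential moments, uniformly on
    [[0, T]]; these come from Dynkin's formula for [exp (k m sin (x / m))],
    whose generator is bounded by a multiple of the function itself
    independently of [m], with Gronwall's inequality and Fatou's lemma.  Since
    the formula holds on every event of the filtration, [N^h] is a martingale.

    For (iii), Fourier inversion, through the Poisson kernel, represents [h_u]
    as the transform of [g = hhat / (2 pi)], and [c(t)] consists of the Taylor
    coefficients at 0 of the transform of [exp (t psi) g].  As [exp (t psi)] is
    a characteristic function it has modulus at most 1, so the exponential
    integrability of [g] is preserved, and by Fubini's theorem the generator
    multiplies the density by [psi], which is differentiation in [t]. *)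
Require Import Defs.
From HB Require Import structures.
From mathcomp Require Import all_boot all_order all_algebra.
From mathcomp Require Import complex.
From mathcomp Require Import all_classical all_reals all_analysis.
From mathcomp Require Import measurable_realfun.
From mathcomp Require Import ring lra.
Set Implicit Arguments.
Unset Strict Implicit.
Unset Printing Implicit Defensive.
Import Order.TTheory GRing.Theory Num.Theory.
Import numFieldNormedType.Exports.
Local Open Scope classical_set_scope.
Local Open Scope ring_scope.

(** * Complex numbers as pairs of reals *)

(** Two obstacles shape the proof. The process is known only through its independent increments and
    their characteristic function, so every statement is reached from characters by limits. The
    substitution [m sin (x / m)] serves this purpose because it is bounded, has bounded derivatives,
    never exceeds [|x|] in modulus and is itself a trigonometric polynomial: powers of it stay among
    the characters and growth bounds survive. Secondly, an entire function is given as one that has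
    a complex derivative at each point, whereas the limits require its power series. The form of
    Cauchy's formula used here rests on a continuous derivative. That is available for a primitive
    of [h], which Goursat's theorem provides; the primitive is expanded and its series
    differentiated.

    Bounded support of [F] enters as a radius [r]: a jump from [x] sees the second derivative within
    distance [r] of [x], so the generator keeps the exponential rate [k] and costs a factor
    [exp (k r)]. The Poisson kernel suits the inversion because it and its transform are both
    integrable and square integrable, so that one argument covers both kinds of Fourier
    transform. *)

Section ComplexNumbers.
Context {R : realType}.
Implicit Types (z w : Cx R) (x y : R).

Lemma Cx_ext z w : reC z = reC w -> imC z = imC w -> z = w.
Proof. by case: z w => [a b] [c d] /= -> ->. Qed.

Lemma reCD z w : reC (z + w) = reC z + reC w.
Proof. by case: z w => [a b] [c d]. Qed.
Lemma imCD z w : imC (z + w) = imC z + imC w.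
Proof. by case: z w => [a b] [c d]. Qed.
Lemma reCN z : reC (- z) = - reC z. Proof. by case: z. Qed.
Lemma imCN z : imC (- z) = - imC z. Proof. by case: z. Qed.
Lemma reCB z w : reC (z - w) = reC z - reC w.
Proof. by rewrite reCD reCN. Qed.
Lemma imCB z w : imC (z - w) = imC z - imC w.
Proof. by rewrite imCD imCN. Qed.
Lemma reCM z w : reC (z * w) = reC z * reC w - imC z * imC w.
Proof. by case: z w => [a b] [c d]. Qed.
Lemma imCM z w : imC (z * w) = reC z * imC w + imC z * reC w.
Proof. by case: z w => [a b] [c d]. Qed.
Lemma reC0 : reC (0 : Cx R) = 0. Proof. by []. Qed.
Lemma imC0 : imC (0 : Cx R) = 0. Proof. by []. Qed.

Lemma reC_sum (I : Type) (r : seq I) (p : pred I) (F : I -> Cx R) :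
  reC (\sum_(i <- r | p i) F i) = \sum_(i <- r | p i) reC (F i).
Proof. exact: (big_morph _ reCD reC0). Qed.
Lemma imC_sum (I : Type) (r : seq I) (p : pred I) (F : I -> Cx R) :
  imC (\sum_(i <- r | p i) F i) = \sum_(i <- r | p i) imC (F i).
Proof. exact: (big_morph _ imCD imC0). Qed.

Lemma ofR_is_additive : additive (@ofR R).
Proof. by move=> x y; apply: Cx_ext; rewrite /ofR ?reCB ?imCB //= subr0. Qed.
Lemma ofR_is_multiplicative : multiplicative (@ofR R).
Proof.
split=> [x y|]; last by [].
by apply: Cx_ext; rewrite /ofR ?reCM ?imCM /= ?mulr0 ?mul0r ?subr0 ?addr0.
Qed.
HB.instance Definition _ := GRing.isAdditive.Build R (Cx R) ofR ofR_is_additive.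
HB.instance Definition _ :=
  GRing.isMultiplicative.Build R (Cx R) ofR ofR_is_multiplicative.

Lemma ofR0 : ofR 0 = 0 :> Cx R. Proof. exact: rmorph0. Qed.
Lemma ofR1 : ofR 1 = 1 :> Cx R. Proof. exact: rmorph1. Qed.
Lemma reCZ x z : reC (ofR x * z) = x * reC z.
Proof. by rewrite reCM /= mul0r subr0. Qed.
Lemma absCE z : absC z = Num.sqrt (reC z ^+ 2 + imC z ^+ 2).
Proof. by case: z. Qed.
Lemma absC_ge0 z : 0 <= absC z. Proof. by rewrite absCE sqrtr_ge0. Qed.
Lemma absC0 : absC (0 : Cx R) = 0. Proof. exact: ComplexField.Normc.normc0. Qed.
Lemma absC1 : absC (1 : Cx R) = 1. Proof. exact: ComplexField.Normc.normc1. Qed.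
Lemma absC_eq0 z : absC z = 0 -> z = 0.
Proof. exact: ComplexField.Normc.eq0_normc. Qed.
Lemma absC_gt0 z : z != 0 -> 0 < absC z.
Proof.
by move=> z0; rewrite lt_neqAle absC_ge0 andbT eq_sym; apply: contra_neq z0 => /absC_eq0.
Qed.
Lemma absCM z w : absC (z * w) = absC z * absC w.
Proof. exact: ComplexField.Normc.normcM. Qed.
Lemma absCV z : absC z^-1 = (absC z)^-1.
Proof. exact: ComplexField.Normc.normcV. Qed.
Lemma absCN z : absC (- z) = absC z.
Proof. by rewrite !absCE reCN imCN !sqrrN. Qed.
Lemma ler_absCD z w : absC (z + w) <= absC z + absC w.
Proof. exact: le_normcD. Qed.
Lemma ler_absCB z w : absC (z - w) <= absC z + absC w.
Proof. by rewrite -(absCN w) ler_absCD. Qed.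
Lemma absC_distC z w : absC (z - w) = absC (w - z).
Proof. by rewrite -absCN opprB. Qed.
Lemma absCX z n : absC (z ^+ n) = absC z ^+ n.
Proof. by elim: n => [|n IH]; rewrite ?expr0 ?absC1// !exprS absCM IH. Qed.
Lemma absC_ofR x : absC (ofR x) = `|x|.
Proof. by rewrite absCE /= expr0n /= addr0 sqrtr_sqr. Qed.
Lemma absC_nat n : absC (n%:R : Cx R) = n%:R.
Proof. by rewrite -(rmorph_nat ofR) absC_ofR normr_nat. Qed.
Lemma absC_cis x : absC (cis x) = 1.
Proof. by rewrite absCE /= cos2Dsin2 sqrtr1. Qed.
Lemma absC_imag : absC (imag : Cx R) = 1.
Proof. by rewrite absCE /= expr0n expr1n add0r sqrtr1. Qed.
Lemma ler_absC_re z : `|reC z| <= absC z.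
Proof. by rewrite absCE -sqrtr_sqr ler_wsqrtr// lerDl sqr_ge0. Qed.
Lemma ler_absC_im z : `|imC z| <= absC z.
Proof. by rewrite absCE -sqrtr_sqr ler_wsqrtr// lerDr sqr_ge0. Qed.
Lemma reim_ofR z : z = ofR (reC z) + imag * ofR (imC z).
Proof.
by apply: Cx_ext; rewrite ?reCD ?imCD ?reCM ?imCM /=
  ?(mul0r, mul1r, mulr0, subr0, addr0, add0r).
Qed.
Lemma ler_absC_reim z : absC z <= `|reC z| + `|imC z|.
Proof.
rewrite {1}(reim_ofR z); apply: (le_trans (ler_absCD _ _)).
by rewrite absCM absC_imag mul1r !absC_ofR.
Qed.
Lemma absC_sum (I : Type) (r : seq I) (p : pred I) (F : I -> Cx R) :
  absC (\sum_(i <- r | p i) F i) <= \sum_(i <- r | p i) absC (F i).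
Proof.
elim/big_ind2: _ => [|z a w b za wb|//]; first by rewrite absC0.
by rewrite (le_trans (ler_absCD _ _))// lerD.
Qed.
Lemma ler_dist_absC z w : `|absC z - absC w| <= absC (z - w).
Proof.
have H (a b : Cx R) : absC a - absC b <= absC (a - b).
  by rewrite lerBlDr (le_trans _ (ler_absCD _ _))// subrK.
by rewrite ler_norml H andbT lerNl opprB absC_distC H.
Qed.

Lemma cisD x y : cis (x + y) = cis x * cis y.
Proof.
by apply: Cx_ext; rewrite ?reCM ?imCM /= ?cosD ?sinD //; ring.
Qed.
Lemma cis0 : cis 0 = 1 :> Cx R.
Proof. by apply: Cx_ext => /=; rewrite ?cos0 ?sin0. Qed.
Lemma cisX x n : cis x ^+ n = cis (n%:R * x).
Proof.
elim: n => [|n IH]; first by rewrite expr0 mul0r cis0.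
by rewrite exprS IH -cisD -[in RHS]addn1 natrD mulrDl mul1r addrC.
Qed.
Lemma cis_neq0 x : cis x != 0 :> Cx R.
Proof. by apply/eqP => /(congr1 absC); rewrite absC_cis absC0 => /eqP; rewrite oner_eq0. Qed.
Lemma cisN x : cis (- x) = (cis x)^-1 :> Cx R.
Proof.
by apply: (mulfI (cis_neq0 x)); rewrite -cisD subrr cis0 mulfV// cis_neq0.
Qed.
Lemma imag2 : imag * imag = -1 :> Cx R.
Proof. by apply: Cx_ext; rewrite ?reCM ?imCM /= ?(mul0r, mul1r, mulr0, subr0, addr0, add0r)// oppr0. Qed.

Lemma expCD z w : expC (z + w) = expC z * expC w.
Proof. by rewrite /expC reCD imCD expRD cisD rmorphM /=; ring. Qed.
Lemma expC0 : expC (0 : Cx R) = 1.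
Proof. by rewrite /expC /= expR0 cis0 ofR1 mulr1. Qed.
Lemma absC_expC z : absC (expC z) = expR (reC z).
Proof. by rewrite /expC absCM absC_cis mulr1 absC_ofR ger0_norm// expR_ge0. Qed.

Lemma normCxE z : `|z| = ofR (absC z).
Proof. by []. Qed.
Lemma ltCx_ofR x y : (ofR x < ofR y) = (x < y).
Proof. exact: ltcR. Qed.
Lemma gtCx0P (e : Cx R) : 0 < e -> exists2 x : R, 0 < x & e = ofR x.
Proof.
case: e => a b; rewrite ltcE /= => /andP[/eqP -> a0].
by exists a.
Qed.

End ComplexNumbers.

(** * Limits and complex derivatives expressed through the real modulus *)

Section ComplexTopology.
Context {R : realType}.
Implicit Types (z w : Cx R) (x y : R).

Lemma cvgCxP {T : Type} (F : set_system T) {FF : Filter F} (f : T -> Cx R) l :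
  f x @[x --> F] --> l <->
  forall e : R, 0 < e -> \forall x \near F, absC (l - f x) < e.
Proof.
split=> [/cvgrPdist_lt H e e0|H].
  have := H (ofR e); rewrite -(ofR0 (R:=R)) ltCx_ofR => /(_ e0).
  by apply: filterS => x; rewrite normCxE ltCx_ofR.
apply/cvgrPdist_lt => _ /gtCx0P[e e0 ->].
by have := H e e0; apply: filterS => x; rewrite normCxE ltCx_ofR.
Qed.

Lemma cvgCx_absP {T : Type} (F : set_system T) {FF : Filter F} (f : T -> Cx R) l :
  f x @[x --> F] --> l <-> absC (f x - l) @[x --> F] --> 0.
Proof.
split=> [/cvgCxP H|/cvgrPdist_lt H].
  apply/cvgrPdist_lt => e /H; apply: filterS => x.
  by rewrite sub0r normrN ger0_norm ?absC_ge0// absC_distC.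
apply/cvgCxP => e /H; apply: filterS => x.
by rewrite sub0r normrN ger0_norm ?absC_ge0// absC_distC.
Qed.

Lemma cvgCx_reim {T : Type} (F : set_system T) {FF : Filter F} (f : T -> Cx R) l :
  f x @[x --> F] --> l <->
  (reC (f x) @[x --> F] --> reC l) /\ (imC (f x) @[x --> F] --> imC l).
Proof.
split=> [/cvgCxP H|[/cvgrPdist_lt H1 /cvgrPdist_lt H2]].
  split; apply/cvgrPdist_lt => e /H; apply: filterS => x; apply: le_lt_trans.
    by rewrite -reCB ler_absC_re.
  by rewrite -imCB ler_absC_im.
apply/cvgCxP => e e0; have e2 : 0 < e / 2 by rewrite divr_gt0.
apply: filterS2 (H1 _ e2) (H2 _ e2) => x; rewrite -reCB -imCB => h1 h2.
by apply: le_lt_trans (ler_absC_reim _) _; rewrite [ltRHS]splitr ltrD.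
Qed.

Lemma continuous_ofR : continuous (ofR : R -> Cx R).
Proof. by move=> x; apply/cvgCx_reim; split => /=; [exact: cvg_id|exact: cvg_cst]. Qed.
Lemma continuous_absC : continuous (absC : Cx R -> R).
Proof.
move=> z; apply/(@cvgrPdist_lt _ _ _ (nbhs z)) => e e0.
have /cvgCxP/(_ e e0) : x @[x --> z] --> z by exact: cvg_id.
by apply: filterS => x; apply: le_lt_trans; exact: ler_dist_absC.
Qed.
Lemma continuous_cis : continuous (cis : R -> Cx R).
Proof.
by move=> x; apply/cvgCx_reim; split => /=; [exact: continuous_cos|exact: continuous_sin].
Qed.

(** The linear-remainder form of the complex derivative, with real tolerances. It involves no
    quotient, so the increment 0 is no exception and remainders can be added and estimated
    directly. *)
Definition cdiff (g : Cx R -> Cx R) z l := forall e : R, 0 < e ->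
  exists2 d : R, 0 < d & forall w, absC w < d ->
    absC (g (z + w) - g z - l * w) <= e * absC w.

Lemma nbhs0_CxP (P : set (Cx R)) :
  (\forall w \near (0 : Cx R), P w) <-> exists2 d : R, 0 < d & forall w, absC w < d -> P w.
Proof.
split.
  move=> /nbhs_ballP[_ /gtCx0P[d d0 ->] H]; exists d => // w wd; apply: H.
  by rewrite /ball /= sub0r normrN normCxE ltCx_ofR.
move=> [d d0 H]; apply/nbhs_ballP; exists (ofR d).
  by rewrite /= -(ofR0 (R:=R)) ltCx_ofR.
by move=> w; rewrite /ball /= sub0r normrN normCxE ltCx_ofR => /H.
Qed.

Lemma is_derive_cdiff g z l : is_derive z 1 g l <-> cdiff g z l.
Proof.
split=> [[/cvg_ex[l' gl] <-] e e0|H].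
  have E : 'D_1 g z = l' by exact: cvg_lim gl.
  rewrite E; move/cvgCxP: gl => /(_ e e0).
  rewrite /nbhs /= => /nbhs0_CxP[d d0 H]; exists d => // w wd.
  have [->|w0] := eqVneq w 0.
    by rewrite mulr0 addr0 !subrr absC0 mulr0.
  have := H w wd w0; rewrite /= [w *: 1]mulr1 => H'.
  rewrite (addrC z).
  have -> : g (w + z) - g z - l' * w = - (w * (l' - w^-1 *: (g (w + z) - g z))).
    by rewrite /GRing.scale /=; field.
  by rewrite absCN absCM mulrC ler_wpM2r ?absC_ge0// ltW.
have D : (fun w => w^-1 *: (g (w *: 1 + z) - g z)) @ 0^' --> l.
  apply/cvgCxP => e e0; have e2 : 0 < e / 2 by rewrite divr_gt0.
  have [d d0 h] := H _ e2.
  apply/nbhs0_CxP; exists d => // w wd w0.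
  have := h w wd.
  have -> : g (z + w) - g z - l * w = - (w * (l - w^-1 *: (g (w *: 1 + z) - g z))).
    by rewrite /GRing.scale /= mulr1 (addrC z); field.
  rewrite absCN absCM mulrC ler_pM2r ?absC_gt0// => /le_lt_trans; apply.
  by rewrite ltr_pdivrMr// ltr_pMr// ltr1n.
by split; [apply/cvg_ex; exists l|exact: cvg_lim D].
Qed.

Lemma derivable_cdiff g z : derivable g z 1 -> cdiff g z (derive1 g z).
Proof. by move=> H; apply/is_derive_cdiff; rewrite derive1E; apply: DeriveDef. Qed.

Lemma cdiff_derivable g z l : cdiff g z l -> derivable g z 1.
Proof. by move=> /is_derive_cdiff[]. Qed.

Lemma cdiff_derive1 g z l : cdiff g z l -> derive1 g z = l.
Proof. by move=> /is_derive_cdiff[_ <-]; rewrite derive1E. Qed.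

Lemma cdiff_continuous g z l : cdiff g z l -> {for z, continuous g}.
Proof.
move=> /is_derive_cdiff[H _]; apply: differentiable_continuous.
exact/derivable1_diffP.
Qed.

End ComplexTopology.

(** * Measurability and integrals of complex functions *)

Section RealIntegrals.
Local Open Scope ereal_scope.
Context {R : realType}.

(** Tonelli and Fubini are applied on full product spaces; a function given on a rectangle is
    extended by zero first. *)
Lemma measurable_patch_prod d1 d2 (T1 : measurableType d1) (T2 : measurableType d2)
    (D1 : set T1) (D2 : set T2) (g : T1 * T2 -> R) :
  measurable D1 -> measurable D2 -> measurable_fun (D1 `*` D2) g ->
  measurable_fun setT (g \_ (D1 `*` D2)).
Proof. by move=> mD1 mD2 mg; apply/(measurable_restrictT _ _).1 => //; exact: measurableX. Qed.

Lemma patch_prod d1 d2 (T1 : measurableType d1) (T2 : measurableType d2)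
    (D1 : set T1) (D2 : set T2) (g : T1 * T2 -> R) x y :
  (g \_ (D1 `*` D2)) (x, y) = (if (x \in D1) && (y \in D2) then g (x, y) else 0)%R.
Proof.
rewrite patchE; congr (if _ then _ else _).
apply/idP/andP; first by rewrite inE => -[/= a b]; split; exact/mem_set.
by move=> [/set_mem a /set_mem b]; rewrite inE.
Qed.

Section Param.
Context d1 d2 (T1 : measurableType d1) (T2 : measurableType d2).
Variables (m2 : {sigma_finite_measure set T2 -> \bar R}).
Variables (D1 : set T1) (D2 : set T2).
Hypotheses (mD1 : measurable D1) (mD2 : measurable D2).

Lemma measurable_integral_param (g : T1 * T2 -> R) :
  measurable_fun (D1 `*` D2) g -> (forall p, (D1 `*` D2) p -> (0 <= g p)%R) ->
  measurable_fun D1 (fun x => \int[m2]_(y in D2) (g (x, y))%:E).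
Proof.
move=> mg g0; pose G := EFin \o (g \_ (D1 `*` D2)).
have mG : measurable_fun setT G.
  by apply/measurable_EFinP; exact: measurable_patch_prod.
have G0 p : 0 <= G p.
  rewrite /G /= lee_fin patchE; case: ifPn => // /[!inE]; exact: g0.
have mF : measurable_fun setT (fubini_F m2 G).
  exact: (@measurable_fun_fubini_tonelli_F _ _ _ _ _ m2 G mG G0).
move: (measurable_funS measurableT (@subsetT _ D1) mF).
apply: eq_measurable_fun => x /set_mem D1x.
rewrite /fubini_F [RHS]integral_mkcond; apply: eq_integral => y _.
by rewrite /G /= patch_prod patchE mem_set//=; case: ifP.
Qed.

Lemma measurable_Rintegral_param (g : T1 * T2 -> R) :
  measurable_fun (D1 `*` D2) g ->
  (forall x, D1 x -> m2.-integrable D2 (EFin \o (fun y => g (x, y)))) ->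
  measurable_fun D1 (fun x => Rintegral m2 D2 (fun y => g (x, y))).
Proof.
move=> mg ig.
(* The nonnegative case applies to each part of [g]; integrability of the sections keeps both
   integrals finite, so that [fine] respects their difference. *)
pose gp p := Num.max (g p) 0%R; pose gn p := Num.max (- g p)%R 0%R.
have mgp : measurable_fun (D1 `*` D2) gp by apply: measurable_maxr.
have mgn : measurable_fun (D1 `*` D2) gn.
  by apply: measurable_maxr => //; apply: measurableT_comp.
pose Ip x := \int[m2]_(y in D2) (gp (x, y))%:E.
pose In x := \int[m2]_(y in D2) (gn (x, y))%:E.
have mI : measurable_fun D1 (fun x => fine (Ip x) - fine (In x))%R.
  apply: measurable_funB; apply: measurableT_comp => //.
    by apply: measurable_integral_param => // p _; rewrite le_max lexx orbT.
  by apply: measurable_integral_param => // p _; rewrite le_max lexx orbT.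
apply: eq_measurable_fun mI => x /set_mem D1x.
have Ep : Ip x = \int[m2]_(y in D2) (fun y => (g (x, y))%:E)^\+ y.
  by apply: eq_integral => y _; rewrite funeposE /= /gp EFin_max.
have En : In x = \int[m2]_(y in D2) (fun y => (g (x, y))%:E)^\- y.
  by apply: eq_integral => y _; rewrite funenegE /= /gn EFin_max.
have E : \int[m2]_(y in D2) (g (x, y))%:E = Ip x - In x by rewrite integralE Ep En.
have Fp : Ip x \is a fin_num by rewrite Ep; exact: integrable_pos_fin_num (ig _ D1x).
have Fn : In x \is a fin_num by rewrite En; exact: integrable_neg_fin_num (ig _ D1x).
by rewrite -(fineB Fp Fn); exact: (congr1 fine (esym E)).
Qed.

Variable m1 : {sigma_finite_measure set T1 -> \bar R}.

(** Integrability is asked of every section, not of almost every one: the inner real integrals then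
    agree with the extended ones everywhere and no exceptional null set has to be tracked. *)
Lemma RFubini (g : T1 * T2 -> R) :
  measurable_fun (D1 `*` D2) g ->
  (forall x, D1 x -> m2.-integrable D2 (EFin \o (fun y => g (x, y)))) ->
  (forall y, D2 y -> m1.-integrable D1 (EFin \o (fun x => g (x, y)))) ->
  \int[m1]_(x in D1) \int[m2]_(y in D2) `|g (x, y)|%:E < +oo ->
  [/\ m1.-integrable D1 (fun x => (Rintegral m2 D2 (fun y => g (x, y)))%:E),
      m2.-integrable D2 (fun y => (Rintegral m1 D1 (fun x => g (x, y)))%:E) &
      Rintegral m1 D1 (fun x => Rintegral m2 D2 (fun y => g (x, y))) =
      Rintegral m2 D2 (fun y => Rintegral m1 D1 (fun x => g (x, y)))].
Proof.
move=> mg i1 i2 goo; pose G := EFin \o (g \_ (D1 `*` D2)).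
have mG : measurable_fun setT G.
  by apply/measurable_EFinP; exact: measurable_patch_prod.
have iG : (m1 \x m2)%E.-integrable setT G.
  apply/(integrable12ltyP m1 m2 mG); apply: le_lt_trans goo.
  rewrite le_eqVlt; apply/orP; left; apply/eqP.
  rewrite [RHS]integral_mkcond; apply: eq_integral => x _.
  rewrite patchE; case: ifPn => xD1; last first.
    by apply: integral0_eq => y _; rewrite /G /= patch_prod (negbTE xD1) /= normr0.
  rewrite [RHS]integral_mkcond; apply: eq_integral => y _.
  by rewrite /G /= patch_prod patchE xD1 /=; case: ifP; rewrite ?normr0.
have E1 : fubini_F m2 G =
    (fun x => (Rintegral m2 D2 (fun y => g (x, y)))%:E) \_ D1.
  apply/funext => x; rewrite /fubini_F patchE; case: ifPn => xD1; last first.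
    by apply: integral0_eq => y _; rewrite /G /= patch_prod (negbTE xD1).
  rewrite /Rintegral fineK; last first.
    by apply: integrable_fin_num => //; apply: i1; exact: set_mem.
  rewrite [RHS]integral_mkcond; apply: eq_integral => y _.
  by rewrite /G /= patch_prod patchE xD1 /=; case: ifP.
have E2 : fubini_G m1 G =
    (fun y => (Rintegral m1 D1 (fun x => g (x, y)))%:E) \_ D2.
  apply/funext => y; rewrite /fubini_G patchE; case: ifPn => yD2; last first.
    by apply: integral0_eq => x _; rewrite /G /= patch_prod (negbTE yD2) andbF.
  rewrite /Rintegral fineK; last first.
    by apply: integrable_fin_num => //; apply: i2; exact: set_mem.
  rewrite [RHS]integral_mkcond; apply: eq_integral => x _.
  by rewrite /G /= patch_prod patchE yD2 andbT /=; case: ifP.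
split.
- by apply/integrable_mkcond => //; rewrite -E1; exact: integrable_fubini_F iG.
- apply/integrable_mkcond => //; rewrite -E2; apply/integrableP; split.
    exact: measurable_fubini_G iG.
  apply: le_lt_trans (((@integrable21ltyP _ _ _ _ _ m1 m2 _ mG).1 iG)).
  apply: ge0_le_integral => //.
  + by apply: measurableT_comp => //; exact: measurable_fubini_G iG.
  + apply: (@measurable_fun_fubini_tonelli_G _ _ _ _ _ m1 (abse \o G)) => //.
      exact: measurableT_comp.
    by move=> p; exact: abse_ge0.
  + move=> y _; apply: le_abse_integral => //.
    by apply: measurableT_comp.
- rewrite {1}/Rintegral [in RHS]/Rintegral; congr fine.
  rewrite [LHS]integral_mkcond [RHS]integral_mkcond -E1 -E2.
  exact: Fubini iG.
Qed.

End Param.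
End RealIntegrals.

Section ComplexMeasurable.
Context {R : realType} {d} {Y : measurableType d}.
Implicit Types (D : set Y) (f g : Y -> Cx R).

Lemma eq_cmeasurable D f g : (forall x, D x -> f x = g x) ->
  cmeasurable D f -> cmeasurable D g.
Proof.
by move=> fg [m1 m2]; split; [apply: eq_measurable_fun m1|apply: eq_measurable_fun m2]
  => x /set_mem Dx /=; rewrite fg.
Qed.

Lemma cmeasurable_cst D (c : Cx R) : cmeasurable D (cst c).
Proof. by split; exact: measurable_cst. Qed.

Lemma cmeasurableD D f g : cmeasurable D f -> cmeasurable D g ->
  cmeasurable D (fun x => f x + g x).
Proof.
move=> [f1 f2] [g1 g2]; split.
  by apply: eq_measurable_fun (measurable_funD f1 g1) => x _ /=; rewrite reCD.
by apply: eq_measurable_fun (measurable_funD f2 g2) => x _ /=; rewrite imCD.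
Qed.

Lemma cmeasurableM D f g : cmeasurable D f -> cmeasurable D g ->
  cmeasurable D (fun x => f x * g x).
Proof.
move=> [f1 f2] [g1 g2]; split.
  have := measurable_funB (measurable_funM f1 g1) (measurable_funM f2 g2).
  by apply: eq_measurable_fun => x _ /=; rewrite reCM.
have := measurable_funD (measurable_funM f1 g2) (measurable_funM f2 g1).
by apply: eq_measurable_fun => x _ /=; rewrite imCM.
Qed.

Lemma cmeasurableZ D (c : Cx R) f : cmeasurable D f -> cmeasurable D (fun x => c * f x).
Proof. by move=> mf; apply: cmeasurableM => //; exact: cmeasurable_cst. Qed.

Lemma cmeasurableB D f g : cmeasurable D f -> cmeasurable D g ->
  cmeasurable D (fun x => f x - g x).
Proof.
move=> mf mg; have := cmeasurableD mf (cmeasurableZ (-1) mg).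
by apply: eq_cmeasurable => x _; rewrite mulN1r.
Qed.

Lemma cmeasurable_sum (I : Type) (r : seq I) D (F : I -> Y -> Cx R) :
  (forall i, cmeasurable D (F i)) -> cmeasurable D (fun x => \sum_(i <- r) F i x).
Proof.
move=> mF; elim: r => [|i r IH].
  by apply: eq_cmeasurable (cmeasurable_cst D 0) => x _; rewrite big_nil.
by apply: eq_cmeasurable (cmeasurableD (mF i) IH) => x _; rewrite big_cons.
Qed.

Lemma cmeasurable_exp D f n : cmeasurable D f -> cmeasurable D (fun x => f x ^+ n).
Proof.
move=> mf; elim: n => [|n IH].
  by apply: eq_cmeasurable (cmeasurable_cst D 1) => x _; rewrite expr0.
by apply: eq_cmeasurable (cmeasurableM mf IH) => x _; rewrite exprS.
Qed.

Lemma cmeasurable_ofR D (f : Y -> R) : measurable_fun D f -> cmeasurable D (ofR \o f).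
Proof. by move=> mf; split => //=; exact: measurable_cst. Qed.

Lemma cmeasurable_cis D (f : Y -> R) : measurable_fun D f -> cmeasurable D (cis \o f).
Proof.
move=> mf; split; apply: measurableT_comp => //.
  by apply: continuous_measurable_fun; exact: continuous_cos.
by apply: continuous_measurable_fun; exact: continuous_sin.
Qed.

Lemma cmeasurable_expC D f : cmeasurable D f -> cmeasurable D (expC \o f).
Proof.
move=> [f1 f2]; apply: cmeasurableM; last exact: cmeasurable_cis.
apply: (@cmeasurable_ofR D (expR \o (reC \o f))).
by apply: measurableT_comp.
Qed.

Lemma cmeasurable_absC D f : cmeasurable D f -> measurable_fun D (absC \o f).
Proof.
move=> [f1 f2].
have -> : absC \o f = @Num.sqrt R \o (fun x => reC (f x) ^+ 2 + imC (f x) ^+ 2).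
  by apply/funext => x /=; rewrite absCE.
apply: measurableT_comp.
  by apply: continuous_measurable_fun; exact: sqrt_continuous.
by apply: measurable_funD; exact: measurable_funX.
Qed.

Lemma cmeasurable_cvg D (f_ : nat -> Y -> Cx R) f : (forall n, cmeasurable D (f_ n)) ->
  (forall x, D x -> f_ n x @[n --> \oo] --> f x) -> cmeasurable D f.
Proof.
move=> mf ff; split.
  apply: (@measurable_fun_cvg _ _ _ D (fun n => reC \o f_ n)).
    by move=> n; case: (mf n).
  by move=> x /ff /cvgCx_reim[].
apply: (@measurable_fun_cvg _ _ _ D (fun n => imC \o f_ n)).
  by move=> n; case: (mf n).
by move=> x /ff /cvgCx_reim[].
Qed.

Lemma cmeasurableT_comp d' (Z : measurableType d') (k : Y -> Cx R) (f : Z -> Y) (D : set Z) :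
  cmeasurable setT k -> measurable_fun D f -> cmeasurable D (k \o f).
Proof.
move=> [k1 k2] mf; split.
  exact: (measurableT_comp (f:=reC \o k)).
exact: (measurableT_comp (f:=imC \o k)).
Qed.

Lemma cmeasurableS (D E : set Y) f : measurable E -> D `<=` E -> cmeasurable E f -> cmeasurable D f.
Proof. by move=> mE DE [f1 f2]; split; [exact: measurable_funS f1|exact: measurable_funS f2]. Qed.

End ComplexMeasurable.

Section ComplexIntegrals.
Context {R : realType} {d} {Y : measurableType d}.
Variables (mu : {measure set Y -> \bar R}) (D : set Y).
Hypothesis mD : measurable D.
Implicit Types (f g : Y -> Cx R).

Lemma cintegrableP f : cintegrable mu D f <->
  mu.-integrable D (EFin \o (reC \o f)) /\ mu.-integrable D (EFin \o (imC \o f)).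
Proof.
split=> [[[f1 f2] foo]|[/integrableP[m1 i1] /integrableP[m2 i2]]].
  have iA : mu.-integrable D (EFin \o (absC \o f)).
    apply/integrableP; split; first exact/measurable_EFinP/cmeasurable_absC.
    by under eq_integral do rewrite /= ger0_norm ?absC_ge0//.
  split; apply: le_integrable iA => //; try exact/measurable_EFinP.
    by move=> x _ /=; rewrite lee_fin [leRHS]ger0_norm ?absC_ge0// ler_absC_re.
  by move=> x _ /=; rewrite lee_fin [leRHS]ger0_norm ?absC_ge0// ler_absC_im.
move/measurable_EFinP : m1 => m1; move/measurable_EFinP : m2 => m2.
split; first by split.
apply: (@le_lt_trans _ _ (\int[mu]_(x in D) (`|reC (f x)|%:E + `|imC (f x)|%:E))%E).
  apply: ge0_le_integral => //.
  - by move=> x _; rewrite lee_fin absC_ge0.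
  - by apply/measurable_EFinP; exact: cmeasurable_absC.
  - by apply: emeasurable_funD; apply/measurable_EFinP; apply: measurableT_comp.
  - by move=> x _; rewrite -EFinD lee_fin ler_absC_reim.
rewrite ge0_integralD//; try by apply/measurable_EFinP; apply: measurableT_comp.
by rewrite lte_add_pinfty.
Qed.

Lemma cintegrable_absC f : cintegrable mu D f ->
  mu.-integrable D (EFin \o (absC \o f)).
Proof.
move=> [mf foo]; apply/integrableP; split.
  exact/measurable_EFinP/cmeasurable_absC.
by under eq_integral do rewrite /= ger0_norm ?absC_ge0//.
Qed.

Lemma cintegrable_le f (g : Y -> R) : cmeasurable D f ->
  mu.-integrable D (EFin \o g) -> (forall x, D x -> absC (f x) <= g x) ->
  cintegrable mu D f.
Proof.
move=> mf /integrableP[mg goo] fg; split=> //; apply: le_lt_trans goo.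
apply: ge0_le_integral => //.
- by move=> x _; rewrite lee_fin absC_ge0.
- by apply/measurable_EFinP; exact: cmeasurable_absC.
- exact: measurableT_comp.
- by move=> x Dx; rewrite lee_fin (le_trans (fg _ Dx))// ler_norm.
Qed.

Lemma eq_cintegrable f g : (forall x, D x -> f x = g x) ->
  cintegrable mu D f -> cintegrable mu D g.
Proof.
move=> fg [mf foo]; split; first exact: eq_cmeasurable mf.
by under eq_integral => x /set_mem Dx do rewrite -fg//.
Qed.

Lemma eq_cintegral f g : (forall x, D x -> f x = g x) ->
  cintegral mu D f = cintegral mu D g.
Proof.
by move=> fg; congr Complex; apply: eq_Rintegral => x /set_mem Dx /=; rewrite fg.
Qed.

Lemma cintegrableD f g : cintegrable mu D f -> cintegrable mu D g ->
  cintegrable mu D (fun x => f x + g x).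
Proof.
move=> /cintegrableP[f1 f2] /cintegrableP[g1 g2]; apply/cintegrableP; split.
  by apply: eq_integrable (integrableD mD f1 g1) => // x _ /=; rewrite reCD.
by apply: eq_integrable (integrableD mD f2 g2) => // x _ /=; rewrite imCD.
Qed.

Lemma cintegralD f g : cintegrable mu D f -> cintegrable mu D g ->
  cintegral mu D (fun x => f x + g x) = cintegral mu D f + cintegral mu D g.
Proof.
move=> /cintegrableP[f1 f2] /cintegrableP[g1 g2]; apply: Cx_ext => /=.
  by rewrite -RintegralD//; apply: eq_Rintegral => x _ /=; rewrite reCD.
by rewrite -RintegralD//; apply: eq_Rintegral => x _ /=; rewrite imCD.
Qed.

Lemma cintegrableZ (c : Cx R) f : cintegrable mu D f -> cintegrable mu D (fun x => c * f x).
Proof.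
move=> fi; apply: (@cintegrable_le _ (fun x => absC c * absC (f x))).
- by apply: cmeasurableZ; case: fi.
- by have := integrableZl mD (absC c) (cintegrable_absC fi); apply: eq_integrable.
- by move=> x _; rewrite absCM.
Qed.

Lemma cintegralZ (c : Cx R) f : cintegrable mu D f ->
  cintegral mu D (fun x => c * f x) = c * cintegral mu D f.
Proof.
move=> /cintegrableP[f1 f2].
have H (k : R) (g : Y -> R) : mu.-integrable D (EFin \o g) ->
    mu.-integrable D (EFin \o (fun x => k * g x)).
  by move=> /(integrableZl mD k); apply: eq_integrable.
apply: Cx_ext; rewrite ?reCM ?imCM /=.
  rewrite -!RintegralZl// -RintegralB ?H//.
  by apply: eq_Rintegral => x _ /=; rewrite reCM.
rewrite -!RintegralZl// -RintegralD ?H//.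
by apply: eq_Rintegral => x _ /=; rewrite imCM.
Qed.

Lemma cintegrableB f g : cintegrable mu D f -> cintegrable mu D g ->
  cintegrable mu D (fun x => f x - g x).
Proof.
move=> fi gi; apply: (@eq_cintegrable (fun x => f x + (-1) * g x)).
  by move=> x _; rewrite mulN1r.
by apply: cintegrableD => //; exact: cintegrableZ.
Qed.

Lemma cintegralB f g : cintegrable mu D f -> cintegrable mu D g ->
  cintegral mu D (fun x => f x - g x) = cintegral mu D f - cintegral mu D g.
Proof.
move=> fi gi; rewrite -mulN1r -cintegralZ// -cintegralD//; last exact: cintegrableZ.
by apply: eq_cintegral => x _; rewrite mulN1r.
Qed.

Lemma cintegrable_sum (I : Type) (r : seq I) (F : I -> Y -> Cx R) :
  (forall i, cintegrable mu D (F i)) -> cintegrable mu D (fun x => \sum_(i <- r) F i x).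
Proof.
move=> iF; elim: r => [|i r IH].
  apply: (@eq_cintegrable (cst 0)); first by move=> x _; rewrite big_nil.
  apply: (@cintegrable_le _ (cst 0)); first exact: cmeasurable_cst.
    exact: integrable0.
  by move=> x _; rewrite absC0.
by apply: eq_cintegrable (cintegrableD (iF i) IH) => x _; rewrite big_cons.
Qed.

Lemma cintegral0 : cintegral mu D (cst 0) = 0.
Proof.
have i0 : cintegrable mu D (cst 0).
  apply: (@cintegrable_le _ (cst 0)); first exact: cmeasurable_cst.
    exact: integrable0.
  by move=> x _; rewrite absC0.
transitivity (0 * cintegral mu D (cst 0)); last by rewrite mul0r.
by rewrite -cintegralZ//; apply: eq_cintegral => x _; rewrite mul0r.
Qed.

Lemma cintegral_sum (I : Type) (r : seq I) (F : I -> Y -> Cx R) :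
  (forall i, cintegrable mu D (F i)) ->
  cintegral mu D (fun x => \sum_(i <- r) F i x) = \sum_(i <- r) cintegral mu D (F i).
Proof.
move=> iF; elim: r => [|i r IH].
  by rewrite big_nil -[RHS]cintegral0; apply: eq_cintegral => x _; rewrite big_nil.
rewrite big_cons -IH -cintegralD//; last exact: cintegrable_sum.
by apply: eq_cintegral => x _; rewrite big_cons.
Qed.

(* The integral is rotated onto the positive real axis. *)
Lemma absC_cintegral_le f : cintegrable mu D f ->
  absC (cintegral mu D f) <= Rintegral mu D (absC \o f).
Proof.
move=> fi; set I := cintegral mu D f.
have [I0|I0] := eqVneq I 0.
  by rewrite I0 absC0; apply: Rintegral_ge0 => x _; exact: absC_ge0.
have aI : absC I != 0 by rewrite gt_eqF// absC_gt0.
pose c : Cx R := ofR (absC I) / I.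
have c1 : absC c = 1.
  by rewrite /c absCM absCV absC_ofR ger0_norm ?absC_ge0// mulfV.
have E : absC I = reC (cintegral mu D (fun x => c * f x)).
  by rewrite cintegralZ// -/I /c mulfVK.
rewrite E; have /cintegrableP[i1 _] := cintegrableZ c fi.
apply: le_Rintegral => //; first exact: cintegrable_absC.
move=> x _ /=; apply: (le_trans (ler_norm _)); apply: (le_trans (ler_absC_re _)).
by rewrite absCM c1 mul1r.
Qed.

Lemma absC_cintegral_le_bound f (g : Y -> R) : cmeasurable D f ->
  mu.-integrable D (EFin \o g) -> (forall x, D x -> absC (f x) <= g x) ->
  absC (cintegral mu D f) <= Rintegral mu D g.
Proof.
move=> mf ig fg; have fi := cintegrable_le mf ig fg.
apply: (le_trans (absC_cintegral_le fi)).
by apply: le_Rintegral => //; exact: cintegrable_absC.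
Qed.

Lemma Rdominated_cvg (f_ : nat -> Y -> R) (f : Y -> R) (g : Y -> R) :
  (forall n, measurable_fun D (f_ n)) ->
  (forall x, D x -> f_ n x @[n --> \oo] --> f x) ->
  mu.-integrable D (EFin \o g) ->
  (forall n x, D x -> `|f_ n x| <= g x) ->
  mu.-integrable D (EFin \o f) /\
  Rintegral mu D (f_ n) @[n --> \oo] --> Rintegral mu D f.
Proof.
move=> mf ff ig fg.
have mF : measurable_fun D f by exact: measurable_fun_cvg mf ff.
have [i _ c] : [/\ mu.-integrable D (EFin \o f),
    [sequence (\int[mu]_(x in D) `|(EFin \o f_ n) x - (EFin \o f) x|)%E]_n @ \oo --> 0%E &
    [sequence (\int[mu]_(x in D) (EFin \o f_ n) x)%E]_n @ \oo -->
      (\int[mu]_(x in D) (EFin \o f) x)%E].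
  apply: (@dominated_convergence _ _ _ mu D mD _ _ (EFin \o g)) => //.
  - by move=> n; exact/measurable_EFinP.
  - exact/measurable_EFinP.
  - apply: aeW => x Dx; apply: cvg_EFin; last exact: ff.
    by apply: nearW.
  - by apply: aeW => x n Dx /=; rewrite lee_fin fg.
split=> //.
apply: (@fine_cvg _ _ _ _ (fun n => \int[mu]_(x in D) (f_ n x)%:E)%E).
by rewrite /Rintegral fineK//; exact: integrable_fin_num i.
Qed.

Lemma cdominated_cvg (f_ : nat -> Y -> Cx R) f (g : Y -> R) :
  (forall n, cmeasurable D (f_ n)) ->
  (forall x, D x -> f_ n x @[n --> \oo] --> f x) ->
  mu.-integrable D (EFin \o g) ->
  (forall n x, D x -> absC (f_ n x) <= g x) ->
  cintegrable mu D f /\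
  cintegral mu D (f_ n) @[n --> \oo] --> cintegral mu D f.
Proof.
move=> mf ff ig fg.
have [i1 c1] := @Rdominated_cvg (fun n => reC \o f_ n) (reC \o f) g
  (fun n => (mf n).1) (fun x Dx => (((cvgCx_reim _ _).1 (ff x Dx))).1) ig
  (fun n x Dx => le_trans (ler_absC_re _) (fg n x Dx)).
have [i2 c2] := @Rdominated_cvg (fun n => imC \o f_ n) (imC \o f) g
  (fun n => (mf n).2) (fun x Dx => (((cvgCx_reim _ _).1 (ff x Dx))).2) ig
  (fun n x Dx => le_trans (ler_absC_im _) (fg n x Dx)).
by split; [exact/cintegrableP|exact/cvgCx_reim].
Qed.

End ComplexIntegrals.

(** * Fubini's theorem for complex functions on rectangles *)

Section ComplexFubini.
Context {R : realType} {d1 d2} {T1 : measurableType d1} {T2 : measurableType d2}.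
Variables (m1 : {sigma_finite_measure set T1 -> \bar R})
  (m2 : {sigma_finite_measure set T2 -> \bar R}) (D1 : set T1) (D2 : set T2).
Hypotheses (mD1 : measurable D1) (mD2 : measurable D2).
Variable f : T1 * T2 -> Cx R.
Hypothesis mf : cmeasurable (D1 `*` D2) f.
Hypothesis i1 : forall x, D1 x -> cintegrable m2 D2 (fun y => f (x, y)).

Lemma cmeasurable_cintegral_param : cmeasurable D1 (fun x => cintegral m2 D2 (fun y => f (x, y))).
Proof.
case: mf => mf1 mf2; split.
  by apply: (measurable_Rintegral_param mD1 mD2 mf1) => x /i1/(cintegrableP _ mD2)[].
by apply: (measurable_Rintegral_param mD1 mD2 mf2) => x /i1/(cintegrableP _ mD2)[].
Qed.

Hypothesis i2 : forall y, D2 y -> cintegrable m1 D1 (fun x => f (x, y)).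
Hypothesis foo : (\int[m1]_(x in D1) \int[m2]_(y in D2) (absC (f (x, y)))%:E < +oo)%E.

Lemma cFubini :
  [/\ cintegrable m1 D1 (fun x => cintegral m2 D2 (fun y => f (x, y))),
      cintegrable m2 D2 (fun y => cintegral m1 D1 (fun x => f (x, y))) &
      cintegral m1 D1 (fun x => cintegral m2 D2 (fun y => f (x, y))) =
      cintegral m2 D2 (fun y => cintegral m1 D1 (fun x => f (x, y)))].
Proof.
have ma : measurable_fun (D1 `*` D2) (absC \o f) by exact: cmeasurable_absC.
have H (p : Cx R -> R) : measurable_fun (D1 `*` D2) (p \o f) ->
    (forall x, D1 x -> measurable_fun D2 (fun y => p (f (x, y)))) ->
    (forall z, `|p z| <= absC z) ->
    (\int[m1]_(x in D1) \int[m2]_(y in D2) `|p (f (x, y))|%:E < +oo)%E.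
  move=> mp mpx pa; apply: le_lt_trans foo; apply: ge0_le_integral => //.
  - by move=> x _; apply: integral_ge0 => y _; rewrite lee_fin.
  - apply: (measurable_integral_param m2 mD1 mD2 (g := Num.norm \o (p \o f))).
      by apply: measurableT_comp.
    by move=> q _; exact: normr_ge0.
  - by apply: (measurable_integral_param m2 mD1 mD2 (g := absC \o f)) => // q _;
      exact: absC_ge0.
  - move=> x D1x; apply: ge0_le_integral => //.
    + apply/measurable_EFinP; apply: measurableT_comp => //.
      exact: mpx.
    + apply/measurable_EFinP; apply: cmeasurable_absC.
      by case: (i1 D1x).
    + by move=> y _; rewrite lee_fin.
case: mf => mf1 mf2.
have [a1 a2 a3] := RFubini mD1 mD2 mf1
  (fun x Dx => ((cintegrableP _ mD2 _).1 (i1 Dx)).1)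
  (fun y Dy => ((cintegrableP _ mD1 _).1 (i2 Dy)).1) (H reC mf1 (fun x Dx => (i1 Dx).1.1) (@ler_absC_re R)).
have [b1 b2 b3] := RFubini mD1 mD2 mf2
  (fun x Dx => ((cintegrableP _ mD2 _).1 (i1 Dx)).2)
  (fun y Dy => ((cintegrableP _ mD1 _).1 (i2 Dy)).2) (H imC mf2 (fun x Dx => (i1 Dx).1.2) (@ler_absC_im R)).
split; [exact/cintegrableP|exact/cintegrableP|].
by rewrite /cintegral; congr Complex.
Qed.

End ComplexFubini.

(** * Power series and entire functions *)

Section RealCurves.
Context {R : realType}.
Implicit Types (x h e : R) (K : R -> Cx R).

Lemma is_derive_epsP (f : R -> R) x l : is_derive x 1 f l <->
  forall e, 0 < e -> exists2 d : R, 0 < d &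
    forall h, `|h| < d -> `|f (x + h) - f x - l * h| <= e * `|h|.
Proof.
split=> [[/cvg_ex[l' fl] <-] e e0|H].
  have E : 'D_1 f x = l' by exact: cvg_lim fl.
  rewrite E; move/cvgrPdist_lt: fl => /(_ e e0).
  rewrite /nbhs /= => /nbhs_ballP[d /= d0 H]; exists d => // w wd.
  have [->|w0] := eqVneq w 0.
    by rewrite mulr0 addr0 !subrr normr0 mulr0.
  have := H w; rewrite /ball /= sub0r normrN => /(_ wd w0).
  rewrite /= [w *: 1]mulr1 => H'.
  rewrite (addrC x).
  have -> : f (w + x) - f x - l' * w = - (w * (l' - w^-1 *: (f (w + x) - f x))).
    by rewrite /GRing.scale /=; field.
  by rewrite normrN normrM mulrC ler_wpM2r// ltW.
have D : (fun w => w^-1 *: (f (w *: 1 + x) - f x)) @ 0^' --> l.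
  apply/cvgrPdist_lt => e e0; have e2 : 0 < e / 2 by rewrite divr_gt0.
  have [d d0 h] := H _ e2.
  apply/nbhs_ballP; exists d => // w; rewrite /ball /= sub0r normrN => wd w0.
  have := h w wd.
  have -> : f (x + w) - f x - l * w = - (w * (l - w^-1 *: (f (w *: 1 + x) - f x))).
    by rewrite /GRing.scale /= mulr1 (addrC x); field.
  rewrite normrN normrM mulrC ler_pM2r ?normr_gt0// => /le_lt_trans; apply.
  by rewrite ltr_pdivrMr// ltr_pMr// ltr1n.
by split; [apply/cvg_ex; exists l|exact: cvg_lim D].
Qed.

(** The counterpart of [cdiff] for complex-valued curves over a real parameter; [rdiff_comp] joins
    the two notions and [cFTC2] integrates along such curves. *)
Definition rdiff K x (l : Cx R) := forall e, 0 < e -> exists2 d : R, 0 < d &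
  forall h, `|h| < d -> absC (K (x + h) - K x - l * ofR h) <= e * `|h|.

Lemma rdiffP K x l : rdiff K x l <->
  is_derive x 1 (reC \o K) (reC l) /\ is_derive x 1 (imC \o K) (imC l).
Proof.
have reE h : reC (K (x + h) - K x - l * ofR h) =
    (reC \o K) (x + h) - (reC \o K) x - reC l * h.
  by rewrite !reCB reCM /= mulr0 subr0.
have imE h : imC (K (x + h) - K x - l * ofR h) =
    (imC \o K) (x + h) - (imC \o K) x - imC l * h.
  by rewrite !imCB imCM /= mulr0 add0r.
split=> [H|[/is_derive_epsP H1 /is_derive_epsP H2] e e0].
  split; apply/is_derive_epsP => e /H[d d0 {}H]; exists d => // h /H; apply: le_trans.
    by rewrite -reE ler_absC_re.
  by rewrite -imE ler_absC_im.
have e2 : 0 < e / 2 by rewrite divr_gt0.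
have [d1 d10 {}H1] := H1 _ e2; have [d2 d20 {}H2] := H2 _ e2.
exists (Num.min d1 d2); first by rewrite lt_min d10 d20.
move=> h; rewrite lt_min => /andP[/H1 h1 /H2 h2].
apply: le_trans (ler_absC_reim _) _; rewrite reE imE [e]splitr mulrDl.
exact: lerD.
Qed.

Lemma rdiff_cst (c : Cx R) x : rdiff (fun=> c) x 0.
Proof.
move=> e e0; exists 1 => // h _.
by rewrite subrr mul0r subrr absC0 mulr_ge0// ltW.
Qed.

Lemma rdiffD K K' x l l' : rdiff K x l -> rdiff K' x l' ->
  rdiff (fun t => K t + K' t) x (l + l').
Proof.
move=> H1 H2 e e0; have e2 : 0 < e / 2 by rewrite divr_gt0.
have [d1 d10 {}H1] := H1 _ e2; have [d2 d20 {}H2] := H2 _ e2.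
exists (Num.min d1 d2); first by rewrite lt_min d10 d20.
move=> h; rewrite lt_min => /andP[/H1 h1 /H2 h2].
have -> : K (x + h) + K' (x + h) - (K x + K' x) - (l + l') * ofR h =
  (K (x + h) - K x - l * ofR h) + (K' (x + h) - K' x - l' * ofR h) by ring.
apply: le_trans (ler_absCD _ _) _; rewrite [e]splitr mulrDl.
exact: lerD.
Qed.

Lemma rdiff_ofR (f : R -> R) x l : is_derive x 1 f l -> rdiff (ofR \o f) x (ofR l).
Proof.
by move=> H; apply/rdiffP; split => //=; exact: (is_derive_cst (0 : R) x 1).
Qed.

Lemma rdiff_lin (a b : Cx R) x : rdiff (fun t => a + ofR t * b) x b.
Proof.
move=> e e0; exists 1 => // h _.
have -> : a + ofR (x + h) * b - (a + ofR x * b) - b * ofR h = 0 by ring.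
by rewrite absC0 mulr_ge0// ltW.
Qed.

Lemma rdiff_comp (g : Cx R -> Cx R) K x l m :
  cdiff g (K x) l -> rdiff K x m -> rdiff (g \o K) x (l * m).
Proof.
move=> Hg HK e e0.
(* [C] bounds the increment of [K] by [C |h|] near [x], and [L] dominates [|l|]; the two remainders
   then get [e / 2] each. Adding 1 keeps both divisors positive. *)
pose C := absC m + 1; have C0 : 0 < C by rewrite ltr_wpDl// absC_ge0.
pose L := absC l + 1; have L0 : 0 < L by rewrite ltr_wpDl// absC_ge0.
have [dg dg0 {}Hg] : exists2 d : R, 0 < d & forall w, absC w < d ->
    absC (g (K x + w) - g (K x) - l * w) <= e / 2 / C * absC w.
  by apply: Hg; rewrite !divr_gt0.
have [d1 d10 H1] := HK 1 ltr01.
have [d2 d20 H2] : exists2 d : R, 0 < d & forall h, `|h| < d ->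
    absC (K (x + h) - K x - m * ofR h) <= e / 2 / L * `|h|.
  by apply: HK; rewrite !divr_gt0.
exists (Num.min (dg / C) (Num.min d1 d2)); first by rewrite !lt_min d10 d20 divr_gt0.
move=> h; rewrite !lt_min => /and3P[hg h1 h2].
pose w := K (x + h) - K x.
have wle : absC w <= C * `|h|.
  have -> : w = (K (x + h) - K x - m * ofR h) + m * ofR h by rewrite /w; ring.
  apply: le_trans (ler_absCD _ _) _; rewrite absCM absC_ofR /C mulrDl addrC.
  by rewrite lerD2l; exact: H1.
have wlt : absC w < dg by apply: le_lt_trans wle _; rewrite mulrC -ltr_pdivlMr.
have -> : (g \o K) (x + h) - (g \o K) x - l * m * ofR h =
    (g (K x + w) - g (K x) - l * w) + l * (K (x + h) - K x - m * ofR h).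
  rewrite /= /w (_ : K x + (K (x + h) - K x) = K (x + h)); [ring|ring].
apply: le_trans (ler_absCD _ _) _; rewrite [e]splitr mulrDl; apply: lerD.
  apply: le_trans (Hg _ wlt) _.
  rewrite -mulrA; apply: ler_wpM2l; first by rewrite ltW// divr_gt0.
  by rewrite mulrC ler_pdivrMr// mulrC.
rewrite absCM; apply: (@le_trans _ _ (L * (e / 2 / L * `|h|))).
  apply: ler_pM; rewrite ?absC_ge0//; first by rewrite /L lerDl.
  exact: H2.
by rewrite (_ : L * _ = e / 2 * `|h|)//; field; rewrite gt_eqF.
Qed.

Lemma cdiff_mulr (c : Cx R) z : cdiff (fun w => c * w) z c.
Proof.
move=> e e0; exists 1 => // w _.
have -> : c * (z + w) - c * z - c * w = 0 by ring.
by rewrite absC0 mulr_ge0// ?absC_ge0// ltW.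
Qed.

Lemma rdiffZ (c : Cx R) K x l : rdiff K x l -> rdiff (fun t => c * K t) x (c * l).
Proof. exact: rdiff_comp (cdiff_mulr c (K x)). Qed.

Lemma rdiff_unique K x l m : rdiff K x l -> rdiff K x m -> l = m.
Proof.
move=> /rdiffP[[_ a1] [_ a2]] /rdiffP[[_ b1] [_ b2]].
by apply: Cx_ext; rewrite -?a1 -?b1 -?a2 -?b2.
Qed.

Lemma rdiff_continuous K : (forall x, exists l, rdiff K x l) -> continuous K.
Proof.
move=> H x; have [l /rdiffP[[H1 _] [H2 _]]] := H x.
by apply/cvgCx_reim; split;
  [move/derivable1_diffP/differentiable_continuous : H1
  |move/derivable1_diffP/differentiable_continuous : H2].
Qed.

Lemma rdiff_cis x : rdiff cis x (imag * cis x).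
Proof.
apply/rdiffP; rewrite reCM imCM /= !mul0r !mul1r add0r; split.
  exact: is_derive_cos.
rewrite add0r; exact: is_derive_sin.
Qed.

Lemma rdiff_compR K (f : R -> R) x l m : rdiff K (f x) l -> is_derive x 1 f m ->
  rdiff (K \o f) x (l * ofR m).
Proof.
move=> /rdiffP[H1 H2] Hf; apply/rdiffP.
rewrite reCM imCM /= !mulr0 subr0 add0r.
have E (g : R -> R) d : is_derive (f x) 1 g d -> is_derive x 1 (g \o f) (d * m).
  by move=> Hg; exact: is_derive1_comp.
by split; [exact: E|exact: E].
Qed.

Lemma rdiff_cisM (c x : R) : rdiff (fun t => cis (c * t)) x (ofR c * imag * cis (c * x)).
Proof.
have H : is_derive x 1 (fun t => c * t) c.
  apply/is_derive_epsP => e e0; exists 1 => // h _.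
  by rewrite mulrDr [c * x + _]addrC addrK subrr normr0 mulr_ge0// ltW.
have := rdiff_compR (rdiff_cis (c * x)) H.
by rewrite (_ : imag * cis (c * x) * ofR c = ofR c * imag * cis (c * x)); last by ring.
Qed.

Lemma RFTC2 (f F : R -> R) (a b : R) : a <= b -> continuous f ->
  (forall x, a <= x <= b -> is_derive x 1 F (f x)) ->
  Rintegral leb `[a, b] f = F b - F a.
Proof.
rewrite le_eqVlt => /predU1P[<- _ _|ab cf dF].
  by rewrite set_itv1 Rintegral_set1 subrr.
have dc x : a <= x <= b -> {for x, continuous F}.
  by move=> /dF[d _]; apply: differentiable_continuous; exact/derivable1_diffP.
rewrite /Rintegral (@continuous_FTC2 _ f F)//.
- exact: continuous_subspaceT.
- split.
  + by move=> x /[!in_itv]/= /andP[/ltW ax /ltW xb]; case: (dF x) => //; apply/andP.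
  + by apply: cvg_at_right_filter; apply: dc; rewrite lexx ltW.
  + by apply: cvg_at_left_filter; apply: dc; rewrite lexx ltW.
- move=> x /[!in_itv]/= /andP[/ltW ax /ltW xb].
  by rewrite derive1E; case: (dF x) => //; apply/andP.
Qed.

Lemma cFTC2 K (k : R -> Cx R) (a b : R) : a <= b -> continuous k ->
  (forall x, a <= x <= b -> rdiff K x (k x)) ->
  cintegral leb `[a, b] k = K b - K a.
Proof.
move=> ab ck dK.
have c1 : continuous (reC \o k) by move=> x; have /cvgCx_reim[] := ck x.
have c2 : continuous (imC \o k) by move=> x; have /cvgCx_reim[] := ck x.
apply: Cx_ext; rewrite ?reCB ?imCB /=.
  by apply: (RFTC2 (F := reC \o K)) => // x /dK/rdiffP[].
by apply: (RFTC2 (F := imC \o K)) => // x /dK/rdiffP[].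
Qed.

(** The derivative is claimed in the open interval only; users take an interval larger than the one
    they integrate over. *)
Lemma antiderivative (f : R -> R) (a b : R) : continuous f ->
  exists F : R -> R, forall x, a < x < b -> is_derive x 1 F (f x).
Proof.
move=> cf; exists (fun x => Rintegral leb `[a, x] f) => x /andP[ax xb].
have fi : leb.-integrable `[a, b] (EFin \o f).
  apply: continuous_compact_integrable; first exact: segment_compact.
  exact: continuous_subspaceT.
have [d <-] := @continuous_FTC1_closed R f a x b xb fi ax (cf x).
by rewrite derive1E; apply: DeriveDef.
Qed.

Lemma cantiderivative (k : R -> Cx R) (a b : R) : continuous k ->
  exists K : R -> Cx R, forall x, a < x < b -> rdiff K x (k x).
Proof.
move=> ck.
have [F1 H1] : exists F : R -> R, forall x, a < x < b -> is_derive x 1 F (reC (k x)).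
  by apply: antiderivative => x; have /cvgCx_reim[] := ck x.
have [F2 H2] : exists F : R -> R, forall x, a < x < b -> is_derive x 1 F (imC (k x)).
  by apply: antiderivative => x; have /cvgCx_reim[] := ck x.
exists (fun x => Complex (F1 x) (F2 x)) => x xab; apply/rdiffP; split.
  exact: H1.
exact: H2.
Qed.

Lemma continuous_cintegrable (k : R -> Cx R) (a b : R) : continuous k ->
  cintegrable leb `[a, b] k.
Proof.
move=> ck; apply/cintegrableP => //; split.
  apply: continuous_compact_integrable; first exact: segment_compact.
  by apply: continuous_subspaceT => x; have /cvgCx_reim[] := ck x.
apply: continuous_compact_integrable; first exact: segment_compact.
by apply: continuous_subspaceT => x; have /cvgCx_reim[] := ck x.
Qed.

Lemma continuous_cmeasurable (k : R -> Cx R) (D : set (measurableTypeR R)) :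
  continuous k -> cmeasurable D k.
Proof.
move=> ck; apply: (@cmeasurableS _ _ _ _ setT) => //.
split; apply: continuous_measurable_fun => x; by have /cvgCx_reim[] := ck x.
Qed.

Lemma absC_cintegral_itv_le (k : R -> Cx R) (a b M : R) : a <= b ->
  cmeasurable `[a, b] k -> (forall t, a <= t <= b -> absC (k t) <= M) ->
  absC (cintegral leb `[a, b] k) <= M * (b - a).
Proof.
move=> ab mk kM; have -> : M * (b - a) = Rintegral leb `[a, b] (cst M).
  by rewrite Rintegral_cst//= lebesgue_measure_itv/= lte_fin; move: ab;
    rewrite le_eqVlt => /predU1P[->|->//]; rewrite ltxx/= subrr mulr0.
apply: absC_cintegral_le_bound => //.
  apply: continuous_compact_integrable; first exact: segment_compact.
  by apply: continuous_subspaceT => x; exact: cvg_cst.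
Qed.

End RealCurves.

(** * Exponential power series and their termwise derivative *)

Section PowerSeries.
Context {R : realType}.
Implicit Types (u : nat -> Cx R) (z w : Cx R) (r : R) (n : nat).

Lemma cvg_series_absC (f : nat -> Cx R) :
  cvgn (series (absC \o f)) -> cvgn (series f).
Proof.
move=> cf.
have H (p : Cx R -> R) : (forall z, `|p z| <= absC z) -> cvgn (series (p \o f)).
  move=> pa; apply: normed_cvg; apply: series_le_cvg cf => //.
  - by move=> n; exact: normr_ge0.
  - by move=> n /=; exact: absC_ge0.
  - by move=> n /=; exact: pa.
have cre := H reC (@ler_absC_re R); have cim := H imC (@ler_absC_im R).
apply/cvg_ex; exists (Complex (limn (series (reC \o f))) (limn (series (imC \o f)))).
apply/cvgCx_reim; split => /=.
  suff -> : (fun n => reC (series f n)) = series (reC \o f) by [].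
  by apply/funext => n; rewrite /series /= reC_sum.
suff -> : (fun n => imC (series f n)) = series (imC \o f) by [].
by apply/funext => n; rewrite /series /= imC_sum.
Qed.

Lemma absC_lim_le (f : nat -> Cx R) l (M : R) : f @ \oo --> l ->
  (forall n, absC (f n) <= M) -> absC l <= M.
Proof.
move=> fl fM; have H : absC (f n) @[n --> \oo] --> absC l.
  exact: (cvg_comp _ _ fl (@continuous_absC R l)).
rewrite -(cvg_lim _ H)//; apply: limr_le; first by apply/cvg_ex; exists (absC l).
exact: nearW.
Qed.

Definition abs_term u r n : R := absC (u n) * r ^+ n / (n`!)%:R.

(* the coefficient sequences [u] for which [hser u] is an entire function *)
Definition eseq u := forall r, 0 <= r -> cvgn (series (abs_term u r)).

Definition majorant u r := limn (series (abs_term u r)).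

Definition shiftc u : nat -> Cx R := fun n => u n.+1.

Lemma abs_term_ge0 u r n : 0 <= r -> 0 <= abs_term u r n.
Proof. by move=> r0; rewrite /abs_term !mulr_ge0 ?absC_ge0 ?exprn_ge0// invr_ge0. Qed.

Lemma absC_pow_term u z n : absC (pow_term u z n) = abs_term u (absC z) n.
Proof. by rewrite /pow_term !absCM absCV absCX absC_nat. Qed.

Lemma cvg_hser_abs u z : eseq u -> cvgn (series (absC \o pow_term u z)).
Proof.
move=> eu; have := eu _ (absC_ge0 z).
by rewrite (_ : absC \o pow_term u z = abs_term u (absC z))//;
  apply/funext => n /=; exact: absC_pow_term.
Qed.

Lemma cvg_hser u z : eseq u -> series (pow_term u z) @ \oo --> hser u z.
Proof. by move=> eu; apply: cvg_series_absC; exact: cvg_hser_abs. Qed.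

Lemma abs_series_le_majorant u r N : eseq u -> 0 <= r ->
  series (abs_term u r) N <= majorant u r.
Proof.
move=> eu r0; apply: nondecreasing_cvgn_le; last exact: eu.
apply/nondecreasing_seqP => n; rewrite seriesSr lerDl; exact: abs_term_ge0.
Qed.

Lemma majorant_ge0 u r : eseq u -> 0 <= r -> 0 <= majorant u r.
Proof.
move=> eu r0; apply: le_trans (abs_series_le_majorant 0 eu r0).
by rewrite /series /= big_geq.
Qed.

Lemma le_abs_term u r r' n : 0 <= r -> r <= r' -> abs_term u r n <= abs_term u r' n.
Proof.
move=> r0 rr; rewrite /abs_term ler_wpM2r ?invr_ge0// ler_wpM2l ?absC_ge0//.
by rewrite lerXn2r// nnegrE// (le_trans r0).
Qed.

Lemma absC_partial_le u z r N : eseq u -> absC z <= r ->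
  absC (series (pow_term u z) N) <= majorant u r.
Proof.
move=> eu zr; have r0 : 0 <= r by exact: le_trans (absC_ge0 z) zr.
apply: le_trans (abs_series_le_majorant N eu r0).
rewrite /series /=; apply: (le_trans (absC_sum _ _ _)); apply: ler_sum => i _.
by rewrite absC_pow_term le_abs_term// absC_ge0.
Qed.

Lemma absC_hser_le u z r : eseq u -> absC z <= r -> absC (hser u z) <= majorant u r.
Proof.
move=> eu zr; apply: (absC_lim_le (cvg_hser eu)) => n; exact: absC_partial_le.
Qed.

(** The remainder is a polynomial with nonnegative coefficients in which [w] has degree at least 2.
    Hence [|w| ^ 2] factors out and, as [|w| <= 1], the rest is largest when [z] and [w] are
    replaced by [|z|] and 1. The induction uses one ring identity at both pairs. *)
Lemma pow_remainder z w n : absC w <= 1 ->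
  absC ((z + w) ^+ n - z ^+ n - n%:R * z ^+ n.-1 * w) <=
  absC w ^+ 2 * ((absC z + 1) ^+ n - absC z ^+ n - n%:R * absC z ^+ n.-1).
Proof.
move=> w1; elim: n => [|n IH].
  by rewrite !expr0 !subrr !mul0r !subr0 absC0 mulr0.
have E (K : comRingType) (x y : K) : (x + y) ^+ n.+1 - x ^+ n.+1 - n.+1%:R * x ^+ n.+1.-1 * y =
    (x + y) * ((x + y) ^+ n - x ^+ n - n%:R * x ^+ n.-1 * y) + y ^+ 2 * (n%:R * x ^+ n.-1).
  have -> : n.+1%:R * x ^+ n.+1.-1 * y = x ^+ n * y + n%:R * (x * x ^+ n.-1) * y.
    case: n {IH} => [|n] /=; first by rewrite expr0; ring.
    by rewrite -exprS -[n.+2]addn1 natrD; ring.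
  by rewrite !exprS; ring.
rewrite E; have := E R (absC z) 1; rewrite !mulr1 expr1n mul1r => ->.
apply: le_trans (ler_absCD _ _) _; rewrite [leRHS]mulrDr; apply: lerD; last first.
  by rewrite !absCM !absCX absC_nat.
rewrite absCM mulrCA; apply: ler_pM; rewrite ?absC_ge0//.
by apply: le_trans (ler_absCD _ _) _; rewrite lerD2l.
Qed.

(** The factor [n] produced by differentiating a power series is absorbed by enlarging the radius by
    1; this gives [eseq_shift]. *)
Lemma nat_exp_le r n : 0 <= r -> n%:R * r ^+ n.-1 <= (r + 1) ^+ n.
Proof.
move=> r0; have r1 : 0 <= r + 1 by rewrite addr_ge0.
elim: n => [|n IH]; first by rewrite mul0r expr0 ler01.
rewrite [X in _ <= X]exprS mulrDl mul1r -[in n.+1%:R]addn1 natrD mulrDl mul1r /=.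
apply: lerD; last by rewrite lerXn2r// ?nnegrE// lerDl.
case: n IH => [|n] IH; first by rewrite mul0r mulr_ge0// exprn_ge0.
by rewrite exprS mulrCA ler_wpM2l.
Qed.

Lemma eseq_shift u : eseq u -> eseq (shiftc u).
Proof.
move=> eu r r0; have r1 : 0 <= r + 1 by rewrite addr_ge0.
apply: (@series_le_cvg _ _ (fun n => abs_term u (r + 1) n.+1)).
- by move=> n; exact: abs_term_ge0.
- by move=> n; exact: abs_term_ge0.
- move=> n; rewrite /abs_term /shiftc -!mulrA ler_wpM2l ?absC_ge0//.
  rewrite ler_pdivlMr ?ltr0n ?fact_gt0// factS natrM mulrA mulrAC.
  rewrite divfK ?pnatr_eq0 -?lt0n ?fact_gt0// mulrC.
  exact: (nat_exp_le n.+1).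
- have := eu _ r1; rewrite -(cvg_shiftS (series _)).
  have -> : (fun n => series (abs_term u (r + 1)) n.+1) =
    (fun n => abs_term u (r + 1) 0 + series (fun n => abs_term u (r + 1) n.+1) n).
    apply/funext => n; rewrite /series /= big_nat_recl//.
  move=> H; set g := (X in series X).
  have -> : series g = (fun n => (abs_term u (r + 1) 0 + series g n) - abs_term u (r + 1) 0).
    by apply/funext => n; rewrite addrC addKr.
  by apply/cvg_ex; eexists; apply: cvgB; [exact: H|exact: cvg_cst].
Qed.

Lemma cdiff_hser u z : eseq u -> cdiff (hser u) z (hser (shiftc u) z).
Proof.
move=> eu e e0; have az1 : 0 <= absC z + 1 by rewrite addr_ge0// absC_ge0.
pose M := majorant u (absC z + 1) + 1.
have M0 : 0 < M by rewrite ltr_wpDl// majorant_ge0.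
(* [pow_remainder] asks for [|w| <= 1], and the resulting bound [M |w| ^ 2] is at most [e |w|] once
   [|w| <= e / M]. *)
exists (Num.min 1 (e / M)); first by rewrite lt_min ltr01 divr_gt0.
move=> w; rewrite lt_min => /andP[/ltW w1 we].
have H : absC (hser u (z + w) - hser u z - hser (shiftc u) z * w) <=
    absC w ^+ 2 * majorant u (absC z + 1).
  (* The partial sums of the function have one term more than those of its derivative, since the
     shift lowers the index by one. *)
  pose f n := series (pow_term u (z + w)) n.+1 - series (pow_term u z) n.+1 -
     series (pow_term (shiftc u) z) n * w.
  apply: (@absC_lim_le f).
    apply: cvgB; first apply: cvgB.
    - by rewrite (cvg_shiftS (series _)); exact: cvg_hser.
    - by rewrite (cvg_shiftS (series _)); exact: cvg_hser.
    - by apply: cvgMl; exact/cvg_hser/eseq_shift.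
  move=> n; rewrite /f /series /=.
  have -> : (\sum_(0 <= k < n) pow_term (shiftc u) z k) * w =
      \sum_(0 <= k < n.+1) u k / (k`!)%:R * (k%:R * z ^+ k.-1 * w).
    rewrite big_nat_recl//= !mul0r mulr0 add0r mulr_suml; apply: eq_bigr => i _.
    rewrite /pow_term /shiftc factS natrM /=.
    have i1 : (i.+1%:R : Cx R) != 0 by rewrite pnatr_eq0.
    have f1 : ((i`!)%:R : Cx R) != 0 by rewrite pnatr_eq0 -lt0n fact_gt0.
    by field; rewrite f1 addrC natr1 i1.
  rewrite -!sumrB; apply: (le_trans (absC_sum _ _ _)).
  apply: (@le_trans _ _ (\sum_(0 <= i < n.+1) absC w ^+ 2 * abs_term u (absC z + 1) i)).
    apply: ler_sum => i _.
    have -> : pow_term u (z + w) i - pow_term u z i - u i / (i`!)%:R * (i%:R * z ^+ i.-1 * w)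
       = u i / (i`!)%:R * ((z + w) ^+ i - z ^+ i - i%:R * z ^+ i.-1 * w).
      by rewrite /pow_term; ring.
    rewrite absCM /abs_term absCM absCV absC_nat.
    have -> : absC w ^+ 2 * (absC (u i) * (absC z + 1) ^+ i / i`!%:R) =
      absC (u i) / i`!%:R * (absC w ^+ 2 * (absC z + 1) ^+ i) by ring.
    rewrite ler_wpM2l ?divr_ge0 ?absC_ge0//.
    apply: (le_trans (pow_remainder z i w1)); rewrite ler_wpM2l ?sqr_ge0//.
    by rewrite -addrA gerDl -opprD oppr_le0 addr_ge0// ?mulr_ge0// exprn_ge0// absC_ge0.
  rewrite -mulr_sumr ler_wpM2l ?sqr_ge0//.
  exact: (abs_series_le_majorant n.+1 eu az1).
apply: (le_trans H); rewrite expr2 mulrAC; apply: ler_wpM2r; first exact: absC_ge0.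
apply: (@le_trans _ _ (absC w * M)); first by rewrite ler_wpM2l ?absC_ge0// lerDl.
by rewrite -ler_pdivlMr// ltW.
Qed.

End PowerSeries.

(** * Goursat's theorem on triangles and the existence of primitives *)

Section Goursat.
Context {R : realType}.
Implicit Types (f : Cx R -> Cx R) (p q r z w : Cx R).

Definition edge f p q : Cx R :=
  (q - p) * cintegral leb `[0 : R, 1] (fun t => f (p + ofR t * (q - p))).

Definition triangle f p q r := edge f p q + edge f q r + edge f r p.

Lemma continuous_lin (a b : Cx R) : continuous (fun t : R => a + ofR t * b).
Proof. by apply: rdiff_continuous => x; exists b; exact: rdiff_lin. Qed.

Lemma continuous_edge f p q : continuous f ->
  continuous (fun t : R => f (p + ofR t * (q - p))).
Proof.
move=> cf t; apply: (@continuous_comp _ _ _ (fun t : R => p + ofR t * (q - p)) f).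
  exact: continuous_lin.
exact: cf.
Qed.

(** A primitive [K] of the integrand in the line parameter makes the integrals over all subsegments
    telescope; splitting at the midpoint and reversal of orientation are both read off from it. *)
Lemma edge_sub f p q : continuous f ->
  exists K : R -> Cx R, forall s t : R, 0 <= s <= 1 -> 0 <= t <= 1 ->
    edge f (p + ofR s * (q - p)) (p + ofR t * (q - p)) = K t - K s.
Proof.
move=> cf; have ck := continuous_edge (p := p) (q := q) cf.
(* The parameters in [[0, 1]] are interior to [[-1, 2]], where the primitive is differentiable. *)
have [K0 HK0] := cantiderivative (-1) 2 ck.
exists (fun x => (q - p) * K0 x) => s' t' s01 t01.
rewrite /edge; set a := p + ofR s' * _; set b := p + ofR t' * _.
have -> : b - a = ofR (t' - s') * (q - p) by rewrite /a /b rmorphB /=; ring.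
have E (x : R) : a + ofR x * (ofR (t' - s') * (q - p)) = p + ofR (s' + x * (t' - s')) * (q - p).
  by rewrite /a; ring.
under eq_cintegral do rewrite E.
have aff (x : R) : is_derive x 1 (fun x : R => s' + x * (t' - s')) (t' - s').
  apply/is_derive_epsP => e e0; exists 1 => // h _.
  rewrite (_ : _ - _ = 0); first by rewrite normr0 mulr_ge0// ltW.
  by ring.
rewrite -mulrBr [X in X * _ = _]mulrC -mulrA; congr (_ * _).
rewrite -cintegralZ//; last first.
  apply: continuous_cintegrable => x.
  apply: (@continuous_comp _ _ _ (fun x : R => s' + x * (t' - s'))
     (fun y => f (p + ofR y * (q - p)))); last exact: ck.
  by have [/derivable1_diffP/differentiable_continuous] := aff x.
have -> : K0 t' - K0 s' = (K0 \o (fun x : R => s' + x * (t' - s'))) 1 -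
    (K0 \o (fun x : R => s' + x * (t' - s'))) 0.
  by rewrite /= mul1r mul0r addr0 addrCA subrr addr0.
apply: (@cFTC2 _ (K0 \o (fun x : R => s' + x * (t' - s')))
  (fun x => ofR (t' - s') * f (p + ofR (s' + x * (t' - s')) * (q - p))) 0 1 ler01).
  move=> x; apply: cvgM; first exact: cvg_cst.
  apply: (@continuous_comp _ _ _ (fun x : R => s' + x * (t' - s'))
     (fun y => f (p + ofR y * (q - p)))); last exact: ck.
  by have [/derivable1_diffP/differentiable_continuous] := aff x.
move=> x /andP[x0 x1]; rewrite mulrC.
have xI : -1 < s' + x * (t' - s') < 2.
  by move: s01 t01 => /andP[s0 s1] /andP[t0 t1]; nra.
exact: (@rdiff_compR _ K0 (fun x : R => s' + x * (t' - s')) x _ _ (HK0 _ xI) (aff x)).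
Qed.

Lemma edge_split f p q : continuous f ->
  edge f p q = edge f p ((p + q) / 2) + edge f ((p + q) / 2) q.
Proof.
move=> cf; have [K HK] := edge_sub p q cf.
have e0 : p + ofR 0 * (q - p) = p by rewrite ofR0 mul0r addr0.
have e1 : p + ofR 1 * (q - p) = q by rewrite ofR1 mul1r addrC subrK.
have e2 : p + ofR (2^-1) * (q - p) = (p + q) / 2.
  by rewrite fmorphV rmorph_nat; field.
have := HK 0 1; rewrite e0 e1 => -> //.
have := HK 0 2^-1; rewrite e0 e2 => -> //.
have := HK 2^-1 1; rewrite e1 e2 => -> //.
- by ring.
- by lra.
- by lra.
- by lra.
- by lra.
- by lra.
- by lra.
Qed.

Lemma edge_opp f p q : continuous f -> edge f q p = - edge f p q.
Proof.
move=> cf; have [K HK] := edge_sub p q cf.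
have e0 : p + ofR 0 * (q - p) = p by rewrite ofR0 mul0r addr0.
have e1 : p + ofR 1 * (q - p) = q by rewrite ofR1 mul1r addrC subrK.
have -> : edge f p q = K 1 - K 0 by have := HK 0 1; rewrite e0 e1; apply; lra.
have -> : edge f q p = K 0 - K 1 by have := HK 1 0; rewrite e0 e1; apply; lra.
by rewrite opprB.
Qed.

Lemma edge_primitive f (F : Cx R -> Cx R) p q : continuous f ->
  (forall z, cdiff F z (f z)) -> edge f p q = F q - F p.
Proof.
move=> cf dF; have ck := continuous_edge (p := p) (q := q) cf.
rewrite /edge -cintegralZ//; last exact: continuous_cintegrable.
have -> : F q - F p = (F \o (fun t : R => p + ofR t * (q - p))) 1 -
    (F \o (fun t : R => p + ofR t * (q - p))) 0.
  by rewrite /= ofR1 ofR0 mul0r mul1r addr0 (addrC p) subrK.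
apply: (@cFTC2 _ (F \o (fun t : R => p + ofR t * (q - p)))
  (fun t => (q - p) * f (p + ofR t * (q - p))) 0 1 ler01).
  by move=> x; apply: cvgM; [exact: cvg_cst|exact: ck].
by move=> x _; rewrite mulrC; apply: rdiff_comp; [exact: dF|exact: rdiff_lin].
Qed.

Lemma edgeB f g p q : continuous f -> continuous g ->
  edge (fun z => f z - g z) p q = edge f p q - edge g p q.
Proof.
move=> cf cg; rewrite /edge -mulrBr -cintegralB//.
  exact/continuous_cintegrable/continuous_edge.
exact/continuous_cintegrable/continuous_edge.
Qed.

Lemma absC_edge_le f p q (M : R) : continuous f ->
  (forall t : R, 0 <= t <= 1 -> absC (f (p + ofR t * (q - p))) <= M) ->
  absC (edge f p q) <= absC (q - p) * M.
Proof.
move=> cf fM; rewrite /edge absCM ler_wpM2l ?absC_ge0//.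
have := @absC_cintegral_itv_le _ _ 0 1 M ler01
  (continuous_cmeasurable _ (continuous_edge (p := p) (q := q) cf)) fM.
by rewrite subr0 mulr1.
Qed.

Lemma cdiff_quad (a b z : Cx R) : cdiff (fun z => a * z + b * z ^+ 2 / 2) z (a + b * z).
Proof.
move=> e e0; pose M := absC b + 1.
have M0 : 0 < M by rewrite ltr_wpDl// absC_ge0.
exists (e / M); first by rewrite divr_gt0.
move=> w we.
have -> : a * (z + w) + b * (z + w) ^+ 2 / 2 - (a * z + b * z ^+ 2 / 2) - (a + b * z) * w
  = (w * b / 2) * w by field.
rewrite absCM ler_wpM2r ?absC_ge0// !absCM absCV absC_nat.
apply: (@le_trans _ _ (absC w * M)); last by rewrite -ler_pdivlMr// ltW.
rewrite -mulrA ler_wpM2l ?absC_ge0// /M; have := absC_ge0 b; lra.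
Qed.

Lemma continuous_aff (a b : Cx R) : continuous (fun z : Cx R => a + b * z).
Proof.
move=> z; apply: (@cdiff_continuous _ _ _ b) => e e0; exists 1 => // w _.
have -> : a + b * (z + w) - (a + b * z) - b * w = 0 by ring.
by rewrite absC0 mulr_ge0// ?absC_ge0// ltW.
Qed.

Lemma triangle_primitive f F p q r : continuous f ->
  (forall z, cdiff F z (f z)) -> triangle f p q r = 0.
Proof.
by move=> cf dF; rewrite /triangle !(edge_primitive _ _ cf dF); ring.
Qed.

Lemma triangleB f g p q r : continuous f -> continuous g ->
  triangle (fun z => f z - g z) p q r = triangle f p q r - triangle g p q r.
Proof. by move=> cf cg; rewrite /triangle !edgeB//; ring. Qed.

Definition perim p q r : R := absC (q - p) + absC (r - q) + absC (p - r).

Lemma absC_seg_le p q (t : R) : 0 <= t <= 1 -> absC (ofR t * (q - p)) <= absC (q - p).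
Proof.
move=> /andP[t0 t1]; rewrite absCM absC_ofR ger0_norm//.
by rewrite ler_piMl ?absC_ge0.
Qed.

Lemma perim_ge p q r : absC (q - p) <= perim p q r /\ absC (r - p) <= perim p q r.
Proof.
rewrite /perim (absC_distC r p).
by have := absC_ge0 (q - p); have := absC_ge0 (r - q); have := absC_ge0 (p - r); lra.
Qed.

(** The radius is a crude one: each point of the boundary is reached from [p] by two displacements
    of length at most the perimeter. *)
Lemma absC_triangle_le f p q r (M : R) : continuous f ->
  (forall z, absC (z - p) <= 2 * perim p q r -> absC (f z) <= M) ->
  absC (triangle f p q r) <= perim p q r * M.
Proof.
move=> cf fM; have [h1 h2] := perim_ge p q r.
have P0 : 0 <= perim p q r by apply: le_trans h1; exact: absC_ge0.
have h3 : absC (r - q) <= perim p q r.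
  by rewrite /perim; have := absC_ge0 (q - p); have := absC_ge0 (p - r); lra.
rewrite /triangle /perim mulrDl mulrDl.
apply: le_trans (ler_absCD _ _) _; apply: lerD; first (apply: le_trans (ler_absCD _ _) _; apply: lerD).
- apply: absC_edge_le => // t t01; apply: fM; rewrite (addrC p) addrK.
  by apply: (le_trans (absC_seg_le _ _ t01)); lra.
- apply: absC_edge_le => // t t01; apply: fM; rewrite addrAC.
  apply: (le_trans (ler_absCD _ _)).
  by have := absC_seg_le q r t01; lra.
- apply: absC_edge_le => // t t01; apply: fM; rewrite addrAC.
  apply: (le_trans (ler_absCD _ _)).
  by have := absC_seg_le r p t01; rewrite (absC_distC p r); lra.
Qed.

(** Joining the midpoints adds three inner edges, each run once in both directions, so that their
    contributions cancel. *)
Lemma triangle_split f p q r : continuous f ->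
  triangle f p q r = triangle f p ((p + q) / 2) ((p + r) / 2) +
    triangle f ((p + q) / 2) q ((q + r) / 2) + triangle f ((p + r) / 2) ((q + r) / 2) r
    + triangle f ((p + q) / 2) ((q + r) / 2) ((p + r) / 2).
Proof.
move=> cf; rewrite /triangle (edge_split p q cf) (edge_split q r cf) (edge_split r p cf).
rewrite (addrC r p) (edge_opp ((q + r) / 2) ((p + q) / 2) cf).
rewrite (edge_opp ((p + r) / 2) ((p + q) / 2) cf) (edge_opp ((q + r) / 2) ((p + r) / 2) cf).
have H (a1 a2 b1 b2 c1 c2 x y z' : Cx R) : a1 + a2 + (b1 + b2) + (c1 + c2) =
  (a1 + - y + c2) + (a2 + b1 + x) + (- z' + b2 + c1) + (- x + z' + y) by ring.
exact: H.
Qed.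

Lemma continuousCx_cst (c : Cx R) : continuous (fun _ : Cx R => c).
Proof.
move=> z; apply/(@cvgCxP _ _ (nbhs z)) => e e0.
by apply: nearW => w; rewrite subrr absC0.
Qed.

Lemma continuousCxB f g : continuous f -> continuous g -> continuous (fun z => f z - g z).
Proof. by move=> cf cg z; exact: (continuousB (@cf z) (@cg z)). Qed.

Section Cauchy.
Variable f : Cx R -> Cx R.
Hypothesis df : forall z, exists l, cdiff f z l.

Lemma diff_continuous : continuous f.
Proof. by move=> z; have [l] := df z; exact: cdiff_continuous. Qed.
Let cf := diff_continuous.

Let triple := (Cx R * Cx R * Cx R)%type.
Let T (t : triple) := triangle f t.1.1 t.1.2 t.2.
Let D (t : triple) := perim t.1.1 t.1.2 t.2.
Let t1 (t : triple) : triple := (t.1.1, (t.1.1 + t.1.2) / 2, (t.1.1 + t.2) / 2).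
Let t2 (t : triple) : triple := ((t.1.1 + t.1.2) / 2, t.1.2, (t.1.2 + t.2) / 2).
Let t3 (t : triple) : triple := ((t.1.1 + t.2) / 2, (t.1.2 + t.2) / 2, t.2).
Let t4 (t : triple) : triple :=
  ((t.1.1 + t.1.2) / 2, (t.1.2 + t.2) / 2, (t.1.1 + t.2) / 2).

Let halfE (p q r : Cx R) : absC ((p + q) / 2 - (p + r) / 2) = absC (q - r) / 2.
Proof.
have -> : (p + q) / 2 - (p + r) / 2 = (q - r) / 2 by field.
by rewrite absCM absCV absC_nat.
Qed.
Let halfE1 (p q : Cx R) : absC ((p + q) / 2 - p) = absC (q - p) / 2.
Proof.
have -> : (p + q) / 2 - p = (q - p) / 2 by field.
by rewrite absCM absCV absC_nat.
Qed.

(** One bisection: some quarter carries at least a fourth of the integral while the perimeter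
    halves. The last bound makes the first vertices a Cauchy sequence. *)
Let step t : exists t', [/\ absC (T t) <= 4 * absC (T t'), D t' = D t / 2 &
  absC (t'.1.1 - t.1.1) <= D t].
Proof.
case: t => [[p q] r]; have := triangle_split p q r cf.
have := perim_ge p q r; rewrite /D /T /perim /=.
have := absC_ge0 (q - p); have := absC_ge0 (r - q); have := absC_ge0 (p - r).
set A1 := triangle f p ((p + q) / 2) ((p + r) / 2).
set A2 := triangle f ((p + q) / 2) q ((q + r) / 2).
set A3 := triangle f ((p + r) / 2) ((q + r) / 2) r.
set A4 := triangle f ((p + q) / 2) ((q + r) / 2) ((p + r) / 2).
move=> d1 d2 d3 [d4 d5] E.
have : absC (triangle f p q r) <= absC A1 + absC A2 + absC A3 + absC A4.
  rewrite E; do 3 (apply: (le_trans (ler_absCD _ _)); rewrite lerD2r).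
  by [].
move=> H.
have h1 (x y : Cx R) : absC ((x + y) / 2 - x) = absC (y - x) / 2 by exact: halfE1.
have h2 (x y : Cx R) : absC (x - (x + y) / 2) = absC (y - x) / 2.
  by rewrite absC_distC halfE1.
have h3 (x y : Cx R) : absC ((x + y) / 2 - y) = absC (y - x) / 2.
  by rewrite (addrC x) halfE1 absC_distC.
have h4 (x y : Cx R) : absC (y - (x + y) / 2) = absC (y - x) / 2.
  by rewrite absC_distC h3.
have k1 : absC ((p + r) / 2 - (p + q) / 2) = absC (r - q) / 2 by rewrite halfE.
have k2 : absC ((q + r) / 2 - (p + q) / 2) = absC (p - r) / 2.
  by rewrite (addrC p q) halfE absC_distC.
have k3 : absC ((p + q) / 2 - (q + r) / 2) = absC (p - r) / 2.
  by rewrite -k2 absC_distC.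
have k4 : absC ((q + r) / 2 - (p + r) / 2) = absC (q - p) / 2.
  by rewrite (addrC q r) (addrC p r) halfE.
have k5 : absC ((p + r) / 2 - (q + r) / 2) = absC (q - p) / 2.
  by rewrite -k4 absC_distC.
have k6 : absC ((p + q) / 2 - (p + r) / 2) = absC (r - q) / 2.
  by rewrite -k1 absC_distC.
have [H1|H1] := leP (absC (triangle f p q r)) (4 * absC A1).
  exists (t1 (p, q, r)); split=> //=; last by rewrite subrr absC0; lra.
  by rewrite h1 k1 h2 (absC_distC r p); lra.
have [H2|H2] := leP (absC (triangle f p q r)) (4 * absC A2).
  exists (t2 (p, q, r)); split=> //=; last by rewrite h1; lra.
  by rewrite h4 h1 k3; lra.
have [H3|H3] := leP (absC (triangle f p q r)) (4 * absC A3).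
  exists (t3 (p, q, r)); split=> //=; last by rewrite h1; lra.
  by rewrite k4 h4 h3 (absC_distC r p); lra.
(* The four moduli add up to at least that of the whole triangle, so if the three corners fail the
   middle triangle succeeds. *)
exists (t4 (p, q, r)); split=> //=.
- by lra.
- by rewrite k2 k5 k6; lra.
- by rewrite h1; lra.
Qed.

Theorem Goursat p q r : triangle f p q r = 0.
Proof.
have [nxt Hn] := choice step.
pose s n := iter n nxt (p, q, r).
pose d := D (p, q, r).
have d0 : 0 <= d by apply: le_trans (perim_ge p q r).1; exact: absC_ge0.
have sD n : D (s n) = d / 2 ^+ n.
  elim: n => [|n IH]; first by rewrite expr0 divr1.
  by rewrite /s iterS; have [_ -> _] := Hn (s n); rewrite IH exprS invfM; field;
    rewrite expf_neq0.
have sT n : absC (T (p, q, r)) <= 4 ^+ n * absC (T (s n)).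
  elim: n => [|n IH]; first by rewrite expr0 mul1r.
  apply: (le_trans IH); rewrite exprSr -mulrA ler_wpM2l ?exprn_ge0//.
  by rewrite /s iterS; have [] := Hn (s n).
have Dn0 n : 0 <= D (s n) by rewrite sD divr_ge0// exprn_ge0.
have near k n : absC ((s (n + k)%N).1.1 - (s n).1.1) <= 2 * D (s n).
  elim: k n => [|k IH] n; first by rewrite addn0 subrr absC0 mulr_ge0.
  have := IH n.+1; rewrite addnS addSn => h.
  have [_ h1 h2] := Hn (s n).
  have -> : (s (n + k).+1).1.1 - (s n).1.1 = ((s (n + k).+1).1.1 - (s n.+1).1.1) +
    ((s n.+1).1.1 - (s n).1.1) by ring.
  apply: (le_trans (ler_absCD _ _)); move: h h1 h2.
  by rewrite -[nxt (s n)]/(s n.+1) => h h1 h2; rewrite h1 in h; lra.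
(* The first vertices move by at most [d / 2 ^ n] at step [n]; their increments sum to a limit, and
   the tail bound [near] passes to it. *)
have [c Hc] : exists c, forall n, absC (c - (s n).1.1) <= 2 * D (s n).
  pose g n := (s n.+1).1.1 - (s n).1.1.
  have gS n : series g n = (s n).1.1 - p.
    rewrite /series /= telescope_sumr //.
  have cg : cvgn (series (absC \o g)).
    apply: (@series_le_cvg _ _ (fun n => d * (2^-1) ^+ n)).
    - by move=> n; exact: absC_ge0.
    - by move=> n; rewrite mulr_ge0// exprn_ge0.
    - move=> n /=; have [_ _ h] := Hn (s n).
      by rewrite exprVn -sD; exact: h.
    - apply: is_cvg_geometric_series; rewrite ger0_norm ?invr_ge0//.
      by rewrite invf_lt1// ltr1n.
  have /cvg_ex[l gl] := cvg_series_absC cg.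
  exists (l + p) => n; apply: (@absC_lim_le _ (fun k => (s (n + k)%N).1.1 - (s n).1.1)).
    apply: cvgB; last exact: cvg_cst.
    have -> : (fun k => (s (n + k)%N).1.1) = (fun k => series g (k + n)%N + p).
      by apply/funext => k; rewrite gS subrK addnC.
    apply: cvgD; last exact: cvg_cst.
    have : [sequence series g (k + n)%N]_k @ \oo --> l by rewrite cvg_shiftn.
    exact.
  by move=> k; exact: near.
have [l dl] := df c.
apply: absC_eq0; apply/eqP; rewrite eq_le absC_ge0 andbT.
apply/ler_addgt0Pr => e e0; rewrite add0r.
(* With this tolerance the final estimate is [4 ^ n * D * e' * 4 D = e (d / (d + 1)) ^ 2], where
   [D = d / 2 ^ n]; the [+ 1] covers a degenerate triangle. *)
pose e' := e / (4 * (d + 1) ^+ 2).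
have d1 : 0 < d + 1 by rewrite ltr_wpDl.
have e'0 : 0 < e' by rewrite divr_gt0// mulr_gt0// exprn_gt0.
have [del del0 Hd] := dl _ e'0.
have [n Hn'] : exists n, 4 * D (s n) < del.
  have : (fun n => 4 * d * (2^-1) ^+ n) @ \oo --> (0 : R).
    rewrite -[X in _ --> X](mulr0 (4 * d)); apply: cvgMr.
    apply: cvg_expr; rewrite ger0_norm ?invr_ge0//.
    by rewrite invf_lt1// ltr1n.
  move=> /cvgrPdist_lt /(_ _ del0) [N _ /(_ N (leqnn _))].
  rewrite sub0r normrN => h; exists N; apply: le_lt_trans h.
  by rewrite sD -exprVn mulrA ler_norm.
(* The affine approximation of [f] at [c] has a quadratic primitive, so subtracting it leaves the
   triangle integral unchanged and the integrand at most [e' |z - c|]. *)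
have caff := @continuous_aff (f c - l * c) l.
pose g z := f z - (f c - l * c + l * z).
have cg : continuous g by exact: continuousCxB.
have Tg : T (s n) = triangle g (s n).1.1 (s n).1.2 (s n).2.
  have T0 := triangle_primitive (s n).1.1 (s n).1.2 (s n).2 caff (cdiff_quad (f c - l * c) l).
  have := triangleB (s n).1.1 (s n).1.2 (s n).2 cf caff.
  by rewrite T0 subr0.
have Tb : absC (T (s n)) <= D (s n) * (e' * (4 * D (s n))).
  rewrite Tg; apply: absC_triangle_le => // z zs.
  have zc : absC (z - c) <= 4 * D (s n).
    have -> : z - c = (z - (s n).1.1) + ((s n).1.1 - c) by ring.
    apply: (le_trans (ler_absCD _ _)); rewrite (absC_distC _ c).
    by have := Hc n; rewrite /D in zs *; lra.
  have := Hd _ (le_lt_trans zc Hn').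
  rewrite (addrC c) subrK => h.
  have -> : g z = f z - f c - l * (z - c) by rewrite /g; ring.
  by apply: (le_trans h); rewrite ler_wpM2l// ltW.
apply: (le_trans (sT n)); apply: (@le_trans _ _ (4 ^+ n * (D (s n) * (e' * (4 * D (s n)))))).
  by rewrite ler_wpM2l// exprn_ge0.
rewrite sD.
have -> : 4 ^+ n * (d / 2 ^+ n * (e' * (4 * (d / 2 ^+ n)))) = e * (d / (d + 1)) ^+ 2.
  have -> : (4 : R) = 2 * 2 by ring.
  rewrite exprMn /e'; field; rewrite gt_eqF//= expf_neq0//.
apply: ler_piMr; first exact: ltW.
apply: exprn_ile1; first by rewrite divr_ge0// ltW.
by rewrite ler_pdivrMr// mul1r lerDl.
Qed.

(** The primitive is the integral from 0. Goursat's theorem on [0, z, z + w] turns its increment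
    into the integral over the segment from [z] to [z + w], and [f z * w] is the same integral of
    the constant [f z]; continuity bounds the difference. *)
Lemma diff_primitive : exists2 F, (forall z, cdiff F z (f z)) & continuous f.
Proof.
exists (edge f 0) => // z e e0.
move: (@cf z); move/cvgCxP => /(_ e e0)/nbhs_ballP[_ /gtCx0P[dl dl0 ->] H].
exists dl => // w wd.
have E : edge f 0 (z + w) - edge f 0 z = edge f z (z + w).
  have := Goursat 0 z (z + w); rewrite /triangle => /eqP.
  rewrite (edge_opp 0 (z + w) cf) subr_eq0 => /eqP <-; ring.
have ce : continuous (fun _ : Cx R => f z) by exact: continuousCx_cst.
have E2 : f z * w = edge (fun _ : Cx R => f z) z (z + w).
  by rewrite (@edge_primitive _ (fun x => f z * x) _ _ ce (cdiff_mulr _)); ring.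
rewrite E E2 -edgeB//.
have -> : e * absC w = absC (z + w - z) * e by rewrite (addrC z) addrK mulrC.
apply: absC_edge_le.
  exact: (continuousCxB cf ce).
move=> t t01; rewrite absC_distC; apply: ltW; apply: H.
rewrite /ball /= opprD addrA subrr sub0r normrN normCxE ltCx_ofR.
apply: le_lt_trans wd; apply: (le_trans (absC_seg_le _ _ t01)).
by rewrite (addrC z) addrK.
Qed.

End Cauchy.
End Goursat.

(** * Measurability through countable gluing and grid approximation *)

Section MeasurableGlue.
Context {R : realType}.

Lemma measurable_glue d d' (Y : measurableType d) (Z : measurableType d') (I : countType)
    (D : set Y) (q : Y -> I) (k : I -> Y -> Z) :
  (forall i, measurable (D `&` q @^-1` [set i])) ->
  (forall i, measurable_fun D (k i)) -> measurable_fun D (fun y => k (q y) y).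
Proof.
move=> mq mk mD B mB.
have -> : D `&` (fun y => k (q y) y) @^-1` B =
    \bigcup_i ((D `&` q @^-1` [set i]) `&` (D `&` (k i) @^-1` B)).
  apply/seteqP; split=> [y /= [Dy By]|y /= [i _ [[Dy /= <-] [_ By]]]].
    by exists (q y).
  by split.
apply: countable_bigcupT_measurable; first exact: countableP.
by move=> i; apply: measurableI => //; exact: mk.
Qed.

Lemma measurable_floor_level d (Y : measurableType d) (D : set Y) (f : Y -> R) (i : int) :
  measurable D -> measurable_fun D f ->
  measurable (D `&` (fun y => Num.floor (f y)) @^-1` [set i]).
Proof.
move=> mD mf.
have -> : D `&` (fun y => Num.floor (f y)) @^-1` [set i] =
    D `&` f @^-1` `[i%:~R, (i + 1)%:~R[.
  apply/seteqP; split=> y /= [Dy].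
    by move=> <-; split=> //; rewrite in_itv/= floor_le floorD1_gt.
  by rewrite in_itv /= => /floor_def <-.
by apply: mf.
Qed.

Definition grid n (x : R) : R := (Num.floor (n.+1%:R * x))%:~R / n.+1%:R.

Lemma cvg_grid (x : R) : grid n x @[n --> \oo] --> x.
Proof.
apply/cvgrPdist_le => e e0.
have [N _ HN] := near_infty_natSinv_lt (PosNum e0).
exists N => // n /= /HN /= ne; have n0 : (0 : R) < n.+1%:R by rewrite ltr0n.
rewrite /grid -[X in X - _](mulKf (lt0r_neq0 n0)) [_^-1 * _]mulrC -mulrBl normrM.
rewrite [X in _ * X]ger0_norm ?invr_ge0 ?ler0n//.
apply: (@le_trans _ _ (1 * n.+1%:R^-1)); last by rewrite mul1r ltW.
rewrite ler_wpM2r ?invr_ge0 ?ler0n//.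
rewrite ger0_norm ?subr_ge0 ?floor_le// lerBlDl.
by have := floorD1_gt (n.+1%:R * x); rewrite intrD => /ltW.
Qed.

(** Measurability is tested on real and imaginary parts, while [phi] mixes them. Rounding both parts
    of [g] to a grid of mesh [1 / (n + 1)] leaves countably many values, on which any [phi] is
    harmless; continuity then gives the limit. *)
Lemma cmeasurable_continuous_comp d (Y : measurableType d) (D : set Y) (phi : Cx R -> Cx R)
    (g : Y -> Cx R) : measurable D -> continuous phi -> cmeasurable D g ->
  cmeasurable D (phi \o g).
Proof.
move=> mD cphi [mg1 mg2].
pose q n y := (Num.floor (n.+1%:R * reC (g y)), Num.floor (n.+1%:R * imC (g y))).
pose k n (i : int * int) : Cx R := Complex (i.1%:~R / n.+1%:R) (i.2%:~R / n.+1%:R).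
apply: (@cmeasurable_cvg _ _ _ D (fun n y => phi (k n (q n y)))).
  have H (p : Cx R -> R) n : measurable_fun D (fun y => p (phi (k n (q n y)))).
    apply: (@measurable_glue _ _ _ _ _ D (q n) (fun i _ => p (phi (k n i)))).
      move=> [i j].
      have -> : D `&` q n @^-1` [set (i, j)] =
        (D `&` (fun y => Num.floor (n.+1%:R * reC (g y))) @^-1` [set i]) `&`
        (D `&` (fun y => Num.floor (n.+1%:R * imC (g y))) @^-1` [set j]).
        apply/seteqP; split=> y /=; first by move=> [Dy [<- <-]].
        by move=> [[Dy <-] [_ <-]].
      by apply: measurableI; apply: measurable_floor_level => //; apply: measurable_funM.
    by move=> i; exact: measurable_cst.
  by move=> n; split; exact: H.
move=> y Dy; have : k n (q n y) @[n --> \oo] --> g y.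
  by apply/cvgCx_reim; split; exact: cvg_grid.
by move/(cvg_comp _ _); apply; exact: cphi.
Qed.

Lemma continuous_disc_bounded (phi : Cx R -> Cx R) (r : R) : continuous phi ->
  exists2 M : R, 0 <= M & forall z, absC z <= r -> absC (phi z) <= M.
Proof.
move=> cphi.
pose m (p : R * R) : R := absC (phi (Complex p.1 p.2)).
have cm : continuous m.
  move=> p; apply: (@continuous_comp _ _ _ (fun p : R * R => Complex p.1 p.2 : Cx R)
      (fun z => absC (phi z))).
    by apply/(@cvgCx_reim _ _ (nbhs p)); split; [exact: cvg_fst|exact: cvg_snd].
  apply: (@continuous_comp _ _ _ phi absC); first exact: cphi.
  exact: continuous_absC.
have cK : compact (`[- r, r]%classic `*` `[- r, r]%classic : set (R * R)).
  by apply: compact_setX; exact: segment_compact.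
have := continuous_compact (continuous_subspaceT cm) cK.
move=> /compact_bounded[M [_ HM]].
exists (`|M| + 1); first by rewrite addr_ge0.
move=> z zr.
have Mlt : M < `|M| + 1 by rewrite ltr_pwDr// ler_norm.
have := HM _ Mlt (absC (phi z)).
rewrite /= ger0_norm ?absC_ge0//; apply.
exists (reC z, imC z); last by rewrite /m /=; case: (z).
have := ler_absC_re z; have := ler_absC_im z.
by rewrite !ler_norml /= !in_itv /= => /andP[h1 h2] /andP[h3 h4]; split;
  apply/andP; split; lra.
Qed.

End MeasurableGlue.

Section LebesgueInterval.
Context {R : realType}.
Variables (D : set (measurableTypeR R)).
Hypothesis mD : measurable D.

Lemma cintegral_lebZ (c : Cx R) (k : R -> Cx R) : cintegrable leb D k ->
  cintegral leb D (fun x => c * k x) = c * cintegral leb D k.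
Proof. exact: cintegralZ. Qed.

Lemma cintegrable_lebZ (c : Cx R) (k : R -> Cx R) : cintegrable leb D k ->
  cintegrable leb D (fun x => c * k x).
Proof. exact: cintegrableZ. Qed.

End LebesgueInterval.

(** * Cauchy's formula on a circle and the power series that it yields *)

Section CauchySeries.
Context {R : realType}.

Lemma continuous_exp (k : R -> Cx R) n : continuous k -> continuous (fun x => k x ^+ n).
Proof.
move=> ck; elim: n => [|n IH].
  have E : (fun x => k x ^+ 0) = (fun _ : R => 1 : Cx R).
    by apply/funext => x; rewrite expr0.
  by rewrite E => x; exact: cvg_cst.
have E : (fun x => k x ^+ n.+1) = (fun x => k x * k x ^+ n).
  by apply/funext => x; rewrite exprS.
by rewrite E => x; apply: cvgM; [exact: ck|exact: IH].
Qed.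
Variables (F f : Cx R -> Cx R).
Hypotheses (dF : forall z, cdiff F z (f z)) (cf : continuous f).
Variable r : R.
Hypothesis r0 : 0 < r.
Let T : R := 2 * pi.
Let T0 : 0 <= T. Proof. by rewrite mulr_ge0// pi_ge0. Qed.
Let g (x : R) : Cx R := ofR r * cis x.

Let absg x : absC (g x) = r.
Proof. by rewrite absCM absC_cis mulr1 absC_ofR gtr0_norm. Qed.
Let g_neq0 x : g x != 0.
Proof. by apply/eqP => /(congr1 absC); rewrite absg absC0 => /eqP; rewrite gt_eqF. Qed.
Let cis2pi : cis T = 1 :> Cx R.
Proof. by apply: Cx_ext; rewrite /= /T mulr_natl ?cos2pi ?sin2pi. Qed.
Let gT : g T = g 0.
Proof. by rewrite /g cis2pi cis0. Qed.
Let dg x : rdiff g x (imag * g x).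
Proof. by rewrite /g mulrCA; apply: rdiffZ; exact: rdiff_cis. Qed.
Let cg : continuous g.
Proof. by apply: rdiff_continuous => x; eexists; exact: dg. Qed.
Let cF : continuous F.
Proof. by move=> z; exact: (cdiff_continuous (dF z)). Qed.
Let imag_neq0 : imag != 0 :> Cx R.
Proof. by apply/eqP => /(congr1 absC); rewrite absC_imag absC0 => /eqP; rewrite oner_eq0. Qed.

(** The integrand is, up to a constant, the derivative of the periodic function
    [F (w + l (g x - w))] when [l] is nonzero, and of [f w * g x] when [l = 0]. *)
Lemma circle_integral0 (w : Cx R) (l : R) :
  cintegral leb `[0, T] (fun x => f (w + ofR l * (g x - w)) * g x) = 0.
Proof.
have dh (x : R) : rdiff (fun x => w + ofR l * (g x - w)) x (ofR l * (imag * g x)).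
  have := rdiffD (rdiff_cst w x) (rdiffZ (ofR l) (rdiffD (dg x) (rdiff_cst (- w) x))).
  by rewrite addr0 add0r.
have ch : continuous (fun x => w + ofR l * (g x - w)).
  by apply: rdiff_continuous => x; eexists; exact: dh.
have ck : continuous (fun x => f (w + ofR l * (g x - w)) * g x).
  move=> x; apply: cvgM; last exact: cg.
  apply: (@continuous_comp _ _ _ (fun x => w + ofR l * (g x - w)) f); first exact: ch.
  exact: cf.
have i2 : - imag * imag = 1 :> Cx R by rewrite mulNr imag2 opprK.
have [l0|l0] := eqVneq l 0.
  rewrite (@cFTC2 _ (fun x => - imag * f w * g x) _ 0 T T0 ck); first by rewrite gT subrr.
  move=> x _; rewrite l0 ofR0 mul0r addr0.
  have E : - imag * f w * (imag * g x) = - imag * imag * (f w * g x) by ring.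
  by have := rdiffZ (- imag * f w) (dg x); rewrite E i2 mul1r.
have ol : ofR l != 0 :> Cx R.
  by apply/eqP => /(congr1 absC)/eqP; rewrite absC_ofR absC0 normr_eq0; apply/negP.
rewrite (@cFTC2 _ (fun x => - imag / ofR l * F (w + ofR l * (g x - w))) _ 0 T T0 ck).
  by rewrite gT subrr.
move=> x _.
have := rdiffZ (- imag / ofR l) (rdiff_comp (dF _) (dh x)).
set A := f _; have -> : - imag / ofR l * (A * (ofR l * (imag * g x))) =
  - imag * imag * (A * g x) by field.
by rewrite i2 mul1r.
Qed.

(** The circle is contracted to [w]: [F (g x) - F w] is [g x - w] times the integral of
    [f (w + l (g x - w))] over [l] in [[0, 1]]. The factor cancels the denominator, and after Fubini
    each inner circle integral vanishes. *)
Lemma cauchy_difference (w : Cx R) : absC w < r ->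
  cintegral leb `[0, T] (fun x => (F (g x) - F w) * (g x / (g x - w))) = 0.
Proof.
move=> wr.
have gw x : g x - w != 0.
  by rewrite subr_eq0; apply/eqP => E; move: wr; rewrite -E absg ltxx.
pose H (p : R * R) := f (w + ofR p.1 * (g p.2 - w)) * g p.2.
have mH : @cmeasurable R _ (measurableTypeR R * measurableTypeR R)%type
    (`[0 : R, 1]%classic `*` `[0 : R, T]%classic) H.
  apply: (@cmeasurableS _ _ _ _ setT) => //.
  apply: cmeasurableM; last first.
    by apply: (cmeasurableT_comp (k := g)) => //; exact: continuous_cmeasurable.
  apply: (@cmeasurable_continuous_comp _ _ _ _ f
    (fun p : R * R => w + ofR p.1 * (g p.2 - w))) => //.
  apply: cmeasurableD; first exact: cmeasurable_cst.
  apply: cmeasurableM.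
    by apply: (@cmeasurable_ofR _ _ _ _ fst).
  apply: cmeasurableB; last exact: cmeasurable_cst.
  by apply: (cmeasurableT_comp (k := g)) => //; exact: continuous_cmeasurable.
(* The argument [w + l (g x - w)] has modulus at most [r + 2 r]. *)
have [M M0 HM] := continuous_disc_bounded (3 * r) cf.
have Hle p : (`[0, 1] `*` `[0, T]) p -> absC (H p) <= M * r.
  move=> [/= ]; rewrite in_itv /= => /andP[p0 p1] _.
  rewrite /H absCM absg; apply: ler_wpM2r; [exact: ltW|apply: HM].
  apply: (le_trans (ler_absCD _ _)); rewrite absCM absC_ofR ger0_norm//.
  have := ler_absCB (g p.2) w; rewrite absg => h.
  have := absC_ge0 (g p.2 - w); nra.
have ic (a b c : R) : leb.-integrable `[a, b] (EFin \o cst c).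
  apply: continuous_compact_integrable; first exact: segment_compact.
  by apply: continuous_subspaceT => x; exact: cvg_cst.
have i1 (x : R) : `[0, 1]%classic x -> cintegrable leb `[0, T] (fun y => H (x, y)).
  move=> _; apply: continuous_cintegrable => y; apply: cvgM; last exact: cg.
  apply: (@continuous_comp _ _ _ (fun y => w + ofR x * (g y - w)) f); last exact: cf.
  apply: cvgD; first exact: cvg_cst; apply: cvgM; first exact: cvg_cst.
  by apply: cvgB; [exact: cg|exact: cvg_cst].
have i2 (y : R) : `[0, T]%classic y -> cintegrable leb `[0, 1] (fun x => H (x, y)).
  move=> _; have ce := continuous_edge (p := w) (q := g y) cf.
  have : continuous (fun x : R => f (w + ofR x * (g y - w)) * g y).
    by move=> x; apply: cvgM; [exact: ce|exact: cvg_cst].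
  exact: continuous_cintegrable.
have foo : (\int[leb]_(x in `[0%R, 1%R]) \int[leb]_(y in `[0%R, T])
    (absC (H (x, y)))%:E < +oo)%E.
  apply: (@le_lt_trans _ _ (\int[leb]_(x in `[0%R, 1%R]) (M * r * T)%:E)%E); last first.
    exact: integrable_lty (ic 0 1 (M * r * T)).
  apply: ge0_le_integral => //.
  - by move=> x _; apply: integral_ge0 => y _; rewrite lee_fin absC_ge0.
  - apply: (@measurable_integral_param R _ _ (measurableTypeR R) (measurableTypeR R) leb
      `[0, 1]%classic `[0, T]%classic (measurable_itv _) (measurable_itv _) (absC \o H)
      (cmeasurable_absC mH)).
    by move=> p _; exact: absC_ge0.
  - move=> x x01; apply: (@le_trans _ _ (\int[leb]_(y in `[0%R, T]) (M * r)%:E)%E).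
      apply: ge0_le_integral => //.
      + by move=> y _; rewrite lee_fin absC_ge0.
      + by apply/measurable_EFinP; apply: cmeasurable_absC; case: (i1 _ x01).
      + by move=> y yT; rewrite lee_fin; exact: Hle.
    rewrite integral_cst//= lebesgue_measure_itv/= lte_fin; case: ltP => _.
      by rewrite EFinM sube0.
    by rewrite mule0 lee_fin mulr_ge0// mulr_ge0// ltW.
have [_ _ E] := @cFubini R _ _ (measurableTypeR R) (measurableTypeR R) leb leb
  `[0, 1]%classic `[0, T]%classic (measurable_itv _) (measurable_itv _) H mH i1 i2 foo.
transitivity (cintegral leb `[0, T] (fun y => cintegral leb `[0, 1] (fun x => H (x, y)))).
  apply: eq_cintegral => y _; rewrite /H /=.
  have := edge_primitive w (g y) cf dF; rewrite /edge => <-.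
  have cint : cintegrable leb `[0, 1] (fun t : R => f (w + ofR t * (g y - w))).
    by apply: continuous_cintegrable; exact: continuous_edge.
  have Z := @cintegral_lebZ R `[0, 1] (measurable_itv _) (g y) _ cint.
  transitivity (g y * cintegral leb `[0, 1] (fun t : R => f (w + ofR t * (g y - w)))).
    by field.
  by rewrite -Z; apply: eq_cintegral => x _; exact: mulrC.
rewrite -E; transitivity (cintegral leb `[0, 1] (fun _ : R => 0 : Cx R)); last exact: cintegral0.
by apply: eq_cintegral => x _; exact: circle_integral0.
Qed.

(** Multiplied by [r ^ n] this is the unnormalised Fourier coefficient of [phi] of order [n] on
    [[0, 2 pi]]. *)
Definition circle_coef (phi : R -> Cx R) n : Cx R :=
  cintegral leb `[0, T] (fun x => phi x * (g x)^-1 ^+ n).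

(** Since [|w / g x| = |w| / r < 1], the Cauchy kernel [g / (g - w)] is a geometric series in
    [w / g], dominated uniformly in [x]. *)
Lemma circle_geometric (phi : R -> Cx R) (w : Cx R) : absC w < r -> continuous phi ->
  series (fun n => circle_coef phi n * w ^+ n) @ \oo -->
  cintegral leb `[0, T] (fun x => phi x * (g x / (g x - w))).
Proof.
move=> wr cphi.
have gw x : g x - w != 0.
  by rewrite subr_eq0; apply/eqP => E; move: wr; rewrite -E absg ltxx.
have cgV : continuous (fun x => (g x)^-1).
  by move=> x; apply: cvgV; [exact: g_neq0|exact: cg].
have cterm n : continuous (fun x => phi x * (g x)^-1 ^+ n).
  by move=> x; apply: cvgM; [exact: cphi|exact: (@continuous_exp (fun x => (g x)^-1) n cgV)].
pose G N x := phi x * \sum_(0 <= n < N) ((g x)^-1 * w) ^+ n.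
have GE N : series (fun n => circle_coef phi n * w ^+ n) N = cintegral leb `[0, T] (G N).
  rewrite /series /=.
  have H n : cintegrable leb `[0, T] (fun x => w ^+ n * (phi x * (g x)^-1 ^+ n)).
    apply: cintegrable_lebZ; first exact: measurable_itv.
    exact: (continuous_cintegrable 0 T (cterm n)).
  rewrite (eq_bigr (fun n => cintegral leb `[0, T] (fun x => w ^+ n * (phi x * (g x)^-1 ^+ n)))).
    rewrite -cintegral_sum//; apply: eq_cintegral => x _.
    by rewrite /G mulr_sumr; apply: eq_bigr => n _; rewrite exprMn; ring.
  move=> n _; rewrite mulrC; apply/esym; apply: cintegral_lebZ; first exact: measurable_itv.
  exact: (continuous_cintegrable 0 T (cterm n)).
rewrite (funext GE).
have q1 : absC w / r < 1 by rewrite ltr_pdivrMr// mul1r.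
have absq x : absC ((g x)^-1 * w) = absC w / r by rewrite absCM absCV absg mulrC.
have qr0 : 0 <= absC w / r by rewrite divr_ge0 ?absC_ge0// ltW.
have geoE (q : Cx R) N : q != 1 -> \sum_(0 <= n < N) q ^+ n = (1 - q ^+ N) / (1 - q).
  move=> q1'; have q1n : 1 - q != 0 by rewrite subr_eq0 eq_sym.
  by apply: (mulIf q1n); rewrite divfK// -[1 - q ^+ N]opprB subrX1 big_mkord; ring.
have qn1 x : (g x)^-1 * w != 1.
  by apply/eqP => /(congr1 absC); rewrite absq absC1 => /eqP; rewrite lt_eqF.
have [_] : cintegrable leb `[0, T] (fun x => phi x * (g x / (g x - w))) /\
  cintegral leb `[0, T] (G N) @[N --> \oo] -->
  cintegral leb `[0, T] (fun x => phi x * (g x / (g x - w))); last by [].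
apply: (@cdominated_cvg R _ (measurableTypeR R) leb `[0, T]%classic (measurable_itv _) G
  (fun x => phi x * (g x / (g x - w))) (fun x => absC (phi x) * (1 - absC w / r)^-1)).
- move=> N; apply: cmeasurableM; first exact: continuous_cmeasurable.
  apply: cmeasurable_sum => n; apply: cmeasurable_exp; apply: cmeasurableM.
    exact: continuous_cmeasurable.
  exact: cmeasurable_cst.
- move=> x _; apply: cvgM; first exact: cvg_cst.
  have -> : g x / (g x - w) = (1 - 0) / (1 - (g x)^-1 * w).
    rewrite subr0 -[X in _ = X / _](mulfV (g_neq0 x)).
    have gn := g_neq0 x; have gwn := gw x.
    field; rewrite gn gwn /=.
    by have := qn1 x; rewrite -subr_eq0 -oppr_eq0 opprB.
  under eq_fun do rewrite geoE//.
  apply: cvgM; last exact: cvg_cst.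
  apply: cvgB; first exact: cvg_cst.
  apply/cvgCx_absP; under eq_fun do rewrite subr0 absCX absq.
  by apply: cvg_expr; rewrite ger0_norm.
- apply: continuous_compact_integrable; first exact: segment_compact.
  apply: continuous_subspaceT => x; apply: cvgM; last exact: cvg_cst.
  by apply: (@continuous_comp _ _ _ phi absC); [exact: cphi|exact: continuous_absC].
- move=> N x _; rewrite /G absCM ler_wpM2l ?absC_ge0//.
  apply: (le_trans (absC_sum _ _ _)).
  under eq_bigr do rewrite absCX absq.
  have -> : \sum_(0 <= i < N) (absC w / r) ^+ i = series (geometric 1 (absC w / r)) N.
    by rewrite /series /=; apply: eq_bigr => i _; rewrite mul1r.
  rewrite geometric_seriesE ?lt_eqF//= mul1r ler_pdivrMr ?subr_gt0//.
  by rewrite mulVf ?gt_eqF ?subr_gt0// gerBl exprn_ge0.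
Qed.

Lemma circle_coef1 n : circle_coef (fun=> 1) n.+1 = 0.
Proof.
rewrite /circle_coef.
have E x : 1 * (g x)^-1 ^+ n.+1 = ofR (r^-1 ^+ n.+1) * cis (- n.+1%:R * x).
  by rewrite mul1r /g invfM exprMn -fmorphV -rmorphXn -cisN cisX mulNr mulrN.
have ck (c : R) : continuous (fun x => cis (c * x)).
  by apply: rdiff_continuous => x; eexists; exact: rdiff_cisM.
have H := @cintegral_lebZ R `[0, T] (measurable_itv _) (ofR (r^-1 ^+ n.+1))
  (fun x => cis (- n.+1%:R * x)) (continuous_cintegrable 0 T (ck _)).
have -> := @eq_cintegral R _ (measurableTypeR R) leb `[0, T] _
  (fun x => ofR (r^-1 ^+ n.+1) * cis (- n.+1%:R * x)) (fun x _ => E x).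
rewrite H.
have on : ofR (- n.+1%:R) * imag != 0 :> Cx R.
  rewrite mulf_neq0//; apply/eqP => /(congr1 absC)/eqP.
  by rewrite absC_ofR absC0 normr_eq0 oppr_eq0 pnatr_eq0.
rewrite (@cFTC2 _ (fun x => (ofR (- n.+1%:R) * imag)^-1 * cis (- n.+1%:R * x)) _ 0 T T0 (ck _)).
  by rewrite mulr0 mulNr cisN -cisX cis2pi expr1n invr1 cis0 subrr mulr0.
move=> x _; have := rdiffZ (ofR (- n.+1%:R) * imag)^-1 (rdiff_cisM (- n.+1%:R) x).
by rewrite mulrA mulVf// mul1r.
Qed.

(** The function 1 supplies the normalisation: its coefficients of positive order vanish, so the
    kernel integrates to its coefficient [c0] of order 0. With [cauchy_difference], [F w * c0] is
    the integral of [F (g x)] against the kernel, which is then expanded. *)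
Lemma cauchy_series (w : Cx R) : absC w < r ->
  series (fun n => circle_coef (F \o g) n / circle_coef (fun=> 1) 0 * w ^+ n) @ \oo --> F w.
Proof.
move=> wr.
have gw x : g x - w != 0.
  by rewrite subr_eq0; apply/eqP => E; move: wr; rewrite -E absg ltxx.
have c1 : continuous (fun _ : R => 1 : Cx R) by move=> x; exact: cvg_cst.
have cFg : continuous (F \o g).
  by move=> x; apply: (@continuous_comp _ _ _ g F); [exact: cg|exact: cF].
have ck : continuous (fun x => g x / (g x - w)).
  move=> x; apply: cvgM; first exact: cg.
  apply: cvgV; first exact: gw.
  by apply: cvgB; [exact: cg|exact: cvg_cst].
set c0 := circle_coef (fun=> 1) 0.
have c0E : c0 = ofR T.
  rewrite /c0 /circle_coef.
  have E x : 1 * (g x)^-1 ^+ 0 = 1 by rewrite expr0 mulr1.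
  under eq_cintegral do rewrite E.
  rewrite (@cFTC2 _ ofR _ 0 T T0 c1); first by rewrite ofR0 subr0.
  move=> x _; have := rdiff_lin 0 1 x.
  by under [X in rdiff X]eq_fun do rewrite add0r mulr1.
have c0n0 : c0 != 0.
  rewrite c0E; apply/eqP => /(congr1 absC)/eqP.
  by rewrite absC_ofR absC0 normr_eq0 gt_eqF// mulr_gt0// pi_gt0.
have I1 : cintegral leb `[0, T] (fun x => 1 * (g x / (g x - w))) = c0.
  have H := circle_geometric wr c1; apply: (cvg_unique (@norm_hausdorff _ _) H).
  suff : series (fun n => circle_coef (fun=> 1) n * w ^+ n) @ \oo --> c0 by [].
  rewrite -(cvg_shiftS (series _)).
  have -> : (fun n => series (fun n => circle_coef (fun=> 1) n * w ^+ n) n.+1) = fun=> c0.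
    apply/funext => n; rewrite /series /= big_nat_recl// expr0 mulr1 big1 ?addr0//.
    by move=> i _; rewrite circle_coef1 mul0r.
  exact: cvg_cst.
have I2 : cintegral leb `[0, T] (fun x => (F \o g) x * (g x / (g x - w))) = F w * c0.
  have ik : cintegrable leb `[0, T] (fun x => 1 * (g x / (g x - w))).
    by apply: eq_cintegrable (continuous_cintegrable 0 T ck) => x _; rewrite mul1r.
  rewrite -I1 -cintegral_lebZ//; apply/eqP; rewrite -subr_eq0 -cintegralB//; last 2 first.
  - by apply: continuous_cintegrable => x; apply: cvgM; [exact: cFg|exact: ck].
  - exact: cintegrable_lebZ.
  rewrite -[X in _ == X](cauchy_difference wr); apply/eqP; apply: eq_cintegral => x _ /=.
  by rewrite mul1r -mulrBl.
have := circle_geometric wr cFg; rewrite I2 => H.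
have -> : F w = c0^-1 * (F w * c0) by rewrite mulrCA mulVf// mulr1.
have -> : series (fun n => circle_coef (F \o g) n / c0 * w ^+ n) =
    (fun N => c0^-1 * series (fun n => circle_coef (F \o g) n * w ^+ n) N).
  apply/funext => N; rewrite /series /= mulr_sumr; apply: eq_bigr => i _.
  by rewrite mulrAC mulrC.
by apply: cvgM; [exact: cvg_cst|exact: H].
Qed.

Lemma circle_coef_bound : exists2 M : R, 0 <= M &
  forall n, absC (circle_coef (F \o g) n / circle_coef (fun=> 1) 0) <= M / r ^+ n.
Proof.
have [M M0 HM] := continuous_disc_bounded r cF.
set c0 := circle_coef (fun=> 1) 0.
exists (M * T / absC c0) => [|n]; first by rewrite divr_ge0 ?absC_ge0// mulr_ge0.
rewrite absCM absCV mulrAC ler_wpM2r ?invr_ge0 ?absC_ge0//.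
have cFg : continuous (F \o g).
  by move=> x; apply: (@continuous_comp _ _ _ g F); [exact: cg|exact: cF].
rewrite mulrAC -[X in _ * X]subr0; apply: absC_cintegral_itv_le => //.
  apply: cmeasurableM; first exact: continuous_cmeasurable.
  apply: cmeasurable_exp; apply: continuous_cmeasurable => x.
  by apply: cvgV; [exact: g_neq0|exact: cg].
move=> x _; rewrite absCM absCX absCV absg exprVn; apply: ler_wpM2r.
  by rewrite invr_ge0 exprn_ge0// ltW.
by apply: HM; rewrite absg.
Qed.

End CauchySeries.

(** * Every entire function is the sum of its power series *)

Section EntireSeries.
Context {R : realType}.
Implicit Types (a b u : nat -> Cx R) (z w : Cx R).

Lemma sum_geometric_tail (q : R) (m n : nat) : (m <= n)%N ->
  (1 - q) * (\sum_(m <= k < n) q ^+ k) = q ^+ m - q ^+ n.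
Proof.
elim: n => [|n IH]; first by rewrite leqn0 => /eqP ->; rewrite big_geq// mulr0 subrr.
rewrite leq_eqVlt => /predU1P[->|mn]; first by rewrite big_geq// mulr0 subrr.
by rewrite big_nat_recr//= mulrDr IH// exprS; ring.
Qed.

(** Strong induction: when the earlier coefficients vanish, the term of order [n] at a small point
    [s] equals minus a tail of order [s ^ (n + 1)]. Dividing by [s ^ n] and letting [s] tend to 0
    kills the coefficient. *)
Lemma power_series_eq0 (d : nat -> Cx R) (r M : R) : 0 < r ->
  (forall n, absC (d n) <= M / r ^+ n) ->
  (forall w, absC w < r -> series (fun n => d n * w ^+ n) @ \oo --> (0 : Cx R)) ->
  forall n, d n = 0.
Proof.
move=> r0 dM dw n; elim/ltn_ind: n => n IH.
have M0 : 0 <= M.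
  by have := dM 0; rewrite expr0 divr1; apply: le_trans; exact: absC_ge0.
have key (s : R) : 0 < s -> s <= r / 2 -> absC (d n) <= 2 * M / r ^+ n.+1 * s.
  (* The condition [s <= r / 2] makes the ratio [q] at most 1/2, so the geometric tail from [n + 1]
     is at most [2 q ^ (n + 1)]; the factor 2 in the bound comes from here. *)
  move=> s0 s2; pose q := s / r.
  have q0 : 0 <= q by rewrite divr_ge0// ltW.
  have q2 : q <= 2^-1 by rewrite /q ler_pdivrMr// mulrC.
  have sr : absC (ofR s : Cx R) < r.
    by rewrite absC_ofR gtr0_norm// (le_lt_trans s2)// ltr_pdivrMr// ltr_pMr// ltr1n.
  have H : absC (0 - d n * ofR s ^+ n) <= 2 * M * q ^+ n.+1.
    pose S := series (fun n => d n * ofR s ^+ n).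
    apply: (@absC_lim_le _ (fun N => S (N + n.+1)%N - d n * ofR s ^+ n)).
      apply: cvgB; last exact: cvg_cst.
      have : [sequence S (k + n.+1)%N]_k @ \oo --> (0 : Cx R) by rewrite cvg_shiftn; exact: dw.
      exact.
    move=> N; rewrite /S /series /=.
    rewrite (@big_cat_nat _ _ _ n.+1)//=; last by rewrite leq_addl.
    rewrite big_nat_recr//= big_nat_cond big1 ?add0r; last first.
      by move=> i /andP[/andP[_ ilt] _]; rewrite IH// mul0r.
    rewrite addrAC subrr add0r; apply: (le_trans (absC_sum _ _ _)).
    apply: (@le_trans _ _ (\sum_(n.+1 <= i < N + n.+1) M * q ^+ i)).
      apply: ler_sum => i _; rewrite absCM absCX absC_ofR gtr0_norm//.
      by rewrite /q expr_div_n mulrA mulrAC ler_wpM2r// exprn_ge0// ltW.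
    rewrite -mulr_sumr mulrAC [X in _ <= X]mulrC ler_wpM2l//.
    have := @sum_geometric_tail q n.+1 (N + n.+1) (leq_addl _ _).
    have : 0 <= \sum_(n.+1 <= k < N + n.+1) q ^+ k.
      by apply: sumr_ge0 => i _; rewrite exprn_ge0.
    have : 0 <= q ^+ (N + n.+1) by rewrite exprn_ge0.
    by set A := \sum_(_ <= _ < _) _; set B := q ^+ (N + _); set C := q ^+ _; nra.
  move: H; rewrite sub0r absCN absCM absCX absC_ofR gtr0_norm//.
  rewrite -ler_pdivlMr ?exprn_gt0// => /le_trans; apply.
  rewrite /q expr_div_n exprS le_eqVlt; apply/orP; left; apply/eqP.
  have sn : s ^+ n != 0 by rewrite expf_neq0// gt_eqF.
  have -> : 2 * M * (s * s ^+ n / r ^+ n.+1) / s ^+ n =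
    2 * M / r ^+ n.+1 * s * (s ^+ n / s ^+ n) by ring.
  by rewrite mulfV// mulr1.
apply: absC_eq0; apply/eqP; rewrite eq_le absC_ge0 andbT.
apply/ler_addgt0Pr => e e0; rewrite add0r.
pose C := 2 * M / r ^+ n.+1 + 1.
have C0 : 0 < C by rewrite ltr_wpDl// divr_ge0 ?mulr_ge0// exprn_ge0// ltW.
pose s := Num.min (r / 2) (e / C).
have s0 : 0 < s by rewrite lt_min !divr_gt0.
apply: (le_trans (key s s0 _)); first by rewrite ge_min lexx.
apply: (@le_trans _ _ (C * s)); first by rewrite ler_wpM2r ?ltW// ltrDl.
by rewrite mulrC -ler_pdivlMr// ge_min lexx orbT.
Qed.

Lemma power_series_unique a b (r M M' : R) : 0 < r ->
  (forall n, absC (a n) <= M / r ^+ n) -> (forall n, absC (b n) <= M' / r ^+ n) ->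
  (forall w, absC w < r -> exists l : Cx R, series (fun n => a n * w ^+ n) @ \oo --> l /\
     series (fun n => b n * w ^+ n) @ \oo --> l) ->
  forall n, a n = b n.
Proof.
move=> r0 aM bM ab n; apply/eqP; rewrite -subr_eq0; apply/eqP.
apply: (@power_series_eq0 (fun n => a n - b n) r (M + M') r0) => [k|w wr].
  by rewrite mulrDl; apply: (le_trans (ler_absCB _ _)); exact: lerD.
have [l [al bl]] := ab w wr.
have -> : series (fun n => (a n - b n) * w ^+ n) =
    (fun N => series (fun n => a n * w ^+ n) N - series (fun n => b n * w ^+ n) N).
  by apply/funext => N; rewrite /series /= -sumrB; apply: eq_bigr => i _; rewrite mulrBl.
by rewrite -(subrr l); exact: cvgB.
Qed.

Lemma primitive_hser (F f : Cx R -> Cx R) : (forall z, cdiff F z (f z)) -> continuous f ->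
  exists2 u, eseq u & forall z, hser u z = F z.
Proof.
move=> dF cf.
pose A r n := circle_coef r (F \o (fun x => ofR r * cis x)) n / circle_coef r (fun=> 1) 0.
have AM r : 0 < r -> exists2 M : R, 0 <= M & forall n, absC (A r n) <= M / r ^+ n.
  by move=> r0; exact: (circle_coef_bound dF r0).
have Aw r w : 0 < r -> absC w < r -> series (fun n => A r n * w ^+ n) @ \oo --> F w.
  by move=> r0 wr; exact: (cauchy_series dF cf r0 wr).
(* Two circles give expansions of [F] on the smaller disc, and the coefficients there are unique;
   one sequence thus serves every radius. *)
have AE r : 0 < r -> A r = A 1.
  move=> r0; have [M M0 HM] := AM r r0; have [N N0 HN] := AM 1 ltr01.
  pose s := Num.min r 1; have s0 : 0 < s by rewrite lt_min r0 ltr01.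
  have le_s (t K : R) n : 0 < t -> 0 <= K -> s <= t -> K / t ^+ n <= K / s ^+ n.
    move=> t0 K0 st; rewrite ler_wpM2l// lef_pV2 ?posrE ?exprn_gt0//.
    by rewrite lerXn2r// nnegrE ltW.
  apply/funext; apply: (@power_series_unique _ _ s M N s0).
  - by move=> n; apply: (le_trans (HM n)); apply: le_s => //; rewrite ge_min lexx.
  - by move=> n; apply: (le_trans (HN n)); apply: le_s => //; rewrite ge_min lexx orbT.
  - move=> w; rewrite lt_min => /andP[wr w1]; exists (F w).
    by split; [exact: Aw|exact: Aw].
pose u n := A 1 n * (n`!)%:R.
have fn n : (n`!)%:R != 0 :> Cx R by rewrite pnatr_eq0 -lt0n fact_gt0.
have uE r w : 0 < r -> pow_term u w = (fun n => A r n * w ^+ n).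
  move=> r0; apply/funext => n; rewrite /pow_term /u AE//.
  by field.
exists u.
  (* The Cauchy estimate on the circle of radius [s] gives terms [M (r / s) ^ n] with
     [r / s <= 1/2]. *)
  move=> r r0; pose s := 2 * (r + 1); have s0 : 0 < s by rewrite mulr_gt0// ltr_wpDl.
  have [M M0 HM] := AM s s0.
  apply: (@series_le_cvg _ _ (fun n => M * (2^-1) ^+ n)).
  - by move=> n; exact: abs_term_ge0.
  - by move=> n; rewrite mulr_ge0// exprn_ge0.
  - move=> n; rewrite /abs_term /u absCM absC_nat mulrAC -mulrA mulrAC.
    have fR : (n`!)%:R != 0 :> R by rewrite pnatr_eq0 -lt0n fact_gt0.
    rewrite [X in X <= _](_ : _ = absC (A s n) * r ^+ n); last by rewrite -(AE s s0); field.
    apply: (@le_trans _ _ (M / s ^+ n * r ^+ n)); first by rewrite ler_wpM2r ?exprn_ge0.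
    rewrite -mulrA ler_wpM2l// [_^-1 * _]mulrC -expr_div_n.
    have h1 : 0 <= r / s by rewrite divr_ge0// ltW.
    have h2 : r / s <= 2^-1 by rewrite ler_pdivrMr// /s; lra.
    by rewrite lerXn2r// nnegrE invr_ge0.
  - apply: is_cvg_geometric_series; rewrite ger0_norm ?invr_ge0//.
    by rewrite invf_lt1// ltr1n.
move=> z; have z0 : 0 < absC z + 1 by rewrite ltr_wpDl// absC_ge0.
rewrite /hser (uE _ _ z0); apply: cvg_lim; first exact: norm_hausdorff.
by apply: Aw => //; rewrite ltrDl.
Qed.

Lemma derive1_hser u : eseq u -> derive1 (hser u) = hser (shiftc u).
Proof. by move=> eu; apply/funext => z; exact: (cdiff_derive1 (cdiff_hser z eu)). Qed.

(** The primitive [F] of [f] has a continuous derivative, so it has a power series; differentiating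
    termwise gives one for [f], with shifted coefficients. *)
Lemma entire_hser (f : Cx R -> Cx R) : entire f -> exists2 u, eseq u & f = hser u.
Proof.
move=> ef.
have df z : exists l, cdiff f z l by exists (derive1 f z); apply: derivable_cdiff; exact: ef.
have [F dF cf] := diff_primitive df.
have [U eU UF] := primitive_hser dF cf.
exists (shiftc U); first exact: eseq_shift.
apply/funext => z; have := cdiff_hser z eU; rewrite (funext UF) => /cdiff_derive1 <-.
by rewrite (cdiff_derive1 (dF z)).
Qed.

Lemma entire_hser_entire u : eseq u -> entire (hser u).
Proof. by move=> eu z _; exact: (cdiff_derivable (cdiff_hser z eu)). Qed.

End EntireSeries.

(** * Cadlag processes *)

Section CadlagPaths.
Context {R : realType}.
Implicit Types (p : R -> R) (T : R).

(** The right limit and the left limit bound the path on either side of each time, hence near it;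
    compactness of [[0, T]] makes the bound uniform. *)
Lemma cadlag_bounded T p : cadlag T p ->
  exists M : R, forall t, 0 <= t <= T -> `|p t| <= M.
Proof.
move=> [pr pl].
have /compact_near_coveringP cov := @segment_compact R 0 T.
have [M [_ HM]] : \forall M \near +oo, `[0, T]%classic `<=`
    [set t | 0 <= t <= T -> `|p t| <= M].
  apply: (cov _ (pinfty_nbhs R) (fun M t => 0 <= t <= T -> `|p t| <= M)).
  move=> t; rewrite /= in_itv /= => /andP[t0 tT].
  have [M1 H1] : exists M1, \forall s \near t, t < s -> 0 <= s <= T -> `|p s| <= M1.
    move: tT; rewrite le_eqVlt => /predU1P[->|tT].
      by exists 0; apply: (@nearW R (nbhs T)) => s Ts /andP[_]; rewrite leNgt Ts.
    exists (`|p t| + 1).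
    have /cvgrPdist_le/(_ 1 ltr01) : p s @[s --> t^'+] --> p t by apply: pr; rewrite t0.
    apply: (@filterS _ (nbhs t)) => s /[apply] h _.
    by rewrite addrC -lerBlDr (le_trans (lerB_dist _ _))// distrC.
  have [M2 H2] : exists M2, \forall s \near t, s < t -> 0 <= s <= T -> `|p s| <= M2.
    move: t0; rewrite le_eqVlt => /predU1P[<-|t0].
      by exists 0; apply: (@nearW R (nbhs (0 : R))) => s s0 /andP[]; rewrite leNgt s0.
    have [|l pl'] := pl t; first by rewrite t0.
    exists (`|l| + 1); move/cvgrPdist_le : pl' => /(_ 1 ltr01).
    apply: (@filterS _ (nbhs t)) => s /[apply] h _.
    by rewrite addrC -lerBlDr (le_trans (lerB_dist _ _))// distrC.
  near=> s M => /= sT.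
  have [ts|st|<-] := ltgtP t s.
  - apply: (@le_trans _ _ M1).
      by apply: (near H1 s) => //.
    by near: M; apply: nbhs_pinfty_ge; exact: num_real.
  - apply: (@le_trans _ _ M2).
      by apply: (near H2 s) => //.
    by near: M; apply: nbhs_pinfty_ge; exact: num_real.
  - by near: M; apply: nbhs_pinfty_ge; exact: num_real.
exists (M + 1) => t tT; apply: HM => //; first by rewrite ltrDl.
Unshelve. all: by end_near. Qed.

End CadlagPaths.

Section ProcessMeasurable.
Context {R : realType} d (Y : measurableType d).
Variables (s t : R).

(** Time is rounded up to a grid and clamped to [[s, t]]. The rounded process uses countably many
    times, hence is jointly measurable, and right continuity gives convergence. Only [Z q] with [q]
    in [[s, t]] enters, so the lemma also yields progressive measurability. *)
Lemma process_measurable (Z : R -> Y -> R) : s <= t ->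
  (forall q, s <= q <= t -> measurable_fun setT (Z q)) ->
  (forall y q, s <= q < t -> Z q' y @[q' --> q^'+] --> Z q y) ->
  @measurable_fun _ _ (measurableTypeR R * Y)%type R (`[s, t]%classic `*` setT)
    (fun p => Z p.1 p.2).
Proof.
move=> st mZ rZ.
(* The [+ 1] places the grid point strictly to the right of [q], as the punctured right limit
   demands. *)
pose g n (q : R) : R := ((Num.floor (n.+1%:R * q))%:~R + 1) / n.+1%:R.
pose c q := Num.max s (Num.min t q).
have c_in q : s <= c q <= t.
  by rewrite /c le_max lexx /= ge_max st /= ge_min lexx.
have g_gt n q : q < g n q.
  rewrite /g ltr_pdivlMr ?ltr0n// mulrC.
  by have := floorD1_gt (n.+1%:R * q); rewrite intrD.
have g_le n q : g n q <= q + n.+1%:R^-1.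
  rewrite /g mulrDl mul1r lerD2r ler_pdivrMr ?ltr0n// mulrC.
  exact: floor_le.
pose D : set (measurableTypeR R * Y) := `[s, t]%classic `*` setT.
have mD : measurable D by apply: measurableX.
apply: (@measurable_fun_cvg _ _ _ D (fun n p => Z (c (g n p.1)) p.2)).
  move=> n.
  apply: (@measurable_glue _ _ _ _ _ D (fun p => Num.floor (n.+1%:R * p.1))
    (fun i p => Z (c ((i%:~R + 1) / n.+1%:R)) p.2)).
    move=> i; apply: measurable_floor_level => //.
    by apply: measurable_funM => //; exact: measurable_funTS.
  move=> i; apply: measurable_funTS.
  by apply: (measurableT_comp (f := Z _)) => //; apply: mZ.
move=> [q y] [/= + _]; rewrite in_itv /= => /andP[sq].
(* At the right end no later time is available; there the clamp returns [t] for every [n]. *)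
rewrite le_eqVlt => /predU1P[->|qt].
  apply: cvg_near_cst; apply: nearW => n.
  by rewrite /c (min_idPl (ltW (g_gt n t))) (max_idPr st).
apply: (@cvg_comp _ _ _ (fun n => c (g n q)) (fun q' => Z q' y) _ (q^'+)); last first.
  by apply: rZ; rewrite sq.
move=> A [e /= e0 He].
have [N1 _ HN1] := near_infty_natSinv_lt (PosNum e0).
have tq0 : 0 < t - q by rewrite subr_gt0.
have [N2 _ HN2] := near_infty_natSinv_lt (PosNum tq0).
exists (maxn N1 N2) => // n /=; rewrite geq_max => /andP[/HN1 /= n1 /HN2 /= n2].
have gt_ : g n q < t.
  by apply: (le_lt_trans (g_le n q)); rewrite -ltrBrDl.
have -> : c (g n q) = g n q.
  rewrite /c (min_idPr (ltW gt_)); apply/max_idPr.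
  by apply: (le_trans sq); exact: ltW.
apply: He => //=.
rewrite ltr0_norm ?subr_lt0// opprB ltrBlDl.
by apply: (le_lt_trans (g_le n q)); rewrite ltrD2l.
Qed.

End ProcessMeasurable.

Section SubSigmaAlgebra.
Context {R : realType} d (Om : measurableType d).
Variable (G : set (set Om)).
Hypothesis sG : sigma_algebra setT G.

(** Making a sub-sigma-algebra a measurable type of its own lets adaptedness be proved with the
    ordinary measurability lemmas. *)
Lemma measurable_subsigma (A : set Om) :
  @measurable _ (g_sigma_algebraType G) A = G A.
Proof. by rewrite /measurable /= (sigma_algebra_id sG). Qed.

Lemma measurable_wrtP (f : Om -> R) : measurable_wrt G f <->
  @measurable_fun _ _ (g_sigma_algebraType G) R setT f.
Proof.
split=> [mf _ B mB|mf B mB].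
  by rewrite setTI measurable_subsigma; exact: mf.
by rewrite -measurable_subsigma -[X in measurable X]setTI; exact: mf.
Qed.

Lemma cmeasurable_wrtP (f : Om -> Cx R) : cmeasurable_wrt G f <->
  @cmeasurable R _ (g_sigma_algebraType G) setT f.
Proof. by split=> -[/measurable_wrtP ? /measurable_wrtP ?]. Qed.

Lemma measurable_wrt_measurable (f : Om -> R) : G `<=` measurable ->
  measurable_wrt G f -> measurable_fun setT f.
Proof. by move=> Gm mf _ B mB; rewrite setTI; apply: Gm; exact: mf. Qed.

End SubSigmaAlgebra.

Section CadlagComplex.
Context {R : realType}.
Variable T : R.

Lemma cadlag_comp (p : R -> R) (phi : R -> Cx R) : continuous phi -> cadlag T p ->
  cadlag T (phi \o p).
Proof.
move=> cphi [pr pl]; split=> t tT.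
  by apply: (cvg_comp _ _ (pr t tT)); exact: cphi.
have [l pl'] := pl t tT; exists (phi l).
by apply: (cvg_comp _ _ pl'); exact: cphi.
Qed.

Lemma cadlagB (p q : R -> Cx R) : cadlag T p -> cadlag T q ->
  cadlag T (fun t => p t - q t).
Proof.
move=> [pr pl] [qr ql]; split=> t tT.
  by apply: cvgB; [exact: pr|exact: qr].
have [l pl'] := pl t tT; have [m ql'] := ql t tT.
by exists ((l : Cx R) - m); exact: (cvgB pl' ql').
Qed.

Lemma cadlag_cst (c : Cx R) : cadlag T (fun _ : R => c).
Proof. by split=> [t _|t _]; [|exists c]; exact: cvg_cst. Qed.

Lemma cintegral_itvB (k : R -> Cx R) (s t : R) : 0 <= s -> s <= t ->
  cintegrable leb `[0, t] k ->
  cintegral leb `[0, t] k - cintegral leb `[0, s] k = cintegral leb `]s, t] k.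
Proof.
move=> s0 st H; have [i1 i2] := (cintegrableP leb (measurable_itv _) k).1 H.
apply: Cx_ext; rewrite ?reCB ?imCB /=.
  by rewrite Rintegral_itvB// bnd_simp.
by rewrite Rintegral_itvB// bnd_simp.
Qed.

Lemma cintegral_itv_obnd_cbnd (k : R -> Cx R) (s t : R) :
  cintegrable leb `]s, t] k -> cintegral leb `]s, t] k = cintegral leb `[s, t] k.
Proof.
move=> H; have [i1 i2] := (cintegrableP leb (measurable_itv _) k).1 H.
by apply: Cx_ext => /=; rewrite Rintegral_itv_obnd_cbnd.
Qed.

Lemma bounded_cintegrable (k : R -> Cx R) (D E : set (measurableTypeR R)) (a b M : R) :
  measurable D -> measurable E -> D `<=` `[a, b] -> E `<=` D ->
  cmeasurable D k -> (forall t, D t -> absC (k t) <= M) -> cintegrable leb E k.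
Proof.
move=> mD mE Dab ED mk kM; apply: (@cintegrable_le _ _ _ _ _ mE _ (cst M)).
- exact: cmeasurableS mk.
- apply: (@integrableS _ (measurableTypeR R) R leb `[a, b]%classic E _ (measurable_itv _) mE).
    by move=> x /ED /Dab.
  apply: continuous_compact_integrable; first exact: segment_compact.
  by apply: continuous_subspaceT => x; exact: cvg_cst.
- by move=> t /ED; exact: kM.
Qed.

Lemma absC_cintegral_oc_le (k : R -> Cx R) (s t M : R) : s <= t ->
  cmeasurable `]s, t] k -> (forall q, s < q <= t -> absC (k q) <= M) ->
  absC (cintegral leb `]s, t] k) <= M * (t - s).
Proof.
move=> st mk kM; have -> : M * (t - s) = Rintegral leb `]s, t] (cst M).
  by rewrite Rintegral_cst//= lebesgue_measure_itv/= lte_fin; move: st;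
    rewrite le_eqVlt => /predU1P[->|->//]; rewrite ltxx/= subrr mulr0.
apply: absC_cintegral_le_bound => //.
  apply: (@integrableS _ (measurableTypeR R) R leb `[s, t]%classic `]s, t]%classic _
    (measurable_itv _) (measurable_itv _)); first exact: subset_itv_oc_cc.
  apply: continuous_compact_integrable; first exact: segment_compact.
  by apply: continuous_subspaceT => x; exact: cvg_cst.
Qed.

(** The integral is Lipschitz in its upper limit with constant [M], so both one-sided limits exist
    and equal the value. *)
Lemma cadlag_integral (k : R -> Cx R) (M : R) : cmeasurable `[0, T] k ->
  (forall t, 0 <= t <= T -> absC (k t) <= M) ->
  cadlag T (fun t => cintegral leb `[0, t] k).
Proof.
move=> mk kM.
have lip s t : 0 <= s -> s <= t -> t <= T ->
    absC (cintegral leb `[0, t] k - cintegral leb `[0, s] k) <= M * (t - s).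
  move=> s0 st tT; rewrite cintegral_itvB//.
    apply: absC_cintegral_oc_le => //.
      apply: (@cmeasurableS _ _ (measurableTypeR R) _ `[0, T]%classic _ (measurable_itv _) _ mk).
      move=> q /=; rewrite !in_itv /= => /andP[sq qt].
      by rewrite (le_trans qt)// (le_trans s0)// ltW.
    by move=> q /andP[sq qt]; apply: kM; rewrite (le_trans qt)// (le_trans s0)// ltW.
  apply: (@bounded_cintegrable k `[0, T]%classic `[0, t]%classic 0 T M) => //.
  by move=> q /=; rewrite !in_itv /= => /andP[-> qt]; rewrite (le_trans qt).
have M0 t : 0 <= t <= T -> 0 <= M by move=> /kM; apply: le_trans; exact: absC_ge0.
split=> t /andP[t0 tT].
  have MM : 0 <= M by apply: (M0 t); rewrite t0 ltW.
  apply/cvgCxP => e e0.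
  have d0 : 0 < e / (M + 1) by rewrite divr_gt0// ltr_wpDl.
  near=> s.
  have ts : t < s by near: s; exact: nbhs_right_gt.
  have sT : s < T by near: s; exact: nbhs_right_lt.
  have sd : s < t + e / (M + 1) by near: s; apply: nbhs_right_lt; rewrite ltrDl.
  rewrite absC_distC; apply: (le_lt_trans (lip t s t0 (ltW ts) (ltW sT))).
  apply: (@le_lt_trans _ _ ((M + 1) * (s - t))).
    by rewrite ler_wpM2r ?subr_ge0 ?(ltW ts)// lerDl.
  by rewrite mulrC -ltr_pdivlMr ?ltrBlDl// ltr_wpDl.
have MM : 0 <= M by apply: (M0 t); rewrite tT ltW.
exists (cintegral leb `[0, t] k).
apply/cvgCxP => e e0.
have d0 : 0 < e / (M + 1) by rewrite divr_gt0// ltr_wpDl.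
near=> s.
have ts : s < t by near: s; exact: nbhs_left_lt.
have s0 : 0 < s by near: s; exact: nbhs_left_gt.
have sd : t - e / (M + 1) < s by near: s; apply: nbhs_left_gt; rewrite gtrBl.
apply: (le_lt_trans (lip s t (ltW s0) (ltW ts) tT)).
apply: (@le_lt_trans _ _ ((M + 1) * (t - s))).
  by rewrite ler_wpM2r ?subr_ge0 ?(ltW ts)// lerDl.
by rewrite mulrC -ltr_pdivlMr ?ltr_wpDl// ltrBlDl addrC -ltrBlDl.
Unshelve. all: by end_near. Qed.

End CadlagComplex.

(** * The generator of a Levy process *)

Section SigmaFinitePack.
Context {R : realType} {d} {Y : measurableType d}.

(** [F] is a plain measure; the equality lets it be rewritten into a packaged sigma-finite one
    wherever Fubini is applied. *)
Lemma sigma_finite_pack (mu : {measure set Y -> \bar R}) : sigma_finite setT mu ->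
  exists m : {sigma_finite_measure set Y -> \bar R}, mu = m :> {measure set Y -> \bar R}.
Proof.
move=> smu.
pose H1 := isSFinite.Build _ _ _ (mu : set Y -> \bar R) (sfinite_measure_sigma_finite smu).
pose H2 := isSigmaFinite.Build _ _ _ (mu : set Y -> \bar R) smu.
pose m := HB.pack_for (SigmaFiniteMeasure.type Y R) (Measure.sort mu) H1 H2.
by exists m; apply: eq_measure.
Qed.

End SigmaFinitePack.

Section Taylor.
Context {R : realType}.
Implicit Types (f : R -> Cx R).

(** The derivatives are carried as data, so that bounds and limits of approximating sequences can be
    stated for them directly. *)
Definition twice_diff (f f1 f2 : R -> Cx R) :=
  [/\ forall t, rdiff f t (f1 t), forall t, rdiff f1 t (f2 t) & continuous f2].

Lemma rdiff_le (K k : R -> Cx R) (M : R) : continuous k -> (forall t, rdiff K t (k t)) ->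
  (forall t, 0 <= t <= 1 -> absC (k t) <= M) -> absC (K 1 - K 0) <= M.
Proof.
move=> ck dK kM; have dK' x : 0 <= x <= 1 -> rdiff K x (k x) by move=> _; exact: dK.
rewrite -(@cFTC2 _ K k 0 1 ler01 ck dK').
have := @absC_cintegral_itv_le _ k 0 1 M ler01 (continuous_cmeasurable _ ck) kM.
by rewrite subr0 mulr1.
Qed.

Lemma is_derive_aff (x y t : R) : is_derive t 1 (fun t : R => x + t * y) y.
Proof.
apply/is_derive_epsP => e e0; exists 1 => // h _.
rewrite (_ : _ - _ = 0); first by rewrite normr0 mulr_ge0// ltW.
by ring.
Qed.

Lemma continuous_affR (x y : R) : continuous (fun t : R => x + t * y).
Proof.
move=> t; have [/derivable1_diffP/differentiable_continuous H _] := is_derive_aff x y t.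
exact: H.
Qed.

Lemma continuous_affR_comp (f : R -> Cx R) (x y : R) : continuous f ->
  continuous (fun t : R => f (x + t * y)).
Proof.
move=> cf t; apply: (@continuous_comp _ _ _ (fun t : R => x + t * y) f).
  exact: continuous_affR.
exact: cf.
Qed.

Lemma taylor1 (f f1 : R -> Cx R) (x y M : R) : (forall t, rdiff f t (f1 t)) -> continuous f1 ->
  (forall t, `|t - x| <= `|y| -> absC (f1 t) <= M) ->
  absC (f (x + y) - f x) <= M * `|y|.
Proof.
move=> df cf1 fM.
pose K (t : R) := f (x + t * y); pose k (t : R) := f1 (x + t * y) * ofR y.
have -> : f (x + y) - f x = K 1 - K 0 by rewrite /K mul1r mul0r addr0.
apply: (@rdiff_le K k).
- by move=> t; apply: cvgM; [exact: continuous_affR_comp|exact: cvg_cst].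
- by move=> t; exact: (rdiff_compR (df _) (is_derive_aff x y t)).
- move=> t /andP[t0 t1]; rewrite /k absCM absC_ofR ler_wpM2r//; apply: fM.
  by rewrite [x + _]addrC addrK normrM (ger0_norm t0) ler_piMl.
Qed.

(** Two mean value estimates in succession, whence the constant [M] instead of [M / 2]. *)
Lemma taylor2 (f f1 f2 : R -> Cx R) (x y M : R) : twice_diff f f1 f2 ->
  (forall t, `|t - x| <= `|y| -> absC (f2 t) <= M) ->
  absC (f (x + y) - f x - f1 x * ofR y) <= M * y ^+ 2.
Proof.
move=> [df df1 cf2] fM.
have cf1 : continuous f1 by apply: rdiff_continuous => t; exists (f2 t).
pose K (t : R) := f (x + t * y) - (ofR t * (f1 x * ofR y)).
pose k (t : R) := f1 (x + t * y) * ofR y - f1 x * ofR y.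
have -> : f (x + y) - f x - f1 x * ofR y = K 1 - K 0.
  by rewrite /K mul1r mul0r addr0 ofR0 ofR1 mul1r mul0r subr0; ring.
apply: (@rdiff_le K k).
- move=> t; apply: cvgB; last exact: cvg_cst.
  by apply: cvgM; [exact: continuous_affR_comp|exact: cvg_cst].
- move=> t; rewrite /K /k.
  have := rdiffD (rdiff_compR (df _) (is_derive_aff x y t))
    (rdiff_lin 0 (- (f1 x * ofR y)) t).
  by under [X in rdiff X _ _ -> _]eq_fun do rewrite add0r mulrN.
- move=> t /andP[t0 t1]; rewrite /k -mulrBl absCM absC_ofR.
  have h : `|t * y| <= `|y| by rewrite normrM (ger0_norm t0) ler_piMl.
  rewrite -[y ^+ 2]real_normK ?num_real// expr2 mulrA ler_wpM2r//.
  have M0 : 0 <= M.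
    by apply: le_trans (fM x _); [exact: absC_ge0|rewrite subrr normr0].
  apply: (@le_trans _ _ (M * `|t * y|)); last by rewrite ler_wpM2l.
  by apply: (taylor1 df1 cf2) => s st; apply: fM; exact: le_trans h.
Qed.

End Taylor.

(** * Levy measures of bounded support *)

Section LevyMeasureFacts.
Context {R : realType}.
Variable F : {measure set (measurableTypeR R) -> \bar R}.
Hypothesis levyF : levy_measure F.

Let mn (y : R) : R := Num.min `|y| (`|y| ^+ 2).

Let measurable_mn (D : set (measurableTypeR R)) : measurable_fun D (mn : measurableTypeR R -> R).
Proof.
apply: measurable_funTS; apply: measurable_minr; first exact: normr_measurable.
by apply: measurable_funX; exact: normr_measurable.
Qed.

Let mn_ge0 y : 0 <= mn y.
Proof. by rewrite /mn le_min normr_ge0 sqr_ge0. Qed.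

(** By Markov's inequality the level sets of [min (|y|, y ^ 2)] above [1 / (n + 1)] have finite
    mass; with the null set of the origin they cover the line. *)
Lemma levy_sigma_finite : sigma_finite setT F.
Proof.
have [F0 Foo] := levyF.
pose A n : set (measurableTypeR R) :=
  if n is n'.+1 then [set y | n%:R^-1 <= mn y] else [set 0].
have mA n : measurable (A n.+1).
  rewrite -[A n.+1]setTI (_ : setT `&` A n.+1 = setT `&` mn @^-1` `[n.+1%:R^-1, +oo[).
    exact: measurable_mn.
  by apply/seteqP; split=> y /= [_]; rewrite in_itv /= andbT.
exists A.
  apply/seteqP; split=> // y _.
  have [->|y0] := eqVneq y 0; first by exists 0%N.
  have m0 : 0 < mn y by rewrite /mn lt_min !normr_gt0 y0 exprn_gt0// normr_gt0.
  have [N _ /(_ N (leqnn _)) /= h] := near_infty_natSinv_lt (PosNum m0).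
  by exists N.+1 => //=; exact: ltW.
move=> [|n]; first by split; [exact: measurable_set1|rewrite /= F0 ltry].
split; first exact: mA.
have n0 : (0 : R) < n.+1%:R by rewrite ltr0n.
have h : (n.+1%:R^-1%:E * F (A n.+1) < +oo)%E.
  apply: le_lt_trans Foo.
  have -> : (n.+1%:R^-1%:E * F (A n.+1) = \int[F]_(y in A n.+1) (n.+1%:R^-1)%:E)%E.
    by rewrite integral_cst//; exact: mA.
  apply: (@le_trans _ _ (\int[F]_(y in A n.+1) (mn y)%:E)%E).
    apply: ge0_le_integral; first exact: mA.
    - by move=> y _; rewrite lee_fin invr_ge0 ltW.
    - exact/measurable_EFinP.
    - by apply/measurable_EFinP; exact: measurable_mn.
    - by [].
  apply: ge0_subset_integral; first exact: mA.
  - exact: measurableT.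
  - by apply/measurable_EFinP; exact: measurable_mn.
  - by move=> y _; rewrite lee_fin.
  - by [].
have := leey (F (A n.+1)); rewrite le_eqVlt => /predU1P[E|//].
by move: h; rewrite E mulry gtr0_sg ?invr_gt0// mul1e ltxx.
Qed.

(** A radius of at least 1 gives [y ^ 2 <= r * min (|y|, y ^ 2)] for [|y| <= r], from which the
    second moment is finite. *)
Lemma support_radius : bounded_support F ->
  exists2 r : R, 1 <= r & F [set y | r < `|y|] = 0%E.
Proof.
move=> [r0 Fr0]; exists (Num.max 1 r0); first by rewrite le_max lexx.
have m (s : R) : measurable ([set y | s < `|y|] : set (measurableTypeR R)).
  rewrite (_ : [set y | _] = setT `&` (fun y : R => `|y|) @^-1` `]s, +oo[%classic).
    by apply: normr_measurable => //; exact: measurable_itv.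
  by apply/seteqP; split=> y /=; rewrite in_itv /= andbT => // -[].
apply: subset_measure0 Fr0 => //.
by move=> y /=; rewrite gt_max => /andP[].
Qed.

Variable r : R.
Hypotheses (r1 : 1 <= r) (Fr : F [set y | r < `|y|] = 0%E).

Definition jump_range : set (measurableTypeR R) := `[- r, r]%classic.
Let D := jump_range.
Let mD : measurable D. Proof. exact: measurable_itv. Qed.

Lemma jump_rangeP y : D y <-> `|y| <= r.
Proof. by rewrite /D /jump_range /= in_itv /= ler_norml. Qed.

Lemma sqr_integrable_levy : F.-integrable D (EFin \o (fun y => y ^+ 2)).
Proof.
have [_ Foo] := levyF.
have i1 : F.-integrable setT (EFin \o (mn : measurableTypeR R -> R)).
  apply/integrableP; split; first by apply/measurable_EFinP; exact: measurable_mn.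
  by under eq_integral do rewrite /= ger0_norm//.
have i2 : F.-integrable D (EFin \o (fun y => r * mn y)).
  have := integrableZl mD r (integrableS measurableT mD (@subsetT _ _) i1).
  by apply: eq_integrable.
apply: le_integrable i2 => //.
  by apply/measurable_EFinP; apply: measurable_funX.
move=> y /jump_rangeP yr; rewrite /= lee_fin (ger0_norm (sqr_ge0 _)).
rewrite ger0_norm; last by rewrite mulr_ge0 ?mn_ge0// (le_trans ler01).
rewrite /mn minEle -(real_normK (num_real y)).
have := normr_ge0 y; case: ifPn => _ y0.
  by rewrite expr2 ler_wpM2r.
by rewrite -[X in X <= _]mul1r ler_wpM2r// sqr_ge0.
Qed.

Definition levy_var : R := Rintegral F D (fun y => y ^+ 2).

Lemma levy_var_ge0 : 0 <= levy_var.
Proof. by apply: Rintegral_ge0 => y _; exact: sqr_ge0. Qed.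

Let FDC : F (~` D) = 0%E.
Proof.
rewrite -Fr; congr (F _); apply/seteqP; split=> y /=.
  by move=> nD; rewrite ltNge; apply/negP => /jump_rangeP.
by rewrite ltNge => /negP h /jump_rangeP.
Qed.

Let integrable_range (k : R -> R) : measurable_fun setT k ->
  F.-integrable D (EFin \o k) ->
  F.-integrable setT (EFin \o k) /\ Rintegral F setT k = Rintegral F D k.
Proof.
move=> mk ik.
have DE : setT `\` ~` D = D by rewrite setTD setCK.
have mDC : measurable (~` D) by exact: measurableC.
have iT : F.-integrable setT (EFin \o k).
  apply/(@negligible_integrable _ _ _ F setT (~` D)) => //.
    exact/measurable_EFinP.
  by rewrite DE.
split=> //; rewrite /Rintegral (negligible_integral mDC _ iT)// DE//.
Qed.

Lemma cintegrable_range (k : R -> Cx R) (c : R) : cmeasurable setT k ->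
  (forall y, `|y| <= r -> absC (k y) <= c * y ^+ 2) ->
  [/\ cintegrable F D k, cintegrable F setT k,
      cintegral F setT k = cintegral F D k & absC (cintegral F setT k) <= c * levy_var].
Proof.
move=> mk kc.
have i2 : F.-integrable D (EFin \o (fun y => c * y ^+ 2)).
  by have := integrableZl mD c sqr_integrable_levy; apply: eq_integrable.
have mkD : cmeasurable D k by apply: cmeasurableS mk.
have iD : cintegrable F D k.
  by apply: (cintegrable_le mD mkD i2) => y /jump_rangeP; exact: kc.
have [iD1 iD2] := (cintegrableP F mD k).1 iD.
have [mk1 mk2] := mk.
have [iT1 E1] := integrable_range mk1 iD1.
have [iT2 E2] := integrable_range mk2 iD2.
have E : cintegral F setT k = cintegral F D k by congr Complex.
split=> //; first by apply/cintegrableP.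
rewrite E; have -> : c * levy_var = Rintegral F D (fun y => c * y ^+ 2).
  by rewrite RintegralZl//; exact: sqr_integrable_levy.
by apply: absC_cintegral_le_bound => // y /jump_rangeP; exact: kc.
Qed.

End LevyMeasureFacts.

Section Generator.
Context {R : realType}.
Variables (b a : R) (F : {measure set (measurableTypeR R) -> \bar R}).
Hypothesis levyF : levy_measure F.
Variable r : R.
Hypotheses (r1 : 1 <= r) (Fr : F [set y | r < `|y|] = 0%E).
Implicit Types (f : R -> Cx R) (x : R).
Let D := jump_range r.
Let V := levy_var F r.

Definition jumps (f f1 : R -> Cx R) x : R -> Cx R := fun y => f (x + y) - f x - f1 x * ofR y.

Definition gen (f f1 f2 : R -> Cx R) x : Cx R :=
  ofR b * f1 x + ofR (a / 2) * f2 x + cintegral F setT (jumps f f1 x).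

Lemma deriv_cE (f f1 : R -> Cx R) : (forall t, rdiff f t (f1 t)) -> deriv_c f = f1.
Proof.
move=> df; apply/funext => x; have /rdiffP[[_ h1] [_ h2]] := df x.
by apply: Cx_ext; rewrite /deriv_c /= derive1E.
Qed.

Lemma generatorE (f f1 f2 : R -> Cx R) : twice_diff f f1 f2 -> generator b a F f = gen f f1 f2.
Proof.
move=> [df df1 _]; apply/funext => x.
by rewrite /generator /gen /jump_integrand (deriv_cE df) (deriv_cE df1).
Qed.

Lemma twice_diff_C2 (f f1 f2 : R -> Cx R) : twice_diff f f1 f2 -> C2 f.
Proof.
move=> [df df1 cf2].
have H (p : Cx R -> R) : (forall (k l : R -> Cx R), (forall t, rdiff k t (l t)) ->
    forall t : R, is_derive t 1 (p \o k) (p (l t))) ->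
    continuous (p \o f2) -> C2_real (p \o f).
  move=> pd cp.
  have E1 : derive1 (p \o f) = p \o f1.
    by apply/funext => t; rewrite derive1E; have [_] := pd _ _ df t.
  have E2 : derive1 (p \o f1) = p \o f2.
    by apply/funext => t; rewrite derive1E; have [_] := pd _ _ df1 t.
  split.
  - by move=> t; have [] := pd _ _ df t.
  - by move=> t; rewrite E1; have [] := pd _ _ df1 t.
  - by rewrite /derive1n /= E1 E2.
split; apply: H.
- by move=> k l dk t; have /rdiffP[] := dk t.
- by move=> t; have /cvgCx_reim[] := cf2 t.
- by move=> k l dk t; have /rdiffP[] := dk t.
- by move=> t; have /cvgCx_reim[] := cf2 t.
Qed.

Lemma twice_diff_continuous (f f1 f2 : R -> Cx R) : twice_diff f f1 f2 -> continuous f /\ continuous f1.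
Proof. by move=> [df df1 _]; split; apply: rdiff_continuous => t; eexists; [exact: df|exact: df1]. Qed.

Lemma jumps_measurable (f f1 : R -> Cx R) x : continuous f -> cmeasurable setT (jumps f f1 x : measurableTypeR R -> Cx R).
Proof.
move=> cf; apply: continuous_cmeasurable => y.
apply: cvgB; first apply: cvgB.
- apply: (@continuous_comp _ _ _ (fun y : R => x + y) f); last exact: cf.
  by apply: cvgD; [exact: cvg_cst|exact: cvg_id].
- exact: cvg_cst.
- by apply: cvgM; [exact: cvg_cst|exact: continuous_ofR].
Qed.

Lemma jumps_le (f f1 f2 : R -> Cx R) x y (M : R) : twice_diff f f1 f2 ->
  (forall t, `|t - x| <= r -> absC (f2 t) <= M) -> `|y| <= r ->
  absC (jumps f f1 x y) <= M * y ^+ 2.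
Proof.
by move=> tf fM yr; apply: (taylor2 tf) => t ty; apply: fM; exact: le_trans yr.
Qed.

Lemma jumps_cintegrable (f f1 f2 : R -> Cx R) x (M : R) : twice_diff f f1 f2 ->
  (forall t, `|t - x| <= r -> absC (f2 t) <= M) ->
  [/\ cintegrable F D (jumps f f1 x), cintegrable F setT (jumps f f1 x),
      cintegral F setT (jumps f f1 x) = cintegral F D (jumps f f1 x) &
      absC (cintegral F setT (jumps f f1 x)) <= M * V].
Proof.
move=> tf fM; apply: (cintegrable_range levyF r1 Fr).
  by apply: jumps_measurable; exact: (twice_diff_continuous tf).1.
by move=> y yr; exact: (jumps_le tf fM yr).
Qed.

Lemma gen_le (f f1 f2 : R -> Cx R) x (M1 M2 : R) : twice_diff f f1 f2 -> absC (f1 x) <= M1 ->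
  (forall t, `|t - x| <= r -> absC (f2 t) <= M2) ->
  absC (gen f f1 f2 x) <= `|b| * M1 + `|a / 2| * M2 + M2 * V.
Proof.
move=> tf fM1 fM2; rewrite /gen; apply: (le_trans (ler_absCD _ _)); apply: lerD.
  apply: (le_trans (ler_absCD _ _)); apply: lerD; rewrite absCM absC_ofR ler_wpM2l//.
  by apply: fM2; rewrite subrr normr0 (le_trans ler01).
by have [_ _ _] := jumps_cintegrable tf fM2.
Qed.

Definition exp_bounded (k C : R) (f f1 f2 : R -> Cx R) := forall x,
  [/\ absC (f x) <= C * expR (k * `|x|), absC (f1 x) <= C * expR (k * `|x|) &
      absC (f2 x) <= C * expR (k * `|x|)].

(** The jump term sees the second derivative on the window of radius [r] around [x], where
    [exp (k |t|)] is at most [exp (k r) exp (k |x|)]; the same bound is used for the diffusion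
    term. *)
Definition gen_const (k : R) : R := `|b| + (`|a / 2| + V) * expR (k * r).

Lemma exp_bounded_shift (k C x t : R) : 0 <= k -> 0 <= C -> `|t - x| <= r ->
  C * expR (k * `|t|) <= C * expR (k * r) * expR (k * `|x|).
Proof.
move=> k0 C0 tx; rewrite -mulrA -expRD -mulrDr ler_wpM2l// ler_expR ler_wpM2l//.
by have := ler_normD (t - x) x; rewrite subrK; lra.
Qed.

Lemma gen_exp_le (k C : R) (f f1 f2 : R -> Cx R) x : 0 <= k -> 0 <= C -> twice_diff f f1 f2 ->
  exp_bounded k C f f1 f2 ->
  absC (gen f f1 f2 x) <= C * gen_const k * expR (k * `|x|).
Proof.
move=> k0 C0 tf fb.
have [_ h1 _] := fb x.
have h2 t : `|t - x| <= r -> absC (f2 t) <= C * expR (k * r) * expR (k * `|x|).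
  by move=> tx; have [_ _ h] := fb t; apply: (le_trans h); exact: exp_bounded_shift.
apply: (le_trans (gen_le tf h1 h2)); rewrite /gen_const.
by rewrite le_eqVlt; apply/orP; left; apply/eqP; ring.
Qed.

Lemma gen_cvg (k C : R) (g g1 g2 : nat -> R -> Cx R) (f f1 f2 : R -> Cx R) x : 0 <= k -> 0 <= C ->
  (forall n, twice_diff (g n) (g1 n) (g2 n)) ->
  (forall n, exp_bounded k C (g n) (g1 n) (g2 n)) ->
  twice_diff f f1 f2 ->
  (forall x, g n x @[n --> \oo] --> f x) -> (forall x, g1 n x @[n --> \oo] --> f1 x) ->
  (forall x, g2 n x @[n --> \oo] --> f2 x) ->
  gen (g n) (g1 n) (g2 n) x @[n --> \oo] --> gen f f1 f2 x.
Proof.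
move=> k0 C0 tg gb tf cg cg1 cg2.
pose M := C * expR (k * r) * expR (k * `|x|).
have hM n t : `|t - x| <= r -> absC (g2 n t) <= M.
  by move=> tx; have [_ _ h] := gb n t; apply: (le_trans h); exact: exp_bounded_shift.
have hMf t : `|t - x| <= r -> absC (f2 t) <= M.
  by move=> tx; apply: (absC_lim_le (cg2 t)) => n; exact: hM.
rewrite /gen; apply: cvgD; first apply: cvgD.
- by apply: cvgM; [exact: cvg_cst|exact: cg1].
- by apply: cvgM; [exact: cvg_cst|exact: cg2].
have [_ _ -> _] := jumps_cintegrable tf hMf.
have -> : (fun n => cintegral F setT (jumps (g n) (g1 n) x)) =
    (fun n => cintegral F D (jumps (g n) (g1 n) x)).
  by apply/funext => n; have [_ _ -> _] := jumps_cintegrable (tg n) (hM n).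
have mD : measurable D by exact: measurable_itv.
have iM : F.-integrable D (EFin \o (fun y => M * y ^+ 2)).
  by have := integrableZl mD M (sqr_integrable_levy levyF r1); apply: eq_integrable.
have [_] : cintegrable F D (jumps f f1 x) /\
  cintegral F D (jumps (g n) (g1 n) x) @[n --> \oo] --> cintegral F D (jumps f f1 x);
  last by [].
apply: (@cdominated_cvg R _ (measurableTypeR R) F D mD _ _ _ _ _ iM).
- move=> n; apply: (@cmeasurableS _ _ _ _ setT) => //; apply: jumps_measurable.
  exact: (twice_diff_continuous (tg n)).1.
- move=> y _; rewrite /jumps; apply: cvgB; first by apply: cvgB; exact: cg.
  by apply: cvgM; [exact: cg1|exact: cvg_cst].
- by move=> n y /jump_rangeP yr; exact: (jumps_le (tg n) (hM n) yr).
Qed.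

Lemma gen_measurable (k C : R) (f f1 f2 : R -> Cx R) : 0 <= k -> 0 <= C -> twice_diff f f1 f2 ->
  exp_bounded k C f f1 f2 -> @cmeasurable R _ (measurableTypeR R) setT (gen f f1 f2).
Proof.
move=> k0 C0 tf fb; have [cf cf1] := twice_diff_continuous tf; have [_ _ cf2] := tf.
apply: cmeasurableD; first apply: cmeasurableD.
- by apply: cmeasurableZ; exact: continuous_cmeasurable.
- by apply: cmeasurableZ; exact: continuous_cmeasurable.
have [m mF] := sigma_finite_pack (levy_sigma_finite levyF).
rewrite mF.
apply: (@cmeasurable_cintegral_param R _ _ (measurableTypeR R) (measurableTypeR R) m setT setT
  measurableT measurableT (fun p => jumps f f1 p.1 p.2)).
- rewrite setXTT; apply: cmeasurableB; first apply: cmeasurableB.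
  + apply: (cmeasurableT_comp (k := f)); first exact: continuous_cmeasurable.
    by apply: measurable_funD.
  + by apply: (cmeasurableT_comp (k := f)); first exact: continuous_cmeasurable.
  + apply: cmeasurableM.
      by apply: (cmeasurableT_comp (k := f1)); first exact: continuous_cmeasurable.
    by apply: (@cmeasurable_ofR _ _ _ _ snd).
- move=> x _; have hM t : `|t - x| <= r -> absC (f2 t) <= C * expR (k * r) * expR (k * `|x|).
    by move=> tx; have [_ _ h] := fb t; apply: (le_trans h); exact: exp_bounded_shift.
  by have [_ + _ _] := jumps_cintegrable tf hM; rewrite mF.
Qed.

End Generator.

(** * Dynkin's formula *)

Section Independence.
Context {R : realType} {d d1 d2} {Om : measurableType d} {T1 : measurableType d1}
  {T2 : measurableType d2}.
Variables (P : probability Om R) (Z : {mfun Om >-> T1}) (Y : {mfun Om >-> T2}).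
Hypothesis indZY : forall A B, measurable A -> measurable B ->
  P (Z @^-1` A `&` Y @^-1` B) = (P (Z @^-1` A) * P (Y @^-1` B))%E.

Let ZY (w : Om) := (Z w, Y w).
Let mZY : measurable_fun setT ZY.
Proof. by apply: measurable_fun_pair. Qed.
Let mixZY := isMeasurableFun.Build _ _ _ _ _ mZY.
Let pZY : {mfun Om >-> (T1 * T2)%type} := HB.pack ZY mixZY.

Let bounded_integrable d' (T' : measurableType d') (Q : probability T' R) (g : T' -> R) (M : R) :
  measurable_fun setT g -> (forall x, `|g x| <= M) -> Q.-integrable setT (EFin \o g).
Proof.
move=> mg gM; apply: (@le_integrable _ _ _ Q _ measurableT _ (cst M%:E)).
- exact/measurable_EFinP.
- move=> x _ /=; rewrite lee_fin; apply: le_trans (gM x) _; exact: ler_norm.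
- exact: finite_measure_integrable_cst.
Qed.

(** Independence says that the law of the pair agrees with the product law on rectangles, hence
    everywhere. Boundedness supplies all integrability and Fubini factors the integral. *)
Lemma indep_Rintegral (g : T1 -> R) (h : T2 -> R) (M N : R) :
  measurable_fun setT g -> measurable_fun setT h ->
  (forall x, `|g x| <= M) -> (forall y, `|h y| <= N) ->
  Rintegral P setT (fun w => g (Z w) * h (Y w)) =
  Rintegral P setT (g \o Z) * Rintegral P setT (h \o Y).
Proof.
move=> mg mh gM hN.
pose m1 := distribution P Z; pose m2 := distribution P Y.
pose k (p : T1 * T2) := g p.1 * h p.2.
have mk : measurable_fun setT k.
  by apply: measurable_funM; apply: measurableT_comp.
have kM p : `|k p| <= M * N.
  by rewrite normrM; apply: ler_pM.
have iZ (f : T1 -> R) : measurable_fun setT f -> (forall x, `|f x| <= M) ->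
    Rintegral P setT (f \o Z) = Rintegral m1 setT f.
  move=> mf fM; rewrite /Rintegral /m1 /distribution integral_pushforward//.
  - exact/measurable_EFinP.
  - by rewrite preimage_setT; apply: (@bounded_integrable _ _ P _ M) => //; exact: measurableT_comp.
have iY (f : T2 -> R) : measurable_fun setT f -> (forall x, `|f x| <= N) ->
    Rintegral P setT (f \o Y) = Rintegral m2 setT f.
  move=> mf fM; rewrite /Rintegral /m2 /distribution integral_pushforward//.
  - exact/measurable_EFinP.
  - by rewrite preimage_setT; apply: (@bounded_integrable _ _ P _ N) => //; exact: measurableT_comp.
have im1 := bounded_integrable m1 mg gM.
have im2 := bounded_integrable m2 mh hN.
have prodE (f : T1 * T2 -> \bar R) :
    (\int[distribution P pZY]_p f p = \int[m1 \x m2]_p f p)%E.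
  apply: eq_measure_integral => A mA _; apply/esym.
  by apply: product_measure_unique => // B C mB mC; exact: indZY.
have ik : (m1 \x m2)%E.-integrable setT (EFin \o k).
  have /integrableP[mk' koo] := bounded_integrable (distribution P pZY) mk kM.
  by apply/integrableP; split=> //; rewrite -prodE.
rewrite iZ// iY// /Rintegral.
have -> : (\int[P]_x (g (Z x) * h (Y x))%:E = \int[distribution P pZY]_p (k p)%:E)%E.
  rewrite /distribution integral_pushforward//.
  - exact/measurable_EFinP.
  - rewrite preimage_setT; apply: (@bounded_integrable _ _ P _ (M * N)) => //.
    exact: measurableT_comp.
rewrite prodE -(integral12_prod_meas1 ik) /= -fineM ?integrable_fin_num//; congr fine.
under eq_integral => x _.
  have -> : fubini_F m2 (EFin \o k) x = ((g x)%:E * \int[m2]_y (EFin \o h) y)%E.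
    by rewrite -integralZl.
  over.
have -> : (\int[m2]_y (EFin \o h) y = (Rintegral m2 setT h)%:E)%E.
  by rewrite /Rintegral fineK//; exact: integrable_fin_num.
by rewrite /Rintegral -integralZr.
Qed.

Lemma indep_cintegral (g : T1 -> Cx R) (h : T2 -> Cx R) (M N : R) :
  cmeasurable setT g -> cmeasurable setT h ->
  (forall x, absC (g x) <= M) -> (forall y, absC (h y) <= N) ->
  cintegral P setT (fun w => g (Z w) * h (Y w)) =
  cintegral P setT (g \o Z) * cintegral P setT (h \o Y).
Proof.
move=> [mg1 mg2] [mh1 mh2] gM hN.
have g1 x := le_trans (ler_absC_re (g x)) (gM x).
have g2 x := le_trans (ler_absC_im (g x)) (gM x).
have h1 x := le_trans (ler_absC_re (h x)) (hN x).
have h2 x := le_trans (ler_absC_im (h x)) (hN x).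
have ii (p : T1 -> R) (q : T2 -> R) : measurable_fun setT p -> measurable_fun setT q ->
    (forall x, `|p x| <= M) -> (forall x, `|q x| <= N) ->
    P.-integrable setT (EFin \o (fun w => p (Z w) * q (Y w))).
  move=> mp mq pM qN; apply: (@bounded_integrable _ _ P _ (M * N)).
    by apply: measurable_funM; apply: measurableT_comp.
  by move=> x; rewrite normrM; apply: ler_pM.
have I11 := indep_Rintegral mg1 mh1 g1 h1.
have I12 := indep_Rintegral mg1 mh2 g1 h2.
have I21 := indep_Rintegral mg2 mh1 g2 h1.
have I22 := indep_Rintegral mg2 mh2 g2 h2.
have J11 := ii _ _ mg1 mh1 g1 h1.
have J12 := ii _ _ mg1 mh2 g1 h2.
have J21 := ii _ _ mg2 mh1 g2 h1.
have J22 := ii _ _ mg2 mh2 g2 h2.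
apply: Cx_ext.
  rewrite reCM /= -I11 -I22 -RintegralB//.
  by apply: eq_Rintegral => w _; rewrite /= reCM.
rewrite imCM /= -I12 -I21 -RintegralD//.
by apply: eq_Rintegral => w _; rewrite /= imCM.
Qed.

End Independence.

Section ProductRule.
Context {R : realType}.

Lemma rdiffM (K L : R -> Cx R) x l m : rdiff K x l -> rdiff L x m ->
  rdiff (fun t => K t * L t) x (K x * m + l * L x).
Proof.
move=> /rdiffP[k1 k2] /rdiffP[l1 l2]; apply/rdiffP.
have e1 : reC \o (fun t => K t * L t) =
    (reC \o K) * (reC \o L) - (imC \o K) * (imC \o L).
  by apply/funext => t /=; rewrite reCM.
have e2 : imC \o (fun t => K t * L t) =
    (reC \o K) * (imC \o L) + (imC \o K) * (reC \o L).
  by apply/funext => t /=; rewrite imCM.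
rewrite e1 e2; split.
  apply: (is_derive_eq (is_deriveB (is_deriveM k1 l1) (is_deriveM k2 l2))).
  by rewrite /GRing.scale /= reCD !reCM; ring.
apply: (is_derive_eq (is_deriveD (is_deriveM k1 l2) (is_deriveM k2 l1))).
by rewrite /GRing.scale /= imCD !imCM; ring.
Qed.

End ProductRule.

(** * Characters as eigenfunctions of the generator *)

Section Characters.
Context {R : realType}.
Variables (b a : R) (F : {measure set (measurableTypeR R) -> \bar R}).
Hypothesis levyF : levy_measure F.
Variable r : R.
Hypotheses (r1 : 1 <= r) (Fr : F [set y | r < `|y|] = 0%E).

Definition chr (u x : R) : Cx R := cis (u * x).
Definition chr1 (u x : R) : Cx R := ofR u * imag * chr u x.
Definition chr2 (u x : R) : Cx R := ofR u * imag * chr1 u x.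

Lemma absC_chr u x : absC (chr u x) = 1. Proof. exact: absC_cis. Qed.

Lemma twice_diff_chr u : twice_diff (chr u) (chr1 u) (chr2 u).
Proof.
have d0 x : rdiff (chr u) x (chr1 u x) by exact: rdiff_cisM.
have d1 x : rdiff (chr1 u) x (chr2 u x) by exact: rdiffZ.
split=> //; apply: rdiff_continuous => x; exists (ofR u * imag * chr2 u x).
exact: rdiffZ.
Qed.

Lemma exp_bounded_chr u : exp_bounded 0 (1 + `|u| + `|u| ^+ 2) (chr u) (chr1 u) (chr2 u).
Proof.
move=> x; rewrite mul0r expR0 mulr1 /chr2 /chr1 !absCM absC_chr absC_ofR absC_imag !mulr1.
by rewrite -expr2; have := normr_ge0 u; have := sqr_ge0 `|u|; split; lra.
Qed.

Let psi := levy_exponent b a F.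

Lemma gen_chr u x : gen b a F (chr u) (chr1 u) (chr2 u) x = psi u * chr u x.
Proof.
have h2 (t : R) : `|t - 0| <= r -> absC (chr2 u t) <= `|u| ^+ 2.
  by move=> _; rewrite /chr2 /chr1 !absCM absC_chr absC_ofR absC_imag !mulr1 -expr2.
have [_ iJ _ _] := jumps_cintegrable levyF r1 Fr (twice_diff_chr u) h2.
have jE y : jumps (chr u) (chr1 u) 0 y = cis (u * y) - 1 - ofR (u * y) * imag.
  by rewrite /jumps /chr1 /chr add0r mulr0 cis0 mulr1 rmorphM /=; ring.
rewrite /gen /psi /levy_exponent.
(* Translation by [x] multiplies a character by the scalar [chr u x], so the jump integral reduces
   to the one at 0, which appears in [psi u]. *)
have -> : cintegral F setT (jumps (chr u) (chr1 u) x) =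
    chr u x * cintegral F setT (jumps (chr u) (chr1 u) 0).
  rewrite -cintegralZ//; apply: eq_cintegral => // y _.
  by rewrite /jumps /chr1 /chr add0r !mulr0 cis0 mulrDr cisD; ring.
have -> : cintegral F setT (jumps (chr u) (chr1 u) 0) =
    cintegral F setT (fun y => cis (u * y) - 1 - ofR (u * y) * imag).
  by apply: eq_cintegral => // y _; exact: jE.
have E : ofR u * imag * (ofR u * imag) = - ofR (u ^+ 2) :> Cx R.
  rewrite (_ : _ * _ = ofR u * ofR u * (imag * imag)); last by ring.
  by rewrite imag2 rmorphXn /=; ring.
rewrite /chr2 /chr1 [ofR u * imag * (_ * _)]mulrA E.
rewrite !rmorphM /=; ring.
Qed.

Lemma rdiff_expC (z : Cx R) (s q : R) :
  rdiff (fun q => expC (ofR (q - s) * z)) q (z * expC (ofR (q - s) * z)).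
Proof.
have E (k : R) : is_derive q 1 (fun q : R => (q - s) * k) k.
  apply/is_derive_epsP => e e0; exists 1 => // h _.
  by rewrite (_ : _ - _ = 0); [rewrite normr0 mulr_ge0// ltW|ring].
have -> : (fun q => expC (ofR (q - s) * z)) =
  (fun q => ofR (expR ((q - s) * reC z)) * cis ((q - s) * imC z)).
  by apply/funext => q'; rewrite /expC reCM imCM /= !mul0r subr0 addr0.
have d1 : rdiff (fun q => ofR (expR ((q - s) * reC z))) q
    (ofR (expR ((q - s) * reC z) * reC z)).
  apply: rdiff_ofR; exact: (is_derive1_comp (is_derive_expR _) (E _)).
have d2 := @rdiff_compR _ _ (fun q : R => (q - s) * imC z) _ _ _
  (rdiff_cis ((q - s) * imC z)) (E (imC z)).
have := rdiffM d1 d2; congr rdiff.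
have zE : z = ofR (reC z) + imag * ofR (imC z).
  by apply: Cx_ext; rewrite ?reCD ?imCD ?reCM ?imCM /=; ring.
transitivity ((ofR (reC z) + imag * ofR (imC z)) * expC (ofR (q - s) * z)); last by rewrite -zE.
rewrite /expC reCM imCM /= !mul0r subr0 addr0 rmorphM /=; ring.
Qed.

Lemma cintegral_expC (z c : Cx R) (s t : R) : s <= t ->
  cintegral leb `[s, t] (fun q => z * expC (ofR (q - s) * z) * c) =
  (expC (ofR (t - s) * z) - 1) * c.
Proof.
move=> st.
have d x : rdiff (fun q => expC (ofR (q - s) * z) * c) x (z * expC (ofR (x - s) * z) * c).
  by have := rdiffM (rdiff_expC z s x) (rdiff_cst c x); rewrite mulr0 add0r.
have ck : continuous (fun q => z * expC (ofR (q - s) * z) * c).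
  apply: rdiff_continuous => x; exists (z * (z * expC (ofR (x - s) * z) * c)).
  have -> : (fun q => z * expC (ofR (q - s) * z) * c) =
    (fun q => z * (expC (ofR (q - s) * z) * c)) by apply/funext => q; rewrite mulrA.
  exact: rdiffZ.
have d' x : s <= x <= t ->
  rdiff (fun q => expC (ofR (q - s) * z) * c) x (z * expC (ofR (x - s) * z) * c) by [].
rewrite (@cFTC2 _ _ _ s t st ck d') subrr ofR0 mul0r expC0 mul1r; ring.
Qed.

End Characters.

Lemma cintegral_leb_lin {R : realType} (s t : R) (f g : R -> Cx R) (c : Cx R) :
  cintegrable leb `[s, t] f -> cintegrable leb `[s, t] g ->
  cintegral leb `[s, t] (fun q => f q + c * g q) =
  cintegral leb `[s, t] f + c * cintegral leb `[s, t] g.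
Proof.
move=> hf hg; rewrite -(cintegral_lebZ (measurable_itv `[s, t]) c hg).
exact: (@cintegralD R _ (measurableTypeR R) leb `[s, t]%classic (measurable_itv _) f
  (fun q => c * g q) hf (cintegrable_lebZ (measurable_itv _) c hg)).
Qed.

Lemma cintegral_indic {R : realType} {d} {Y : measurableType d}
    (mu : {measure set Y -> \bar R}) (A : set Y) (f : Y -> Cx R) :
  cintegral mu A f = cintegral mu setT (fun w => ofR (\1_A w) * f w).
Proof.
congr Complex; rewrite Rintegral_mkcond; apply: eq_Rintegral => w _ /=;
  rewrite ?reCM ?imCM /= mul0r ?subr0 ?addr0 patchE indicE;
  by case: ifPn => wA; rewrite ?mul1r ?mul0r.
Qed.

Section LawFacts.
Context {R : realType} {d} {Om : measurableType d}.
Variable P : probability Om R.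

Lemma eq_law_Rintegral (Y Z : Om -> R) (h : R -> R) : measurable_fun setT Y ->
  measurable_fun setT Z -> (forall B : set (measurableTypeR R), measurable B ->
    P [set w | B (Y w)] = P [set w | B (Z w)]) ->
  @measurable_fun _ _ (measurableTypeR R) R setT h -> (forall x, `|h x| <= 1) ->
  Rintegral P setT (h \o Y) = Rintegral P setT (h \o Z).
Proof.
move=> mY mZ YZ mh h1.
pose mixY := isMeasurableFun.Build _ _ _ _ _ mY.
pose pY : {mfun Om >-> R} := HB.pack Y mixY.
pose mixZ := isMeasurableFun.Build _ _ _ _ _ mZ.
pose pZ : {mfun Om >-> R} := HB.pack Z mixZ.
have iP (V : Om -> R) : measurable_fun setT V -> P.-integrable setT (EFin \o (h \o V)).
  move=> mV; apply: (@le_integrable _ _ _ P _ measurableT _ (cst 1%:E)).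
  - by apply/measurable_EFinP; exact: measurableT_comp.
  - by move=> x _ /=; rewrite lee_fin normr1 h1.
  - exact: finite_measure_integrable_cst.
rewrite /Rintegral.
have -> : (\int[P]_w (h (Y w))%:E = \int[distribution P pY]_y (h y)%:E)%E.
  rewrite /distribution integral_pushforward//; first exact/measurable_EFinP.
  by rewrite preimage_setT; exact: iP.
have -> : (\int[P]_w (h (Z w))%:E = \int[distribution P pZ]_y (h y)%:E)%E.
  rewrite /distribution integral_pushforward//; first exact/measurable_EFinP.
  by rewrite preimage_setT; exact: iP.
by congr fine; apply: eq_measure_integral => B mB _; exact: YZ.
Qed.

Lemma eq_law_cintegral (Y Z : Om -> R) (h : R -> Cx R) : measurable_fun setT Y ->
  measurable_fun setT Z -> (forall B : set (measurableTypeR R), measurable B ->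
    P [set w | B (Y w)] = P [set w | B (Z w)]) ->
  @cmeasurable R _ (measurableTypeR R) setT h -> (forall x, absC (h x) <= 1) ->
  cintegral P setT (h \o Y) = cintegral P setT (h \o Z).
Proof.
move=> mY mZ YZ [mh1 mh2] h1; congr Complex.
  by apply: (eq_law_Rintegral mY mZ YZ mh1) => x; exact: le_trans (ler_absC_re _) (h1 x).
by apply: (eq_law_Rintegral mY mZ YZ mh2) => x; exact: le_trans (ler_absC_im _) (h1 x).
Qed.

End LawFacts.

(** * Dynkin's formula on events of the filtration and its stability under limits *)

Section Dynkin.
Context {R : realType} {d : measure_display} {Om : measurableType d}.
Variables (P : probability Om R) (T : R) (Ft : R -> set (set Om)) (X : R -> Om -> R).
Variables (b a : R) (F : {measure set (measurableTypeR R) -> \bar R}).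
Hypotheses (T_gt0 : 0 < T) (filtrationF : filtration T Ft).
Hypotheses (levyF : levy_measure F) (levyX : levy_process P T Ft X b a F).
Variable r : R.
Hypotheses (r1 : 1 <= r) (Fr : F [set y | r < `|y|] = 0%E).
Let psi := levy_exponent b a F.

Lemma itv_horizon (s t q : R) : 0 <= s -> t <= T -> s <= q <= t -> 0 <= q <= T.
Proof. by move=> s0 tT /andP[sq qt]; apply/andP; split; lra. Qed.

Lemma measurable_wrt_X (t : R) : 0 <= t <= T -> measurable_wrt (Ft t) (X t).
Proof. by have [H _ _ _ _] := levyX; exact: H. Qed.

Lemma measurable_X (t : R) : 0 <= t <= T -> measurable_fun setT (X t).
Proof.
move=> tT; have [_ H _] := filtrationF.
exact: measurable_wrt_measurable (H t tT) (measurable_wrt_X tT).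
Qed.

Lemma Ft_measurable (t : R) A : 0 <= t <= T -> Ft t A -> measurable A.
Proof. by move=> tT; have [_ H _] := filtrationF; exact: H. Qed.

Lemma char_increment (s t u : R) : 0 <= s -> s <= t -> t <= T ->
  cintegral P setT (fun w => cis (u * (X t w - X s w))) = expC (ofR (t - s) * psi u).
Proof.
move=> s0 st tT; have [_ _ _ stat char] := levyX.
have m q : 0 <= q <= T -> measurable_fun setT (X q) by exact: measurable_X.
have mI p q : 0 <= p <= T -> 0 <= q <= T -> measurable_fun setT (fun w => X q w - X p w).
  by move=> pT qT; apply: measurable_funB; exact: m.
have tsT : 0 <= t - s <= T by rewrite subr_ge0 st /=; lra.
rewrite -(char _ u tsT).
apply: (@eq_law_cintegral _ _ _ P (fun w => X t w - X s w) (fun w => X (t - s) w - X 0 w)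
  (fun x => cis (u * x))).
- by apply: mI; apply/andP; split=> //; lra.
- by apply: mI => //; rewrite lexx ltW.
- by move=> B mB; exact: stat.
- by apply: cmeasurable_cis; apply: measurable_funM.
- by move=> x; rewrite absC_cis.
Qed.

Lemma char_conditional (s t u : R) A : 0 <= s -> s <= t -> t <= T -> Ft s A ->
  cintegral P A (fun w => chr u (X t w)) =
  expC (ofR (t - s) * psi u) * cintegral P A (fun w => chr u (X s w)).
Proof.
move=> s0 st tT FsA; have [_ _ ind _ _] := levyX.
have sT : 0 <= s <= T by apply/andP; split=> //; lra.
have tT' : 0 <= t <= T by apply/andP; split=> //; lra.
have [sig sub _] := filtrationF.
have mI : measurable_fun setT (fun w => X t w - X s w).
  by apply: measurable_funB; exact: measurable_X.
pose mixY := isMeasurableFun.Build _ _ _ _ _ mI.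
pose Y : {mfun Om >-> R} := HB.pack (fun w => X t w - X s w) mixY.
have mid : @measurable_fun _ _ Om (g_sigma_algebraType (Ft s)) setT (fun w : Om => w).
  by move=> _ B; rewrite measurable_subsigma ?setTI; [exact: sub|exact: sig].
pose mixZ := isMeasurableFun.Build _ _ _ _ _ mid.
(* [Z] is the identity into [Om] with the sigma-algebra [Ft s]. The indicator of [A] and [X s] are
   both functions of [Z], and independence of [Z] and [Y] is exactly the independence of the
   increment from [Ft s]. *)
pose Z : {mfun Om >-> g_sigma_algebraType (Ft s)} := HB.pack (fun w : Om => w) mixZ.
pose g (w : g_sigma_algebraType (Ft s)) : Cx R := ofR (\1_(A : set Om) w) * chr u (X s w).
rewrite (cintegral_indic P A (fun w => chr u (X t w))).
rewrite (cintegral_indic P A (fun w => chr u (X s w))).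
rewrite -(char_increment u s0 st tT) [RHS]mulrC.
have -> : cintegral P setT (fun w => ofR (\1_A w) * chr u (X t w)) =
    cintegral P setT (fun w => g (Z w) * cis (u * Y w)).
  apply: eq_cintegral => // w _; rewrite /g /chr /= -mulrA -cisD.
  by congr (_ * cis _); ring.
apply: (@indep_cintegral _ _ _ _ _ _ _ P Z Y _ g (fun x => cis (u * x)) 1 1).
- move=> B C; rewrite measurable_subsigma; last exact: sig.
  by move=> FB mC; exact: (ind s t s0 st tT).
- apply: cmeasurableM.
    apply: cmeasurable_ofR; apply: measurable_indic.
    by rewrite measurable_subsigma//; exact: sig.
  apply: (cmeasurableT_comp (k := chr u)).
    by apply: cmeasurable_cis; apply: measurable_funM.
  by apply/measurable_wrtP; [exact: sig|exact: measurable_wrt_X].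
- by apply: cmeasurable_cis; apply: measurable_funM.
- move=> w; rewrite /g absCM absC_ofR absC_chr mulr1 indicE.
  by case: (_ \in _); rewrite ?normr1 ?normr0.
- by move=> x; rewrite absC_cis.
Qed.

Definition EX (A : set Om) (f : R -> Cx R) (q : R) : Cx R :=
  cintegral P A (fun w => f (X q w)).

Definition dynkin_formula (f f1 f2 : R -> Cx R) := forall A (s t : R), 0 <= s -> s <= t -> t <= T -> Ft s A ->
  EX A f t = EX A f s + cintegral leb `[s, t] (EX A (gen b a F f f1 f2)).

(** By [char_conditional] the expectation over [A] evolves as an exponential of rate [psi u]; the
    generator multiplies it by [psi u], so the time integrand is its derivative. *)
Lemma dynkin_chr u : dynkin_formula (chr u) (chr1 u) (chr2 u).
Proof.
move=> A s t s0 st tT FsA.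
have tT' : 0 <= t <= T by apply/andP; split=> //; lra.
have sT : 0 <= s <= T by apply/andP; split=> //; lra.
have mA : measurable A by exact: Ft_measurable FsA.
have E q : `[s, t]%classic q -> psi u * expC (ofR (q - s) * psi u) * EX A (chr u) s =
    EX A (gen b a F (chr u) (chr1 u) (chr2 u)) q.
  rewrite /= in_itv /= => /andP[sq qt].
  have qT : 0 <= q <= T by apply/andP; split; lra.
  have -> : EX A (gen b a F (chr u) (chr1 u) (chr2 u)) q = psi u * EX A (chr u) q.
    rewrite /EX -cintegralZ//.
      by apply: eq_cintegral => // w _; rewrite (gen_chr b a levyF r1 Fr).
    apply: (@cintegrable_le _ _ _ P A mA _ (cst 1)).
    - apply: (cmeasurableT_comp (k := chr u)).
        by apply: cmeasurable_cis; apply: measurable_funM.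
      by apply: measurable_funTS; exact: measurable_X.
    - exact: finite_measure_integrable_cst.
    - by move=> w _; rewrite absC_chr.
  rewrite {2}/EX (char_conditional u s0 sq _ FsA) -?/(EX A (chr u) s); first by rewrite mulrA.
  by lra.
rewrite -(@eq_cintegral R _ (measurableTypeR R) leb `[s, t]%classic _ _ E).
rewrite (cintegral_expC _ _ st) {1}/EX (char_conditional u s0 st tT FsA) -/(EX A (chr u) s).
by ring.
Qed.

Definition exp_moment (k M : R) := forall q : R, 0 <= q <= T ->
  P.-integrable setT (EFin \o (fun w => expR (k * `|X q w|))) /\
  Rintegral P setT (fun w => expR (k * `|X q w|)) <= M.

Lemma exp_moment0 : exp_moment 0 1.
Proof.
move=> q qT; have E : (fun w => expR (0 * `|X q w|)) = cst 1.
  by apply/funext => w; rewrite mul0r expR0.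
rewrite E; split; first exact: finite_measure_integrable_cst.
have -> : Rintegral P setT (cst 1) = 1; last by [].
have E1 : (\int[P]_x (cst 1%E) x = 1)%E.
  by rewrite (integral_cst P measurableT) [X in (_ * X)%E]probability_setT mule1.
by rewrite /Rintegral [X in fine X]E1.
Qed.

Lemma X_jointly_measurable (s t : R) : 0 <= s -> s <= t -> t <= T ->
  @measurable_fun _ _ (measurableTypeR R * Om)%type R (`[s, t]%classic `*` setT)
    (fun p => X p.1 p.2).
Proof.
move=> s0 st tT; apply: (process_measurable st).
- by move=> q /andP[sq qt]; apply: measurable_X; apply/andP; split; lra.
- move=> w q /andP[sq qt]; have [_ /(_ w)[cr _] _ _ _] := levyX.
  by apply: cr; apply/andP; split; lra.
Qed.

Section Expectations.
Variables (A : set Om) (mA : measurable A) (f : R -> Cx R) (k C M s t : R).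
Hypotheses (mf : @cmeasurable R _ (measurableTypeR R) setT f) (C0 : 0 <= C)
  (fC : forall x, absC (f x) <= C * expR (k * `|x|)) (kM : exp_moment k M).
Hypotheses (s0 : 0 <= s) (st : s <= t) (tT : t <= T).

Lemma EX_cintegrable (q : R) : 0 <= q <= T -> cintegrable P A (fun w => f (X q w)).
Proof.
move=> qT; have [iq _] := kM qT.
have iC : P.-integrable A (EFin \o (fun w => C * expR (k * `|X q w|))).
  have := integrableZl mA C (integrableS measurableT mA (@subsetT _ _) iq).
  by apply: eq_integrable.
apply: (@cintegrable_le _ _ _ P A mA _ _ _ iC) => [|w _]; last exact: fC.
by apply: (cmeasurableT_comp mf); apply: measurable_funTS; exact: measurable_X.
Qed.

Lemma EX_le (q : R) : 0 <= q <= T -> absC (EX A f q) <= C * M.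
Proof.
move=> qT; have [iq iM] := kM qT.
apply: le_trans (absC_cintegral_le mA (EX_cintegrable qT)) _.
have iC : P.-integrable setT (EFin \o (fun w => C * expR (k * `|X q w|))).
  by have := integrableZl measurableT C iq; apply: eq_integrable.
have ia := cintegrable_absC (EX_cintegrable qT).
apply: (@le_trans _ _ (Rintegral P setT (fun w => C * expR (k * `|X q w|)))); last first.
  by rewrite RintegralZl// ler_wpM2l.
apply: (@le_trans _ _ (Rintegral P A (fun w => C * expR (k * `|X q w|)))).
  by apply: le_Rintegral => //; exact: integrableS iC.
rewrite /Rintegral fine_le ?integrable_fin_num//; first exact: integrableS iC.
apply: ge0_subset_integral => //; first by case/integrableP: iC.
by move=> w _; rewrite /= lee_fin mulr_ge0// expR_ge0.
Qed.

Lemma X_comp_cmeasurable : @cmeasurable R _ (measurableTypeR R * Om)%type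
  (`[s, t]%classic `*` A) (fun p => f (X p.1 p.2)).
Proof.
apply: (@cmeasurableS _ _ _ _ (`[s, t]%classic `*` setT)).
- by apply: measurableX; [exact: measurable_itv|exact: measurableT].
- by move=> p [].
- by apply: (cmeasurableT_comp mf); exact: X_jointly_measurable.
Qed.

Lemma EX_cmeasurable : @cmeasurable R _ (measurableTypeR R) `[s, t]%classic (EX A f).
Proof.
apply: (@cmeasurable_cintegral_param R _ _ (measurableTypeR R) Om P `[s, t]%classic A
  (measurable_itv _) mA (fun p => f (X p.1 p.2)) X_comp_cmeasurable).
move=> q /=; rewrite in_itv /= => sqt.
by apply: EX_cintegrable; exact: itv_horizon sqt.
Qed.

Lemma EX_itv_cintegrable : cintegrable leb `[s, t] (EX A f).
Proof.
apply: (@bounded_cintegrable _ _ `[s, t]%classic `[s, t]%classic s t (C * M)) => //.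
- exact: EX_cmeasurable.
- by move=> q /=; rewrite in_itv /= => sqt; apply: EX_le; exact: itv_horizon sqt.
Qed.

End Expectations.

(** Expectations converge by domination with the exponential moment, and the time integral by a
    constant bound. The bound [K] on the generators is uniform in [n], because [gen_exp_le] depends
    on the sequence through [k] and [C] alone. *)
Lemma dynkin_cvg (k C M : R) (g g1 g2 : nat -> R -> Cx R) (f f1 f2 : R -> Cx R) :
  0 <= k -> 0 <= C -> exp_moment k M ->
  (forall n, twice_diff (g n) (g1 n) (g2 n)) ->
  (forall n, exp_bounded k C (g n) (g1 n) (g2 n)) -> twice_diff f f1 f2 ->
  (forall x, g n x @[n --> \oo] --> f x) -> (forall x, g1 n x @[n --> \oo] --> f1 x) ->
  (forall x, g2 n x @[n --> \oo] --> f2 x) ->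
  (forall n, dynkin_formula (g n) (g1 n) (g2 n)) -> dynkin_formula f f1 f2.
Proof.
move=> k0 C0 kM tg gb tf cg cg1 cg2 dg A s t s0 st tT FsA.
have sT : 0 <= s <= T by apply/andP; split=> //; lra.
have mA : measurable A by exact: Ft_measurable FsA.
have Ecvg (h : nat -> R -> Cx R) (l : R -> Cx R) (K q : R) : 0 <= K -> 0 <= q <= T ->
    (forall n, @cmeasurable R _ (measurableTypeR R) setT (h n)) ->
    (forall n x, absC (h n x) <= K * expR (k * `|x|)) ->
    (forall x, h n x @[n --> \oo] --> l x) -> EX A (h n) q @[n --> \oo] --> EX A l q.
  move=> K0 qT mh hK hl; have [iq _] := kM q qT.
  have iK : P.-integrable A (EFin \o (fun w => K * expR (k * `|X q w|))).
    have := integrableZl mA K (integrableS measurableT mA (@subsetT _ _) iq).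
    by apply: eq_integrable.
  have [_] : cintegrable P A (fun w => l (X q w)) /\ EX A (h n) q @[n --> \oo] --> EX A l q; last by [].
  apply: (@cdominated_cvg R _ Om P A mA _ _ _ _ _ iK).
  - move=> n; apply: (cmeasurableT_comp (mh n)).
    by apply: measurable_funTS; exact: measurable_X.
  - by move=> w _; exact: hl.
  - by move=> n w _; exact: hK.
have mg n : @cmeasurable R _ (measurableTypeR R) setT (g n).
  by apply: continuous_cmeasurable; have [] := twice_diff_continuous (tg n).
have bg n x : absC (g n x) <= C * expR (k * `|x|) by have [] := gb n x.
have mG n := gen_measurable b a levyF r1 Fr k0 C0 (tg n) (gb n).
pose K := C * gen_const b a F r k.
have K0 : 0 <= K.
  rewrite mulr_ge0// /gen_const addr_ge0// mulr_ge0 ?expR_ge0// addr_ge0//.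
  exact: levy_var_ge0.
have bG n x : absC (gen b a F (g n) (g1 n) (g2 n) x) <= K * expR (k * `|x|).
  by have := gen_exp_le b a levyF r1 Fr x k0 C0 (tg n) (gb n).
have cG x : gen b a F (g n) (g1 n) (g2 n) x @[n --> \oo] --> gen b a F f f1 f2 x.
  exact: (gen_cvg levyF r1 Fr k0 C0 tg gb tf cg cg1 cg2).
have ct : EX A (g n) t @[n --> \oo] --> EX A f t.
  by apply: (Ecvg _ _ C) => //; apply/andP; split; lra.
have cs : EX A (g n) s @[n --> \oo] --> EX A f s by apply: (Ecvg _ _ C).
have [_ ci] : cintegrable leb `[s, t] (EX A (gen b a F f f1 f2)) /\
    cintegral leb `[s, t] (EX A (gen b a F (g n) (g1 n) (g2 n))) @[n --> \oo] -->
    cintegral leb `[s, t] (EX A (gen b a F f f1 f2)).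
  apply: (@cdominated_cvg R _ (measurableTypeR R) leb `[s, t]%classic (measurable_itv _)
    _ _ (cst (K * M))).
  - by move=> n; apply: (EX_cmeasurable mA (mG n) (bG n) kM s0 st tT).
  - move=> q /=; rewrite in_itv /= => sqt; apply: (Ecvg _ _ K) => //.
    exact: itv_horizon sqt.
  - apply: continuous_compact_integrable; first exact: segment_compact.
    by apply: continuous_subspaceT => x; exact: cvg_cst.
  - move=> n q /=; rewrite in_itv /= => sqt; apply: (EX_le mA (mG n) K0 (bG n) kM).
    exact: itv_horizon sqt.
have E : (fun n => EX A (g n) t) = (fun n => EX A (g n) s +
    cintegral leb `[s, t] (EX A (gen b a F (g n) (g1 n) (g2 n)))).
  by apply/funext => n; exact: (dg n A s t).
rewrite E in ct; exact: (cvg_unique _ ct (cvgD cs ci)).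
Qed.

Lemma genD (f f1 f2 g g1 g2 : R -> Cx R) (k C K : R) x : 0 <= k -> 0 <= C -> 0 <= K ->
  twice_diff f f1 f2 -> twice_diff g g1 g2 -> exp_bounded k C f f1 f2 -> exp_bounded k K g g1 g2 ->
  forall c : Cx R,
  gen b a F (fun x => f x + c * g x) (fun x => f1 x + c * g1 x) (fun x => f2 x + c * g2 x) x =
  gen b a F f f1 f2 x + c * gen b a F g g1 g2 x.
Proof.
move=> k0 C0 K0 tf tg fb gb c.
have hf u : `|u - x| <= r -> absC (f2 u) <= C * expR (k * r) * expR (k * `|x|).
  by move=> ux; have [_ _ h] := fb u; apply: (le_trans h); exact: exp_bounded_shift.
have hg u : `|u - x| <= r -> absC (g2 u) <= K * expR (k * r) * expR (k * `|x|).
  by move=> ux; have [_ _ h] := gb u; apply: (le_trans h); exact: exp_bounded_shift.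
have [_ jf _ _] := jumps_cintegrable levyF r1 Fr tf hf.
have [_ jg _ _] := jumps_cintegrable levyF r1 Fr tg hg.
rewrite /gen; have -> : cintegral F setT (jumps (fun x => f x + c * g x) (fun x => f1 x + c * g1 x) x) =
    cintegral F setT (jumps f f1 x) + c * cintegral F setT (jumps g g1 x).
  rewrite -cintegralZ// -cintegralD//; last exact: cintegrableZ.
  by apply: eq_cintegral => // y _; rewrite /jumps; ring.
ring.
Qed.

Lemma dynkinD (f f1 f2 g g1 g2 : R -> Cx R) (k C K M : R) (c : Cx R) :
  0 <= k -> 0 <= C -> 0 <= K -> exp_moment k M ->
  twice_diff f f1 f2 -> twice_diff g g1 g2 -> exp_bounded k C f f1 f2 -> exp_bounded k K g g1 g2 ->
  dynkin_formula f f1 f2 -> dynkin_formula g g1 g2 ->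
  dynkin_formula (fun x => f x + c * g x) (fun x => f1 x + c * g1 x) (fun x => f2 x + c * g2 x).
Proof.
move=> k0 C0 K0 kM tf tg fb gb df dg A s t s0 st tT FsA.
have sT : 0 <= s <= T by apply/andP; split=> //; lra.
have tT' : 0 <= t <= T by apply/andP; split=> //; lra.
have mA : measurable A by exact: Ft_measurable FsA.
have EXD (h l : R -> Cx R) (H L q : R) : 0 <= H -> 0 <= L -> 0 <= q <= T ->
    @cmeasurable R _ (measurableTypeR R) setT h -> @cmeasurable R _ (measurableTypeR R) setT l ->
    (forall x, absC (h x) <= H * expR (k * `|x|)) ->
    (forall x, absC (l x) <= L * expR (k * `|x|)) ->
    EX A (fun x => h x + c * l x) q = EX A h q + c * EX A l q.
  move=> H0 L0 qT mh ml hH lL.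
  have ih := EX_cintegrable mA mh hH kM qT.
  have il := EX_cintegrable mA ml lL kM qT.
  by rewrite /EX -cintegralZ// -cintegralD//; exact: cintegrableZ.
have m (h h1 h2 : R -> Cx R) : twice_diff h h1 h2 -> @cmeasurable R _ (measurableTypeR R) setT h.
  by move=> th; apply: continuous_cmeasurable; have [] := twice_diff_continuous th.
have fb0 x : absC (f x) <= C * expR (k * `|x|) by have [] := fb x.
have gb0 x : absC (g x) <= K * expR (k * `|x|) by have [] := gb x.
have mGf := gen_measurable b a levyF r1 Fr k0 C0 tf fb.
have mGg := gen_measurable b a levyF r1 Fr k0 K0 tg gb.
have bGf x := gen_exp_le b a levyF r1 Fr x k0 C0 tf fb.
have bGg x := gen_exp_le b a levyF r1 Fr x k0 K0 tg gb.
have gc0 : 0 <= gen_const b a F r k.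
  by rewrite /gen_const addr_ge0// mulr_ge0 ?expR_ge0// addr_ge0// levy_var_ge0.
have C'0 := mulr_ge0 C0 gc0; have K'0 := mulr_ge0 K0 gc0.
rewrite !(EXD f g C K)//; [|exact: m tf|exact: m tg|exact: m tf|exact: m tg].
have iF := EX_itv_cintegrable mA mGf C'0 bGf kM s0 st tT.
have iG := EX_itv_cintegrable mA mGg K'0 bGg kM s0 st tT.
have E : cintegral leb `[s, t] (EX A (gen b a F (fun x => f x + c * g x)
     (fun x => f1 x + c * g1 x) (fun x => f2 x + c * g2 x))) =
   cintegral leb `[s, t] (EX A (gen b a F f f1 f2)) +
   c * cintegral leb `[s, t] (EX A (gen b a F g g1 g2)).
  rewrite -(cintegral_leb_lin c iF iG).
  apply: (@eq_cintegral R _ (measurableTypeR R) leb `[s, t]%classic).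
  move=> q /=; rewrite in_itv /= => sqt; have qT := itv_horizon s0 tT sqt.
  rewrite -(EXD _ _ _ _ q C'0 K'0 qT mGf mGg bGf bGg).
  congr (EX A _ q); apply/funext => x; exact: (genD (C := C) (K := K) (k := k)).
rewrite E (df A s t s0 st tT FsA) (dg A s t s0 st tT FsA).
by rewrite mulrDr addrACA.
Qed.

End Dynkin.

(** * From characters to entire functions of exponential growth *)

Section SeriesTools.
Context {R : realType}.
Implicit Types (u : nat -> Cx R) (z w : Cx R).

Definition trunc N u : nat -> Cx R := fun k => if (k < N)%N then u k else 0.

Lemma series_truncE N u z m : (N <= m)%N ->
  series (pow_term (trunc N u) z) m = series (pow_term u z) N.
Proof.
move=> Nm; rewrite /series /= (@big_cat_nat _ _ _ N)//= [X in _ + X]big_nat_cond.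
rewrite [X in _ + X]big1 ?addr0; last first.
  move=> i; rewrite andbT => /andP[Ni _].
  by rewrite /pow_term /trunc ltnNge Ni/= !mul0r.
rewrite big_nat_cond [RHS]big_nat_cond; apply: eq_bigr => i; rewrite andbT => /andP[_ iN].
by rewrite /pow_term /trunc iN.
Qed.

Lemma hser_trunc N u z : hser (trunc N u) z = series (pow_term u z) N.
Proof.
rewrite /hser; apply: cvg_lim => //.
apply: cvg_near_cst.
by exists N => // m /= Nm; exact: series_truncE.
Qed.

Lemma eseq_trunc N u : eseq u -> eseq (trunc N u).
Proof.
move=> eu q q0; apply: (@series_le_cvg _ _ (abs_term u q)); last exact: eu.
- by move=> n; exact: abs_term_ge0.
- by move=> n; exact: abs_term_ge0.
- move=> n; rewrite /abs_term /trunc; case: ifP => // _.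
  by rewrite absC0 !mul0r; exact: abs_term_ge0.
Qed.

Lemma shiftc_trunc N u : shiftc (trunc N.+1 u) = trunc N (shiftc u).
Proof. by []. Qed.

Lemma cvg_hser_trunc j u z : eseq u -> hser (trunc (n + j) u) z @[n --> \oo] --> hser u z.
Proof.
move=> eu; have -> : (fun n => hser (trunc (n + j) u) z) =
    (fun n => series (pow_term u z) (n + j)%N).
  by apply/funext => n; rewrite hser_trunc.
by have := @cvg_hser _ u z eu; rewrite -(cvg_shiftn j).
Qed.

Lemma absC_hser_trunc_le N u z q : eseq u -> absC z <= q -> absC (hser (trunc N u) z) <= majorant u q.
Proof. by move=> eu zq; rewrite hser_trunc; exact: absC_partial_le. Qed.

Lemma hserZ (c : Cx R) u z : eseq u -> hser (fun k => c * u k) z = c * hser u z.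
Proof.
move=> eu; apply: cvg_lim => //.
have -> : series (pow_term (fun k => c * u k) z) = (fun n => c * series (pow_term u z) n).
  apply/funext => n; rewrite /series /= mulr_sumr; apply: eq_bigr => i _.
  by rewrite /pow_term -!mulrA.
by apply: cvgM; [exact: cvg_cst|exact: cvg_hser].
Qed.

Lemma hser0 u : hser u 0 = u 0%N.
Proof.
rewrite /hser; apply: cvg_lim => //.
apply: cvg_near_cst.
exists 1%N => // m /= m1; rewrite /series /= big_ltn// big_nat_cond big1 ?addr0.
  by rewrite /pow_term expr0 mulr1 fact0 divr1.
by move=> i; rewrite andbT => /andP[i1 _]; rewrite /pow_term expr0n gtn_eqF//= mulr0 mul0r.
Qed.

Definition powseq z : nat -> Cx R := fun k => z ^+ k.

Lemma eseq_powseq z : eseq (powseq z).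
Proof.
move=> q q0; have -> : abs_term (powseq z) q = exp_coeff (absC z * q).
  by apply/funext => n; rewrite /abs_term /powseq absCX /exp_coeff /= exprMn.
exact: is_cvg_series_exp_coeff.
Qed.

Lemma shiftc_powseq z : shiftc (powseq z) = (fun k => z * powseq z k).
Proof. by apply/funext => k; rewrite /shiftc /powseq exprS. Qed.

(** The series at [t w] times [exp (- t z w)] has derivative 0 in [t], hence equals 1 at [t = 1] as
    at [t = 0]. *)
Lemma hser_powseq z w : hser (powseq z) w = expC (z * w).
Proof.
pose K (t : R) := hser (powseq z) (ofR t * w) * expC (ofR (t - 0) * (- (z * w))).
have dlin t : rdiff (fun t => ofR t * w) t w.
  by have := rdiff_lin 0 w t; under [X in rdiff X _ _ -> _]eq_fun do rewrite add0r.
have dK t : rdiff K t ((fun=> 0) t).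
  have d1 := rdiff_comp (cdiff_hser (ofR t * w) (@eseq_powseq z)) (dlin t).
  have := rdiffM d1 (rdiff_expC (- (z * w)) 0 t); congr rdiff.
  rewrite shiftc_powseq hserZ; last exact: eseq_powseq.
  rewrite /=; ring.
have ck : continuous ((fun=> 0) : R -> Cx R) by move=> t; exact: cvg_cst.
have dK' (x : R) : 0 <= x <= 1 -> rdiff K x ((fun=> 0) x) by [].
have := @cFTC2 _ K _ 0 1 ler01 ck dK'.
have := @cintegral0 R _ (measurableTypeR R) leb `[0, 1]%classic (measurable_itv _).
rewrite /cst => -> /eqP; rewrite eq_sym subr_eq0 => /eqP.
have -> : K 1 = hser (powseq z) w * expC (- (z * w)) by rewrite /K subr0 ofR1 !mul1r.
have -> : K 0 = 1.
  by rewrite /K subr0 ofR0 !mul0r expC0 mulr1 hser0 /powseq expr0.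
move=> h; rewrite -[LHS]mulr1 -expC0 -(addNr (z * w)) expCD mulrA h mul1r.
by [].
Qed.

End SeriesTools.

(** * The bounded substitution [m sin (x / m)] *)

Section SineScaling.
Context {R : realType}.
Variable n : nat.
Let m : R := n.+1%:R.
Let m0 : 0 < m. Proof. by rewrite ltr0n. Qed.
Let m1 : 1 <= m. Proof. by rewrite ler1n. Qed.

Definition sn (x : R) : R := m * sin (m^-1 * x).
Definition csn (x : R) : R := cos (m^-1 * x).
Definition ssn (x : R) : R := - (m^-1 * sin (m^-1 * x)).

Let dm (x : R) : is_derive x 1 (fun x : R => m^-1 * x) m^-1.
Proof.
apply/is_derive_epsP => e e0; exists 1 => // h _.
by rewrite (_ : _ - _ = 0); [rewrite normr0 mulr_ge0// ltW|ring].
Qed.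

Lemma is_derive_sn (x : R) : is_derive x 1 sn (csn x).
Proof.
apply: (is_derive_eq (is_deriveZ m (is_derive1_comp (is_derive_sin (m^-1 * x)) (dm x)))).
by rewrite /GRing.scale /= mulrCA divff ?mulr1// gt_eqF.
Qed.

Lemma is_derive_csn (x : R) : is_derive x 1 csn (ssn x).
Proof.
apply: (is_derive_eq (is_derive1_comp (is_derive_cos (m^-1 * x)) (dm x))).
by rewrite /ssn mulNr mulrC.
Qed.

Let continuous_of_derive (f g : R -> R) : (forall x : R, is_derive x 1 f (g x)) -> continuous f.
Proof.
by move=> df x; have [/derivable1_diffP/differentiable_continuous H _] := df x; exact: H.
Qed.

Lemma twice_diff_sn : twice_diff (ofR \o sn) (ofR \o csn) (ofR \o ssn).
Proof.
split.
- by move=> t; apply: rdiff_ofR; exact: is_derive_sn.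
- by move=> t; apply: rdiff_ofR; exact: is_derive_csn.
- move=> t; apply: continuous_comp; last exact: continuous_ofR.
  apply: cvgN; apply: cvgM; first exact: cvg_cst.
  have dsin (x : R) : is_derive x 1 (fun x : R => sin (m^-1 * x)) (cos (m^-1 * x) * m^-1).
    exact: (is_derive1_comp (is_derive_sin (m^-1 * x)) (dm x)).
  exact: (continuous_of_derive dsin).
Qed.

Lemma csn_le1 (x : R) : `|csn x| <= 1. Proof. exact: cos_max. Qed.

Lemma ssn_le (x : R) : `|ssn x| <= m^-1.
Proof.
rewrite /ssn normrN normrM ger0_norm; last by rewrite invr_ge0 ltW.
rewrite -[X in _ <= X]mulr1; apply: ler_wpM2l; last exact: sin_max.
by rewrite invr_ge0 ltW.
Qed.

Lemma ssn_le1 (x : R) : `|ssn x| <= 1.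
Proof. by apply: le_trans (ssn_le x) _; rewrite invf_le1. Qed.

Lemma sn_lip (x t : R) : `|sn t - sn x| <= `|t - x|.
Proof.
have [d1 d2 _] := twice_diff_sn.
have cc : continuous (ofR \o csn : R -> Cx R) by apply: rdiff_continuous => y; eexists; exact: d2.
have h (y : R) : `|y - x| <= `|t - x| -> absC ((ofR \o csn) y) <= 1.
  by move=> _; rewrite [X in X <= _]absC_ofR; exact: csn_le1.
have := taylor1 d1 cc h; rewrite mul1r addrCA subrr addr0.
by rewrite (_ : _ - _ = ofR (sn t - sn x)) ?absC_ofR// rmorphB.
Qed.

Lemma sn0 : sn 0 = 0. Proof. by rewrite /sn mulr0 sin0 mulr0. Qed.

Lemma sn_le (x : R) : `|sn x| <= `|x|.
Proof. by have := sn_lip 0 x; rewrite sn0 !subr0. Qed.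

Lemma sn_le_m (x : R) : `|sn x| <= m.
Proof.
rewrite normrM (ger0_norm (ltW m0)) -[X in _ <= X]mulr1; apply: ler_wpM2l; last exact: sin_max.
exact: ltW.
Qed.

Lemma sn_approx (x : R) : `|sn x - x| <= m^-1 * x ^+ 2.
Proof.
have h (y : R) : `|y - 0| <= `|x| -> absC ((ofR \o ssn) y) <= m^-1.
  by move=> _; rewrite [X in X <= _]absC_ofR; exact: ssn_le.
have := taylor2 twice_diff_sn h; rewrite add0r.
rewrite (_ : _ - _ = ofR (sn x - x)) ?absC_ofR//.
have -> : (ofR \o sn) 0 = 0 :> Cx R by exact: (congr1 ofR sn0).
have -> : (ofR \o csn) 0 = 1 :> Cx R.
  by apply: (congr1 ofR (_ : csn 0 = 1)); rewrite /csn mulr0 cos0.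
by rewrite subr0 mul1r rmorphB.
Qed.

Implicit Types u : nat -> Cx R.

Definition sc0 u (x : R) : Cx R := hser u (ofR (sn x)).
Definition sc1 u (x : R) : Cx R := hser (shiftc u) (ofR (sn x)) * ofR (csn x).
Definition sc2 u (x : R) : Cx R :=
  sc0 (shiftc u) x * ofR (ssn x) + sc1 (shiftc u) x * ofR (csn x).

Lemma rdiff_sc0 u x : eseq u -> rdiff (sc0 u) x (sc1 u x).
Proof.
move=> eu; apply: (rdiff_comp (g := hser u) (K := ofR \o sn)); first exact: cdiff_hser.
by have [H _ _] := twice_diff_sn; exact: H.
Qed.

Lemma rdiff_sc1 u x : eseq u -> rdiff (sc1 u) x (sc2 u x).
Proof.
move=> eu; have [_ H _] := twice_diff_sn.
exact: (rdiffM (rdiff_sc0 x (eseq_shift eu)) (H x)).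
Qed.

Lemma twice_diff_sc u : eseq u -> twice_diff (sc0 u) (sc1 u) (sc2 u).
Proof.
move=> eu; have e1 := eseq_shift eu; have [d1 d2 d3] := twice_diff_sn.
have c0 v : eseq v -> continuous (sc0 v).
  by move=> ev; apply: rdiff_continuous => x; exists (sc1 v x); exact: rdiff_sc0.
have c1 v : eseq v -> continuous (sc1 v).
  by move=> ev; apply: rdiff_continuous => x; exists (sc2 v x); exact: rdiff_sc1.
have cc : continuous (ofR \o csn : R -> Cx R) by apply: rdiff_continuous => y; eexists; exact: d2.
split=> [x|x|x]; [exact: rdiff_sc0|exact: rdiff_sc1|].
apply: cvgD; apply: cvgM; [exact: c0|exact: d3|exact: c1|exact: cc].
Qed.

(** Only values on [[-m, m]], which contains the range of [sn], are involved, and [|sn x| <= |x|]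
    preserves the rate. The factor 2 accounts for the two terms of the second derivative. *)
Lemma exp_bounded_sc u (k C : R) : 0 <= k -> 0 <= C ->
  (forall x : R, `|x| <= m -> [/\ absC (hser u (ofR x)) <= C * expR (k * `|x|),
     absC (hser (shiftc u) (ofR x)) <= C * expR (k * `|x|) &
     absC (hser (shiftc (shiftc u)) (ofR x)) <= C * expR (k * `|x|)]) ->
  exp_bounded k (2 * C) (sc0 u) (sc1 u) (sc2 u).
Proof.
move=> k0 C0 H x.
have E : C * expR (k * `|sn x|) <= C * expR (k * `|x|).
  by rewrite ler_wpM2l// ler_expR ler_wpM2l// sn_le.
have [h0 h1 h2] := H _ (sn_le_m x).
have p0 : 0 <= C * expR (k * `|x|) by rewrite mulr_ge0// expR_ge0.
have pr (z : Cx R) (y : R) : absC z <= C * expR (k * `|sn x|) -> `|y| <= 1 ->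
    absC (z * ofR y) <= C * expR (k * `|x|).
  move=> hz hy; rewrite absCM absC_ofR; apply: le_trans E; apply: le_trans hz.
  by rewrite -[X in _ <= X]mulr1; apply: ler_wpM2l => //; exact: absC_ge0.
have q0 := pr _ _ h1 (csn_le1 x).
have q1 := pr _ _ h1 (ssn_le1 x).
have q2 : absC (sc1 (shiftc u) x * ofR (csn x)) <= C * expR (k * `|x|).
  apply: le_trans (pr _ _ h2 (csn_le1 x)); rewrite absCM absC_ofR.
  by rewrite -[X in _ <= X]mulr1; apply: ler_wpM2l; [exact: absC_ge0|exact: csn_le1].
rewrite -mulrA; split.
- by rewrite /sc0; lra.
- by rewrite /sc1; lra.
- by rewrite /sc2; apply: le_trans (ler_absCD _ _) _; rewrite /sc0; lra.
Qed.

End SineScaling.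

Section SineLimit.
Context {R : realType}.
Implicit Types u : nat -> Cx R.

Lemma cvg_invS : (n.+1%:R^-1 : R) @[n --> \oo] --> (0 : R).
Proof. exact: cvg_harmonic. Qed.

Lemma cvg_sn (x : R) : sn n x @[n --> \oo] --> x.
Proof.
apply/cvgrPdistC_le => e e0.
have c : n.+1%:R^-1 * x ^+ 2 @[n --> \oo] --> (0 : R).
  by rewrite -[X in _ --> X](mul0r (x ^+ 2)); apply: cvgM; [exact: cvg_invS|exact: cvg_cst].
near=> n; apply: le_trans (sn_approx n x) _; near: n.
exact: (cvgr_le _ c _ e0).
Unshelve. all: by end_near. Qed.

Lemma cvg_csn (x : R) : csn n x @[n --> \oo] --> (1 : R).
Proof.
rewrite -[X in _ --> X]cos0; apply: continuous_cvg; first exact: continuous_cos.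
by rewrite -[X in _ --> X](mul0r x); apply: cvgM; [exact: cvg_invS|exact: cvg_cst].
Qed.

Lemma cvg_ssn (x : R) : ssn n x @[n --> \oo] --> (0 : R).
Proof.
apply/cvgrPdistC_le => e e0; near=> n; rewrite subr0.
apply: le_trans (ssn_le n x) _; near: n.
exact: (cvgr_le _ cvg_invS _ e0).
Unshelve. all: by end_near. Qed.

Lemma cvg_ofR (f : nat -> R) (l : R) : f @ \oo --> l -> ofR (f n) @[n --> \oo] --> (ofR l : Cx R).
Proof. by move=> fl; apply: continuous_cvg => //; exact: continuous_ofR. Qed.

Lemma cvg_sc0 u (x : R) : eseq u -> sc0 n u x @[n --> \oo] --> hser u (ofR x).
Proof.
move=> eu; apply: (@continuous_cvg _ _ _ \oo _ (fun n => ofR (sn n x)) (hser u) (ofR x)).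
  by apply: cdiff_continuous; exact: cdiff_hser.
exact: cvg_ofR (@cvg_sn x).
Qed.

Lemma cvg_sc1 u (x : R) : eseq u -> sc1 n u x @[n --> \oo] --> hser (shiftc u) (ofR x).
Proof.
move=> eu; rewrite -[X in _ --> X]mulr1 -ofR1; apply: cvgM.
  exact: (cvg_sc0 (eseq_shift eu)).
exact: cvg_ofR (@cvg_csn x).
Qed.

Lemma cvg_sc2 u (x : R) : eseq u -> sc2 n u x @[n --> \oo] --> hser (shiftc (shiftc u)) (ofR x).
Proof.
move=> eu; rewrite -[X in _ --> X]add0r; apply: cvgD.
  rewrite -(mulr0 (hser (shiftc u) (ofR x))) -ofR0; apply: cvgM.
    exact: (cvg_sc0 (eseq_shift eu)).
  exact: cvg_ofR (@cvg_ssn x).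
rewrite -[X in _ --> X]mulr1 -ofR1; apply: cvgM.
  exact: (cvg_sc1 (eseq_shift eu)).
exact: cvg_ofR (@cvg_csn x).
Qed.

Definition re0 u (x : R) : Cx R := hser u (ofR x).

Lemma rdiff_re0 u (x : R) : eseq u -> rdiff (re0 u) x (re0 (shiftc u) x).
Proof.
move=> eu; have := rdiff_comp (K := ofR) (cdiff_hser (ofR x) eu).
have d : rdiff (ofR : R -> Cx R) x 1.
  have := rdiff_lin 0 1 x; under [X in rdiff X _ _ -> _]eq_fun do rewrite add0r mulr1.
  by [].
by move=> /(_ _ d); rewrite mulr1.
Qed.

Lemma continuous_re0 u : eseq u -> continuous (re0 u).
Proof. by move=> eu; apply: rdiff_continuous => x; exists (re0 (shiftc u) x); exact: rdiff_re0. Qed.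

Lemma twice_diff_re u : eseq u -> twice_diff (re0 u) (re0 (shiftc u)) (re0 (shiftc (shiftc u))).
Proof.
move=> eu; have e1 := eseq_shift eu; split=> [x|x|]; [exact: rdiff_re0|exact: rdiff_re0|].
by apply: continuous_re0; exact: eseq_shift.
Qed.

End SineLimit.

(** * Trigonometric polynomials *)

Section TrigPolynomials.
Context {R : realType}.
Implicit Types f g : R -> Cx R.

(** One character is added at a time, the shape in which [dynkinD] carries Dynkin's formula through
    an induction. *)
Inductive trigpoly : (R -> Cx R) -> Prop :=
| trigpoly_chr u : trigpoly (chr u)
| trigpoly_add f (c : Cx R) u : trigpoly f -> trigpoly (fun x => f x + c * chr u x).

Lemma trigpoly_eq f g : trigpoly f -> f = g -> trigpoly g.
Proof. by move=> tf <-. Qed.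

Lemma chr0 x : chr 0 x = 1 :> Cx R. Proof. by rewrite /chr mul0r cis0. Qed.

Lemma trigpoly0 : trigpoly (fun=> 0).
Proof.
apply: (trigpoly_eq (trigpoly_add (-1) 0 (trigpoly_chr 0))); apply/funext => x.
by rewrite chr0; ring.
Qed.

Lemma trigpolyZ_chr (c : Cx R) u : trigpoly (fun x => c * chr u x).
Proof.
by apply: (trigpoly_eq (trigpoly_add c u trigpoly0)); apply/funext => x; rewrite add0r.
Qed.

Lemma trigpolyD f g : trigpoly f -> trigpoly g -> trigpoly (fun x => f x + g x).
Proof.
move=> tf; elim=> [u|{}g c u _ IH].
  by apply: (trigpoly_eq (trigpoly_add 1 u tf)); apply/funext => x; rewrite mul1r.
by apply: (trigpoly_eq (trigpoly_add c u IH)); apply/funext => x; rewrite addrA.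
Qed.

Lemma trigpolyM_chr f (c : Cx R) v : trigpoly f -> trigpoly (fun x => f x * (c * chr v x)).
Proof.
have E u x : chr u x * chr v x = chr (u + v) x :> Cx R by rewrite /chr mulrDl cisD.
elim=> [u|{}f e u _ IH].
  apply: (trigpoly_eq (trigpolyZ_chr c (u + v))); apply/funext => x.
  by rewrite -E; ring.
apply: (trigpoly_eq (trigpolyD IH (trigpolyZ_chr (e * c) (u + v)))); apply/funext => x.
by rewrite -E; ring.
Qed.

Lemma trigpolyM f g : trigpoly f -> trigpoly g -> trigpoly (fun x => f x * g x).
Proof.
move=> tf; elim=> [u|{}g c u _ IH].
  apply: (trigpoly_eq (trigpolyM_chr 1 u tf)); apply/funext => x.
  by rewrite mul1r.
apply: (trigpoly_eq (trigpolyD IH (trigpolyM_chr c u tf))); apply/funext => x.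
by rewrite mulrDr.
Qed.

Lemma trigpoly_cst (c : Cx R) : trigpoly (fun=> c).
Proof.
by apply: (trigpoly_eq (trigpolyZ_chr c 0)); apply/funext => x; rewrite chr0 mulr1.
Qed.

Lemma trigpolyX f k : trigpoly f -> trigpoly (fun x => f x ^+ k).
Proof.
move=> tf; elim: k => [|k IH].
  by apply: (trigpoly_eq (trigpoly_cst 1)); apply/funext => x; rewrite expr0.
by apply: (trigpoly_eq (trigpolyM tf IH)); apply/funext => x; rewrite exprS.
Qed.

Lemma trigpoly_sum (h : nat -> R -> Cx R) N : (forall i, trigpoly (h i)) ->
  trigpoly (fun x => \sum_(0 <= i < N) h i x).
Proof.
move=> th; elim: N => [|N IH].
  by apply: (trigpoly_eq trigpoly0); apply/funext => x; rewrite big_geq.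
by apply: (trigpoly_eq (trigpolyD IH (th N))); apply/funext => x; rewrite big_nat_recr.
Qed.

Lemma trigpoly_sn n : trigpoly (ofR \o sn n).
Proof.
pose m : Cx R := n.+1%:R.
(* Euler's formula: [m sin y = - (m / 2) i (exp (i y) - exp (- i y))]. *)
apply: (trigpoly_eq (trigpolyD (trigpolyZ_chr (- (m / 2) * imag) n.+1%:R^-1)
  (trigpolyZ_chr (m / 2 * imag) (- n.+1%:R^-1)))); apply/funext => x.
set y := n.+1%:R^-1 * x.
have D : cis y - cis (- y) = 2 * imag * ofR (sin y) :> Cx R.
  have E2 : (2 : Cx R) = ofR 2 by rewrite rmorph_nat.
  rewrite E2; apply: Cx_ext; rewrite ?reCD ?imCD ?reCN ?imCN ?reCM ?imCM /= ?cosN ?sinN.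
    ring.
  ring.
have -> : chr (- n.+1%:R^-1) x = cis (- y) :> Cx R by rewrite /chr mulNr.
rewrite /chr -/y (_ : _ + _ = - (m / 2) * imag * (cis y - cis (- y))); last by ring.
rewrite D (_ : _ * _ = - (imag * imag) * (2 / 2) * (m * ofR (sin y))); last by ring.
rewrite imag2 divff ?pnatr_eq0// opprK !mul1r /= /sn -/y rmorphM rmorph_nat.
by [].
Qed.

Lemma trigpoly_sc0 n N (u : nat -> Cx R) : trigpoly (sc0 n (trunc N u)).
Proof.
apply: (trigpoly_eq (@trigpoly_sum (fun i x => u i / (i`!)%:R * ((ofR \o sn n) x) ^+ i) N _)).
  by move=> i; apply: trigpolyM; [exact: trigpoly_cst|apply: trigpolyX; exact: trigpoly_sn].
apply/funext => x; rewrite /sc0 hser_trunc /series /=; apply: eq_bigr => i _.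
by rewrite /pow_term mulrAC.
Qed.

End TrigPolynomials.

(** * Dynkin's formula for entire functions, and exponential moments *)

Section ExponentialMoments.
Context {R : realType} {d : measure_display} {Om : measurableType d}.
Variables (P : probability Om R) (T : R) (Ft : R -> set (set Om)) (X : R -> Om -> R).
Variables (b a x0 : R) (F : {measure set (measurableTypeR R) -> \bar R}).
Hypotheses (T_gt0 : 0 < T) (filtrationF : filtration T Ft).
Hypotheses (levyF : levy_measure F) (levyX : levy_process P T Ft X b a F).
Hypothesis X0 : {ae P, forall w, X 0 w = x0}.
Variable r : R.
Hypotheses (r1 : 1 <= r) (Fr : F [set y | r < `|y|] = 0%E).

Let dynk (f f1 f2 : R -> Cx R) := dynkin_formula P T Ft X b a F f f1 f2.
Let moment0 := @exp_moment0 _ _ _ P T X.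

Lemma exp_boundedD (k C K : R) (f f1 f2 g g1 g2 : R -> Cx R) (c : Cx R) :
  exp_bounded k C f f1 f2 -> exp_bounded k K g g1 g2 ->
  exp_bounded k (C + absC c * K) (fun x => f x + c * g x) (fun x => f1 x + c * g1 x)
    (fun x => f2 x + c * g2 x).
Proof.
move=> fb gb x; have [h0 h1 h2] := fb x; have [l0 l1 l2] := gb x.
by split; rewrite mulrDl -mulrA; apply: (le_trans (ler_absCD _ _)); apply: lerD => //;
  rewrite absCM; apply: ler_wpM2l => //; exact: absC_ge0.
Qed.

Lemma twice_diffD (f f1 f2 g g1 g2 : R -> Cx R) (c : Cx R) :
  twice_diff f f1 f2 -> twice_diff g g1 g2 ->
  twice_diff (fun x => f x + c * g x) (fun x => f1 x + c * g1 x) (fun x => f2 x + c * g2 x).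
Proof.
move=> [d0 d1 d2] [e0 e1 e2]; split=> t.
- by apply: rdiffD => //; exact: rdiffZ.
- by apply: rdiffD => //; exact: rdiffZ.
- by apply: cvgD; [exact: d2|apply: cvgM; [exact: cvg_cst|exact: e2]].
Qed.

Lemma trigpoly_dynkin f : trigpoly f -> exists f1 f2 (C : R),
  [/\ 0 <= C, twice_diff f f1 f2, exp_bounded 0 C f f1 f2 & dynk f f1 f2].
Proof.
have C0 (u : R) : 0 <= 1 + `|u| + `|u| ^+ 2 by rewrite !addr_ge0// sqr_ge0.
elim=> [u|{}f c u _ [f1 [f2 [C [Cp tf fb df]]]]].
  exists (chr1 u), (chr2 u), (1 + `|u| + `|u| ^+ 2); split.
  - exact: C0.
  - exact: twice_diff_chr.
  - exact: exp_bounded_chr.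
  - exact: (dynkin_chr T_gt0 filtrationF levyF levyX r1 Fr u).
exists (fun x => f1 x + c * chr1 u x), (fun x => f2 x + c * chr2 u x),
  (C + absC c * (1 + `|u| + `|u| ^+ 2)); split.
- by rewrite addr_ge0// mulr_ge0// absC_ge0.
- exact: (twice_diffD c tf (twice_diff_chr u)).
- exact: (exp_boundedD c fb (exp_bounded_chr u)).
- have du := dynkin_chr T_gt0 filtrationF levyF levyX r1 Fr u.
  exact (dynkinD filtrationF levyF levyX r1 Fr c (lexx 0) Cp (C0 u) moment0 tf
    (twice_diff_chr u) fb (exp_bounded_chr u) df du).
Qed.

(** The induction on [trigpoly] produces derivatives of its own; uniqueness of derivatives
    identifies them with those at hand. *)
Lemma trigpoly_dynkin_diff f f1 f2 : trigpoly f -> twice_diff f f1 f2 -> dynk f f1 f2.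
Proof.
move=> /trigpoly_dynkin[g1 [g2 [C [_ [d0 d1 _] _ dg]]]] [e0 e1 _].
have E1 : g1 = f1 by apply/funext => x; exact: rdiff_unique (d0 x) (e0 x).
have E2 : g2 = f2.
  by apply/funext => x; rewrite E1 in d1; exact: rdiff_unique (d1 x) (e1 x).
by rewrite -E1 -E2.
Qed.

Lemma dynkin_sc n u : eseq u -> dynk (sc0 n u) (sc1 n u) (sc2 n u).
Proof.
move=> eu; pose m : R := n.+1%:R.
have e1 := eseq_shift eu; have e2 := eseq_shift e1.
have m0 : 0 <= m by rewrite ler0n.
(* On the disc of radius [m] the majorants dominate the function, its two derivatives and all
   truncations of their series. *)
pose C := majorant u m + majorant (shiftc u) m + majorant (shiftc (shiftc u)) m.
have M0 := majorant_ge0 eu m0; have M1 := majorant_ge0 e1 m0; have M2 := majorant_ge0 e2 m0.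
have C0 : 0 <= C by rewrite !addr_ge0.
have bt v : eseq v -> majorant v m <= C -> forall N (x : R), `|x| <= m ->
    absC (hser (trunc N v) (ofR x)) <= C * expR (0 * `|x|).
  move=> ev vC N x xm; rewrite mul0r expR0 mulr1; apply: le_trans vC.
  by apply: absC_hser_trunc_le; rewrite // absC_ofR.
have C20 : 0 <= 2 * C by rewrite mulr_ge0.
(* Everything is bounded for fixed [n], so rate 0 and the trivial moment suffice. Cutting at [N + 2]
   leaves truncations at [N + 1] and [N] after one and two shifts. *)
refine (dynkin_cvg filtrationF levyF levyX r1 Fr (lexx 0) C20 moment0
  (g := fun N => sc0 n (trunc (N + 2) u)) (g1 := fun N => sc1 n (trunc (N + 2) u))
  (g2 := fun N => sc2 n (trunc (N + 2) u)) _ _ _ _ _ _ _).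
- by move=> N; apply: twice_diff_sc; exact: eseq_trunc.
- move=> N; apply: exp_bounded_sc => // x xm; rewrite !addnS addn0 !shiftc_trunc; split.
  + by apply: bt; rewrite // /C -addrA lerDl addr_ge0.
  + by apply: bt; rewrite // /C addrAC lerDr addr_ge0.
  + by apply: bt; rewrite // /C lerDr addr_ge0.
- exact: twice_diff_sc.
- by move=> x; exact: cvg_hser_trunc.
- move=> x; apply: cvgM; last exact: cvg_cst.
  have -> : (fun N => hser (shiftc (trunc (N + 2) u)) (ofR (sn n x))) =
    (fun N => hser (trunc (N + 1) (shiftc u)) (ofR (sn n x))).
    by apply/funext => N; rewrite !addnS addn0 shiftc_trunc.
  exact: cvg_hser_trunc.
- move=> x; have c1 : hser (shiftc (trunc (N + 2) u)) (ofR (sn n x)) @[N --> \oo] -->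
      hser (shiftc u) (ofR (sn n x)).
    have -> : (fun N => hser (shiftc (trunc (N + 2) u)) (ofR (sn n x))) =
      (fun N => hser (trunc (N + 1) (shiftc u)) (ofR (sn n x))).
      by apply/funext => N; rewrite !addnS addn0 shiftc_trunc.
    exact: cvg_hser_trunc.
  have c2 : hser (shiftc (shiftc (trunc (N + 2) u))) (ofR (sn n x)) @[N --> \oo] -->
      hser (shiftc (shiftc u)) (ofR (sn n x)).
    have -> : (fun N => hser (shiftc (shiftc (trunc (N + 2) u))) (ofR (sn n x))) =
      (fun N => hser (trunc (N + 0) (shiftc (shiftc u))) (ofR (sn n x))).
      by apply/funext => N; rewrite !addnS addn0 !shiftc_trunc.
    exact: cvg_hser_trunc.
  apply: cvgD; first by apply: cvgM; [exact: c1|exact: cvg_cst].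
  by apply: cvgM; [apply: cvgM; [exact: c2|exact: cvg_cst]|exact: cvg_cst].
- by move=> N; apply: trigpoly_dynkin_diff; [exact: trigpoly_sc0|apply: twice_diff_sc; exact: eseq_trunc].
Qed.

Lemma dynkin_exp_bounded u (k C M : R) : eseq u -> 0 <= k -> 0 <= C ->
  exp_moment P T X k M ->
  exp_bounded k C (re0 u) (re0 (shiftc u)) (re0 (shiftc (shiftc u))) ->
  dynk (re0 u) (re0 (shiftc u)) (re0 (shiftc (shiftc u))).
Proof.
move=> eu k0 C0 kM ub; have C20 : 0 <= 2 * C by rewrite mulr_ge0.
refine (dynkin_cvg filtrationF levyF levyX r1 Fr k0 C20 kM
  (g := fun n => sc0 n u) (g1 := fun n => sc1 n u) (g2 := fun n => sc2 n u) _ _ _ _ _ _ _).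
- by move=> n; exact: twice_diff_sc.
- by move=> n; apply: exp_bounded_sc => // x _; exact: ub.
- exact: twice_diff_re.
- by move=> x; exact: cvg_sc0.
- by move=> x; exact: cvg_sc1.
- by move=> x; exact: cvg_sc2.
- by move=> n; exact: dynkin_sc.
Qed.

Section OneSided.
Variable k : R.
Let u := powseq (ofR k : Cx R).
Let eu : eseq u := @eseq_powseq R (ofR k).
(** As [exp (k |x|)] is not differentiable at 0, a one-sided exponential is treated, with [k] of
    either sign. *)
Let E n (x : R) : R := expR (k * sn n x).
(** The second derivative of [E n] is [(k ^ 2 * csn ^ 2 + k * ssn) * E n], where [csn] and [ssn]
    have modulus at most 1. *)
Let C2 : R := k ^+ 2 + `|k|.
(** All bounds are relative to [E n x]: since [sn n] is 1-Lipschitz, [E n] grows by at most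
    [exp (|k| r)] within distance [r]. The constant is independent of [n], which makes the moment
    bound survive the limit. *)
Let K : R := `|b| * `|k| + (`|a / 2| + levy_var F r) * (C2 * expR (`|k| * r)).

Let C20 : 0 <= C2. Proof. by rewrite addr_ge0// sqr_ge0. Qed.

Let K0 : 0 <= K.
Proof.
rewrite addr_ge0// ?mulr_ge0// ?expR_ge0// addr_ge0//; exact: levy_var_ge0.
Qed.

Let E_ge0 n x : 0 <= E n x. Proof. exact: expR_ge0. Qed.

Let sc0E n x : sc0 n u x = ofR (E n x).
Proof.
rewrite /sc0 hser_powseq -rmorphM /expC.
have -> : imC (ofR (k * sn n x) : Cx R) = 0 by [].
by rewrite cis0 mulr1.
Qed.

Let sc0_shift n x : sc0 n (shiftc u) x = ofR k * sc0 n u x.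
Proof. by rewrite /sc0 shiftc_powseq hserZ. Qed.

Let sc1_le n x : absC (sc1 n u x) <= `|k| * E n x.
Proof.
rewrite /sc1 -/(sc0 n (shiftc u) x) sc0_shift sc0E !absCM !absC_ofR (ger0_norm (E_ge0 _ _)).
by rewrite ler_piMr ?csn_le1// mulr_ge0.
Qed.

Let sc2_le n x : absC (sc2 n u x) <= C2 * E n x.
Proof.
rewrite /sc2 sc0_shift sc0E /sc1 shiftc_powseq; set v := fun k => _.
have -> : hser (shiftc v) (ofR (sn n x)) = ofR k * ofR k * sc0 n u x.
  have -> : shiftc v = fun i => ofR k * ofR k * u i.
    by apply/funext => i; rewrite /shiftc /v /powseq exprS mulrA.
  by rewrite hserZ.
rewrite sc0E; apply: (le_trans (ler_absCD _ _)).
rewrite !absCM !absC_ofR (ger0_norm (E_ge0 _ _)) /C2.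
have p0 : 0 <= `|k| * E n x by rewrite mulr_ge0.
have p1 : 0 <= `|k| * `|k| * E n x by rewrite !mulr_ge0.
have h1 : `|k| * E n x * `|ssn n x| <= `|k| * E n x by rewrite ler_piMr ?ssn_le1.
have h2 : `|k| * `|k| * E n x * `|csn n x| <= `|k| * `|k| * E n x by rewrite ler_piMr ?csn_le1.
have h3 : `|k| * `|k| * E n x * `|csn n x| * `|csn n x| <= `|k| * `|k| * E n x.
  by apply: le_trans h2; rewrite ler_piMr ?csn_le1// mulr_ge0.
rewrite -(real_normK (num_real k)) expr2 mulrDl; lra.
Qed.

Let gen_sc_le n x : absC (gen b a F (sc0 n u) (sc1 n u) (sc2 n u) x) <= K * E n x.
Proof.
have h2 t : `|t - x| <= r -> absC (sc2 n u t) <= C2 * expR (`|k| * r) * E n x.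
  move=> tx; apply: (le_trans (sc2_le n t)); rewrite -mulrA; apply: ler_wpM2l => //.
  rewrite /E -expRD ler_expR -lerBlDr -mulrBr; apply: (le_trans (ler_norm _)).
  rewrite normrM; apply: ler_wpM2l => //; exact: le_trans (sn_lip n x t) tx.
apply: (le_trans (gen_le b a levyF r1 Fr (twice_diff_sc n eu) (sc1_le n x) h2)).
by rewrite /K le_eqVlt; apply/orP; left; apply/eqP; ring.
Qed.

Let E_le_cst n x : E n x <= expR (`|k| * n.+1%:R).
Proof.
rewrite /E ler_expR; apply: (le_trans (ler_norm _)); rewrite normrM.
by apply: ler_wpM2l => //; exact: sn_le_m.
Qed.

Let E_le n x : E n x <= expR (`|k| * `|x|).
Proof.
rewrite /E ler_expR; apply: (le_trans (ler_norm _)); rewrite normrM.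
by apply: ler_wpM2l => //; exact: sn_le.
Qed.

Let phi n q : R := Rintegral P setT (fun w => E n (X q w)).

Let E_meas n : @measurable_fun _ _ (measurableTypeR R) R setT (E n).
Proof.
have [d0 _ _] := twice_diff_sc n eu.
have /continuous_cmeasurable-/(_ setT)[m _] : continuous (sc0 n u).
  by apply: rdiff_continuous => x; eexists; exact: d0.
by apply: eq_measurable_fun m => x _; rewrite /= sc0E.
Qed.

Let E_int n (q : R) : 0 <= q <= T -> P.-integrable setT (EFin \o (fun w => E n (X q w))).
Proof.
move=> qT; apply: (@le_integrable _ _ _ P _ measurableT _ (cst (expR (`|k| * n.+1%:R))%:E)).
- apply/measurable_EFinP; apply: (measurableT_comp (E_meas n)).
  exact: (measurable_X filtrationF levyX).
- by move=> x _; rewrite /= lee_fin (ger0_norm (E_ge0 _ _)) (ger0_norm (expR_ge0 _)); exact: E_le_cst.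
- exact: finite_measure_integrable_cst.
Qed.

Let phi_ge0 n q : 0 <= phi n q.
Proof. by apply: Rintegral_ge0 => w _; exact: E_ge0. Qed.

Let PsetT : fine (P [set: Om]) = 1.
Proof. by have := probability_setT P; rewrite /= => ->. Qed.

Let phi_cst n (q c : R) : 0 <= q <= T -> (forall w, E n (X q w) <= c) -> phi n q <= c.
Proof.
move=> qT Ec; apply: (@le_trans _ _ (Rintegral P setT (cst c))).
  apply: le_Rintegral => //; [exact: E_int|exact: finite_measure_integrable_cst].
by rewrite /cst [X in X <= _]Rintegral_cst// [X in _ * X]PsetT mulr1.
Qed.

Let T00 : (0 : R) <= 0 <= T. Proof. by rewrite lexx ltW. Qed.

Let phi0_le n : phi n 0 <= expR (`|k| * `|x0|).
Proof.
have mX0 := measurable_X filtrationF levyX T00.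
have -> : phi n 0 = Rintegral P setT (cst (E n x0)).
  rewrite /phi /Rintegral; congr fine; apply: ae_eq_integral => //.
  - by case/integrableP: (E_int n T00).
  - exact: (measurable_cst (E n x0)%:E).
  - apply: (@filterS _ _ _ (fun w => X 0 w = x0)) => [w /= -> _//|]; exact: X0.
rewrite /cst Rintegral_cst// [X in _ * X]PsetT mulr1; exact: E_le.
Qed.

Let EX_phi n q : EX P X setT (sc0 n u) q = ofR (phi n q).
Proof.
apply: Cx_ext => /=.
  by apply: eq_Rintegral => w _; rewrite /= sc0E.
rewrite (@eq_Rintegral _ _ _ P setT (cst 0)).
  by rewrite /cst Rintegral_cst// mul0r.
by move=> w _; rewrite /= sc0E.
Qed.

Let phi_dynkin n (q : R) : 0 <= q <= T ->
  phi n q <= phi n 0 + absC (cintegral leb `[0, q]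
    (EX P X setT (gen b a F (sc0 n u) (sc1 n u) (sc2 n u)))).
Proof.
move=> /andP[q0 qT].
have FT : Ft 0 setT.
  by have [/(_ 0 T00)[h0 hD _] _ _] := filtrationF; rewrite -(setD0 setT); exact: hD.
have := dynkin_sc n eu (lexx 0) q0 qT FT; rewrite !EX_phi => h.
rewrite -[X in X <= _]ger0_norm// -[X in X <= _]absC_ofR h.
by apply: (le_trans (ler_absCD _ _)); rewrite absC_ofR ger0_norm.
Qed.

Let sc_bounded n : exists C : R, 0 <= C /\ exp_bounded 0 C (sc0 n u) (sc1 n u) (sc2 n u).
Proof.
exists ((1 + `|k| + C2) * expR (`|k| * n.+1%:R)); split.
  by rewrite mulr_ge0 ?expR_ge0// addr_ge0// addr_ge0.
move=> x; rewrite mul0r expR0 mulr1.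
have E1 := E_le_cst n x; have k0 := normr_ge0 k; have c0 := C20.
have h (p : R) : 0 <= p -> p <= 1 + `|k| + C2 ->
    p * E n x <= (1 + `|k| + C2) * expR (`|k| * n.+1%:R).
  by move=> p0 pC; apply: ler_pM.
split.
- by rewrite sc0E absC_ofR ger0_norm// -[X in X <= _]mul1r; apply: h => //; rewrite -addrA lerDl addr_ge0.
- by apply: (le_trans (sc1_le n x)); apply: h => //; lra.
- by apply: (le_trans (sc2_le n x)); apply: h => //; lra.
Qed.

Let G n := gen b a F (sc0 n u) (sc1 n u) (sc2 n u).

Let mG n : @cmeasurable R _ (measurableTypeR R) setT (G n).
Proof.
have [C [C0 sb]] := sc_bounded n.
exact: (gen_measurable b a levyF r1 Fr (lexx 0) C0 (twice_diff_sc n eu) sb).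
Qed.

Let EX_gen_le n (q : R) : 0 <= q <= T -> absC (EX P X setT (G n) q) <= K * phi n q.
Proof.
move=> qT; rewrite /phi -RintegralZl//; last exact: E_int.
apply: (absC_cintegral_le_bound measurableT).
- by apply: (cmeasurableT_comp (mG n)); exact: (measurable_X filtrationF levyX).
- by have := integrableZl measurableT K (E_int n qT); apply: eq_integrable.
- by move=> w _; exact: gen_sc_le.
Qed.

Let EXG_meas n (q : R) : 0 <= q -> q <= T ->
  @cmeasurable R _ (measurableTypeR R) `[0, q]%classic (EX P X setT (G n)).
Proof.
move=> q0 qT; have bG x : absC (G n x) <= K * expR (`|k| * n.+1%:R) * expR (0 * `|x|).
  by rewrite mul0r expR0 mulr1; apply: (le_trans (gen_sc_le n x)); apply: ler_wpM2l.
exact: (EX_cmeasurable filtrationF levyX measurableT (mG n) bG moment0 (lexx 0) q0 qT).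
Qed.

(* Gronwall, by comparing [phi n] with the supremum [B] of [phi n q * exp (- 2 K q)]. *)
Let phi_le n (q : R) : 0 <= q <= T -> phi n q <= 2 * expR (`|k| * `|x0|) * expR (2 * K * T).
Proof.
set m0 := expR (`|k| * `|x0|).
(* The supremum is finite because [sn n] is bounded, so that [phi n] is at most [exp (|k| (n + 1))].
   This finiteness known in advance is what the truncation provides. *)
pose A : set R := [set phi n p * expR (- (2 * K * p)) | p in [set p | 0 <= p <= T]].
have supA : has_sup A.
  split; first by exists (phi n 0 * expR (- (2 * K * 0))), 0.
  exists (expR (`|k| * n.+1%:R)) => _ [p pT <-].
  rewrite -[X in _ <= X]mulr1; apply: ler_pM => //.
    by apply: phi_cst => // w; exact: E_le_cst.
  by rewrite -expR0 ler_expR oppr_le0 !mulr_ge0//; case/andP: pT.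
pose B := sup A.
have phiB p : 0 <= p <= T -> phi n p <= B * expR (2 * K * p).
  move=> pT; rewrite -ler_pdivrMr ?expR_gt0// -expRN.
  by apply: sup_upper_bound => //; exists p.
have B0 : 0 <= B.
  have := phiB 0 T00; rewrite mulr0 expR0 mulr1; exact: le_trans.
(* Inserting [phi n <= B exp (2 K p)] into Dynkin's formula and integrating [K B exp (2 K p)] yields
   [B / 2]. The doubled rate is chosen for this half, which allows [B <= m0 + B / 2] to be solved
   for [B]. *)
have BP p : 0 <= p <= T -> phi n p <= (m0 + B / 2) * expR (2 * K * p).
  move=> pT; have /andP[p0 pT'] := pT.
  have dF (x : R) : is_derive x 1 (fun p : R => B / 2 * expR (2 * K * p)) (K * (B * expR (2 * K * x))).
    have dl : is_derive x 1 (fun p : R => 2 * K * p) (2 * K).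
      apply/is_derive_epsP => e e0; exists 1 => // h _.
      by rewrite (_ : _ - _ = 0); [rewrite normr0 mulr_ge0// ltW|ring].
    apply: (is_derive_eq (is_deriveZ (B / 2) (is_derive1_comp (is_derive_expR _) dl))).
    by rewrite /GRing.scale /=; field.
  have cg : continuous (fun p : R => K * (B * expR (2 * K * p))).
    move=> x; apply: cvgM; first exact: cvg_cst.
    apply: cvgM; first exact: cvg_cst.
    apply: continuous_comp; last exact: continuous_expR.
    by apply: cvgM; [exact: cvg_cst|exact: cvg_id].
  have I : absC (cintegral leb `[0, p] (EX P X setT (G n))) <=
      Rintegral leb `[0, p] (fun p : R => K * (B * expR (2 * K * p))).
    apply: (@absC_cintegral_le_bound R _ (measurableTypeR R) leb `[0, p]%classic (measurable_itv _)).
    - exact: EXG_meas.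
    - apply: continuous_compact_integrable; first exact: segment_compact.
      exact: continuous_subspaceT.
    - move=> x /=; rewrite in_itv /= => xp.
      have xT := itv_horizon (lexx 0) pT' xp.
      by apply: (le_trans (EX_gen_le n xT)); apply: ler_wpM2l => //; exact: phiB.
  have := @RFTC2 R _ _ 0 p p0 cg (fun x _ => dF x).
  rewrite mulr0 expR0 mulr1 => IE; rewrite IE in I.
  apply: (le_trans (phi_dynkin n pT)); rewrite -/(G n) mulrDl.
  have e1 : 1 <= expR (2 * K * p) by rewrite -expR0 ler_expR !mulr_ge0.
  have m0e : m0 <= m0 * expR (2 * K * p) by rewrite ler_peMr// expR_ge0.
  by have := phi0_le n; rewrite -/m0; lra.
have Bm : B <= 2 * m0.
  have : B <= m0 + B / 2.
    apply: ge_sup; first by exists (phi n 0 * expR (- (2 * K * 0))), 0 => //=; exact: T00.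
    by move=> _ [p pT <-]; rewrite expRN ler_pdivrMr ?expR_gt0//; exact: BP.
  by lra.
move=> qT; apply: (le_trans (phiB q qT)); apply: ler_pM => //.
by rewrite ler_expR; apply: ler_wpM2l; [rewrite mulr_ge0|case/andP: qT].
Qed.

Lemma exp_moment_one_sided (q : R) : 0 <= q <= T ->
  P.-integrable setT (EFin \o (fun w => expR (k * X q w))) /\
  Rintegral P setT (fun w => expR (k * X q w)) <= 2 * expR (`|k| * `|x0|) * expR (2 * K * T).
Proof.
move=> qT; set M := 2 * _ * _.
have mX := measurable_X filtrationF levyX qT.
have mE : measurable_fun setT (fun w => expR (k * X q w)).
  by apply: measurableT_comp => //; apply: measurable_funM.
have fat : (\int[P]_w (expR (k * X q w))%:E <= M%:E)%E.
  have mEn n : measurable_fun setT (fun w => (E n (X q w))%:E).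
    by case/integrableP: (E_int n qT).
  have En0 n w : setT w -> (0 <= (E n (X q w))%:E)%E by rewrite lee_fin.
  have := @fatou _ _ _ P setT measurableT _ mEn En0.
  have -> : (fun w => limn_einf (fun n => (E n (X q w))%:E)) = (fun w => (expR (k * X q w))%:E).
    apply/funext => w; apply: (cvg_limn_einf_sup _).1.
    apply: cvg_EFin; first exact: nearW.
    apply: continuous_cvg; first exact: continuous_expR.
    by apply: cvgM; [exact: cvg_cst|exact: cvg_sn].
  move=> h; apply: (le_trans h); rewrite limn_einf_lim; apply: lime_le.
    exact: is_cvg_einfs.
  apply: nearW => n; apply: (@le_trans _ _ (\int[P]_w (E n (X q w))%:E)%E).
    by apply: ereal_inf_lbound; exists n => //=.
  have fI : (\int[P]_w (E n (X q w))%:E)%E \is a fin_num.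
    by apply: integrable_fin_num => //; exact: E_int.
  by rewrite -(fineK fI) lee_fin; exact: phi_le.
have I0 : (0 <= \int[P]_w (expR (k * X q w))%:E)%E.
  by apply: integral_ge0 => w _; rewrite lee_fin expR_ge0.
have Ioo : (\int[P]_w (expR (k * X q w))%:E < +oo)%E by exact: le_lt_trans fat (ltry _).
split.
  apply/integrableP; split; first exact/measurable_EFinP.
  by under eq_integral do rewrite /= ger0_norm ?expR_ge0//.
by rewrite /Rintegral -lee_fin fineK// (ge0_fin_numE I0).
Qed.

End OneSided.

(** [exp (k |x|)] is at most the sum of the exponentials of [k x] and [- k x], both covered by the
    one-sided bound. *)
Lemma exp_moment_exists (k : R) : 0 <= k -> exists M : R, exp_moment P T X k M.
Proof.
move=> k0; eexists => q qT.
have [i1 M1] := exp_moment_one_sided k qT; have [i2 M2] := exp_moment_one_sided (- k) qT.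
have le w : expR (k * `|X q w|) <= expR (k * X q w) + expR (- k * X q w).
  have := expR_ge0 (k * X q w); have := expR_ge0 (- k * X q w).
  by rewrite mulNr; case: (ger0P (X q w)) => _; rewrite ?mulrN; lra.
have iD : P.-integrable setT (EFin \o (fun w => expR (k * X q w) + expR (- k * X q w))).
  by have := integrableD measurableT i1 i2; apply: eq_integrable.
have ik : P.-integrable setT (EFin \o (fun w => expR (k * `|X q w|))).
  apply: le_integrable iD => //.
    apply/measurable_EFinP; apply: measurableT_comp => //.
    apply: measurable_funM => //; apply: measurableT_comp => //.
    exact: (measurable_X filtrationF levyX qT).
  move=> w _; rewrite /= lee_fin (ger0_norm (expR_ge0 _)).
  exact: le_trans (le w) (ler_norm _).
split=> //; apply: (@le_trans _ _ (Rintegral P setT (fun w => expR (k * X q w) + expR (- k * X q w)))).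
  by apply: le_Rintegral.
rewrite RintegralD//; exact: (lerD M1 M2).
Qed.

End ExponentialMoments.

Lemma integral_itv_cst_lty {R : realType} (s t c : R) :
  (\int[leb]_(q in `[s, t]) c%:E < +oo)%E.
Proof.
have H : leb.-integrable `[s, t]%classic (EFin \o (cst c)).
  apply: continuous_compact_integrable; first exact: segment_compact.
  by apply: continuous_subspaceT => x; exact: cvg_cst.
exact: integrable_lty H.
Qed.

Lemma stopping_pinfty {R : realType} (Om : Type) (t : R) :
  [set w : Om | (+oo <= t%:E)%E] = set0.
Proof. by apply/seteqP; split=> w //=; rewrite leye_eq. Qed.

Lemma image_swap_setX (U V : Type) (B : set V) :
  [set (p.2, p.1) | p in (setT : set U) `*` B] `<=` B `*` setT.
Proof. by move=> _ [[w q] [_ /= qt] <-]. Qed.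

Opaque cintegral.

(** * The martingale property *)

Section Martingale.
Context {R : realType} {d : measure_display} {Om : measurableType d}.
Variables (P : probability Om R) (T : R) (Ft : R -> set (set Om)) (X : R -> Om -> R).
Variables (b a : R) (F : {measure set (measurableTypeR R) -> \bar R}).
Hypotheses (T_gt0 : 0 < T) (filtrationF : filtration T Ft).
Hypotheses (levyF : levy_measure F) (levyX : levy_process P T Ft X b a F).
Variable r : R.
Hypotheses (r1 : 1 <= r) (Fr : F [set y | r < `|y|] = 0%E).
Variables (f f1 f2 : R -> Cx R) (k C M : R).
Hypotheses (k0 : 0 <= k) (C0 : 0 <= C) (tf : twice_diff f f1 f2)
  (fb : exp_bounded k C f f1 f2) (kM : exp_moment P T X k M)
  (df : dynkin_formula P T Ft X b a F f f1 f2).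

Let G := gen b a F f f1 f2.
Let K := C * gen_const b a F r k.

Let K0 : 0 <= K.
Proof.
by rewrite mulr_ge0// /gen_const addr_ge0// mulr_ge0 ?expR_ge0// addr_ge0// levy_var_ge0.
Qed.

Let bG x : absC (G x) <= K * expR (k * `|x|).
Proof. exact: (gen_exp_le b a levyF r1 Fr x k0 C0 tf fb). Qed.

Let mG : @cmeasurable R _ (measurableTypeR R) setT G.
Proof. exact: (gen_measurable b a levyF r1 Fr k0 C0 tf fb). Qed.

Let mf : @cmeasurable R _ (measurableTypeR R) setT f.
Proof. by apply: continuous_cmeasurable; have [] := twice_diff_continuous tf. Qed.

Let bf x : absC (f x) <= C * expR (k * `|x|).
Proof. by have [] := fb x. Qed.

Let path_measurable (w : Om) : @cmeasurable R _ (measurableTypeR R) `[0, T]%classic (fun q => G (X q w)).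
Proof.
have m := X_jointly_measurable filtrationF levyX (lexx 0) (ltW T_gt0) (lexx T).
apply: (cmeasurableT_comp mG).
apply: (@measurable_comp _ _ _ _ _ _ (`[0, T]%classic `*` setT) _ _
  (fun q : measurableTypeR R => (q, w)) _ _ m) => //.
- by apply: measurableX => //; exact: measurable_itv.
- by move=> _ [q qT <-].
- exact: measurable_funTS (pair2_measurable w).
Qed.

Let path_bounded w : exists B : R, forall q, 0 <= q <= T -> absC (G (X q w)) <= B.
Proof.
have [_ /(_ w) /cadlag_bounded[B hB] _ _ _] := levyX.
exists (K * expR (k * B)) => q qT; apply: (le_trans (bG _)).
by apply: ler_wpM2l => //; rewrite ler_expR; apply: ler_wpM2l => //; exact: hB.
Qed.

Let sub_itv (t : R) : t <= T -> `[0, t]%classic `<=` (`[0, T]%classic : set R).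
Proof.
by move=> tT q; rewrite /= !in_itv /= => /andP[-> qt]; exact: le_trans tT.
Qed.

Let path_cintegrable w (t : R) : t <= T -> cintegrable leb `[0, t] (fun q => G (X q w)).
Proof.
move=> tT; have [B hB] := path_bounded w.
apply: (@bounded_cintegrable _ _ `[0, T]%classic `[0, t]%classic 0 T B).
- exact: measurable_itv.
- exact: measurable_itv.
- by [].
- exact: sub_itv.
- exact: path_measurable.
- by move=> q; rewrite /= in_itv; exact: hB.
Qed.

Let NE : Nproc b a F X f = fun t w => f (X t w) - f (X 0 w) -
  cintegral leb `[0, t] (fun q => G (X q w)).
Proof. by rewrite /Nproc (generatorE b a F tf). Qed.

Lemma Nproc_definedP : Nproc_defined T b a F X f.
Proof.
by move=> w t /andP[_ tT]; rewrite (generatorE b a F tf); exact: path_cintegrable.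
Qed.

Let N_cadlag w : cadlag T (Nproc b a F X f ^~ w).
Proof.
have [cf _] := twice_diff_continuous tf; have [B hB] := path_bounded w.
have [_ cX _ _ _] := levyX.
rewrite NE; apply: cadlagB; last exact: (cadlag_integral (path_measurable w) hB).
by apply: cadlagB; [exact: (cadlag_comp cf (cX w))|exact: cadlag_cst].
Qed.

Let N_adapted (t : R) : 0 <= t <= T -> cmeasurable_wrt (Ft t) (Nproc b a F X f t).
Proof.
move=> tT; have /andP[t0 tT'] := tT; have [sig _ mono] := filtrationF.
have mX (q : R) : 0 <= q <= t -> @measurable_fun _ _ (g_sigma_algebraType (Ft t)) R setT (X q).
  move=> /andP[q0 qt]; apply/measurable_wrtP; first exact: sig.
  have qT : 0 <= q <= T by rewrite q0 (le_trans qt).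
  by move=> B mB; apply: (mono q t q0 qt tT'); exact: (measurable_wrt_X levyX qT mB).
have T00 : (0 : R) <= 0 <= t by rewrite lexx.
have Tt : (0 : R) <= t <= t by rewrite lexx t0.
rewrite NE; apply/cmeasurable_wrtP; first exact: sig.
apply: cmeasurableB; first apply: cmeasurableB.
- by apply: (cmeasurableT_comp mf); exact: mX.
- by apply: (cmeasurableT_comp mf); exact: mX.
(* Progressive measurability: on [[0, t]] the process is jointly measurable with respect to [Ft t],
   so its time integral up to [t] is [Ft t]-measurable. *)
have m : @measurable_fun _ _ (measurableTypeR R * g_sigma_algebraType (Ft t))%type R
    (`[0, t]%classic `*` setT) (fun p => X p.1 p.2).
  apply: (process_measurable t0) => [q qt|w q /andP[q0 qt]]; first exact: mX.
  have [_ /(_ w)[cr _] _ _ _] := levyX.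
  by apply: cr; rewrite q0/=; exact: lt_le_trans tT'.
apply: (@cmeasurable_cintegral_param R _ _ (g_sigma_algebraType (Ft t)) (measurableTypeR R)
  leb setT `[0, t]%classic measurableT (measurable_itv _) (fun p => G (X p.2 p.1))).
  apply: (cmeasurableT_comp mG).
  refine (@measurable_comp _ _ _ (g_sigma_algebraType (Ft t) * measurableTypeR R)%type
    (measurableTypeR R * g_sigma_algebraType (Ft t))%type R
    (`[0, t]%classic `*` setT) (fun p => X p.1 p.2) (setT `*` `[0, t]%classic)
    (fun p => (p.2, p.1)) _ _ m _).
  - by apply: measurableX => //; exact: measurable_itv.
  - exact: image_swap_setX.
  - exact: (measurable_funTS (measurable_fun_pair measurable_snd measurable_fst)).
move=> w _; exact: path_cintegrable.
Qed.

(** The moment bound is uniform in time, so the mean of [|G (X q)|] is at most [K M] for each [q]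
    and the order of integration may be exchanged. *)
Let Fub A (t : R) : measurable A -> 0 <= t -> t <= T ->
  cintegrable P A (fun w => cintegral leb `[0, t] (fun q => G (X q w))) /\
  cintegral P A (fun w => cintegral leb `[0, t] (fun q => G (X q w))) =
  cintegral leb `[0, t] (EX P X A G).
Proof.
move=> mA t0 tT.
have mj : @cmeasurable R _ (measurableTypeR R * Om)%type (`[0, t]%classic `*` A)
  (fun p => G (X p.1 p.2)).
  exact: (X_comp_cmeasurable filtrationF levyX A mG (lexx 0) t0 tT).
have qT (q : R) : `[0, t]%classic q -> 0 <= q <= T.
  by rewrite /= in_itv /= => /(itv_horizon (lexx 0) tT).
have iq (q : R) : `[0, t]%classic q -> cintegrable P A (fun w => G (X q w)).
  by move=> /qT qT'; exact: (EX_cintegrable filtrationF levyX mA mG bG kM qT').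
have fin : (\int[leb]_(q in `[0%R, t]) \int[P]_(w in A) (absC (G (X q w)))%:E < +oo)%E.
  apply: (@le_lt_trans _ _ (\int[leb]_(q in `[0%R, t]) (K * M)%:E)%E); last exact: integral_itv_cst_lty.
  apply: (@ge0_le_integral _ (measurableTypeR R) R leb `[0, t]%classic (measurable_itv _)).
  - by move=> q _; apply: integral_ge0 => w _; rewrite lee_fin absC_ge0.
  - apply: (@measurable_integral_param R _ _ (measurableTypeR R) Om P `[0, t]%classic A
      (measurable_itv _) mA (fun p => absC (G (X p.1 p.2)))).
      exact: cmeasurable_absC.
    by move=> p _; exact: absC_ge0.
  - exact: measurable_cst.
  - move=> q /qT qT'; have [iM1 iM2] := kM qT'.
    have iK : P.-integrable setT (EFin \o (fun w => K * expR (k * `|X q w|))).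
      by have := integrableZl measurableT K iM1; apply: eq_integrable.
    apply: (@le_trans _ _ (\int[P]_w (K * expR (k * `|X q w|))%:E)%E).
      apply: (@le_trans _ _ (\int[P]_(w in A) (K * expR (k * `|X q w|))%:E)%E).
        apply: ge0_le_integral; first exact: mA.
        - move=> w _; rewrite lee_fin; exact: absC_ge0.
        - apply/measurable_EFinP; apply: cmeasurable_absC; apply: (cmeasurableT_comp mG).
          apply: measurable_funTS; exact: (measurable_X filtrationF levyX qT').
        - apply: measurable_funTS; exact: (integrableP _ _ _ iK).1.
        - move=> w _; rewrite lee_fin; exact: bG.
      apply: ge0_subset_integral; [exact: mA|exact: measurableT| |move=> w _|exact: subsetT].
        exact: (integrableP _ _ _ iK).1.
      rewrite lee_fin; apply: mulr_ge0; [exact: K0|exact: expR_ge0].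
    have -> : (\int[P]_w (K * expR (k * `|X q w|))%:E)%E =
        (Rintegral P setT (fun w => K * expR (k * `|X q w|)))%:E.
      apply: esym; apply: fineK; exact: integrable_fin_num iK.
    rewrite lee_fin RintegralZl; [exact: (ler_wpM2l K0 iM2)|exact: measurableT|exact: iM1].
have i2 w : A w -> cintegrable leb `[0, t] (fun q => G (X q w)) by move=> _; exact: path_cintegrable.
have [_ h1 h2] := @cFubini R _ _ (measurableTypeR R) Om leb P `[0, t]%classic A (measurable_itv _) mA
  (fun p => G (X p.1 p.2)) mj iq i2 fin.
by split; [exact: h1|exact: esym h2].
Qed.

Let Ef_cintegrable A (t : R) : measurable A -> 0 <= t <= T -> cintegrable P A (fun w => f (X t w)).
Proof. by move=> mA tT; exact: (EX_cintegrable filtrationF levyX mA mf bf kM tT). Qed.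

Let T00 : (0 : R) <= 0 <= T. Proof. by rewrite lexx ltW. Qed.

Let N_integral A (t : R) : measurable A -> 0 <= t <= T ->
  cintegrable P A (Nproc b a F X f t) /\
  cintegral P A (Nproc b a F X f t) =
    EX P X A f t - EX P X A f 0 - cintegral leb `[0, t] (EX P X A G).
Proof.
move=> mA tT; have /andP[t0 tT'] := tT; have [i1 e1] := Fub mA t0 tT'.
have i2 := Ef_cintegrable mA tT; have i3 := Ef_cintegrable mA T00.
have i23 := cintegrableB mA i2 i3.
rewrite NE; split; first exact: (cintegrableB mA i23 i1).
by rewrite (cintegralB mA i23 i1) (cintegralB mA i2 i3) e1.
Qed.

Lemma martingale_Nproc : martingale P T Ft (Nproc b a F X f).
Proof.
have mFt (t : R) A : 0 <= t <= T -> Ft t A -> measurable A.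
  by have [_ H _] := filtrationF => tT; exact: H.
split.
- exact: N_cadlag.
- exact: N_adapted.
- by move=> t tT; have [] := N_integral measurableT tT.
move=> s t s0 st tT.
have sT : 0 <= s <= T by rewrite s0 (le_trans st).
have tT' : 0 <= t <= T by rewrite tT (le_trans s0).
split.
- by have [] := N_integral measurableT sT.
- exact: N_adapted.
move=> A FA; have mA := mFt _ _ sT FA.
have [_ ->] := N_integral mA sT; have [_ ->] := N_integral mA tT'.
have iG : cintegrable leb `[0, t] (EX P X A G).
  exact: (EX_itv_cintegrable filtrationF levyX mA mG K0 bG kM (lexx 0) (le_trans s0 st) tT).
have ioc : cintegrable leb `]s, t] (EX P X A G).
  have [m1 _] := iG.
  apply: (@bounded_cintegrable _ _ `[0, t]%classic `]s, t]%classic 0 t (K * M)).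
  - exact: measurable_itv.
  - exact: measurable_itv.
  - by [].
  - by move=> q; rewrite /= !in_itv /= => /andP[sq ->]; rewrite (le_trans s0 (ltW sq)).
  - exact: m1.
  - move=> q; rewrite /= in_itv /= => qt.
    exact: (EX_le filtrationF levyX mA mG K0 bG kM (itv_horizon (lexx 0) tT qt)).
(* Dynkin's formula between [s] and [t] cancels the increment of the time integral. The subtraction
   leaves an interval open at [s], which has the same integral as the closed one. *)
have := cintegral_itvB s0 st iG; rewrite (cintegral_itv_obnd_cbnd ioc).
rewrite (df s0 st tT FA) -/G => <-.
move: (cintegral leb `[0, t] _) (cintegral leb `[0, s] _) => I1 I2.
move: (EX P X A f s) (EX P X A f 0) => e1 e2; ring.
Qed.

Lemma local_martingale_Nproc : local_martingale P T Ft (Nproc b a F X f).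
Proof.
split; [exact: N_cadlag|exact: N_adapted|].
(* A true martingale is localized by the times that never stop it. *)
exists (fun _ _ => +oo%E); split.
- move=> _; split=> [w|t tT]; first exact: leey.
  have [/(_ t tT)[h0 _ _] _ _] := filtrationF.
  rewrite stopping_pinfty; exact: h0.
- move=> n w; exact: lexx.
- apply: aeW => w; exists 0%N; exact: leey.
- move=> _; have -> : stopped (Nproc b a F X f) (fun=> +oo%E) = Nproc b a F X f.
    by apply/funext => t; apply/funext => w; rewrite /stopped min_l ?leey.
  exact: martingale_Nproc.
Qed.

End Martingale.

(** * The class of test functions in terms of coefficient sequences *)

Section EntireClass.
Context {R : realType}.
Implicit Types (u v : nat -> Cx R) (h : Cx R -> Cx R).

Lemma series_lin (c : Cx R) u v z n : series (pow_term (fun k => c * u k + v k) z) n =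
  c * series (pow_term u z) n + series (pow_term v z) n.
Proof.
rewrite /series /= mulr_sumr -big_split /=; apply: eq_bigr => i _.
by rewrite /pow_term !mulrDl !mulrA.
Qed.

Lemma eseq_lin (c : Cx R) u v : eseq u -> eseq v -> eseq (fun k => c * u k + v k).
Proof.
move=> eu ev q q0.
apply: (@series_le_cvg _ _ (fun n => absC c * abs_term u q n + abs_term v q n)).
- by move=> n; exact: abs_term_ge0.
- move=> n; apply: addr_ge0; last exact: abs_term_ge0.
  by apply: mulr_ge0; [exact: absC_ge0|exact: abs_term_ge0].
- move=> n; rewrite /abs_term !mulrA -!mulrDl ler_wpM2r ?invr_ge0//.
  apply: ler_wpM2r; first exact: exprn_ge0.
  by apply: le_trans (ler_absCD _ _) _; rewrite absCM.
have -> : series (fun n => absC c * abs_term u q n + abs_term v q n) =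
   (fun n => absC c * series (abs_term u q) n + series (abs_term v q) n).
  by apply/funext => n; rewrite /series /= mulr_sumr -big_split.
apply: is_cvgD; last exact: ev.
by apply: is_cvgM; [exact: is_cvg_cst|exact: eu].
Qed.

Lemma hser_lin (c : Cx R) u v z : eseq u -> eseq v ->
  hser (fun k => c * u k + v k) z = c * hser u z + hser v z.
Proof.
move=> eu ev; apply: cvg_lim => //.
have -> : series (pow_term (fun k => c * u k + v k) z) =
  (fun n => c * series (pow_term u z) n + series (pow_term v z) n).
  by apply/funext => n; rewrite series_lin.
by apply: cvgD; [apply: cvgM; [exact: cvg_cst|exact: cvg_hser]|exact: cvg_hser].
Qed.

Opaque hser.

Definition exp_bounded_seq (k C : R) u :=
  exp_bounded k C (re0 u) (re0 (shiftc u)) (re0 (shiftc (shiftc u))).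

Lemma exp_bounded_mono (k k' C C' : R) (f f1 f2 : R -> Cx R) : 0 <= C -> k <= k' -> C <= C' ->
  exp_bounded k C f f1 f2 -> exp_bounded k' C' f f1 f2.
Proof.
move=> C0 kk CC fb x; have [h0 h1 h2] := fb x.
have E : C * expR (k * `|x|) <= C' * expR (k' * `|x|).
  by apply: ler_pM => //; rewrite ler_expR ler_wpM2r.
by split; [exact: le_trans h0 E|exact: le_trans h1 E|exact: le_trans h2 E].
Qed.

Lemma derive2_entire u : eseq u -> derive1n 2 (hser u) = hser (shiftc (shiftc u)).
Proof.
move=> eu; rewrite /derive1n /= derive1_hser// derive1_hser//; exact: eseq_shift.
Qed.

Lemma calV_hser u (k C : R) : eseq u -> 0 <= C -> exp_bounded_seq k C u -> calV (hser u).
Proof.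
move=> eu C0 ub; split; first exact: entire_hser_entire.
exists k, (C + 1); split=> [|x]; first by rewrite ltr_wpDl.
rewrite derive1_hser// derive2_entire//.
have [h0 h1 h2] := ub x; have e0 := expR_ge0 (k * `|x|).
have E : C * expR (k * `|x|) <= (C + 1) * expR (k * `|x|) by rewrite ler_wpM2r// lerDl.
by split; [exact: le_trans h0 E|exact: le_trans h1 E|exact: le_trans h2 E].
Qed.

Lemma calV_series h : calV h -> exists u (k C : R),
  [/\ eseq u, h = hser u, 0 <= k, 0 <= C & exp_bounded_seq k C u].
Proof.
move=> [/entire_hser[u eu ->] [k [C [C0 H]]]].
(* [calV] admits a negative rate; its absolute value gives a weaker bound with the sign used
   throughout. *)
exists u, `|k|, C; split=> //; first exact: ltW.
apply: (@exp_bounded_mono k `|k| C C); [exact: ltW|exact: ler_norm|exact: lexx|].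
by move=> x; have := H x; rewrite derive1_hser// derive2_entire.
Qed.

Lemma linear_subset_calV : linear_subset (@on_reals R @` calV).
Proof.
split.
  have z0 : derive1 (cst (0 : Cx R) : Cx R -> Cx R) = cst 0.
    by apply/funext => z; rewrite derive1_cst.
  exists (cst 0) => //; split; first by move=> z _; exact: derivable_cst.
  have z2 : derive1n 2 (cst (0 : Cx R) : Cx R -> Cx R) = cst 0.
    by rewrite derive1nS derive1n1 !z0.
  exists 0, 1; split=> // x.
  have E : absC (0 : Cx R) <= 1 * expR (0 * `|x|) by rewrite absC0 mul0r expR0 mulr1.
  by rewrite z0 z2; split; exact: E.
move=> c _ _ [f /calV_series[u [k [C [eu -> k0 C0 ub]]]] <-]
  [g /calV_series[v [l [D [ev -> l0 D0 vb]]]] <-].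
exists (hser (fun n => c * u n + v n)); last first.
  by apply/funext => x; rewrite /on_reals hser_lin.
pose m := Num.max k l.
have ub' : exp_bounded_seq m C u by apply: exp_bounded_mono ub; rewrite // le_max lexx.
have vb' : exp_bounded_seq m D v by apply: exp_bounded_mono vb; rewrite // le_max lexx orbT.
have E w w' : eseq w -> eseq w' -> re0 (fun n => c * w n + w' n) = (fun x => re0 w' x + c * re0 w x).
  by move=> ew ew'; apply/funext => x; rewrite /re0 hser_lin// addrC.
have eu1 := eseq_shift eu; have ev1 := eseq_shift ev.
apply: (@calV_hser _ m (D + absC c * C)).
- exact: eseq_lin.
- by rewrite addr_ge0// mulr_ge0// absC_ge0.
rewrite /exp_bounded_seq (E u v eu ev) (E _ _ eu1 ev1) (E _ _ (eseq_shift eu1) (eseq_shift ev1)).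
exact: exp_boundedD vb' ub'.
Qed.

End EntireClass.

Section AbstractRules.
Context {R : realType}.

Lemma rdiff_mulr (K : R -> Cx R) (w : Cx R) x l : rdiff K x l -> rdiff (fun t => K t * w) x (l * w).
Proof. by move=> dK; have := rdiffM dK (rdiff_cst w x); rewrite mulr0 add0r. Qed.

Lemma rdiff_shift (g : Cx R -> Cx R) (z : Cx R) (y : R) l : cdiff g (z + ofR y) l ->
  rdiff (fun t => g (z + ofR t)) y l.
Proof.
move=> dg; have d : rdiff (fun t => z + ofR t) y 1.
  have := rdiff_lin z 1 y.
  rewrite (_ : (fun t => z + ofR t * 1) = (fun t => z + ofR t))//.
  by apply/funext => t; rewrite mulr1.
by have := rdiff_comp (K := fun t => z + ofR t) dg d; rewrite mulr1.
Qed.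

Lemma cdiffD (f g : Cx R -> Cx R) (z l m : Cx R) : cdiff f z l -> cdiff g z m ->
  cdiff (fun z => f z + g z) z (l + m).
Proof.
move=> H1 H2 e e0; have e2 : 0 < e / 2 by rewrite divr_gt0.
have [d1 d10 {}H1] := H1 _ e2; have [d2 d20 {}H2] := H2 _ e2.
exists (Num.min d1 d2); first by rewrite lt_min d10 d20.
move=> w; rewrite lt_min => /andP[/H1 h1 /H2 h2].
have -> : f (z + w) + g (z + w) - (f z + g z) - (l + m) * w =
  (f (z + w) - f z - l * w) + (g (z + w) - g z - m * w) by ring.
by apply: (le_trans (ler_absCD _ _)); lra.
Qed.

Lemma cdiffZ (c : Cx R) (f : Cx R -> Cx R) (z l : Cx R) : cdiff f z l ->
  cdiff (fun z => c * f z) z (c * l).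
Proof.
move=> H e e0; pose C := absC c + 1; have C0 : 0 < C by rewrite ltr_wpDl// absC_ge0.
have eC : 0 < e / C by rewrite divr_gt0.
have [d d0 {}H] := H _ eC; exists d => // w /H h.
have -> : c * f (z + w) - c * f z - c * l * w = c * (f (z + w) - f z - l * w) by ring.
rewrite absCM; apply: (@le_trans _ _ (C * (e / C * absC w))).
  by apply: ler_pM; rewrite ?absC_ge0// /C lerDl.
by rewrite mulrA mulrCA divff ?mulr1// gt_eqF.
Qed.

Lemma cdiff_lin3 (f g h : Cx R -> Cx R) (c e z l m n : Cx R) :
  cdiff f z l -> cdiff g z m -> cdiff h z n ->
  cdiff (fun z => c * f z + e * g z + h z) z (c * l + e * m + n).
Proof. by move=> df dg dh; do 2![apply: cdiffD => //]; exact: cdiffZ. Qed.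

Lemma jumps_difference (p1 q1 s1 p2 q2 s2 p3 q3 s3 w y : Cx R) :
  p1 - q1 - s1 * y - (p2 - q2 - s2 * y) - w * (p3 - q3 - s3 * y) =
  (p1 + -1 * (p2 + w * p3)) - (q1 + -1 * (q2 + w * q3)) - (s1 + -1 * (s2 + w * s3)) * y.
Proof. by ring. Qed.

Lemma second_difference (A B C w : Cx R) : A + (-1) * (B + w * C) = A - B - C * w.
Proof. by ring. Qed.

End AbstractRules.

(** * The generator maps entire functions to entire functions *)

Section EntireGenerator.
Context {R : realType}.
Variables (b a : R) (F : {measure set (measurableTypeR R) -> \bar R}).
Hypothesis levyF : levy_measure F.
Variable r : R.
Hypotheses (r1 : 1 <= r) (Fr : F [set y | r < `|y|] = 0%E).
Implicit Types (u : nat -> Cx R) (z w : Cx R).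

(** The real estimate [taylor2] is applied along the segment [z + t w], which stays in the disc of
    radius [q]. *)
Lemma hser_taylor2 u z w (q : R) : eseq u -> absC z + absC w <= q ->
  absC (hser u (z + w) - hser u z - hser (shiftc u) z * w) <=
  absC w ^+ 2 * majorant (shiftc (shiftc u)) q.
Proof.
move=> eu zq; have e1 := eseq_shift eu; have e2 := eseq_shift e1.
have dl t : rdiff (fun t => z + ofR t * w) t w by exact: rdiff_lin.
pose f (v : nat -> Cx R) (t : R) := hser v (z + ofR t * w).
have d0 v t : eseq v -> rdiff (f v) t (f (shiftc v) t * w).
  by move=> ev; exact: (rdiff_comp (cdiff_hser (z + ofR t * w) ev) (dl t)).
have cf v : eseq v -> continuous (f v).
  by move=> ev; apply: rdiff_continuous => t; eexists; exact: d0.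
have tf : twice_diff (f u) (fun t => f (shiftc u) t * w) (fun t => f (shiftc (shiftc u)) t * w * w).
  split=> [t|t|t]; first exact: d0.
    exact: (rdiff_mulr w (d0 (shiftc u) t e1)).
  by apply: cvgM; [apply: cvgM; [exact: cf|exact: cvg_cst]|exact: cvg_cst].
have B (t : R) : `|t - 0| <= `|1 : R| -> absC (f (shiftc (shiftc u)) t * w * w) <=
    absC w ^+ 2 * majorant (shiftc (shiftc u)) q.
  rewrite subr0 normr1 => t1; rewrite -mulrA mulrC absCM absCM -expr2.
  apply: ler_wpM2l; first exact: sqr_ge0.
  apply: absC_hser_le => //; apply: le_trans zq; apply: (le_trans (ler_absCD _ _)).
  by rewrite lerD2l absCM absC_ofR ler_piMl ?absC_ge0.
have := taylor2 tf B; rewrite expr1n mulr1 add0r /f.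
by rewrite ofR0 ofR1 mul0r mul1r addr0 mulr1.
Qed.

Definition shifted u z (y : R) : Cx R := hser u (z + ofR y).

Lemma rdiff_shifted u z (y : R) : eseq u -> rdiff (shifted u z) y (shifted (shiftc u) z y).
Proof.
by move=> eu; exact: (rdiff_shift (cdiff_hser (z + ofR y) eu)).
Qed.

Lemma twice_diff_shifted u z : eseq u ->
  twice_diff (shifted u z) (shifted (shiftc u) z) (shifted (shiftc (shiftc u)) z).
Proof.
move=> eu; have e1 := eseq_shift eu; have e2 := eseq_shift e1.
split=> [t|t|]; [exact: rdiff_shifted|exact: rdiff_shifted|].
by apply: rdiff_continuous => t; eexists; exact: rdiff_shifted.
Qed.

(** The jump term at a complex point: jumps are real and start at 0, while [z] is absorbed into the
    function. *)
Let J u z := cintegral F setT (jumps (shifted u z) (shifted (shiftc u) z) 0).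

Let J_bound u z (t : R) : eseq u -> `|t - 0| <= r ->
  absC (shifted u z t) <= majorant u (absC z + r).
Proof.
move=> eu; rewrite subr0 => tr; apply: absC_hser_le => //.
by apply: (le_trans (ler_absCD _ _)); rewrite lerD2l absC_ofR.
Qed.

Let J_cintegrable u z : eseq u ->
  cintegrable F setT (jumps (shifted u z) (shifted (shiftc u) z) 0).
Proof.
move=> eu; have e2 := eseq_shift (eseq_shift eu).
have B t := @J_bound (shiftc (shiftc u)) z t e2.
by have [_ + _ _] := jumps_cintegrable levyF r1 Fr (twice_diff_shifted z eu) B.
Qed.

(** By linearity the remainder of [J u] in [w] is the jump integral of the remainder [phi u] of the
    shifted functions. The second derivative of [phi u] in the jump variable is itself a first-order
    Taylor remainder in [w], so the integral is of order [|w| ^ 2]. *)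
Lemma cdiff_jump_integral u z : eseq u -> cdiff (J u) z (J (shiftc u) z).
Proof.
move=> eu; have e1 := eseq_shift eu; have e2 := eseq_shift e1.
have e3 := eseq_shift e2; have e4 := eseq_shift e3.
(* The arguments are [z] displaced by a jump of size at most [r] and by [w] of size at most 1. Two
   derivatives go to the jump and two to [w], whence the fourth shift in [B]. *)
pose Q := absC z + r + 1.
have Q0 : 0 <= Q by rewrite !addr_ge0 ?absC_ge0// (le_trans ler01).
pose B := majorant (shiftc (shiftc (shiftc (shiftc u)))) Q.
have B0 : 0 <= B by exact: majorant_ge0.
pose V := levy_var F r; have V0 : 0 <= V by exact: levy_var_ge0.
have H w : absC w <= 1 -> absC (J u (z + w) - J u z - J (shiftc u) z * w) <= absC w ^+ 2 * B * V.
  move=> w1.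
  pose phi (v : nat -> Cx R) (y : R) :=
    shifted v (z + w) y + (-1) * (shifted v z y + w * shifted (shiftc v) z y).
  have tphi : twice_diff (phi u) (phi (shiftc u)) (phi (shiftc (shiftc u))).
    apply: (@twice_diffD _ _ _ _ _ _ _ (-1)); first exact: twice_diff_shifted.
    by apply: twice_diffD; exact: twice_diff_shifted.
  have bphi (t : R) : `|t - 0| <= r -> absC (phi (shiftc (shiftc u)) t) <= absC w ^+ 2 * B.
    rewrite subr0 => tr.
    have -> : phi (shiftc (shiftc u)) t = hser (shiftc (shiftc u)) (z + ofR t + w) -
        hser (shiftc (shiftc u)) (z + ofR t) - hser (shiftc (shiftc (shiftc u))) (z + ofR t) * w.
      have E : z + w + ofR t = z + ofR t + w by rewrite addrAC.
      apply: etrans (congr1 (fun x => hser (shiftc (shiftc u)) x - hser (shiftc (shiftc u)) (z + ofR t) -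
        hser (shiftc (shiftc (shiftc u))) (z + ofR t) * w) E).
      exact: second_difference.
    apply: hser_taylor2 => //; rewrite /Q; apply: lerD => //.
    by apply: (le_trans (ler_absCD _ _)); rewrite lerD2l absC_ofR.
  have [_ iphi _ bI] := jumps_cintegrable levyF r1 Fr tphi bphi.
  suff -> : J u (z + w) - J u z - J (shiftc u) z * w = cintegral F setT (jumps (phi u) (phi (shiftc u)) 0).
    exact: bI.
  have i1 := J_cintegrable (z + w) eu; have i2 := J_cintegrable z eu.
  have i3 := J_cintegrable z e1.
  have i3' := cintegrableZ measurableT w i3.
  have i12 := cintegrableB measurableT i1 i2.
  rewrite [J (shiftc u) z * w]mulrC -(cintegralZ measurableT w i3).
  rewrite -(cintegralB measurableT i1 i2) -(cintegralB measurableT i12 i3').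
  apply: eq_cintegral => y _; exact: jumps_difference.
move=> e e0; pose D := B * V + 1.
have D0 : 0 < D by rewrite ltr_wpDl// mulr_ge0.
exists (Num.min 1 (e / D)); first by rewrite lt_min ltr01 divr_gt0.
move=> w; rewrite lt_min => /andP[w1 we].
apply: (le_trans (H w (ltW w1))).
rewrite (_ : absC w ^+ 2 * B * V = absC w * (B * V) * absC w); last by ring.
apply: ler_wpM2r; first exact: absC_ge0.
move: we; rewrite ltr_pdivlMr// => /ltW; apply: le_trans.
by apply: ler_wpM2l; [exact: absC_ge0|rewrite /D lerDl].
Qed.

(** The entire function that extends the generator from the real line and so places it in
    [calO S]. *)
Definition gen_ext u z : Cx R :=
  ofR b * hser (shiftc u) z + ofR (a / 2) * hser (shiftc (shiftc u)) z + J u z.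

Lemma entire_gen_ext u : eseq u -> entire (gen_ext u).
Proof.
move=> eu z _; have e1 := eseq_shift eu; have e2 := eseq_shift e1.
have H := cdiff_lin3 (ofR b) (ofR (a / 2)) (cdiff_hser z e1) (cdiff_hser z e2)
  (cdiff_jump_integral z eu).
exact: (cdiff_derivable H).
Qed.

Lemma gen_extE u (x : R) : eseq u ->
  gen b a F (re0 u) (re0 (shiftc u)) (re0 (shiftc (shiftc u))) x = gen_ext u (ofR x).
Proof.
move=> eu.
have E0 : ofR x = ofR x + ofR 0 :> Cx R by rewrite ofR0 addr0.
have E (y : R) : ofR (x + y) = ofR x + ofR (0 + y) :> Cx R by rewrite add0r rmorphD.
apply: (congr1 (fun I => ofR b * hser (shiftc u) (ofR x) +
  ofR (a / 2) * hser (shiftc (shiftc u)) (ofR x) + I)).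
apply: eq_cintegral => y _.
apply: (congr2 (fun p q => hser u p - hser u q - hser (shiftc u) q * ofR y)); first exact: E.
exact: E0.
Qed.

End EntireGenerator.

(** * The holomorphic process property and the true martingales *)

Section LevyHolomorphic.
Context {R : realType} {d : measure_display} {Om : measurableType d}.
Variables (P : probability Om R) (T : R) (Ft : R -> set (set Om)) (X : R -> Om -> R).
Variables (S : set R) (b a x0 : R) (F : {measure set (measurableTypeR R) -> \bar R}).
Hypotheses (T_gt0 : 0 < T) (filtrationF : filtration T Ft).
Hypotheses (levyF : levy_measure F) (bsuppF : bounded_support F).
Hypotheses (levyX : levy_process P T Ft X b a F) (XS : valued_in T S X).
Hypothesis X0 : {ae P, forall w, X 0 w = x0}.

Lemma entire_calO (f : R -> Cx R) (g : Cx R -> Cx R) : entire g ->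
  (forall x, f x = g (ofR x)) -> calO S f.
Proof.
move=> eg fg; exists 1 => //; exists g => [z _|x _]; first exact: eg.
exact: fg.
Qed.

Lemma entire_martingale u (k C : R) : eseq u -> 0 <= k -> 0 <= C -> exp_bounded_seq k C u ->
  [/\ generator_domain S F (re0 u), calO S (generator b a F (re0 u)),
      Nproc_defined T b a F X (re0 u), martingale P T Ft (Nproc b a F X (re0 u)) &
      local_martingale P T Ft (Nproc b a F X (re0 u))].
Proof.
move=> eu k0 C0 ub; have [r r1 Fr] := support_radius bsuppF.
have tf := twice_diff_re eu.
have [M kM] := exp_moment_exists T_gt0 filtrationF levyF levyX X0 r1 Fr k0.
have df := dynkin_exp_bounded T_gt0 filtrationF levyF levyX r1 Fr eu k0 C0 kM ub.
split.
- split; first exact: (twice_diff_C2 tf).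
  move=> x _; have [d0 d1 _] := tf.
  have hM t : `|t - x| <= r -> absC (re0 (shiftc (shiftc u)) t) <= C * expR (k * r) * expR (k * `|x|).
    by move=> tx; have [_ _ h] := ub t; apply: (le_trans h); exact: exp_bounded_shift.
  have [_ [_ H] _ _] := jumps_cintegrable levyF r1 Fr tf hM.
  by rewrite /jump_integrand (deriv_cE d0); exact: H.
- have eg : entire (gen_ext b a F u) by exact: (entire_gen_ext levyF r1 Fr eu).
  rewrite (generatorE b a F tf); apply: (@entire_calO _ (gen_ext b a F u) eg).
  by move=> x; exact: gen_extE.
- exact: (Nproc_definedP T_gt0 filtrationF levyF levyX r1 Fr k0 C0 tf ub).
- exact: (martingale_Nproc T_gt0 filtrationF levyF levyX r1 Fr k0 C0 tf ub kM df).
- exact: (local_martingale_Nproc T_gt0 filtrationF levyF levyX r1 Fr k0 C0 tf ub kM df).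
Qed.

Lemma holomorphic_process_levy : holomorphic_process P T Ft b a F X S (@on_reals R @` calV).
Proof.
split.
- exact: linear_subset_calV.
- by move=> _ [h [eh _] <-]; exact: (entire_calO eh).
- exact: XS.
- move=> _ [h /calV_series[u [k [C [eu -> k0 C0 ub]]]] <-].
  by have [h1 h2 h3 h4 h5] := entire_martingale eu k0 C0 ub; split.
Qed.

Lemma martingale_calV h : calV h ->
  Nproc_defined T b a F X (on_reals h) /\ martingale P T Ft (Nproc b a F X (on_reals h)).
Proof.
move=> /calV_series[u [k [C [eu -> k0 C0 ub]]]].
by have [_ _ h3 h4 _] := entire_martingale eu k0 C0 ub.
Qed.

End LevyHolomorphic.

Transparent cintegral hser.

Lemma Rintegrable_le {R : realType} {d} {Y : measurableType d} (mu : {measure set Y -> \bar R})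
    (D : set Y) (f g : Y -> R) : measurable D -> measurable_fun D f ->
  mu.-integrable D (EFin \o g) -> (forall x, D x -> `|f x| <= g x) ->
  mu.-integrable D (EFin \o f).
Proof.
move=> mD mf ig fg; apply: le_integrable ig => //; first exact/measurable_EFinP.
by move=> x Dx /=; rewrite lee_fin; apply: le_trans (fg x Dx) (ler_norm _).
Qed.

(** * Fourier inversion *)

Section LineIntegrals.
Context {R : realType}.

Let line n : set (measurableTypeR R) := `[- n%:R, n%:R]%classic.

Let line_cover : \bigcup_n line n = setT.
Proof.
apply/seteqP; split=> // x _.
have [N _ /(_ N (leqnn _)) h] : \forall n \near \oo, `|x| <= n%:R by exact: nbhs_infty_ger.
by exists N => //; rewrite /line /= in_itv /= -ler_norml.
Qed.

(** Monotone convergence along the intervals [[-n, n]], on each of which [G] evaluates the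
    integral. *)
Lemma integral_line (g G : R -> R) (l : R) : continuous g -> (forall x, 0 <= g x) ->
  (forall x : R, is_derive x 1 G (g x)) ->
  (G n%:R - G (- n%:R)) @[n --> \oo] --> l ->
  leb.-integrable setT (EFin \o g) /\ Rintegral leb setT g = l.
Proof.
move=> cg g0 dG Gl.
have mg : @measurable_fun _ _ (measurableTypeR R) R setT g by exact: continuous_measurable_fun.
have cv : (\int[leb]_(x in line n) (g x)%:E)%E @[n --> \oo] --> (\int[leb]_(x in \bigcup_n line n) (g x)%:E)%E.
  apply: (@ge0_nondecreasing_set_cvg_integral _ (measurableTypeR R) R line (EFin \o g)).
  - apply/nondecreasing_seqP => n; rewrite subsetEset => x; rewrite /line /= !in_itv /= => /andP[x1 x2].
    have h : (n%:R : R) <= n.+1%:R by rewrite ler_nat.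
    by apply/andP; split; lra.
  - by move=> n; exact: measurable_itv.
  - by move=> n; apply: measurable_funTS; exact/measurable_EFinP.
  - by move=> n x _; rewrite lee_fin.
rewrite line_cover in cv.
have E : (fun n => (\int[leb]_(x in line n) (g x)%:E)%E) = (fun n => (G n%:R - G (- n%:R))%:E).
  apply/funext => n.
  have n0 : - n%:R <= (n%:R : R) by have : (0 : R) <= n%:R by []; lra.
  rewrite -(RFTC2 n0 cg (fun x _ => dG x)) /Rintegral fineK//.
  apply: integrable_fin_num; first exact: measurable_itv.
  apply: continuous_compact_integrable; first exact: segment_compact.
  exact: continuous_subspaceT.
rewrite E in cv.
have I : (\int[leb]_x (g x)%:E = l%:E)%E.
  have cl : ((G n%:R - G (- n%:R))%:E @[n --> \oo] --> l%:E)%E.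
    by apply: cvg_EFin; [exact: nearW|exact: Gl].
  exact: (cvg_unique _ cv cl).
split; last by rewrite /Rintegral I.
apply/integrableP; split; first exact/measurable_EFinP.
have -> : (\int[leb]_x `|(EFin \o g) x| = \int[leb]_x (g x)%:E)%E.
  by apply: eq_integral => x _ /=; rewrite ger0_norm.
by rewrite I ltry.
Qed.

Lemma cvg_cintegral_line (k : R -> Cx R) : cintegrable leb setT k ->
  cintegral leb `[- n%:R, n%:R] k @[n --> \oo] --> cintegral leb setT k.
Proof.
move=> ik; have [mk _] := ik.
have -> : (fun n => cintegral leb `[- n%:R, n%:R] k) =
  (fun n => cintegral leb setT (fun x => ofR (\1_(line n) x) * k x)).
  by apply/funext => n; rewrite -cintegral_indic.
have [_] : cintegrable leb setT k /\
  cintegral leb setT (fun x => ofR (\1_(line n) x) * k x) @[n --> \oo] --> cintegral leb setT k;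
  last by [].
apply: (@cdominated_cvg R _ (measurableTypeR R) leb setT measurableT _ _ _ _ _ (cintegrable_absC ik)).
- move=> n; apply: cmeasurableM => //; apply: cmeasurable_ofR.
  by apply: measurable_indic; exact: measurable_itv.
- move=> x _; apply: cvg_near_cst.
  near=> n; rewrite indicE mem_set ?mul1r ?ofR1 ?mul1r//.
  rewrite /line /= in_itv /= -ler_norml; near: n; exact: nbhs_infty_ger.
- move=> n x _ /=; rewrite absCM absC_ofR ler_piMl ?absC_ge0// indicE.
  by case: (_ \in _); rewrite ?normr1 ?normr0.
Unshelve. all: by end_near. Qed.

Lemma cintegral_split (k : R -> Cx R) (a s t : R) : a <= s -> s <= t ->
  cintegrable leb `[a, t] k ->
  cintegral leb `[a, t] k = cintegral leb `[a, s] k + cintegral leb `[s, t] k.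
Proof.
move=> as_ st H; have [i1 i2] := (cintegrableP leb (measurable_itv _) k).1 H.
have E (p : R -> R) : leb.-integrable `[a, t] (EFin \o p) ->
    Rintegral leb `[a, t] p = Rintegral leb `[a, s] p + Rintegral leb `[s, t] p.
  move=> ip; have ioc : leb.-integrable `]s, t] (EFin \o p).
    apply: (@integrableS _ (measurableTypeR R) R leb `[a, t]%classic) => //; try exact: measurable_itv.
    by move=> x; rewrite /= !in_itv /= => /andP[sx ->]; rewrite (le_trans as_ (ltW sx)).
  by rewrite -(Rintegral_itv_obnd_cbnd ioc) -(Rintegral_itvB ip) ?bnd_simp// addrC subrK.
by apply: Cx_ext; rewrite ?reCD ?imCD; exact: E.
Qed.

End LineIntegrals.

(** * The Poisson kernel and the two-sided exponential *)

Section PoissonKernel.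
Context {R : realType}.
Implicit Types (e x y : R).

(** The Poisson kernel of width [e], scaled to total mass [2 pi] so that it is the transform of
    [exp (- e |v|)] without a further constant. *)
Definition pker e x y : R := 2 * e / (e ^+ 2 + (y - x) ^+ 2).

Let den_gt0 e (d : R) : 0 < e -> 0 < e ^+ 2 + d ^+ 2.
Proof. by move=> e0; rewrite ltr_pwDl ?sqr_ge0// exprn_gt0. Qed.

Lemma pker_ge0 e x y : 0 < e -> 0 <= pker e x y.
Proof. by move=> e0; rewrite divr_ge0 ?mulr_ge0 ?ltW// den_gt0. Qed.

Lemma continuous_pker e x : 0 < e -> continuous (pker e x).
Proof.
move=> e0 y; apply: cvgM; first exact: cvg_cst.
apply: cvgV; first by rewrite gt_eqF// den_gt0.
apply: cvgD; first exact: cvg_cst.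
have c : y' - x @[y' --> y] --> y - x by apply: cvgB; [exact: cvg_id|exact: cvg_cst].
by rewrite !expr2; apply: cvgM.
Qed.

Lemma pker_mass e x : 0 < e ->
  leb.-integrable setT (EFin \o pker e x) /\ Rintegral leb setT (pker e x) = 2 * pi.
Proof.
move=> e0; have en : e != 0 by rewrite gt_eqF.
apply: (@integral_line _ _ (fun y => 2 * atan ((y - x) / e))).
- exact: continuous_pker.
- by move=> y; exact: pker_ge0.
- move=> y; have dl : is_derive y 1 (fun y => (y - x) / e) e^-1.
    apply/is_derive_epsP => q q0; exists 1 => // h _.
    by rewrite (_ : _ - _ = 0); [rewrite normr0 mulr_ge0// ltW|ring].
  have da (z : R) : is_derive z 1 (@atan R) (1 + z ^+ 2)^-1.
    by apply: DeriveDef; [exact: derivable_atan|rewrite -derive1E derive1_atan].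
  apply: (is_derive_eq (is_deriveZ 2 (is_derive1_comp (da _) dl))).
  rewrite /GRing.scale /= /pker.
  have h1 : e ^+ 2 + (y - x) ^+ 2 != 0 by rewrite gt_eqF// den_gt0.
  have h2 : 1 + ((y - x) / e) ^+ 2 != 0 by rewrite gt_eqF// ltr_pwDl// sqr_ge0.
  by field; rewrite en /=; apply/andP; split.
have c (z : R) : atan ((n%:R - z) / e) @[n --> \oo] --> (pi / 2 : R).
  apply: (@cvg_comp _ _ _ (fun n : nat => (n%:R - z) / e) (@atan R) _ (+oo : set_system R)); last exact: cvgy_atan.
  apply/cvgryPge => A; near=> n; rewrite ler_pdivlMr// lerBrDr.
  near: n; exact: nbhs_infty_ger.
have -> : (fun n => 2 * atan ((n%:R - x) / e) - 2 * atan ((- n%:R - x) / e)) =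
  (fun n => 2 * (atan ((n%:R - x) / e) + atan ((n%:R - - x) / e)) :> R).
  apply/funext => n; rewrite (_ : (- n%:R - x) / e = - ((n%:R - - x) / e)); last by ring.
  by rewrite atanN; ring.
apply: cvgM; first exact: cvg_cst.
rewrite (_ : pi = pi / 2 + pi / 2); last by field.
exact: (cvgD (c x) (c (- x))).
Unshelve. all: by end_near. Qed.

(** All widths are compared with the kernel of width 1, so that one weighted integrability condition
    on [h] serves for every [e]. *)
Lemma pker_le_unit e x y : 0 < e -> e <= 1 -> pker e x y <= e^-1 * pker 1 x y.
Proof.
move=> e0 e1; rewrite /pker expr1n mulr1 mulrA.
have s0 := sqr_ge0 (y - x).
rewrite ler_pdivrMr ?den_gt0// mulrAC ler_pdivlMr; last by rewrite ltr_pwDl.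
have -> : 2 * e * (1 + (y - x) ^+ 2) = e^-1 * 2 * (e ^+ 2 * (1 + (y - x) ^+ 2)).
  by field; rewrite gt_eqF.
apply: ler_wpM2l; first by rewrite mulr_ge0// invr_ge0 ltW.
rewrite mulrDr mulr1 lerD2l ler_piMl// expr2.
by rewrite -[X in _ <= X]mulr1; apply: ler_pM => //; exact: ltW.
Qed.

(** Off the centre [1 <= (y - x) ^ 2 / dl ^ 2], so the kernel is a factor [e] smaller than a fixed
    one; this makes the far part vanish with [e]. *)
Lemma pker_le_far e dl x y : 0 < e -> 0 < dl -> dl <= `|y - x| ->
  pker e x y <= e * (1 + dl ^- 2) * pker 1 x y.
Proof.
move=> e0 dl0 far; rewrite /pker expr1n mulr1.
have s0 := sqr_ge0 (y - x); have e20 := sqr_ge0 e.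
have h : 1 <= dl ^- 2 * (y - x) ^+ 2.
  rewrite mulrC ler_pdivlMr ?exprn_gt0// mul1r -[X in _ <= X]real_normK ?num_real//.
  by rewrite ler_pXn2r// nnegrE ltW.
rewrite ler_pdivrMr ?den_gt0// !mulrA mulrAC ler_pdivlMr; last by rewrite ltr_pwDl.
have -> : 2 * e * (1 + (y - x) ^+ 2) = e * 2 * (1 + (y - x) ^+ 2) by ring.
have -> : e * (1 + dl ^- 2) * 2 * (e ^+ 2 + (y - x) ^+ 2) =
  e * 2 * ((1 + dl ^- 2) * (e ^+ 2 + (y - x) ^+ 2)) by ring.
apply: ler_wpM2l; first by rewrite mulr_ge0// ltW.
have d0 : 0 <= dl ^- 2 by rewrite invr_ge0 sqr_ge0.
have := mulr_ge0 d0 e20; lra.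
Qed.

Definition pexp e (v : R) : R := expR (- (e * `|v|)).

Lemma pexp_ge0 e v : 0 <= pexp e v. Proof. exact: expR_ge0. Qed.

(** [exp s = exp (s / 2) ^ 2 >= (1 + s / 2) ^ 2] at [s = e |v|] dominates a multiple of [1 + v ^ 2];
    integrability is inherited from the Poisson kernel. *)
Lemma pexp_le e (v : R) : 0 < e -> e <= 1 -> pexp e v <= 2 * e ^- 2 * pker 1 0 v.
Proof.
move=> e0 e1; rewrite /pexp expRN /pker expr1n mulr1 subr0.
have v0 := normr_ge0 v; have s0 := sqr_ge0 v.
have h : e ^+ 2 / 4 * (1 + v ^+ 2) <= expR (e * `|v|).
  have -> : expR (e * `|v|) = expR (e * `|v| / 2) ^+ 2.
    by rewrite -expRM_natl; congr expR; field.
  have h1 := expR_ge1Dx (e * `|v| / 2).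
  have p0 : 0 <= 1 + e * `|v| / 2 by rewrite addr_ge0// divr_ge0// mulr_ge0// ltW.
  apply: (@le_trans _ _ ((1 + e * `|v| / 2) ^+ 2)); last by rewrite ler_pXn2r// nnegrE expR_ge0.
  rewrite -(real_normK (num_real v)); have e2 : e ^+ 2 <= 1 by rewrite expr_le1// ltW.
  have ev : 0 <= e * `|v| by rewrite mulr_ge0// ltW.
  by rewrite !expr2 in e2 *; nra.
have p1 : 0 < 1 + v ^+ 2 by rewrite ltr_pwDl.
have -> : 2 * e ^- 2 * (2 / (1 + v ^+ 2)) = (e ^+ 2 / 4 * (1 + v ^+ 2))^-1.
  by field; rewrite !gt_eqF.
by rewrite lef_pV2// posrE ?expR_gt0// mulr_gt0// divr_gt0// exprn_gt0.
Qed.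

Lemma pexp_le1 e (v : R) : 0 < e -> pexp e v <= 1.
Proof. by move=> e0; rewrite -expR0 ler_expR oppr_le0 mulr_ge0// ltW. Qed.

Lemma continuous_pexp e : continuous (pexp e).
Proof.
move=> v; apply: continuous_comp; last exact: continuous_expR.
by apply: cvgN; apply: cvgM; [exact: cvg_cst|exact: cvg_norm].
Qed.

Lemma pexp_integrable e : 0 < e -> e <= 1 -> leb.-integrable setT (EFin \o pexp e).
Proof.
move=> e0 e1.
have i : leb.-integrable setT (EFin \o (fun v => 2 * e ^- 2 * pker 1 0 v)).
  have := integrableZl measurableT (2 * e ^- 2) (pker_mass 0 ltr01).1.
  by apply: eq_integrable.
apply: le_integrable i => //.
  by apply/measurable_EFinP; apply: continuous_measurable_fun; exact: continuous_pexp.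
move=> v _; rewrite /= lee_fin (ger0_norm (pexp_ge0 _ _)).
exact: le_trans (pexp_le v e0 e1) (ler_norm _).
Qed.

End PoissonKernel.

Section PoissonTransform.
Context {R : realType}.
Implicit Types (e d : R).

Definition pwave e d (v : R) : Cx R := ofR (pexp e v) * cis (v * d).

Lemma absC_pwave e d v : absC (pwave e d v) = pexp e v.
Proof. by rewrite absCM absC_ofR absC_cis mulr1 (ger0_norm (pexp_ge0 _ _)). Qed.

Lemma continuous_pwave e d : continuous (pwave e d).
Proof.
move=> v; apply: cvgM.
  by apply: continuous_comp; [exact: continuous_pexp|exact: continuous_ofR].
apply: continuous_comp; last exact: continuous_cis.
by apply: cvgM; [exact: cvg_id|exact: cvg_cst].
Qed.

Lemma pwave_cintegrable e d : 0 < e -> e <= 1 -> cintegrable leb setT (pwave e d).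
Proof.
move=> e0 e1.
apply: (@cintegrable_le R _ (measurableTypeR R) leb setT measurableT _ _ _ (pexp_integrable e0 e1)).
  by apply: continuous_cmeasurable; exact: continuous_pwave.
by move=> v _; rewrite absC_pwave.
Qed.

Lemma cvg_expC_nat (z : Cx R) : reC z < 0 -> expC (ofR n%:R * z) @[n --> \oo] --> (0 : Cx R).
Proof.
move=> z0; apply/cvgCx_absP.
have -> : (fun n => absC (expC (ofR n%:R * z) - 0)) = (fun n => expR (reC z) ^+ n).
  by apply/funext => n; rewrite subr0 absC_expC reCM /= mul0r subr0 expRM_natl.
by apply: cvg_expr; rewrite ger0_norm ?expR_ge0// -expR0 ltr_expR.
Qed.

Lemma poisson_transform e d : 0 < e -> e <= 1 ->
  cintegral leb setT (pwave e d) = ofR (2 * e / (e ^+ 2 + d ^+ 2)).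
Proof.
move=> e0 e1.
(* The wave is [exp (v z1)] on the right half-line and [exp (v z2)] on the left one; together they
   contribute [1 / z2 - 1 / z1]. *)
pose z1 : Cx R := Complex (- e) d; pose z2 : Cx R := Complex e d.
have z1n : z1 != 0 by apply/eqP => /(congr1 reC) /eqP; rewrite /= oppr_eq0 gt_eqF.
have z2n : z2 != 0 by apply/eqP => /(congr1 reC) /eqP; rewrite /= gt_eqF.
have pos n : cintegral leb `[0, n%:R] (pwave e d) = (expC (ofR n%:R * z1) - 1) * z1^-1.
  have n0 : (0 : R) <= n%:R by [].
  rewrite -[X in expC (ofR X * _)]subr0 -(cintegral_expC z1 z1^-1 n0).
  apply: (@eq_cintegral R _ (measurableTypeR R) leb `[0, n%:R]%classic).
  move=> v /=; rewrite in_itv /= => /andP[v0 _].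
  rewrite mulrAC divff// mul1r subr0 /pwave /pexp /expC reCM imCM /= !mul0r subr0 addr0.
  by rewrite (ger0_norm v0) mulrN [e * v]mulrC.
have neg n : cintegral leb `[- n%:R, 0] (pwave e d) = (1 - expC (ofR n%:R * - z2)) * z2^-1.
  have n0 : - n%:R <= (0 : R) by rewrite oppr_le0.
  have E : expC (ofR n%:R * z2) * expC (ofR n%:R * - z2) = 1.
    by rewrite -expCD mulrN subrr expC0.
  transitivity ((expC (ofR (0 - - n%:R) * z2) - 1) * (z2^-1 * expC (ofR n%:R * - z2))).
    rewrite -(cintegral_expC z2 _ n0).
    apply: (@eq_cintegral R _ (measurableTypeR R) leb `[- n%:R, 0]%classic).
    move=> v /=; rewrite in_itv /= => /andP[_ v0].
    rewrite mulrACA divff// mul1r -expCD (_ : _ + _ = ofR v * z2); last by rewrite !rmorphB rmorphN /=; ring.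
    rewrite /pwave /pexp /expC reCM imCM /= !mul0r subr0 addr0.
    by rewrite (ler0_norm v0) mulrN opprK [e * v]mulrC.
  rewrite sub0r opprK.
  transitivity ((expC (ofR n%:R * z2) * expC (ofR n%:R * - z2) - expC (ofR n%:R * - z2)) * z2^-1).
    by ring.
  by rewrite E.
have ik := pwave_cintegrable d e0 e1.
have sp n : cintegral leb `[- n%:R, n%:R] (pwave e d) =
    (1 - expC (ofR n%:R * - z2)) * z2^-1 + (expC (ofR n%:R * z1) - 1) * z1^-1.
  rewrite -neg -pos; apply: cintegral_split; rewrite ?oppr_le0//.
  by apply: continuous_cintegrable; exact: continuous_pwave.
have cv := cvg_cintegral_line ik.
have E : (fun n => cintegral leb `[- n%:R, n%:R] (pwave e d)) = (fun n =>
    (1 - expC (ofR n%:R * - z2)) * z2^-1 + (expC (ofR n%:R * z1) - 1) * z1^-1).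
  by apply/funext => n; exact: sp.
rewrite E in cv.
have c1 : expC (ofR n%:R * z1) @[n --> \oo] --> (0 : Cx R).
  by apply: cvg_expC_nat; rewrite /= oppr_lt0.
have c2 : expC (ofR n%:R * - z2) @[n --> \oo] --> (0 : Cx R).
  by apply: cvg_expC_nat; rewrite /= oppr_lt0.
have cl : (1 - expC (ofR n%:R * - z2)) * z2^-1 + (expC (ofR n%:R * z1) - 1) * z1^-1
    @[n --> \oo] --> (1 - 0) * z2^-1 + (0 - 1) * z1^-1.
  apply: cvgD; (apply: cvgM; last exact: cvg_cst).
    exact: (cvgB (cvg_cst _) c2).
  exact: (cvgB c1 (cvg_cst _)).
rewrite (cvg_unique _ cv cl).
apply: (mulfI z1n); apply: (mulfI z2n).
have -> : z2 * (z1 * ((1 - 0) * z2^-1 + (0 - 1) * z1^-1)) = z1 - z2 by field; rewrite z1n z2n.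
have dn : e ^+ 2 + d ^+ 2 != 0 by rewrite gt_eqF// ltr_pwDl ?sqr_ge0// exprn_gt0.
  by apply: Cx_ext; rewrite ?(reCD, imCD, reCN, imCN, reCM, imCM) /=; field; exact: dn.
exact: norm_hausdorff.
Qed.

End PoissonTransform.

(** * Pairings in L2 and approximation by the Poisson kernel *)

Section FourierInversion.
Context {R : realType}.
Let M := measurableTypeR R.
Implicit Types (f g h : M -> Cx R) (e x : R).

Lemma cintegral_ofR (k : M -> R) : cintegral leb setT (fun y => ofR (k y)) = ofR (Rintegral leb setT k).
Proof.
apply: Cx_ext => //=; rewrite (@eq_Rintegral _ M R leb setT (cst 0))//.
by rewrite /cst Rintegral_cst// mul0r.
Qed.

Lemma continuous_cmeasurableT f : continuous (f : R -> Cx R) -> @cmeasurable R _ M setT f.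
Proof. by move=> cf; exact: continuous_cmeasurable. Qed.

Lemma cmeasurable_pker e x : 0 < e -> @cmeasurable R _ M setT (fun y => ofR (pker e x y)).
Proof.
by move=> e0; apply: cmeasurable_ofR; apply: continuous_measurable_fun; exact: continuous_pker.
Qed.

Lemma integrable_young f g : cmeasurable setT f -> cmeasurable setT g ->
  leb.-integrable setT (EFin \o (fun y => absC (f y) ^+ 2)) ->
  leb.-integrable setT (EFin \o (fun y => absC (g y) ^+ 2)) ->
  cintegrable leb setT (fun y => f y * g y).
Proof.
move=> mf mg i1 i2.
have i : leb.-integrable setT (EFin \o (fun y => absC (f y) ^+ 2 + absC (g y) ^+ 2)).
  by have := integrableD measurableT i1 i2; apply: eq_integrable.
apply: (@cintegrable_le R _ M leb setT measurableT _ _ _ i); first exact: cmeasurableM.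
move=> y _; rewrite absCM; set A := absC (f y); set B := absC (g y).
have := sqr_ge0 (A - B); have := sqr_ge0 (A + B); rewrite sqrrB sqrrD; lra.
Qed.

Lemma csquare_integrableP f : csquare_integrable leb f ->
  leb.-integrable setT (EFin \o (fun y => absC (f y) ^+ 2)).
Proof.
move=> [mf foo]; apply/integrableP; split.
  by apply/measurable_EFinP; apply: measurable_funX; exact: cmeasurable_absC.
by under eq_integral do rewrite /= ger0_norm ?sqr_ge0//.
Qed.

(** The weighted inequality [A B <= l A ^ 2 / 2 + B ^ 2 / (2 l)] plays the role of
    Cauchy-Schwarz. *)
Lemma L2_pairing (fn : nat -> M -> Cx R) f g :
  (forall n, cmeasurable setT (fn n)) -> cmeasurable setT f -> cvg_L2 leb fn f ->
  csquare_integrable leb g -> (forall n, cintegrable leb setT (fun y => fn n y * g y)) ->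
  cintegrable leb setT (fun y => f y * g y) ->
  cintegral leb setT (fun y => fn n y * g y) @[n --> \oo] --> cintegral leb setT (fun y => f y * g y).
Proof.
move=> mfn mf cv sg ifn if_; apply/cvgCxP => q q0.
have ig := csquare_integrableP sg; have mg := sg.1.
pose G := Rintegral leb setT (fun y => absC (g y) ^+ 2).
have G0 : 0 <= G by apply: Rintegral_ge0 => y _; exact: sqr_ge0.
(* With this weight the term in [g] is at most [q / 2] for every [n]; then [n] is taken so large
   that the other integral is below [q / l]. The [+ 1] covers [G = 0]. *)
pose l := (G + 1) / q; have l0 : 0 < l by rewrite divr_gt0// ltr_wpDl.
have ql : 0 < q / l by rewrite divr_gt0.
have near0 : \forall n \near \oo, ((\int[leb]_y (absC (fn n y - f y) ^+ 2)%:E) < (q / l)%:E)%E.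
  have /fine_cvgP[fn_fin fn_cv] := cv.
  have fn_lt : \forall n \near \oo, fine (\int[leb]_y (absC (fn n y - f y) ^+ 2)%:E)%E < q / l.
    exact: (cvgr_lt 0 fn_cv _ ql).
  by move: fn_fin fn_lt; apply: filterS2 => n nfin nlt; rewrite -(fineK nfin) lte_fin.
apply: filterS near0 => n an.
have md : cmeasurable setT (fun y => fn n y - f y) by exact: cmeasurableB.
have ia : leb.-integrable setT (EFin \o (fun y => absC (fn n y - f y) ^+ 2)).
  by apply: csquare_integrableP; split=> //; exact: lt_trans an (ltry _).
pose a := Rintegral leb setT (fun y => absC (fn n y - f y) ^+ 2).
have aq : a < q / l.
  rewrite -lte_fin /a /Rintegral fineK//; exact: integrable_fin_num ia.
rewrite absC_distC -(cintegralB measurableT (ifn n) if_).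
have ib : leb.-integrable setT (EFin \o (fun y => l / 2 * absC (fn n y - f y) ^+ 2)).
  by have := integrableZl measurableT (l / 2) ia; apply: eq_integrable.
have ic : leb.-integrable setT (EFin \o (fun y => l^-1 / 2 * absC (g y) ^+ 2)).
  by have := integrableZl measurableT (l^-1 / 2) ig; apply: eq_integrable.
have ibc : leb.-integrable setT (EFin \o (fun y => l / 2 * absC (fn n y - f y) ^+ 2 +
    l^-1 / 2 * absC (g y) ^+ 2)).
  by have := integrableD measurableT ib ic; apply: eq_integrable.
have bd y : setT y -> absC (fn n y * g y - f y * g y) <=
    l / 2 * absC (fn n y - f y) ^+ 2 + l^-1 / 2 * absC (g y) ^+ 2.
  move=> _; rewrite -mulrBl absCM; set A := absC (fn n y - f y); set B := absC (g y).
  have := mulr_ge0 (ltW l0) (sqr_ge0 (A - l^-1 * B)).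
  have -> : l * (A - l^-1 * B) ^+ 2 = l * A ^+ 2 - 2 * (A * B) + l^-1 * B ^+ 2.
    by field; rewrite gt_eqF.
  by lra.
have mm : cmeasurable setT (fun y => fn n y * g y - f y * g y).
  by apply: cmeasurableB; apply: cmeasurableM.
apply: (le_lt_trans (@absC_cintegral_le_bound R _ M leb setT measurableT _ _ mm ibc bd)).
rewrite RintegralD// !RintegralZl// -/a -/G.
have h1 : l / 2 * a < q / 2.
  move: aq; rewrite ltr_pdivlMr// => aq.
  by rewrite (_ : l / 2 * a = a * l / 2); [lra|ring].
have h2 : l^-1 / 2 * G <= q / 2.
  have lq : l^-1 * G <= q.
    rewrite /l invf_div -mulrA ler_piMr ?(ltW q0)// mulrC ler_pdivrMr; first by rewrite mul1r; lra.
    by lra.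
  by rewrite (_ : l^-1 / 2 * G = l^-1 * G / 2); [lra|ring].
by lra.
Qed.

Lemma poisson_approx h x : continuous (h : R -> Cx R) ->
  leb.-integrable setT (EFin \o (fun y => absC (h y) * pker 1 x y)) ->
  cintegral leb setT (fun y => ofR (pker n.+1%:R^-1 x y) * h y) @[n --> \oo] --> ofR (2 * pi) * h x.
Proof.
move=> ch iw; apply/cvgCxP => q q0.
have p0 : (0 : R) < pi by exact: pi_gt0.
(* The near part contributes [eta] times the mass [2 pi], that is [q / 4]; the far part will be
   below [q / 2]. *)
pose eta := q / (8 * pi); have eta0 : 0 < eta by rewrite divr_gt0// mulr_gt0.
have qe : eta * (2 * pi) = q / 4.
  rewrite /eta; have : (pi : R) != 0 by rewrite gt_eqF.
  move: (pi : R) => c cn; field; exact: cn.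
have [dl dl0 near_h] : exists2 dl : R, 0 < dl & forall y, `|y - x| < dl -> absC (h y - h x) <= eta.
  have /cvgCxP/(_ _ eta0)[dl /= dl0 H] := ch x; exists dl => // y yx.
  by apply: ltW; rewrite -absC_distC; apply: H; rewrite /= distrC.
(* An integrable majorant of [|h y - h x|] against the kernel of width 1, independent of [e]. *)
pose W (y : R) := absC (h y) * pker 1 x y + absC (h x) * pker 1 x y.
have [ip1 _] := pker_mass x (@ltr01 R).
have iW : leb.-integrable setT (EFin \o W).
  have i2 := integrableZl measurableT (absC (h x)) ip1.
  by have := integrableD measurableT iw i2; apply: eq_integrable.
pose I := Rintegral leb setT W; pose D := 1 + dl ^- 2.
have D0 : 0 <= D by rewrite addr_ge0// invr_ge0 sqr_ge0.
have W0 y : 0 <= W y by rewrite /W addr_ge0// mulr_ge0 ?absC_ge0// pker_ge0.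
have I0 : 0 <= I by apply: Rintegral_ge0 => y _; exact: W0.
have c0 : n.+1%:R^-1 * (D * I) @[n --> \oo] --> (0 : R).
  rewrite -[X in _ --> X](mul0r (D * I)); apply: cvgM; last exact: cvg_cst.
  exact: cvg_invS.
have q2 : 0 < q / 2 by rewrite divr_gt0.
have small : \forall n \near \oo, n.+1%:R^-1 * (D * I) < q / 2 by exact: (cvgr_lt 0 c0 _ q2).
apply: filterS small => n nq.
pose e : R := n.+1%:R^-1; have e0 : 0 < e by rewrite invr_gt0.
have e1 : e <= 1 by rewrite invf_le1// ler1n.
have [ip pm] := pker_mass x e0.
have mp := cmeasurable_pker x e0.
have iph : cintegrable leb setT (fun y => ofR (pker e x y) * h y).
  have i3 : leb.-integrable setT (EFin \o (fun y => e^-1 * (absC (h y) * pker 1 x y))).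
    by have := integrableZl measurableT e^-1 iw; apply: eq_integrable.
  apply: (@cintegrable_le R _ M leb setT measurableT _ _ _ i3).
    by apply: cmeasurableM => //; exact: continuous_cmeasurableT.
  move=> y _; rewrite absCM absC_ofR ger0_norm ?pker_ge0// mulrCA [X in X <= _]mulrC.
  by apply: ler_wpM2l; [exact: absC_ge0|exact: pker_le_unit].
have ipc : cintegrable leb setT (fun y => h x * ofR (pker e x y)).
  apply: (@cintegrableZ R _ M leb setT measurableT).
  apply: (@cintegrable_le R _ M leb setT measurableT _ _ mp ip) => y _.
  by rewrite absC_ofR ger0_norm// pker_ge0.
have -> : ofR (2 * pi) * h x = cintegral leb setT (fun y => h x * ofR (pker e x y)).
  rewrite (@cintegralZ R _ M leb setT measurableT).
    by rewrite cintegral_ofR pm mulrC.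
  apply: (@cintegrable_le R _ M leb setT measurableT _ _ mp ip) => y _.
  by rewrite absC_ofR ger0_norm// pker_ge0.
rewrite absC_distC -(cintegralB measurableT iph ipc).
have i1 : leb.-integrable setT (EFin \o (fun y => eta * pker e x y)).
  by have := integrableZl measurableT eta ip; apply: eq_integrable.
have i2 : leb.-integrable setT (EFin \o (fun y => e * D * W y)).
  by have := integrableZl measurableT (e * D) iW; apply: eq_integrable.
have i12 : leb.-integrable setT (EFin \o (fun y => eta * pker e x y + e * D * W y)).
  by have := integrableD measurableT i1 i2; apply: eq_integrable.
have bd y : setT y -> absC (ofR (pker e x y) * h y - h x * ofR (pker e x y)) <=
    eta * pker e x y + e * D * W y.
  move=> _; rewrite [h x * _]mulrC -mulrBr absCM absC_ofR ger0_norm ?pker_ge0//.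
  have pk0 := pker_ge0 x y e0.
  have w0 : 0 <= e * D * W y by rewrite mulr_ge0// mulr_ge0// ltW.
  have [near|far] := ltP `|y - x| dl.
    have := ler_wpM2l pk0 (near_h y near); rewrite [_ * eta]mulrC; lra.
  have pf := pker_le_far e0 dl0 far.
  have hd : absC (h y - h x) <= absC (h y) + absC (h x) by exact: ler_absCB.
  have e3 : pker e x y * absC (h y - h x) <= e * D * pker 1 x y * (absC (h y) + absC (h x)).
    by apply: ler_pM => //; exact: absC_ge0.
  have -> : e * D * W y = e * D * pker 1 x y * (absC (h y) + absC (h x)) by rewrite /W; ring.
  have : 0 <= eta * pker e x y by rewrite mulr_ge0// ltW.
  by lra.
have mm : cmeasurable setT (fun y : M => ofR (pker e x y) * h y - h x * ofR (pker e x y)).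
  apply: cmeasurableB; first by apply: cmeasurableM => //; exact: continuous_cmeasurableT.
  exact: cmeasurableZ.
apply: (le_lt_trans (@absC_cintegral_le_bound R _ M leb setT measurableT _ _ mm i12 bd)).
have E1 : Rintegral leb setT (fun y : M => eta * pker e x y) = q / 4.
  rewrite -qe -pm; exact: (@RintegralZl _ M R leb setT).
have E2 : Rintegral leb setT (fun y : M => e * D * W y) = e * (D * I).
  by rewrite RintegralZl// -/I mulrA.
rewrite (RintegralD measurableT i1 i2) E1 E2.
by move: nq; rewrite -/e; lra.
Qed.

End FourierInversion.

Section Inversion.
Context {R : realType}.
Let M := measurableTypeR R.
Implicit Types (f g h : M -> Cx R) (e x : R).

Lemma cmeasurable_fourier f : cintegrable leb setT f -> @cmeasurable R _ M setT (fourier_integral f).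
Proof.
move=> [mf foo]; have if_ : cintegrable leb setT f by [].
apply: (@cmeasurable_cintegral_param R _ _ M M leb setT setT measurableT measurableT
  (fun p => f p.2 * cis (- (p.1 * p.2)))).
  rewrite setXTT; apply: cmeasurableM; first exact: (cmeasurableT_comp mf measurable_snd).
  apply: (cmeasurable_cis (f := fun p : M * M => - (p.1 * p.2))).
  by apply: measurableT_comp => //; apply: measurable_funM.
move=> v _; apply: (@cintegrable_le R _ M leb setT measurableT _ _ _ (cintegrable_absC if_)).
  apply: cmeasurableM => //; apply: (cmeasurable_cis (f := fun y : M => - (v * y))).
  by apply: measurableT_comp => //; apply: measurable_funM.
by move=> y _; rewrite absCM absC_cis mulr1.
Qed.

Lemma cintegral_pwave e x y : 0 < e -> e <= 1 ->
  cintegral leb setT (pwave e (x - y)) = ofR (pker e x y).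
Proof. by move=> e0 e1; rewrite poisson_transform// /pker -(sqrrN (y - x)) opprB. Qed.

(** The damping [exp (- e |v|)] makes the double integral absolutely convergent; after Fubini the
    inner integral over [v] is the Poisson kernel. *)
Lemma multiplication_formula f e x : cintegrable leb setT f -> 0 < e -> e <= 1 ->
  cintegrable leb setT (fun v => fourier_integral f v * pwave e x v) /\
  cintegral leb setT (fun v => fourier_integral f v * pwave e x v) =
  cintegral leb setT (fun y => f y * ofR (pker e x y)).
Proof.
move=> if_ e0 e1; have [mf foo] := if_.
pose k (p : M * M) := f p.2 * cis (- (p.1 * p.2)) * pwave e x p.1.
have kE v y : k (v, y) = f y * pwave e (x - y) v.
  rewrite /k /pwave /= -mulrA [cis _ * _]mulrC -mulrA -cisD.
  by congr (_ * (_ * cis _)); ring.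
have mwave : @cmeasurable R _ M setT (pwave e x).
  by apply: continuous_cmeasurable; exact: continuous_pwave.
have mk : cmeasurable (setT `*` setT) k.
  rewrite setXTT; apply: cmeasurableM; last exact: (cmeasurableT_comp mwave measurable_fst).
  apply: cmeasurableM; first exact: (cmeasurableT_comp mf measurable_snd).
  apply: (cmeasurable_cis (f := fun p : M * M => - (p.1 * p.2))).
  by apply: measurableT_comp => //; apply: measurable_funM.
have mw' d : @cmeasurable R _ M setT (pwave e d).
  by apply: continuous_cmeasurable; exact: continuous_pwave.
have i1 v : setT v -> cintegrable leb setT (fun y => k (v, y)).
  move=> _; apply: (@cintegrable_le R _ M leb setT measurableT _ _ _ (cintegrable_absC if_)).
    apply: cmeasurableM; last exact: (@cmeasurable_cst R _ M setT (pwave e x v)).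
    apply: cmeasurableM => //; apply: (cmeasurable_cis (f := fun y : M => - (v * y))).
    by apply: measurableT_comp => //; apply: measurable_funM.
  move=> y _; rewrite kE absCM absC_pwave ler_piMr ?absC_ge0//; exact: pexp_le1.
have i2 y : setT y -> cintegrable leb setT (fun v => k (v, y)).
  move=> _; apply: (@eq_cintegrable R _ M leb setT (fun v => f y * pwave e (x - y) v)).
    by move=> v _; rewrite kE.
  apply: (@cintegrableZ R _ M leb setT measurableT); exact: pwave_cintegrable.
pose I := Rintegral leb setT (fun y => absC (f y)).
have inner v : (\int[leb]_y (absC (k (v, y)))%:E = (I * pexp e v)%:E)%E.
  have ia : leb.-integrable setT (EFin \o (fun y => pexp e v * absC (f y))).
    by have := integrableZl measurableT (pexp e v) (cintegrable_absC if_); apply: eq_integrable.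
  have -> : (I * pexp e v)%:E = (Rintegral leb setT (fun y => pexp e v * absC (f y)))%:E.
    by rewrite RintegralZl//; [rewrite mulrC|exact: cintegrable_absC if_].
  rewrite /Rintegral fineK; last exact: integrable_fin_num ia.
  by apply: eq_integral => y _; rewrite kE absCM absC_pwave mulrC.
have fin : (\int[leb]_v \int[leb]_y (absC (k (v, y)))%:E < +oo)%E.
  have ie : leb.-integrable setT (EFin \o (fun v => I * pexp e v)).
    by have := integrableZl measurableT I (pexp_integrable e0 e1); apply: eq_integrable.
  by under eq_integral do rewrite inner; exact: integrable_lty ie.
have [h1 _ h3] := @cFubini R _ _ M M leb leb setT setT measurableT measurableT k mk i1 i2 fin.
have E v : cintegral leb setT (fun y => k (v, y)) = fourier_integral f v * pwave e x v.
  rewrite mulrC -(@cintegralZ R _ M leb setT measurableT).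
    by apply: eq_cintegral => y _; rewrite /k mulrC.
  apply: (@cintegrable_le R _ M leb setT measurableT _ _ _ (cintegrable_absC if_)).
    apply: cmeasurableM; first exact: mf.
    apply: (cmeasurable_cis (f := fun y : M => - (v * y))).
    by apply: measurableT_comp => //; apply: measurable_funM.
  by move=> y _; rewrite absCM absC_cis mulr1.
have E2 y : cintegral leb setT (fun v => k (v, y)) = f y * ofR (pker e x y).
  rewrite (@eq_cintegral R _ M leb setT _ (fun v => f y * pwave e (x - y) v)); last first.
    by move=> v _; rewrite kE.
  rewrite (@cintegralZ R _ M leb setT measurableT); last exact: pwave_cintegrable.
  by rewrite (cintegral_pwave _ _ e0 e1).
split.
  by apply: eq_cintegrable h1 => v _; exact: E.
rewrite -(@eq_cintegral R _ M leb setT _ _ (fun v _ => E v)) h3.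
by apply: eq_cintegral => y _; exact: E2.
Qed.

Lemma pwave_square e x : 0 < e -> e <= 1 -> csquare_integrable leb (pwave e x).
Proof.
move=> e0 e1; split; first by apply: continuous_cmeasurable; exact: continuous_pwave.
have ip := pexp_integrable e0 e1.
have i2 : leb.-integrable setT (EFin \o (fun v => absC (pwave e x v) ^+ 2)).
  apply: (Rintegrable_le measurableT _ ip).
    apply: measurable_funX; apply: cmeasurable_absC.
    by apply: continuous_cmeasurable; exact: continuous_pwave.
  move=> v _; rewrite ger0_norm ?sqr_ge0// absC_pwave expr2.
  by rewrite ler_piMr ?pexp_ge0// pexp_le1.
exact: integrable_lty i2.
Qed.

Lemma pker_square e x : 0 < e -> csquare_integrable leb (fun y => ofR (pker e x y)).
Proof.
move=> e0; have mp := cmeasurable_pker x e0; split=> //.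
have [ip _] := pker_mass x e0.
have bd y : pker e x y <= 2 / e.
  rewrite /pker ler_pdivrMr ?ltr_pwDl ?sqr_ge0 ?exprn_gt0//.
  have -> : 2 / e * (e ^+ 2 + (y - x) ^+ 2) = 2 * e + 2 / e * (y - x) ^+ 2.
    by field; rewrite gt_eqF.
  by rewrite lerDl mulr_ge0// ?sqr_ge0// divr_ge0// ltW.
have i1 : leb.-integrable setT (EFin \o (fun y => 2 / e * pker e x y)).
  by have := integrableZl measurableT (2 / e) ip; apply: eq_integrable.
have i2 : leb.-integrable setT (EFin \o (fun y => absC (ofR (pker e x y) : Cx R) ^+ 2)).
  apply: (Rintegrable_le measurableT _ i1).
    by apply: measurable_funX; exact: cmeasurable_absC.
  move=> y _; rewrite ger0_norm ?sqr_ge0// absC_ofR (ger0_norm (pker_ge0 _ _ e0)).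
  by rewrite expr2; apply: ler_wpM2r; [exact: pker_ge0|exact: bd].
exact: integrable_lty i2.
Qed.

(** In the L2 case the formula holds along the approximating sequence and passes to the limit on
    both sides, because the wave and the kernel are both square integrable. *)
Lemma poisson_pairing h g e x : is_fourier_transform h g -> cmeasurable setT h ->
  0 < e -> e <= 1 ->
  cintegral leb setT (fun v => g v * pwave e x v) =
  cintegral leb setT (fun y => h y * ofR (pker e x y)).
Proof.
move=> [[ih gE]|[_ sh sg [phi [iphi ch cg]]]] mh e0 e1.
  have -> : g = fourier_integral h by apply/funext => v; exact: gE.
  by have [] := multiplication_formula x ih e0 e1.
have sw := pwave_square x e0 e1; have sp := pker_square x e0.
have cl : cintegral leb setT (fun v => fourier_integral (phi n) v * pwave e x v) @[n --> \oo] -->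
    cintegral leb setT (fun v => g v * pwave e x v).
  apply: L2_pairing => //.
  - by move=> n; apply: cmeasurable_fourier; have [] := iphi n.
  - exact: sg.1.
  - by move=> n; have [i1 _] := iphi n; have [] := multiplication_formula x i1 e0 e1.
  - apply: integrable_young; [exact: sg.1|exact: sw.1|exact: csquare_integrableP|exact: csquare_integrableP].
have cr : cintegral leb setT (fun y => phi n y * ofR (pker e x y)) @[n --> \oo] -->
    cintegral leb setT (fun y => h y * ofR (pker e x y)).
  apply: L2_pairing => //.
  - by move=> n; have [[]] := iphi n.
  - move=> n; have [[m1 _] s1] := iphi n.
    apply: integrable_young; [exact: m1|exact: sp.1|exact: csquare_integrableP|exact: csquare_integrableP].
  - apply: integrable_young; [exact: mh|exact: sp.1|exact: csquare_integrableP|exact: csquare_integrableP].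
have E : (fun n => cintegral leb setT (fun v => fourier_integral (phi n) v * pwave e x v)) =
    (fun n => cintegral leb setT (fun y => phi n y * ofR (pker e x y))).
  by apply/funext => n; have [i1 _] := iphi n; have [] := multiplication_formula x i1 e0 e1.
rewrite E in cl; exact: (cvg_unique (@norm_hausdorff _ _) cl cr).
Qed.

(** For integrable [h] the kernel is bounded by 2; for square integrable [h] it is square
    integrable. *)
Lemma fourier_weighted h g x : is_fourier_transform h g -> cmeasurable setT h ->
  leb.-integrable setT (EFin \o (fun y => absC (h y) * pker 1 x y)).
Proof.
move=> H mh.
have mw : measurable_fun setT (fun y => absC (h y) * pker 1 x y).
  apply: measurable_funM; first exact: cmeasurable_absC.
  by apply: continuous_measurable_fun; apply: continuous_pker.
have [[ih _]|[_ sh _ _]] := H.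
  have i2 : leb.-integrable setT (EFin \o (fun y => 2 * absC (h y))).
    by have := integrableZl measurableT 2 (cintegrable_absC ih); apply: eq_integrable.
  apply: (Rintegrable_le measurableT mw i2) => y _.
  rewrite ger0_norm; last by apply: mulr_ge0; [exact: absC_ge0|exact: pker_ge0].
  rewrite mulrC; apply: ler_wpM2r; first exact: absC_ge0.
  rewrite /pker expr1n mulr1 ler_pdivrMr ?ltr_pwDl ?sqr_ge0//.
  by have := sqr_ge0 (y - x); lra.
have i := integrable_young mh (pker_square x (@ltr01 R)).1 (csquare_integrableP sh)
  (csquare_integrableP (pker_square x (@ltr01 R))).
have := cintegrable_absC i; apply: eq_integrable => // y _ /=.
by rewrite absCM absC_ofR (ger0_norm (pker_ge0 _ _ ltr01)).
Qed.

(** As the width tends to 0 in [poisson_pairing], the kernel side tends to [2 pi h x] by continuity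
    of [h], and the frequency side converges by domination with the integrable [g]. The identity
    therefore holds at every point. *)
Lemma fourier_inversion h g x : continuous (h : R -> Cx R) -> is_fourier_transform h g ->
  cintegrable leb setT g ->
  ofR (2 * pi) * h x = cintegral leb setT (fun v => g v * cis (v * x)).
Proof.
move=> ch H ig; have mh := continuous_cmeasurableT ch; have [mg _] := ig.
have c1 := poisson_approx ch (fourier_weighted x H mh).
have e0 n : (0 : R) < n.+1%:R^-1 by rewrite invr_gt0.
have e1 n : (n.+1%:R^-1 : R) <= 1 by rewrite invf_le1// ler1n.
have E : (fun n => cintegral leb setT (fun y => ofR (pker n.+1%:R^-1 x y) * h y)) =
    (fun n => cintegral leb setT (fun v => g v * pwave n.+1%:R^-1 x v)).
  apply/funext => n; rewrite (poisson_pairing x H mh (e0 n) (e1 n)).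
  by apply: eq_cintegral => y _; rewrite mulrC.
rewrite E in c1.
have [_ c2] : cintegrable leb setT (fun v => g v * cis (v * x)) /\
    cintegral leb setT (fun v => g v * pwave n.+1%:R^-1 x v) @[n --> \oo] -->
    cintegral leb setT (fun v => g v * cis (v * x)).
  apply: (@cdominated_cvg R _ M leb setT measurableT _ _ _ _ _ (cintegrable_absC ig)).
  - move=> n; apply: cmeasurableM => //.
    by apply: continuous_cmeasurable; exact: continuous_pwave.
  - move=> v _; apply: cvgM; first exact: cvg_cst.
    rewrite -[X in _ --> X]mul1r; apply: cvgM; last exact: cvg_cst.
    rewrite -ofR1; apply: cvg_ofR; rewrite -[X in _ --> X]expR0.
    apply: continuous_cvg; first exact: continuous_expR.
    rewrite -[X in _ --> X]oppr0; apply: cvgN; rewrite -[X in _ --> X](mul0r `|v|).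
    by apply: cvgM; [exact: cvg_invS|exact: cvg_cst].
  - move=> n v _; rewrite absCM absC_pwave ler_piMr ?absC_ge0//; exact: pexp_le1.
exact: (cvg_unique (@norm_hausdorff _ _) c1 c2).
Qed.

End Inversion.

(** * The evolution of the coefficients *)

Section Moments.
Context {R : realType}.
Let M := measurableTypeR R.
Implicit Types (D E : M -> Cx R) (z : Cx R).

(** Densities with all exponential moments: their transforms extend to entire functions, and the
    class is stable under multiplication by the frequency, by [psi] and by [exp (t psi)]. *)
Definition exp_density D := cmeasurable setT D /\ forall q : R,
  leb.-integrable setT (EFin \o (fun v : M => absC (D v) * expR (q * `|v|))).

Lemma exp_density_le D E (k C : R) : exp_density D -> cmeasurable setT E ->
  (forall v : R, absC (E v) <= C * expR (k * `|v|) * absC (D v)) -> exp_density E.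
Proof.
move=> [mD iD] mE ED; split=> // q.
have i : leb.-integrable setT (EFin \o (fun v : M => C * (absC (D v) * expR ((k + q) * `|v|)))).
  by have := integrableZl measurableT C (iD (k + q)); apply: eq_integrable.
apply: (Rintegrable_le measurableT _ i).
  apply: measurable_funM; first exact: cmeasurable_absC.
  by apply: measurableT_comp => //; apply: measurable_funM => //; exact: normr_measurable.
move=> v _; rewrite ger0_norm; last by rewrite mulr_ge0// ?absC_ge0// expR_ge0.
apply: (le_trans (ler_wpM2r (expR_ge0 _) (ED v))).
by rewrite mulrDl expRD le_eqVlt; apply/orP; left; apply/eqP; ring.
Qed.

Lemma exp_density_cintegrable D : exp_density D -> cintegrable leb setT D.
Proof.
move=> [mD iD]; apply: (@cintegrable_le R _ M leb setT measurableT _ _ mD (iD 0)) => v _.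
by rewrite mul0r expR0 mulr1.
Qed.

Lemma cmeasurable_frequency : @cmeasurable R _ M setT (fun v => ofR v * imag).
Proof.
apply: cmeasurableM; last exact: (@cmeasurable_cst R _ M setT imag).
by apply: (@cmeasurable_ofR _ _ M setT id).
Qed.

Lemma exp_density_freq D : exp_density D -> exp_density (fun v => D v * (ofR v * imag)).
Proof.
move=> dD; have [mD _] := dD.
apply: (exp_density_le (k := 1) (C := 1) dD).
  by apply: cmeasurableM => //; exact: cmeasurable_frequency.
move=> v; rewrite mul1r mul1r !absCM absC_imag mulr1 absC_ofR mulrC.
apply: ler_wpM2r; first exact: absC_ge0.
by have := expR_ge1Dx `|v|; lra.
Qed.

Lemma exp_density_pow D n : exp_density D -> exp_density (fun v => D v * (ofR v * imag) ^+ n).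
Proof.
move=> dD; elim: n => [|n IH].
  by rewrite (_ : (fun v : M => _) = D)//; apply/funext => v; rewrite expr0 mulr1.
have := exp_density_freq IH; congr exp_density; apply/funext => v.
by rewrite exprSr [RHS]mulrA.
Qed.

(* The Taylor coefficients at 0 of the transform [x |-> \int D v * cis (v * x)]. *)
Definition mom D : nat -> Cx R := fun n => cintegral leb setT (fun v => D v * (ofR v * imag) ^+ n).

Lemma mom_term D z n : exp_density D ->
  cintegrable leb setT (fun v => D v * pow_term (powseq (ofR v * imag)) z n) /\
  pow_term (mom D) z n = cintegral leb setT (fun v => D v * pow_term (powseq (ofR v * imag)) z n).
Proof.
move=> dD; have i := exp_density_cintegrable (exp_density_pow n dD).
have E (v : M) : D v * pow_term (powseq (ofR v * imag)) z n =
    z ^+ n / (n`!)%:R * (D v * (ofR v * imag) ^+ n).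
  rewrite /pow_term /powseq; ring.
split.
  apply: (@eq_cintegrable R _ M leb setT (fun v => z ^+ n / (n`!)%:R * (D v * (ofR v * imag) ^+ n))).
    by move=> v _; rewrite E.
  exact: (@cintegrableZ R _ M leb setT measurableT).
rewrite (@eq_cintegral R _ M leb setT _ _ (fun v _ => E v)).
by rewrite (@cintegralZ R _ M leb setT measurableT)// /pow_term /mom -mulrA mulrC.
Qed.

Lemma mom_series D z N : exp_density D -> series (pow_term (mom D) z) N =
  cintegral leb setT (fun v => D v * series (pow_term (powseq (ofR v * imag)) z) N).
Proof.
move=> dD; rewrite /series /=.
under eq_bigr do rewrite (mom_term _ _ dD).2.
rewrite -(@cintegral_sum R _ M leb setT measurableT).
  by apply: eq_cintegral => v _; rewrite mulr_sumr.
by move=> n; have [] := mom_term z n dD.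
Qed.

Lemma abs_term_powseq z (q : R) : abs_term (powseq z) q = exp_coeff (absC z * q).
Proof. by apply/funext => n; rewrite /abs_term /powseq absCX /exp_coeff /= exprMn. Qed.

Lemma majorant_powseq z (q : R) : majorant (powseq z) q = expR (absC z * q).
Proof. by rewrite /majorant abs_term_powseq. Qed.

Lemma absC_frequency (v : R) : absC (ofR v * imag : Cx R) = `|v|.
Proof. by rewrite absCM absC_imag mulr1 absC_ofR. Qed.

Lemma expC_frequency (v x : R) : expC (ofR v * imag * ofR x) = cis (v * x) :> Cx R.
Proof.
have -> : ofR v * imag * ofR x = Complex 0 (v * x) :> Cx R.
  by apply: Cx_ext; rewrite !(reCM, imCM) /=; ring.
by rewrite /expC /= expR0 ofR1 mul1r.
Qed.

Lemma exp_coeff_le (x : R) n : 0 <= x -> x ^+ n / (n`!)%:R <= expR x.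
Proof.
move=> x0; have := abs_series_le_majorant n.+1 (@eseq_powseq R 1) x0.
rewrite majorant_powseq absC1 mul1r; apply: le_trans.
have -> : x ^+ n / (n`!)%:R = abs_term (powseq (1 : Cx R)) x n.
  by rewrite abs_term_powseq absC1 mul1r.
by rewrite seriesSr lerDr; apply: sumr_ge0 => i _; exact: abs_term_ge0.
Qed.

Lemma eseq_mom D : exp_density D -> eseq (mom D).
Proof.
move=> dD q q0; have [_ iD] := dD.
(* The rate is doubled because [(q |v|) ^ n / n!] is at most [2 ^ - n] times [exp (2 q |v|)], which
   gives a geometric majorant. *)
pose K := Rintegral leb setT (fun v : M => absC (D v) * expR (2 * q * `|v|)).
have K0 : 0 <= K by apply: Rintegral_ge0 => v _; rewrite mulr_ge0 ?absC_ge0 ?expR_ge0.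
apply: (@series_le_cvg _ _ (fun n => K * (2^-1) ^+ n)).
- by move=> n; exact: abs_term_ge0.
- by move=> n; rewrite mulr_ge0// exprn_ge0.
- move=> n; have [i E] := mom_term (ofR q) n dD.
  have -> : abs_term (mom D) q n = absC (pow_term (mom D) (ofR q) n).
    by rewrite absC_pow_term absC_ofR ger0_norm.
  rewrite E [X in _ <= X]mulrC -RintegralZl//.
  apply: (@absC_cintegral_le_bound R _ M leb setT measurableT).
  - by case: i.
  - by have := integrableZl measurableT (2^-1 ^+ n) (iD (2 * q)); apply: eq_integrable.
  move=> v _; rewrite absCM absC_pow_term absC_ofR (ger0_norm q0) [X in _ <= X]mulrCA.
  apply: ler_wpM2l; first exact: absC_ge0.
  rewrite /abs_term /powseq absCX absC_frequency -exprMn.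
  have v0 : 0 <= 2 * q * `|v| by rewrite !mulr_ge0.
  have := exp_coeff_le n v0.
  have -> : `|v| * q = 2^-1 * (2 * q * `|v|) by field.
  move: (2 * q * `|v|) => w h; rewrite exprMn -mulrA; apply: ler_wpM2l h.
  by rewrite exprn_ge0// invr_ge0.
- have g : `|2^-1 : R| < 1 by rewrite ger0_norm ?invr_ge0// invf_lt1// ltr1n.
  exact: (is_cvg_geometric_series (a := K) g).
Qed.

Lemma hser_mom D (x : R) : exp_density D ->
  cintegrable leb setT (fun v => D v * cis (v * x)) /\
  hser (mom D) (ofR x) = cintegral leb setT (fun v => D v * cis (v * x)).
Proof.
move=> dD; have [mD iD] := dD; have ed := eseq_mom dD.
have c1 := @cvg_hser _ (mom D) (ofR x) ed.
have lE : series (pow_term (mom D) (ofR x)) = (fun N =>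
   cintegral leb setT (fun v => D v * series (pow_term (powseq (ofR v * imag)) (ofR x)) N)).
  by apply/funext => N; exact: mom_series.
rewrite lE in c1.
have [h1 h2] : cintegrable leb setT (fun v => D v * cis (v * x)) /\
    cintegral leb setT (fun v => D v * series (pow_term (powseq (ofR v * imag)) (ofR x)) N)
    @[N --> \oo] --> cintegral leb setT (fun v => D v * cis (v * x)).
  apply: (@cdominated_cvg R _ M leb setT measurableT _ _ _ _ _ (iD `|x|)).
  - move=> N; have i n := (mom_term (ofR x) n dD).1.1.
    apply: (@eq_cmeasurable R _ M setT (fun v => \sum_(0 <= n < N) (D v * pow_term (powseq (ofR v * imag)) (ofR x) n))).
      by move=> v _; rewrite /series /= mulr_sumr.
    by apply: cmeasurable_sum => n; exact: i.
  - move=> v _; apply: cvgM; first exact: cvg_cst.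
    have -> : cis (v * x) = hser (powseq (ofR v * imag)) (ofR x) :> Cx R.
      by rewrite hser_powseq expC_frequency.
    by apply: cvg_hser; exact: eseq_powseq.
  - move=> N v _; rewrite absCM; apply: ler_wpM2l; first exact: absC_ge0.
    rewrite [`|x| * _]mulrC -(absC_frequency v) -majorant_powseq.
    by apply: absC_partial_le; [exact: eseq_powseq|rewrite absC_ofR].
split=> //; exact: (cvg_unique (@norm_hausdorff _ _) c1 h2).
Qed.

Lemma shiftc_mom D : shiftc (mom D) = mom (fun v => D v * (ofR v * imag)).
Proof.
apply/funext => n; rewrite /shiftc /mom; apply: eq_cintegral => v _.
by rewrite exprS mulrA.
Qed.

Lemma absC_re0_mom D (x : R) : exp_density D ->
  absC (re0 (mom D) x) <= Rintegral leb setT (fun v => absC (D v)).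
Proof.
move=> dD; rewrite /re0; have [i ->] := hser_mom x dD.
apply: (@absC_cintegral_le_bound R _ M leb setT measurableT _ _ i.1
  (cintegrable_absC (exp_density_cintegrable dD))).
by move=> v _; rewrite absCM absC_cis mulr1.
Qed.

(** On the real line the characters have modulus 1, so the transform and its derivatives are
    bounded; the rate is 0. *)
Lemma exp_bounded_mom D : exp_density D -> exists2 C : R, 0 <= C & exp_bounded_seq 0 C (mom D).
Proof.
move=> dD; have d1 := exp_density_freq dD; have d2 := exp_density_freq d1.
pose I E := Rintegral leb setT (fun v : M => absC (E v)).
have I0 E : 0 <= I E by apply: Rintegral_ge0 => v _; exact: absC_ge0.
pose D1 : M -> Cx R := fun v => D v * (ofR v * imag).
pose D2 : M -> Cx R := fun v => D1 v * (ofR v * imag).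
exists (I D + I D1 + I D2); first by rewrite !addr_ge0.
move=> x; rewrite mul0r expR0 mulr1 !shiftc_mom.
have h0 := absC_re0_mom x dD; have h1 := absC_re0_mom x d1; have h2 := absC_re0_mom x d2.
have p0 := I0 D; have p1 := I0 D1; have p2 := I0 D2.
split.
- apply: (le_trans h0); rewrite -addrA lerDl; exact: addr_ge0.
- apply: (le_trans h1); apply: ler_wpDr => //; rewrite lerDr; exact: p0.
- apply: (le_trans h2); rewrite lerDr; exact: addr_ge0.
Qed.

Lemma dual_set_mom (S : set R) D : exp_density D -> dual_set S calV (mom D).
Proof.
move=> dD; have ed := eseq_mom dD; have [C C0 bD] := exp_bounded_mom dD.
split; last first.
  by exists (hser (mom D)); [exact: (calV_hser ed C0 bD)|move=> z; exact: cvg_hser].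
split=> [z _|]; first exact: (cvg_hser_abs (z := z) ed).
exists 1 => //; exists (hser (mom D)) => // z _; exact: entire_hser_entire.
Qed.

End Moments.

Section ProductBound.
Context {R : realType} {d1 d2 : measure_display}.
Context {T1 : measurableType d1} {T2 : measurableType d2}.
Variables (m1 : {sigma_finite_measure set T1 -> \bar R}).
Variables (m2 : {sigma_finite_measure set T2 -> \bar R}).
Variables (D1 : set T1) (D2 : set T2).
Hypotheses (mD1 : measurable D1) (mD2 : measurable D2).

Lemma cmeasurable_comp {d3} {T3 : measurableType d3} (E : set T3) (k : T3 -> T1 * T2) (f : T1 * T2 -> Cx R) :
  cmeasurable (D1 `*` D2) f -> (forall y, E y -> (D1 `*` D2) (k y)) -> measurable_fun E k ->
  cmeasurable E (f \o k).
Proof.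
move=> [f1 f2] kD mk; have mD := measurableX mD1 mD2.
have sub : [set k x | x in E] `<=` D1 `*` D2 by move=> _ [y Ey <-]; exact: kD.
by split; [exact: (measurable_comp mD sub f1 mk)|exact: (measurable_comp mD sub f2 mk)].
Qed.

Lemma cmeasurable_section1 (f : T1 * T2 -> Cx R) x : cmeasurable (D1 `*` D2) f -> D1 x ->
  cmeasurable D2 (fun y => f (x, y)).
Proof.
move=> mf Dx; apply: (cmeasurable_comp (k := pair x) mf) => //.
exact: measurable_funTS (pair1_measurable x).
Qed.

Lemma cmeasurable_section2 (f : T1 * T2 -> Cx R) y : cmeasurable (D1 `*` D2) f -> D2 y ->
  cmeasurable D1 (fun x => f (x, y)).
Proof.
move=> mf Dy; apply: (cmeasurable_comp (k := fun x => (x, y)) mf) => //.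
exact: measurable_funTS (pair2_measurable y).
Qed.

(** A majorant that is a product of integrable functions settles all hypotheses of [cFubini] at
    once. *)
Lemma cFubini_bound (f : T1 * T2 -> Cx R) (al : T1 -> R) (be : T2 -> R) :
  cmeasurable (D1 `*` D2) f ->
  m1.-integrable D1 (EFin \o al) -> m2.-integrable D2 (EFin \o be) ->
  (forall x y, D1 x -> D2 y -> absC (f (x, y)) <= al x * be y) ->
  [/\ cintegrable m1 D1 (fun x => cintegral m2 D2 (fun y => f (x, y))),
      cintegrable m2 D2 (fun y => cintegral m1 D1 (fun x => f (x, y))) &
      cintegral m1 D1 (fun x => cintegral m2 D2 (fun y => f (x, y))) =
      cintegral m2 D2 (fun y => cintegral m1 D1 (fun x => f (x, y)))].
Proof.
move=> mf ia ib fab.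
have ib' x : m2.-integrable D2 (EFin \o (fun y => al x * be y)).
  by have := integrableZl mD2 (al x) ib; apply: eq_integrable.
have ia' y : m1.-integrable D1 (EFin \o (fun x => al x * be y)).
  have := integrableZl mD1 (be y) ia; apply: eq_integrable => // x _ /=.
  by rewrite mulrC.
pose B := Rintegral m2 D2 be.
have iaB : m1.-integrable D1 (EFin \o (fun x => al x * B)).
  have := integrableZl mD1 B ia; apply: eq_integrable => // x _ /=.
  by rewrite mulrC.
have inner x : D1 x -> (\int[m2]_(y in D2) (absC (f (x, y)))%:E <= (al x * B)%:E)%E.
  move=> Dx; rewrite -RintegralZl//.
  rewrite /Rintegral fineK; last exact: integrable_fin_num (ib' x).
  apply: ge0_le_integral => //.
  - by move=> y _; rewrite lee_fin absC_ge0.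
  - by apply/measurable_EFinP; apply: cmeasurable_absC; exact: cmeasurable_section1.
  - by have /integrableP[] := ib' x.
  - by move=> y Dy; rewrite lee_fin; exact: fab.
apply: cFubini => //.
- move=> x Dx; apply: (cintegrable_le mD2 (cmeasurable_section1 mf Dx) (ib' x)) => y Dy.
  exact: fab.
- move=> y Dy; apply: (cintegrable_le mD1 (cmeasurable_section2 mf Dy) (ia' y)) => x Dx.
  exact: fab.
- apply: (@le_lt_trans _ _ (\int[m1]_(x in D1) (al x * B)%:E)%E); last exact: integrable_lty iaB.
  apply: ge0_le_integral => //.
  - by move=> x Dx; apply: integral_ge0 => y _; rewrite lee_fin absC_ge0.
  - apply: (measurable_integral_param m2 mD1 mD2 (g := absC \o f)).
      exact: cmeasurable_absC.
    by move=> p _; exact: absC_ge0.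
  - by have /integrableP[] := iaB.
Qed.

End ProductBound.

(** * The generator acts on transforms as multiplication of the density by the exponent *)

Section ExponentWeights.
Context {R : realType}.
Variables (b a : R) (F : {measure set (measurableTypeR R) -> \bar R}).
Hypothesis levyF : levy_measure F.
Variable r : R.
Hypotheses (r1 : 1 <= r) (Fr : F [set y | r < `|y|] = 0%E).
Let M := measurableTypeR R.
Let psi := levy_exponent b a F.
Let V := levy_var F r.

Let chr2_le (u x t : R) : `|t - x| <= r -> absC (chr2 u t : Cx R) <= `|u| ^+ 2.
Proof. by move=> _; rewrite /chr2 /chr1 !absCM absC_chr absC_ofR absC_imag !mulr1 -expr2. Qed.

(** [psi v] has the modulus of the generator of the character at 0, so [gen_le] gives quadratic
    growth; the exponential form is the one that [exp_density_le] accepts. *)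
Lemma absC_exponent_le (v : R) :
  absC (psi v) <= (`|b| + `|a / 2| + V) * expR (2 * `|v|).
Proof.
have V0 : 0 <= V by exact: levy_var_ge0.
have h1 : absC (chr1 v 0 : Cx R) <= `|v|.
  by rewrite /chr1 !absCM absC_chr absC_ofR absC_imag !mulr1.
have := gen_le b a levyF r1 Fr (twice_diff_chr v) h1 (@chr2_le v 0).
rewrite (gen_chr b a levyF r1 Fr) absCM absC_chr mulr1 => h; apply: (le_trans h).
have v0 := normr_ge0 v; have e1 := expR_ge1Dx `|v|.
have -> : expR (2 * `|v|) = expR `|v| ^+ 2 by rewrite -expRM_natl.
have x1 : `|v| <= expR `|v| ^+ 2 by rewrite expr2; nra.
have x2 : `|v| ^+ 2 <= expR `|v| ^+ 2 by rewrite !expr2; nra.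
rewrite !mulrDl [X in _ + X <= _]mulrC.
by apply: lerD; [apply: lerD|]; apply: ler_wpM2l.
Qed.

Lemma cmeasurable_exponent : @cmeasurable R _ M setT psi.
Proof.
have mid : @measurable_fun _ _ M R setT id by [].
apply: cmeasurableD; first apply: cmeasurableB.
- apply: cmeasurableM; last exact: (@cmeasurable_cst R _ M setT imag).
  by apply: (@cmeasurable_ofR _ _ M setT (fun u => b * u)); apply: measurable_funM.
- apply: (@cmeasurable_ofR _ _ M setT (fun u => a * u ^+ 2 / 2)).
  by apply: measurable_funM => //; apply: measurable_funM => //; apply: measurable_funX.
have [m mF] := sigma_finite_pack (levy_sigma_finite levyF).
rewrite mF.
apply: (@cmeasurable_cintegral_param R _ _ M M m setT setT
  measurableT measurableT (fun p => cis (p.1 * p.2) - 1 - ofR (p.1 * p.2) * imag)).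
- rewrite setXTT; apply: cmeasurableB; first apply: cmeasurableB.
  + by apply: (cmeasurable_cis (f := fun p : M * M => p.1 * p.2)); apply: measurable_funM.
  + exact: (@cmeasurable_cst R _ (M * M)%type setT 1).
  + apply: cmeasurableM; last exact: (@cmeasurable_cst R _ (M * M)%type setT imag).
    by apply: (cmeasurable_ofR (f := fun p : M * M => p.1 * p.2)); apply: measurable_funM.
- move=> u _; have [_ + _ _] := jumps_cintegrable levyF r1 Fr (twice_diff_chr u) (@chr2_le u 0).
  rewrite mF; apply: eq_cintegrable => y _.
  by rewrite /jumps /chr1 /chr add0r mulr0 cis0 mulr1 rmorphM /=; ring.
Qed.

Lemma exp_density_exponent (D : M -> Cx R) : exp_density D -> exp_density (fun v => D v * psi v).
Proof.
move=> dD; have [mD _] := dD.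
apply: (exp_density_le (k := 2) (C := `|b| + `|a / 2| + V) dD).
  by apply: cmeasurableM => //; exact: cmeasurable_exponent.
move=> v; rewrite absCM mulrC; apply: ler_wpM2r; first exact: absC_ge0.
exact: absC_exponent_le.
Qed.

Section GeneratorOfTransform.
Variable (D : M -> Cx R).
Hypothesis dD : exp_density D.
Variable x : R.
Let D1 : M -> Cx R := fun v => D v * (ofR v * imag).
Let D2 : M -> Cx R := fun v => D1 v * (ofR v * imag).
Let d1 : exp_density D1. Proof. exact: exp_density_freq. Qed.
Let d2 : exp_density D2. Proof. exact: exp_density_freq. Qed.
Let J (y : R) (v : M) : Cx R := D v * jumps (chr v) (chr1 v) x y.

Let jumps_transform (y : R) :
  jumps (re0 (mom D)) (re0 (mom D1)) x y = cintegral leb setT (J y).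
Proof.
have [i1 e1] := hser_mom (x + y) dD; have [i2 e2] := hser_mom x dD.
have [i3 e3] := hser_mom x d1.
have i12 := cintegrableB measurableT i1 i2.
have i4 := cintegrableZ measurableT (ofR y) i3.
have E v : J y v = D v * cis (v * (x + y)) - D v * cis (v * x) - ofR y * (D1 v * cis (v * x)).
  by rewrite /J /jumps /chr1 /chr /D1; ring.
rewrite (@eq_cintegral R _ M leb setT _ _ (fun v _ => E v)).
rewrite (cintegralB measurableT i12 i4) (cintegralB measurableT i1 i2) (cintegralZ measurableT _ i3).
by rewrite /jumps /re0 e1 e2 e3 [ofR y * _]mulrC.
Qed.

(** The integrand is at most [y ^ 2] times [v ^ 2 |D v|], a product of integrable functions; [y ^ 2]
    is integrable on the jump range, which is why the exchange is made there. *)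
Let jump_fubini :
  cintegrable leb setT (fun v => cintegral F (jump_range r) (fun y => J y v)) /\
  cintegral F (jump_range r) (fun y => cintegral leb setT (J y)) =
  cintegral leb setT (fun v => cintegral F (jump_range r) (fun y => J y v)).
Proof.
have mDr : measurable (jump_range r : set M) by exact: measurable_itv.
have iy := sqr_integrable_levy levyF r1.
have [m mF] := sigma_finite_pack (levy_sigma_finite levyF).
rewrite mF in iy *.
have [_ h2 h3] : [/\ cintegrable m (jump_range r) (fun y => cintegral leb setT (J y)),
  cintegrable leb setT (fun v => cintegral m (jump_range r) (fun y => J y v)) &
  cintegral m (jump_range r) (fun y => cintegral leb setT (J y)) =
  cintegral leb setT (fun v => cintegral m (jump_range r) (fun y => J y v))]; last by [].
apply: (@cFubini_bound R _ _ M M m leb (jump_range r) setT mDr measurableT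
  (fun p => J p.1 p.2) (fun y => y ^+ 2) (fun v => absC (D2 v))) => //.
- apply: (@cmeasurableS _ _ _ _ setT) => //.
  apply: cmeasurableM; first by apply: (cmeasurableT_comp dD.1).
  have m1 (f : M * M -> R) : measurable_fun setT f -> cmeasurable setT (fun p : M * M => cis (p.2 * f p)).
    move=> mf; apply: (cmeasurable_cis (f := fun p : M * M => p.2 * f p)).
    by apply: measurable_funM.
  apply: cmeasurableB; first apply: cmeasurableB.
  + by apply: m1; apply: measurable_funD.
  + by apply: m1.
  + apply: cmeasurableM; last by apply: (@cmeasurable_ofR _ _ _ _ fst).
    apply: cmeasurableM; last by apply: m1.
    by apply: (cmeasurableT_comp cmeasurable_frequency).
- exact: cintegrable_absC (exp_density_cintegrable d2).
- move=> y v /jump_rangeP yr _ /=.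
  rewrite /J /D2 /D1 !absCM !absC_ofR !absC_imag !mulr1.
  have -> : y ^+ 2 * (absC (D v) * `|v| * `|v|) = absC (D v) * (`|v| ^+ 2 * y ^+ 2) by ring.
  apply: ler_wpM2l; first exact: absC_ge0.
  exact: (jumps_le (twice_diff_chr v) (@chr2_le v x) yr).
Qed.

(** Once all terms stand under the integral over [v], the integrand is [D v] times the generator of
    the character of frequency [v], and [gen_chr] applies. *)
Lemma gen_mom : gen b a F (re0 (mom D)) (re0 (shiftc (mom D))) (re0 (shiftc (shiftc (mom D)))) x =
  hser (mom (fun v => D v * psi v)) (ofR x).
Proof.
have [C C0 bD] := exp_bounded_mom dD; have ed := eseq_mom dD.
have C_le t : `|t - x| <= r -> absC (re0 (shiftc (shiftc (mom D))) t) <= C.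
  by move=> _; have [_ _] := bD t; rewrite mul0r expR0 mulr1.
have [_ _ + _] := jumps_cintegrable levyF r1 Fr (twice_diff_re ed) C_le.
rewrite /gen => ->; rewrite !shiftc_mom -/D1 -/D2.
have [i1 e1] := hser_mom x d1; have [i2 e2] := hser_mom x d2.
have [ij ej] := jump_fubini.
have -> : cintegral F (jump_range r) (jumps (re0 (mom D)) (re0 (mom D1)) x) =
    cintegral leb setT (fun v => cintegral F (jump_range r) (fun y => J y v)).
  by rewrite -ej; apply: eq_cintegral => y _; exact: jumps_transform.
rewrite /re0 e1 e2 (hser_mom x (exp_density_exponent dD)).2.
have j1 := cintegrableZ measurableT (ofR b) i1.
have j2 := cintegrableZ measurableT (ofR (a / 2)) i2.
have j12 := cintegrableD measurableT j1 j2.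
rewrite -(cintegralZ measurableT (ofR b) i1) -(cintegralZ measurableT (ofR (a / 2)) i2).
rewrite -(cintegralD measurableT j1 j2) -(cintegralD measurableT j12 ij).
apply: eq_cintegral => v _.
have [iv _ ev _] := jumps_cintegrable levyF r1 Fr (twice_diff_chr v) (@chr2_le v x).
have mDr : measurable (jump_range r : set M) by exact: measurable_itv.
have -> : cintegral F (jump_range r) (fun y => J y v) = D v * cintegral F setT (jumps (chr v) (chr1 v) x).
  by rewrite ev -(cintegralZ mDr (D v) iv).
have H := gen_chr b a levyF r1 Fr v x; rewrite -mulrA -/(chr v x) -H /gen.
by rewrite /D2 /D1 /chr2 /chr1 -/(chr v x); ring.
Qed.

End GeneratorOfTransform.

End ExponentWeights.

Lemma ae_eq_cintegral {R : realType} {d} {Y : measurableType d} (mu : {measure set Y -> \bar R})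
    (f g : Y -> Cx R) : cmeasurable setT f -> cmeasurable setT g ->
  {ae mu, forall w, f w = g w} -> cintegral mu setT f = cintegral mu setT g.
Proof.
move=> [f1 f2] [g1 g2] fg.
have H (p : Cx R -> R) : measurable_fun setT (p \o f) -> measurable_fun setT (p \o g) ->
    Rintegral mu setT (p \o f) = Rintegral mu setT (p \o g).
  move=> m1 m2; rewrite /Rintegral; congr fine; apply: ae_eq_integral => //.
  - exact/measurable_EFinP.
  - exact/measurable_EFinP.
  - by apply: filterS fg => w /= -> _.
by apply: Cx_ext; [exact: (H reC)|exact: (H imC)].
Qed.

(** * The transform of [exp (t psi) g] and its expectation *)

Section Evolution.
Context {R : realType} {d : measure_display} {Om : measurableType d}.
Variables (P : probability Om R) (T : R) (Ft : R -> set (set Om)) (X : R -> Om -> R).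
Variables (b a x0 : R) (F : {measure set (measurableTypeR R) -> \bar R}).
Hypotheses (T_gt0 : 0 < T) (filtrationF : filtration T Ft).
Hypotheses (levyF : levy_measure F) (levyX : levy_process P T Ft X b a F).
Hypothesis X0 : {ae P, forall w, X 0 w = x0}.
Variable r : R.
Hypotheses (r1 : 1 <= r) (Fr : F [set y | r < `|y|] = 0%E).
Let M := measurableTypeR R.
Let psi := levy_exponent b a F.

Let TT : 0 <= T <= T. Proof. by rewrite lexx ltW. Qed.
Let T0 : (0 : R) <= 0 <= T. Proof. by rewrite lexx ltW. Qed.

Let P_cst (c : R) : P.-integrable setT (EFin \o cst c).
Proof. exact: finite_measure_integrable_cst. Qed.

Let Rint_cst (c : R) : Rintegral P setT (cst c) = c.
Proof.
have E : (\int[P]_x (cst c%:E) x = c%:E)%E.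
  by rewrite (integral_cst P measurableT) [X in (_ * X)%E]probability_setT mule1.
by rewrite /Rintegral [X in fine X]E.
Qed.

Let cis_measurable (Z : Om -> R) (v : R) : measurable_fun setT Z -> cmeasurable setT (fun w => cis (v * Z w) : Cx R).
Proof.
by move=> mZ; apply: (cmeasurable_cis (f := fun w => v * Z w)); apply: measurable_funM.
Qed.

Let char_X v : cintegral P setT (fun w => cis (v * (X T w - X 0 w))) = expC (ofR T * psi v).
Proof. by have [_ _ _ _] := levyX; exact. Qed.

Let mX_T : measurable_fun setT (X T). Proof. exact: (measurable_X filtrationF levyX). Qed.
Let mX_0 : measurable_fun setT (X 0). Proof. exact: (measurable_X filtrationF levyX). Qed.

(* The characteristic function of [X T - X 0] has modulus at most 1. *)
Lemma reC_exponent_le0 v : reC (psi v) <= 0.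
Proof.
have : absC (expC (ofR T * psi v)) <= 1.
  rewrite -char_X -[X in _ <= X](Rint_cst 1).
  apply: (absC_cintegral_le_bound measurableT _ (P_cst 1)).
    by apply: cis_measurable; exact: measurable_funB.
  by move=> w _; rewrite absC_cis.
by rewrite absC_expC reCZ -[X in _ <= X]expR0 ler_expR pmulr_rle0.
Qed.

Lemma absC_propagator_le (t v : R) : 0 <= t -> absC (expC (ofR t * psi v)) <= 1.
Proof.
move=> t0; rewrite absC_expC reCZ -[X in _ <= X]expR0 ler_expR.
by rewrite mulr_ge0_le0// reC_exponent_le0.
Qed.

Let mpsi : @cmeasurable R _ M setT psi. Proof. exact: (cmeasurable_exponent b a levyF r1 Fr). Qed.

Variable g : M -> Cx R.
Hypothesis dg : exp_density g.

Definition evolved (t : R) : M -> Cx R := fun v => g v * expC (ofR t * psi v).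

Lemma absC_evolved_le (t v : R) : 0 <= t -> absC (evolved t v) <= absC (g v).
Proof. by move=> t0; rewrite absCM ler_piMr ?absC_ge0// absC_propagator_le. Qed.

Lemma exp_density_evolved (t : R) : 0 <= t -> exp_density (evolved t).
Proof.
move=> t0; have [mg _] := dg; apply: (exp_density_le (k := 0) (C := 1) dg).
  apply: cmeasurableM; first exact: mg.
  by apply: (cmeasurable_expC (f := fun v => ofR t * psi v)); exact: cmeasurableZ.
by move=> v; rewrite mul0r expR0 !mul1r; exact: absC_evolved_le.
Qed.

Definition evolution (t : R) : nat -> Cx R := mom (evolved t).

(** The time derivative of the evolved function, equal to its generator. It is named without
    reference to [L], which meets it only at points of [S]. *)
Definition rate (t x : R) : Cx R := hser (mom (fun v => evolved t v * psi v)) (ofR x).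

Let dpsi (t : R) : 0 <= t -> exp_density (fun v => evolved t v * psi v).
Proof. by move=> t0; apply: (exp_density_exponent b a levyF r1 Fr); exact: exp_density_evolved. Qed.

Lemma rateE (t x : R) : 0 <= t ->
  cintegrable leb setT (fun v => evolved t v * psi v * cis (v * x)) /\
  rate t x = cintegral leb setT (fun v => evolved t v * psi v * cis (v * x)).
Proof. by move=> t0; exact: (hser_mom x (dpsi t0)). Qed.

Lemma generator_evolution (t x : R) : 0 <= t ->
  generator b a F (on_reals (hser (evolution t))) x = rate t x.
Proof.
move=> t0; have de := exp_density_evolved t0; have ee := eseq_mom de.
rewrite -/(re0 (evolution t)) (generatorE b a F (twice_diff_re ee)).
exact: (gen_mom b a levyF r1 Fr de x).
Qed.

Let gpsi : exp_density (fun v => g v * psi v).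
Proof. exact: (exp_density_exponent b a levyF r1 Fr dg). Qed.

Let igpsi := cintegrable_absC (exp_density_cintegrable gpsi).

Let K := Rintegral leb setT (fun v => absC (g v * psi v)).

Let K0 : 0 <= K. Proof. by apply: Rintegral_ge0 => v _; exact: absC_ge0. Qed.

Let integrand_le (t v x : R) : 0 <= t ->
  absC (evolved t v * psi v * cis (v * x)) <= absC (g v * psi v).
Proof.
move=> t0; rewrite absCM absC_cis mulr1 absCM [X in _ <= X]absCM.
apply: ler_wpM2r; [exact: absC_ge0|exact: absC_evolved_le].
Qed.

Lemma absC_rate_le (t x : R) : 0 <= t -> absC (rate t x) <= K.
Proof.
move=> t0; have [i ->] := rateE x t0.
apply: (@absC_cintegral_le_bound R _ M leb setT measurableT _ _ i.1 igpsi) => v _.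
exact: integrand_le.
Qed.

Let integrand_measurable (d' : measure_display) (Z : measurableType d') (D : set Z) (s v x : Z -> R) :
  measurable_fun D s -> measurable_fun D (v : Z -> M) -> measurable_fun D x ->
  cmeasurable D (fun z => evolved (s z) (v z) * psi (v z) * cis (v z * x z)).
Proof.
move=> ms mv mx; have [mg _] := dg.
have mpv : cmeasurable D (fun z => psi (v z)) by exact: (cmeasurableT_comp mpsi mv).
apply: cmeasurableM; first apply: cmeasurableM.
- apply: cmeasurableM; first exact: (cmeasurableT_comp mg mv).
  apply: (cmeasurable_expC (f := fun z => ofR (s z) * psi (v z))).
  by apply: cmeasurableM; [exact: (cmeasurable_ofR ms)|exact: mpv].
- exact: mpv.
- by apply: (cmeasurable_cis (f := fun z => v z * x z)); exact: measurable_funM.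
Qed.

(** After Fubini the integral over time is taken for each frequency, where [psi exp (s psi)]
    integrates to [exp (t psi) - 1]. *)
Lemma evolution_integral (t x : R) : 0 <= t ->
  cintegrable leb `[0, t] (fun s => rate s x) /\
  hser (evolution t) (ofR x) = hser (mom g) (ofR x) + cintegral leb `[0, t] (fun s => rate s x).
Proof.
move=> t0; have mI : measurable (`[0, t]%classic : set M) by exact: measurable_itv.
pose k (p : M * M) := evolved p.1 p.2 * psi p.2 * cis (p.2 * x).
have i1 : leb.-integrable (`[0, t]%classic : set M) (EFin \o cst 1).
  apply/integrableP; split; first by apply/measurable_EFinP.
  have := integral_itv_cst_lty 0 t 1; congr (_ < _)%E; apply: eq_integral => s _ /=.
  by rewrite normr1.
have mk : cmeasurable ((`[0, t]%classic : set M) `*` (setT : set M)) k.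
  apply: integrand_measurable => //.
  - exact: measurable_funTS measurable_fst.
  - exact: measurable_funTS measurable_snd.
have bk s v : (`[0, t]%classic : set M) s -> (setT : set M) v -> absC (k (s, v)) <= cst 1 s * absC (g v * psi v).
  by rewrite /= in_itv /= => /andP[s0 _] _; rewrite mul1r; exact: integrand_le.
have [h1 h2 h3] := @cFubini_bound R _ _ M M leb leb `[0, t]%classic setT mI measurableT k
  (cst 1) (fun v => absC (g v * psi v)) mk i1 igpsi bk.
have E s : (`[0, t]%classic : set M) s -> cintegral leb setT (fun v => k (s, v)) = rate s x.
  by rewrite /= in_itv /= => /andP[s0 _]; rewrite (rateE x s0).2.
split; first by apply: (@eq_cintegrable R _ M leb `[0, t]%classic _ _ E h1).
have [it et] := hser_mom x (exp_density_evolved t0); have [ig eg] := hser_mom x dg.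
rewrite -(@eq_cintegral R _ M leb `[0, t]%classic _ _ E) h3 /evolution et eg.
have inner v : cintegral leb (`[0, t]%classic : set M) (fun s => k (s, v)) =
    evolved t v * cis (v * x) - g v * cis (v * x).
  transitivity ((expC (ofR (t - 0) * psi v) - 1) * (g v * cis (v * x))).
    rewrite -(cintegral_expC (psi v) (g v * cis (v * x)) t0).
    apply: (@eq_cintegral R _ M leb `[0, t]%classic) => s _.
    by rewrite /k /evolved subr0 /=; ring.
  by rewrite subr0 /evolved; ring.
rewrite (@eq_cintegral R _ M leb setT _ _ (fun v _ => inner v)).
by rewrite (cintegralB measurableT it ig) addrC subrK.
Qed.

Let dist_X0 v : {ae P, forall w, cis (v * X T w) = cis (v * x0) * cis (v * (X T w - X 0 w)) :> Cx R}.
Proof. by apply: filterS X0 => w <-; rewrite -cisD; congr cis; ring. Qed.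

(** Fubini reduces the expectation to that of each character of [X T], which is
    [cis (v x0) exp (T psi v)] as [X 0 = x0] almost surely. *)
Lemma expectation_evolution :
  cintegrable P setT (fun w => hser (mom g) (ofR (X T w))) /\
  cintegral P setT (fun w => hser (mom g) (ofR (X T w))) = hser (evolution T) (ofR x0).
Proof.
have [mg _] := dg.
pose k (p : Om * M) := g p.2 * cis (p.2 * X T p.1).
have mk : cmeasurable (setT `*` setT) k.
  rewrite setXTT; apply: cmeasurableM; first exact: (cmeasurableT_comp mg measurable_snd).
  apply: (cmeasurable_cis (f := fun p : Om * M => p.2 * X T p.1)); apply: measurable_funM.
    exact: measurable_snd.
  exact: (measurableT_comp mX_T measurable_fst).
have bk w v : (setT : set Om) w -> (setT : set M) v -> absC (k (w, v)) <= cst 1 w * absC (g v).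
  by move=> _ _; rewrite absCM absC_cis mulr1 mul1r.
have ig := cintegrable_absC (exp_density_cintegrable dg).
have [h1 _ h3] := @cFubini_bound R _ _ Om M P leb setT setT measurableT measurableT k
  (cst 1) (fun v => absC (g v)) mk (P_cst 1) ig bk.
have E w : cintegral leb setT (fun v => k (w, v)) = hser (mom g) (ofR (X T w)).
  by rewrite (hser_mom (X T w) dg).2.
split; first by apply: eq_cintegrable h1 => w _; exact: E.
rewrite -(@eq_cintegral R _ Om P setT _ _ (fun w _ => E w)) h3.
have T0' : 0 <= T by exact: ltW.
rewrite /evolution (hser_mom x0 (exp_density_evolved T0')).2.
apply: eq_cintegral => v _.
have mI := cis_measurable v (measurable_funB mX_T mX_0).
have bI w : setT w -> absC (cis (v * (X T w - X 0 w)) : Cx R) <= cst 1 w.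
  by move=> _; rewrite absC_cis.
have iI := cintegrable_le measurableT mI (P_cst 1) bI.
have iZ := cintegrableZ measurableT (cis (v * x0)) iI.
have mT := cis_measurable v mX_T.
have E2 := ae_eq_cintegral mT iZ.1 (dist_X0 v).
have bT w : setT w -> absC (cis (v * X T w) : Cx R) <= cst 1 w.
  by move=> _; rewrite absC_cis.
have iT := cintegrable_le measurableT mT (P_cst 1) bT.
rewrite (cintegralZ measurableT (g v) iT) E2 (cintegralZ measurableT _ iI) char_X /evolved.
by rewrite -mulrA [cis _ * _]mulrC mulrA mulrA.
Qed.

Let I : set M := `[0, T]%classic.
Let mI : measurable I. Proof. exact: measurable_itv. Qed.

Let I_ge0 s : I s -> 0 <= s.
Proof. by rewrite /I /= in_itv /= => /andP[]. Qed.

Let rate_measurable : @cmeasurable R _ (M * M)%type (I `*` setT) (fun p => rate p.1 p.2).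
Proof.
have mD : measurable (I `*` (setT : set M)) by exact: measurableX.
pose k (p : (M * M) * M) := evolved p.1.1 p.2 * psi p.2 * cis (p.2 * p.1.2).
have E (p : M * M) : (I `*` (setT : set M)) p -> cintegral leb setT (fun v => k (p, v)) = rate p.1 p.2.
  by move=> [/I_ge0 s0 _]; rewrite (rateE p.2 s0).2.
apply: (eq_cmeasurable E).
apply: (@cmeasurable_cintegral_param R _ _ (M * M)%type M leb (I `*` setT) setT mD measurableT k).
- apply: integrand_measurable; apply: measurable_funTS.
  + exact: (measurableT_comp measurable_fst measurable_fst).
  + exact: measurable_snd.
  + exact: (measurableT_comp measurable_snd measurable_fst).
- by move=> p [/I_ge0 s0 _]; exact: (rateE p.2 s0).1.
Qed.

Let mean (p : M * M) : R := Rintegral P setT (fun w => absC (rate p.1 (X p.2 w))).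

Let state_measurable : @cmeasurable R _ ((M * M) * Om)%type ((I `*` I) `*` setT)
  (fun p => rate p.1.1 (X p.1.2 p.2)).
Proof.
have mII : measurable (I `*` I) by exact: measurableX.
have T0' : 0 <= T by exact: ltW.
have mXj := X_jointly_measurable filtrationF levyX (lexx 0) T0' (lexx T).
have mD : measurable (I `*` (setT : set Om)) by exact: measurableX.
have mk : measurable_fun ((I `*` I) `*` (setT : set Om)) (fun p => (p.1.2, p.2)).
  apply: measurable_funTS; apply: measurable_fun_pair; last exact: measurable_snd.
  exact: (measurableT_comp measurable_snd measurable_fst).
have sub : [set (p.1.2, p.2) | p in (I `*` I) `*` (setT : set Om)] `<=` I `*` setT.
  by move=> _ [[[s t] w] [[_ /= It] _] <-].
have mX := measurable_comp mD sub mXj mk.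
apply: (cmeasurable_comp mI measurableT (k := fun p : (M * M) * Om => (p.1.1, X p.1.2 p.2)) rate_measurable).
- by move=> [[s t] w] [[/= Is _] _].
(* The process is jointly measurable on the horizon; extending it by zero gives a map measurable on
   the whole space, with which the pair can be formed and restricted again. *)
- pose D := (I `*` I) `*` (setT : set Om).
  have mD' : measurable D by exact: measurableX.
  have mX' := (measurable_restrictT _ mD').1 mX.
  apply: (@eq_measurable_fun _ _ _ _ D (fun p => (p.1.1, ((fun p : (M * M) * Om => X p.1.2 p.2) \_ D) p) : M * M)).
    by move=> p pD; rewrite patchE pD.
  apply: measurable_funTS; apply: measurable_fun_pair; last exact: mX'.
  exact: (measurableT_comp measurable_fst measurable_fst).
Qed.

Let section_measurable (p : M * M) : (I `*` I) p ->
  cmeasurable setT (fun w => rate p.1 (X p.2 w)).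
Proof.
move=> Ip; exact: (cmeasurable_section1 (measurableX mI mI) measurableT state_measurable Ip).
Qed.

Let section_integrable (p : M * M) : (I `*` I) p ->
  P.-integrable setT (EFin \o (fun w => absC (rate p.1 (X p.2 w)))).
Proof.
move=> Ip; have s0 := I_ge0 Ip.1.
have bd w : setT w -> absC (rate p.1 (X p.2 w)) <= cst K w by move=> _; exact: absC_rate_le.
exact: cintegrable_absC (cintegrable_le measurableT (section_measurable Ip) (P_cst K) bd).
Qed.

Let mean_measurable : @measurable_fun _ _ (M * M)%type R (I `*` I) mean.
Proof.
apply: (@measurable_Rintegral_param R _ _ (M * M)%type Om P (I `*` I) setT
  (measurableX mI mI) measurableT (fun p => absC (rate p.1.1 (X p.1.2 p.2)))).
- exact: (cmeasurable_absC state_measurable).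
- exact: section_integrable.
Qed.

Let mean_ge0 p : 0 <= mean p.
Proof. by apply: Rintegral_ge0 => w _; exact: absC_ge0. Qed.

Let mean_le p : (I `*` I) p -> mean p <= K.
Proof.
move=> Ip; rewrite -[X in _ <= X](Rint_cst K); apply: le_Rintegral => //.
- exact: section_integrable.
- exact: P_cst.
- by move=> w _; apply: absC_rate_le; exact: I_ge0 Ip.1.
Qed.

Let mean_abs_generatorE p : (I `*` I) p -> mean_abs_generator P b a F X evolution p = (mean p)%:E.
Proof.
move=> Ip; have s0 := I_ge0 Ip.1.
rewrite /mean /Rintegral fineK; last exact: integrable_fin_num (section_integrable Ip).
by apply: eq_integral => w _; rewrite generator_evolution.
Qed.

Lemma mean_abs_generator_measurable :
  measurable_fun (I `*` I) (mean_abs_generator P b a F X evolution).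
Proof.
apply: (@eq_measurable_fun _ _ _ _ (I `*` I) (EFin \o mean)).
  by move=> p /set_mem Ip; rewrite mean_abs_generatorE.
exact/measurable_EFinP.
Qed.

(** [rate] is bounded by [K] uniformly in time and space, so the iterated integral is at most that
    of a constant over a square. *)
Lemma mean_abs_generator_lty :
  (\int[leb]_(t in I) \int[leb]_(s in I) mean_abs_generator P b a F X evolution (s, t) < +oo)%E.
Proof.
pose B := (\int[leb]_(s in I) K%:E)%E.
have B_lty : (B < +oo)%E by exact: integral_itv_cst_lty.
have B0 : (0 <= B)%E by apply: integral_ge0 => s _; rewrite lee_fin.
have BE : B = (fine B)%:E by rewrite fineK// ge0_fin_numE.
have E t : I t -> (\int[leb]_(s in I) mean_abs_generator P b a F X evolution (s, t) =
    \int[leb]_(s in I) (mean (s, t))%:E)%E.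
  by move=> It; apply: eq_integral => s /set_mem Is; exact: mean_abs_generatorE.
have -> : (\int[leb]_(t in I) \int[leb]_(s in I) mean_abs_generator P b a F X evolution (s, t) =
    \int[leb]_(t in I) \int[leb]_(s in I) (mean (s, t))%:E)%E.
  by apply: eq_integral => t /set_mem; exact: E.
apply: (@le_lt_trans _ _ (\int[leb]_(t in I) (fine B)%:E)%E); last exact: integral_itv_cst_lty.
have ms : @measurable_fun _ _ (M * M)%type R (I `*` I) (fun p => mean (p.2, p.1)).
  apply: (measurable_comp (measurableX mI mI) _ mean_measurable).
    by move=> _ [[s t] [/= Is It] <-].
  apply: measurable_funTS; apply: measurable_fun_pair; [exact: measurable_snd|exact: measurable_fst].
apply: (@ge0_le_integral _ M R leb I mI).
- by move=> t _; apply: integral_ge0 => s _; rewrite lee_fin.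
- by apply: (measurable_integral_param leb mI mI ms).
- by apply/measurable_EFinP.
- move=> t It; rewrite -BE; apply: (@ge0_le_integral _ M R leb I mI).
  + by move=> s _; rewrite lee_fin.
  + apply/measurable_EFinP.
    apply: (measurable_comp (measurableX mI mI) _ mean_measurable (g := fun s => (s, t))).
      by move=> _ [s Is <-].
    exact: measurable_funTS (pair2_measurable t).
  + by apply/measurable_EFinP.
  + by move=> s Is; rewrite lee_fin; exact: mean_le.
Qed.

End Evolution.

(** * From the Fourier transform to the initial density *)

Section FourierDensity.
Context {R : realType}.
Let M := measurableTypeR R.

Lemma cmeasurable_fourier_transform (h g : M -> Cx R) : is_fourier_transform h g ->
  @cmeasurable R _ M setT g.
Proof.
move=> [[ih gE]|[_ _ [mg _] _]]; last exact: mg.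
have -> : g = fourier_integral h by apply/funext => v; exact: gE.
exact: cmeasurable_fourier.
Qed.

Lemma exp_density_finite (g : M -> Cx R) : cmeasurable setT g ->
  (forall x : R, (\int[leb]_v (expR `|v * x| * absC (g v))%:E < +oo)%E) -> exp_density g.
Proof.
move=> mg H; split=> // q.
have mw (e : M -> R) : measurable_fun setT e -> measurable_fun setT (fun v => expR (e v) * absC (g v)).
  by move=> me; apply: measurable_funM; [apply: measurableT_comp|exact: cmeasurable_absC].
have mq (x : R) : measurable_fun setT (fun v : M => v * x) by apply: measurable_funM.
have mabs : measurable_fun setT (fun v : M => `|v|) by exact: measurableT_comp.
have i : leb.-integrable setT (EFin \o (fun v : M => expR `|v * q| * absC (g v))).
  apply/integrableP; split.
    by apply/measurable_EFinP; apply: mw; apply: measurableT_comp.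
  have := H q; congr (_ < _)%E; apply: eq_integral => v _ /=.
  by rewrite [X in _ = X%:E]ger0_norm// mulr_ge0 ?expR_ge0 ?absC_ge0.
apply: (Rintegrable_le measurableT _ i).
  have := mw (fun v => q * `|v|); rewrite (_ : (fun v => expR _ * _) = (fun v => absC (g v) * expR (q * `|v|))).
    by apply; apply: measurable_funM.
  by apply/funext => v; rewrite mulrC.
move=> v _; rewrite ger0_norm; last by rewrite mulr_ge0 ?expR_ge0 ?absC_ge0.
rewrite mulrC; apply: ler_wpM2r; first exact: absC_ge0.
rewrite ler_expR normrM mulrC; apply: ler_wpM2l; first exact: normr_ge0.
exact: ler_norm.
Qed.

(** [hser u] is identified with the expansion of the entire function to which it converges, whose
    coefficients are known to satisfy [eseq]. *)
Lemma dual_set_calV (S : set R) u : dual_set S calV u ->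
  exists2 w, eseq w & hser u = hser w.
Proof.
move=> [_ [h /calV_series[w [k [C [ew -> _ _ _]]]] cv]]; exists w => //.
by apply/funext => z; apply: cvg_lim (cv z); exact: norm_hausdorff.
Qed.

(** Dividing by [2 pi] compensates the mass of the Poisson kernel in the inversion formula; the
    exponential moments of [hhat] include its integrability. *)
Lemma hser_inverse_transform u w hhat (x : R) : eseq w -> hser u = hser w ->
  is_fourier_transform (on_reals (hser u)) hhat -> exp_density hhat ->
  exp_density (fun v => ofR (2 * pi)^-1 * hhat v) /\
  hser (mom (fun v => ofR (2 * pi)^-1 * hhat v)) (ofR x) = hser u (ofR x).
Proof.
move=> ew uw ft dh; have p0 : (0 : R) < 2 * pi by rewrite mulr_gt0// pi_gt0.
have dg : exp_density (fun v => ofR (2 * pi)^-1 * hhat v).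
  apply: (exp_density_le (k := 0) (C := (2 * pi)^-1) dh).
    by apply: cmeasurableZ; have [] := dh.
  by move=> v; rewrite mul0r expR0 mulr1 absCM absC_ofR ger0_norm// invr_ge0 ltW.
split=> //; have ch : continuous (on_reals (hser u) : R -> Cx R).
  by rewrite uw; exact: continuous_re0.
have inv := fourier_inversion x ch ft (exp_density_cintegrable dh).
rewrite (hser_mom x dg).2; have [ih _] := hser_mom x dh.
have -> : cintegral leb setT (fun v => ofR (2 * pi)^-1 * hhat v * cis (v * x)) =
    ofR (2 * pi)^-1 * cintegral leb setT (fun v => hhat v * cis (v * x)).
  by rewrite -(cintegralZ measurableT _ ih); apply: eq_cintegral => v _; rewrite mulrA.
have e1 : ofR (2 * pi)^-1 * ofR (2 * pi) = 1 :> Cx R by rewrite -rmorphM mulVf ?gt_eqF//.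
by rewrite -inv mulrA e1 mul1r.
Qed.

End FourierDensity.

Theorem corollary3p31 (R : realType) (d : measure_display)
    (Om : measurableType d) (P : probability Om R) (T : R)
    (Ft : R -> set (set Om)) (S : set R) (b a x0 : R)
    (F : {measure set (measurableTypeR R) -> \bar R}) (X : R -> Om -> R)
    (T_gt0 : 0 < T) (filtrationF : filtration T Ft)
    (a_ge0 : 0 <= a) (levyF : levy_measure F) (bsuppF : bounded_support F)
    (levyX : levy_process P T Ft X b a F)
    (XS : valued_in T S X) (X0 : {ae P, forall w, X 0 w = x0}) :
  [/\
   holomorphic_process P T Ft b a F X S (@on_reals R @` calV),
   forall h, calV h ->
     Nproc_defined T b a F X (on_reals h) /\
     martingale P T Ft (Nproc b a F X (on_reals h)) &
   forall L, generator_lift S b a F (dual_set S calV) L ->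
   forall u, dual_set S calV u ->
     (\int[leb]_x (absC (hser u (ofR x)))%:E < +oo)%E \/
     (\int[leb]_x (absC (hser u (ofR x)) ^+ 2)%:E < +oo)%E ->
   forall hhat, is_fourier_transform (on_reals (hser u)) hhat ->
     (forall x : R,
        (\int[leb]_v (expR `|v * x| * absC (hhat v))%:E < +oo)%E) ->
   exists c : R -> nat -> Cx R,
     [/\ forall t, 0 <= t <= T -> dual_set S calV (c t),
         forall x t, S x -> 0 <= t <= T ->
           cintegrable leb `[0, t]
             (fun s => hser (L (c s)) (ofR x)) /\
           hser (c t) (ofR x) = hser u (ofR x)
             + cintegral leb `[0, t] (fun s => hser (L (c s)) (ofR x)),
         forall s, 0 <= s <= T ->
           Nproc_defined T b a F X (on_reals (hser (c s))) /\
           martingale P T Ft (Nproc b a F X (on_reals (hser (c s)))),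
         (* measurability makes the iterated integral meaningful *)
         measurable_fun (`[0, T] `*` `[0, T]) (mean_abs_generator P b a F X c) /\
         (\int[leb]_(t in `[0%R, T]) \int[leb]_(s in `[0%R, T])
            mean_abs_generator P b a F X c (s, t) < +oo)%E &
         cintegrable P setT (fun w => hser u (ofR (X T w))) /\
         cintegral P setT (fun w => hser u (ofR (X T w)))
           = hser (c T) (ofR x0)]].
Proof.
split.
- exact: (holomorphic_process_levy T_gt0 filtrationF levyF bsuppF levyX XS X0).
- move=> h Vh; exact: (martingale_calV S T_gt0 filtrationF levyF bsuppF levyX X0 Vh).
move=> L [_ _ lift] u u_dual _ hhat ft fin.
have [r r1 Fr] := support_radius bsuppF.
have [w ew uw] := dual_set_calV u_dual.
have dh := exp_density_finite (cmeasurable_fourier_transform ft) fin.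
pose g v := ofR (2 * pi)^-1 * hhat v.
have [dg _] := hser_inverse_transform 0 ew uw ft dh.
have hg x : hser (mom g) (ofR x) = hser u (ofR x).
  exact: (hser_inverse_transform x ew uw ft dh).2.
pose c := evolution b a F g.
have c_dual s : 0 <= s -> dual_set S calV (c s).
  move=> s0; apply: dual_set_mom.
  exact: (exp_density_evolved T_gt0 filtrationF levyF levyX r1 Fr dg s0).
exists c; split.
- by move=> t /andP[t0 _]; exact: c_dual.
- move=> x t Sx /andP[t0 _].
  (* At a point of [S] the defining identity of [L] equates its series with the generator of the
     evolved function, which is the rate. *)
  have E s : (`[0, t]%classic : set (measurableTypeR R)) s -> rate b a F g s x = hser (L (c s)) (ofR x).
    rewrite /= in_itv /= => /andP[s0 _]; rewrite -(lift _ _ (c_dual s s0) Sx).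
    by rewrite (generator_evolution T_gt0 filtrationF levyF levyX r1 Fr dg x s0).
  have [h1 h2] := evolution_integral T_gt0 filtrationF levyF levyX r1 Fr dg x t0.
  split; first by apply: (@eq_cintegrable R _ (measurableTypeR R) leb `[0, t]%classic _ _ E h1).
  by rewrite h2 hg (@eq_cintegral R _ (measurableTypeR R) leb `[0, t]%classic _ _ E).
- move=> s /andP[s0 _]; apply: (martingale_calV S T_gt0 filtrationF levyF bsuppF levyX X0).
  have de := exp_density_evolved T_gt0 filtrationF levyF levyX r1 Fr dg s0.
  have [C C0 bC] := exp_bounded_mom de.
  exact: (calV_hser (eseq_mom de) C0 bC).
- split; first exact: (mean_abs_generator_measurable T_gt0 filtrationF levyF levyX r1 Fr dg).
  exact: (mean_abs_generator_lty T_gt0 filtrationF levyF levyX r1 Fr dg).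
- have [h1 h2] := expectation_evolution T_gt0 filtrationF levyF levyX X0 r1 Fr dg.
  have E : (fun w0 => hser (mom g) (ofR (X T w0))) = (fun w0 => hser u (ofR (X T w0))).
    by apply/funext => w0; exact: hg.
  by rewrite E in h1 h2.
Qed.
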